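(* Let $X \subseteq \mathbb{P}^n$ be a smooth arithmetically Gorenstein surface of degree $d \geq 2$, and suppose that $X$ admits an Ulrich bundle $\mathcal{E}$ of rank $r$ whose first Chern class $c_1(\mathcal{E})$ is represented by a smooth (not necessarily connected) curve $C$ of arithmetic genus $g$. If $c_2(\mathcal{E}) = g - 1 + r$, then $X$ is either a smooth quadric surface in $\mathbb{P}^3$ or a del Pezzo surface.
   Context: We work over an algebraically closed field of characteristic zero. A smooth projective variety $X \subseteq \mathbb{P}^n$ is ACM if its homogeneous coordinate ring is Cohen-Macaulay, and is arithmetically Gorenstein (AG) if it is ACM and its canonical bundle is isomorphic to $\mathcal{O}_X(m)$ for some $m \in \mathbb{Z}$. Del Pezzo surfaces are understood to be embedded by their anticanonical series ($K_X = -H$, $H$ the hyperplane class). Ulrich bundles: let $X \subseteq \mathbb{P}^n$ be a smooth projective variety of dimension $k$, and let $S$ be the homogeneous coordinate ring (polynomial ring) of $\mathbb{P}^n$. For a vector bundle $\mathcal{E}$ on $X$ put $\Gamma_*(\mathcal{E}) = \bigoplus_{m \in \mathbb{Z}} H^0(\mathcal{E}(m))$. A (nonzero) vector bundle $\mathcal{E}$ is an Ulrich bundle if $\Gamma_*(\mathcal{E})$ is a graded Cohen-Macaulay $S$-module whose minimal graded free resolution has the linear form $0 \leftarrow \Gamma_*(\mathcal{E}) \leftarrow S^{\beta_0} \leftarrow S(-1)^{\beta_1} \leftarrow \cdots \leftarrow S(-(n-k))^{\beta_{n-k}} \leftarrow 0$. *)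

(* Defs.v *)
(* Written with the Mathematical Components libraries (with multinomials).

   Projective varieties over an algebraically closed field are given by their
   homogeneous prime ideals.  All sheaves live inside constant sheaves: L X is
   the fraction field of the homogeneous coordinate ring S/I, the function
   field of X is its degree 0 part, and a twisted sheaf O_X(m) is a family of
   subsets of the degree m part of L X.  Since the ground field is algebraically
   closed, only closed points are used. *)
From HB Require Import structures.
From mathcomp Require Import all_boot all_order all_algebra.
From mathcomp Require Import mpoly.
From Stdlib Require Import ClassicalEpsilon.

Set Implicit Arguments.
Unset Strict Implicit.
Unset Printing Implicit Defensive.

Import GRing.Theory.
Local Open Scope ring_scope.
Local Open Scope quotient_scope.

(* The library proves that the quotient by a prime ideal has no zero divisors
   but does not make it an idomainType, which needs an inverse function. *)
Section PrimeQuotient.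
Variables (R : comNzRingType) (I : prime_idealr R).
Local Notation Q := {ideal_quot I}.

Definition pquot_unit : {pred Q} :=
  fun x => excluded_middle_informative (exists y : Q, y * x = 1) : bool.

Definition pquot_inv (x : Q) : Q :=
  match excluded_middle_informative (exists y : Q, y * x = 1) with
  | left ex => proj1_sig (constructive_indefinite_description _ ex)
  | right _ => x
  end.

Fact pquot_mulVx : {in pquot_unit, left_inverse 1 pquot_inv *%R}.
Proof.
move=> x; rewrite /pquot_inv unfold_in /pquot_unit.
by case: excluded_middle_informative => // ex _; case: (constructive_indefinite_description _ ex).
Qed.

Fact pquot_unitPl (x y : Q) : y * x = 1 -> pquot_unit x.
Proof.
by move=> yx; rewrite /pquot_unit; case: excluded_middle_informative => // -[]; exists y.
Qed.

Fact pquot_inv_out : {in [predC pquot_unit], pquot_inv =1 id}.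
Proof.
move=> x; rewrite inE /pquot_inv unfold_in /pquot_unit.
by case: excluded_middle_informative.
Qed.

HB.instance Definition _ := GRing.ComNzRing_hasMulInverse.Build Q
  pquot_mulVx pquot_unitPl pquot_inv_out.
HB.instance Definition _ := GRing.ComUnitRing_isIntegral.Build Q
  (@Quotient.rquot_IdomainAxiom R I).
End PrimeQuotient.

Definition homogeneous_ideal (k : fieldType) (n : nat)
    (P : {pred {mpoly k[n]}}) : Prop :=
  forall d F, F \in P -> pihomog mdeg d F \in P.

(* P does not contain the irrelevant ideal. *)
Definition relevant (k : fieldType) (n : nat)
    (P : {pred {mpoly k[n.+1]}}) : Prop :=
  exists i : 'I_n.+1, 'X_i \notin P.

Record projective_variety (k : fieldType) (n : nat) := ProjectiveVariety {
  pv_ideal :> prime_idealr {mpoly k[n.+1]};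
  pv_homogeneous : homogeneous_ideal pv_ideal;
  pv_relevant : relevant pv_ideal
}.

(* There is a chain P_0 < ... < P_e of prime ideals satisfying Q and
   containing J. *)
Definition prime_chain (R : comNzRingType) (Q : {pred R} -> Prop)
    (J : R -> Prop) (e : nat) : Prop :=
  exists P : nat -> {pred R},
    (forall i, (i <= e)%N -> [/\ idealr_closed (P i), prime_idealr_closed (P i),
       Q (P i) & forall F, J F -> F \in P i]) /\
    (forall i, (i < e)%N -> {subset P i <= P i.+1} /\
       exists2 F, F \in P i.+1 & F \notin P i).

Definition max_prime_chain (R : comNzRingType) (Q : {pred R} -> Prop)
    (J : R -> Prop) (e : nat) : Prop :=
  prime_chain Q J e /\ ~ prime_chain Q J e.+1.

(* dim R/J = e *)
Definition krull_dim (R : comNzRingType) (J : R -> Prop) (e : nat) : Prop :=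
  max_prime_chain (fun _ => True) J e.

(* A / (A /\ B) is a vector space of dimension e, with basis the classes of b;
   V is a k-algebra via j. *)
Definition quot_dim (k : fieldType) (V : comNzRingType) (j : k -> V)
    (A B : V -> Prop) (e : nat) : Prop :=
  exists b : 'I_e -> V,
    [/\ forall i, A (b i),
        forall v, A v -> exists c : 'I_e -> k, B (v - \sum_i j (c i) * b i) &
        forall c : 'I_e -> k, B (\sum_i j (c i) * b i) -> forall i, c i = 0].

(* P is the Hilbert polynomial of S/J, for J given by its homogeneous
   components J_t. *)
Definition hilbert_polynomial (k : fieldType) (n : nat)
    (J : nat -> {mpoly k[n]} -> Prop) (P : {poly rat}) : Prop :=
  exists t0 : nat, forall t, (t0 <= t)%N ->
    exists e : nat, quot_dim (@mpolyC n k) (fun F => F \is t.-homog) (J t) e /\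
      P.[t%:R] = e%:R.

(* Projective points are handled through their homogeneous coordinates. *)
Definition same_point (k : fieldType) (n : nat) (p q : 'I_n.+1 -> k) : Prop :=
  exists2 c : k, c != 0 & forall i, q i = c * p i.

Section Variety.
Variables (k : fieldType) (n : nat) (X : projective_variety k n).
Local Notation S := {mpoly k[n.+1]}.

Definition L := {fraction {ideal_quot X}}.

Definition to_L (F : S) : L := FracField.tofrac (\pi_({ideal_quot X}) F).

Definition on_variety (p : 'I_n.+1 -> k) : Prop :=
  (exists i, p i != 0) /\ forall F, F \in (X : {pred S}) -> F.@[p] = 0.

(* Elements of L X that are homogeneous of degree m. *)
Definition hdeg (m : int) (a : L) : Prop :=
  exists F G : S, exists d e : nat,
    [/\ F \is d.-homog, G \is e.-homog, d%:Z - e%:Z = m,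
        to_L G != 0 & a = to_L F / to_L G].

Definition function_field : L -> Prop := hdeg 0.

(* The stalk of O_X(m) at p. *)
Definition stalk (m : int) (p : 'I_n.+1 -> k) (a : L) : Prop :=
  exists F G : S, exists d e : nat,
    [/\ F \is d.-homog, G \is e.-homog, d%:Z - e%:Z = m,
        G.@[p] != 0 & a = to_L F / to_L G].

Definition local_ring : ('I_n.+1 -> k) -> L -> Prop := stalk 0.

Definition max_ideal (p : 'I_n.+1 -> k) (a : L) : Prop :=
  exists F G : S, exists d : nat,
    [/\ F \is d.-homog, G \is d.-homog, F.@[p] = 0,
        G.@[p] != 0 & a = to_L F / to_L G].

Definition max_ideal_sq (p : 'I_n.+1 -> k) (a : L) : Prop :=
  exists N : nat, exists b c : 'I_N -> L,
    [/\ forall i, max_ideal p (b i), forall i, max_ideal p (c i) &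
        a = \sum_i b i * c i].

(* a is a local generator of O_X(m) at p. *)
Definition local_generator (m : int) (p : 'I_n.+1 -> k) (a : L) : Prop :=
  [/\ a != 0, stalk m p a & stalk (- m) p a^-1].

Definition local_unit : ('I_n.+1 -> k) -> L -> Prop := local_generator 0.

(* Dimension as a topological space: chains of irreducible closed subsets. *)
Definition variety_dim (e : nat) : Prop :=
  max_prime_chain (fun P => homogeneous_ideal P /\ relevant P)
    (fun F : S => F \in (X : {pred S})) e.

Definition variety_degree (d : nat) : Prop :=
  exists e P, [/\ variety_dim e,
    hilbert_polynomial (fun _ F => F \in (X : {pred S})) P &
    d%:R = (e`!)%:R * lead_coef P :> rat].

(* u, v generate the maximal ideal of O_{X,p}. *)
Definition local_parameters2 (p : 'I_n.+1 -> k) (u v : L) : Prop :=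
  forall a, max_ideal p a <->
    exists b c, [/\ local_ring p b, local_ring p c & a = b * u + c * v].

(* Over an algebraically closed field, smooth means that all local rings are
   regular. *)
Definition smooth_surface : Prop :=
  variety_dim 2 /\
  forall p, on_variety p -> exists u v, local_parameters2 p u v.

(* k-derivations of the function field of X; only the restriction of D to the
   function field matters. *)
Definition derivation (D : L -> L) : Prop :=
  [/\ forall a, function_field a -> function_field (D a),
      forall a b, function_field a -> function_field b -> D (a + b) = D a + D b,
      forall a b, function_field a -> function_field b ->
        D (a * b) = a * D b + b * D a &
      forall c : k, D (to_L c%:MP) = 0].

(* The rational 2-form du /\ dv as an alternating form on derivations. *)
Definition wedge (u v : L) (D1 D2 : L -> L) : L := D1 u * D2 v - D1 v * D2 u.

(* omega_X is isomorphic to O_X(m), for a smooth surface X: omega_X(-m) has a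
   nowhere vanishing section f da /\ db with f of degree -m.  The stalk of
   omega_X at p is free on du /\ dv for local parameters u, v at p. *)
Definition canonical_iso_twist (m : int) : Prop :=
  exists f a b : L, [/\ hdeg (- m) f, function_field a, function_field b &
    forall p, on_variety p ->
    exists u v t e : L,
      [/\ local_parameters2 p u v, local_generator m p t, local_unit p e &
      forall D1 D2, derivation D1 -> derivation D2 ->
        f * t * wedge a b D1 D2 = e * wedge u v D1 D2]].

(* S-submodules M of L^r, with F in S acting by to_L F. *)
Section Modules.
Variable r : nat.
Implicit Types (M : 'rV[L]_r -> Prop).

Definition annihilator M (F : S) : Prop := forall v, M v -> to_L F *: v = 0.

(* The submodule (F_0, ..., F_{c-1}) M. *)
Definition seq_mul (Fs : seq S) M (v : 'rV[L]_r) : Prop :=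
  exists w : nat -> 'rV[L]_r, (forall j, M (w j)) /\
    v = \sum_(j < size Fs) to_L (nth 0 Fs j) *: w j.

Definition regular_sequence M (Fs : seq S) : Prop :=
  (forall i v, (i < size Fs)%N -> M v ->
     seq_mul (take i Fs) M (to_L (nth 0 Fs i) *: v) -> seq_mul (take i Fs) M v) /\
  (exists2 v, M v & ~ seq_mul Fs M v).

(* Graded Cohen-Macaulay modules: there is a regular sequence of homogeneous
   elements of positive degree whose length is dim M. *)
Definition cohen_macaulay M : Prop :=
  exists Fs : seq S,
    [/\ forall F, F \in Fs -> exists2 d, (0 < d)%N & F \is d.-homog,
        regular_sequence M Fs & krull_dim (annihilator M) (size Fs)].
End Modules.

Definition ACM : Prop :=
  cohen_macaulay (fun v : 'rV[L]_1 => exists F : S, v = const_mx (to_L F)).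

Definition arithmetically_gorenstein_surface : Prop :=
  ACM /\ exists m : int, canonical_iso_twist m.

(* A vector bundle of rank r on the integral scheme X, as a subsheaf of the
   constant sheaf K^r, where K is the function field: its stalk at p is
   spanned over O_{X,p} by the rows of [frame p], and every frame generates the
   stalks in a neighbourhood of its point.  Every vector bundle is isomorphic
   to one of these. *)
Record vector_bundle (r : nat) := VectorBundle {
  frame : ('I_n.+1 -> k) -> 'M[L]_r;
  frame_unit : forall p, on_variety p ->
    frame p \in unitmx /\ forall i j, function_field (frame p i j);
  frame_coherent : forall p, on_variety p ->
    exists G : S, exists d : nat, [/\ G \is d.-homog, G.@[p] != 0 &
      forall q, on_variety q -> G.@[q] != 0 -> forall i j,
        local_ring q ((frame p *m invmx (frame q)) i j) /\
        local_ring q ((frame q *m invmx (frame p)) i j)]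
}.

Section Bundle.
Variables (r : nat) (E : vector_bundle r).

(* v is in H^0(X, E(m)) *)
Definition global_section (m : int) (v : 'rV[L]_r) : Prop :=
  (forall i, hdeg m (v 0 i)) /\
  forall p, on_variety p -> forall i, stalk m p ((v *m invmx (frame E p)) 0 i).

(* The sum over all m is direct inside L^r. *)
Definition Gamma_star (v : 'rV[L]_r) : Prop :=
  exists (ms : seq int) (w : int -> 'rV[L]_r),
    (forall m, m \in ms -> global_section m (w m)) /\ v = \sum_(m <- ms) w m.

(* 0 <- Gamma_star <- S^(b 0) <- S(-1)^(b 1) <- ... <- S(-c)^(b c) <- 0 is
   exact, with matrices acting on row vectors; the resolution is minimal since
   the entries of the matrices are linear forms. *)
Definition linear_resolution (c : nat) : Prop :=
  exists (b : nat -> nat) (s : 'M[L]_(b 0%N, r))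
         (phi : forall i, 'M[S]_(b i.+1, b i)),
  [/\ forall i, (c < i)%N -> b i = 0%N,
      (forall j, global_section 0 (row j s)) /\
      (forall i x y, phi i x y \is 1.-homog),
      forall v, Gamma_star v <-> exists u : 'rV[S]_(b 0%N), v = map_mx to_L u *m s,
      forall u : 'rV[S]_(b 0%N),
        map_mx to_L u *m s = 0 <-> exists w, u = w *m phi 0%N &
      forall i (u : 'rV[S]_(b i.+1)), u *m phi i = 0 <-> exists w, u = w *m phi i.+1].

Definition ulrich : Prop :=
  [/\ (0 < r)%N, cohen_macaulay Gamma_star &
      exists2 e, variety_dim e & linear_resolution (n - e)].

(* The ideal of O_{X,p} generated by the maximal minors of r - 1 sections,
   the rows of s. *)
Definition degeneracy_ideal (s : 'M[L]_(r.-1, r)) (p : 'I_n.+1 -> k) (a : L) : Prop :=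
  exists c : 'I_r -> L, (forall j, local_ring p (c j)) /\
    a = \sum_j c j * \det (col' j (s *m invmx (frame E p))).

(* deg c_2(E) = N on a smooth surface: N is the length of the scheme where r - 1
   global sections of E become dependent, this scheme being finite (the
   description of the second Chern class as a degeneracy locus).  Such sections
   exist whenever E is globally generated, as Ulrich bundles are, and N does not
   depend on them; nothing is asserted for bundles having no such sections. *)
Definition second_chern_number (N : nat) : Prop :=
  exists s : 'M[L]_(r.-1, r), exists (l : nat) (p : 'I_l -> 'I_n.+1 -> k) (len : 'I_l -> nat),
  [/\ forall j, global_section 0 (row j s),
      (forall i, on_variety (p i)) /\
      (forall i j, same_point (p i) (p j) -> i = j),
      forall q, on_variety q ->
        (exists i, same_point (p i) q) \/ degeneracy_ideal s q 1,
      forall i, quot_dim (fun c : k => to_L c%:MP) (local_ring (p i))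
                  (degeneracy_ideal s (p i)) (len i) &
      N = (\sum_i len i)%N].
End Bundle.

(* In the rest of the section an effective Cartier divisor C is given by its
   ideal sheaf, a rank one subsheaf of O_X; the frame at p is then a local
   equation of C. *)
Definition local_equation (C : vector_bundle 1) (p : 'I_n.+1 -> k) : L :=
  frame C p 0 0.

Definition effective (C : vector_bundle 1) : Prop :=
  forall p, on_variety p -> local_ring p (local_equation C p).

(* The points of C are those where the local equation is in the maximal ideal;
   on a smooth surface, C is regular there if and only if the equation is not
   in the square of that ideal. *)
Definition smooth_curve (C : vector_bundle 1) : Prop :=
  [/\ effective C,
      exists2 p, on_variety p & max_ideal p (local_equation C p) &
      forall p, on_variety p -> max_ideal p (local_equation C p) ->
        ~ max_ideal_sq p (local_equation C p)].

(* The degree t part of the homogeneous ideal of C in P^n is the inverse image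
   of H^0(X, I_C(t)); p_a(C) = 1 - P_C(0). *)
Definition arithmetic_genus (C : vector_bundle 1) (g : int) : Prop :=
  exists2 P : {poly rat},
    hilbert_polynomial (fun t F => global_section C t%:Z (const_mx (to_L F))) P &
    g%:~R = 1 - P.[0].

(* det E is isomorphic to O_X(C), through multiplication by h. *)
Definition first_chern_class_represented (r : nat) (E : vector_bundle r)
    (C : vector_bundle 1) : Prop :=
  exists h : L, [/\ h != 0, function_field h &
    forall p, on_variety p ->
      local_unit p (h * \det (frame E p) * local_equation C p)].

(* S_1 -> H^0(X, O_X(1)) is onto, i.e. the embedding is given by the complete
   linear series of hyperplane sections. *)
Definition linearly_normal : Prop :=
  forall a : L, (forall p, on_variety p -> stalk 1 p a) ->
    exists2 F : S, F \is 1.-homog & a = to_L F.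

Definition del_pezzo : Prop :=
  [/\ smooth_surface, canonical_iso_twist (- 1) & linearly_normal].

(* X is a quadric hypersurface in the linear subspace P^3 of P^n where the
   forms l vanish; there are no such forms if n = 3. *)
Definition smooth_quadric_surface : Prop :=
  smooth_surface /\ (3 <= n)%N /\
  exists (l : 'I_(n - 3) -> S) (q : S),
  [/\ forall i, l i \is 1.-homog,
      forall c : 'I_(n - 3) -> k, \sum_i c i *: l i = 0 -> forall i, c i = 0,
      q \is 2.-homog &
      forall F, F \in (X : {pred S}) <->
        exists (a : 'I_(n - 3) -> S) (b : S), F = \sum_i a i * l i + b * q].
End Variety.

(* Main.v *)
(* Let A be the homogeneous coordinate ring and R = k[l_0, l_1, l_2] a Noether normalization by
   linear forms. The Cohen-Macaulay modules A and M = Gamma_*(E) are free over R: A is the sum of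
   the R(-a_i), with a_i = 0 for a single i, and since the resolution of M is linear, M = R^b with
   b at least r times the rank of A. The canonical module Hom_R(A, R(-3)) is A(m), that is
   Hom_R(A, R) = A(s) with s = m + 3, and A has a second basis over R, in degrees s - a_i; the
   generator of Hom_R(A, R) is found by comparing, at each point, the given 2-form with the socle
   of the diagonal in the tensor square of A. Duality turns M = R^b into the Hilbert function of
   Hom(E, O).

   In 0 -> I_C -> Hom(E, O) -> O^(r-1), the second map given by the r - 1 sections and the first by
   their maximal minors, the cokernel has in high degrees dimension at least the length of the
   degeneracy scheme. Put kappa(a) = (1 - a)(2 - a) / 2 for all a; for a natural number it vanishes
   at 1 and 2 only, and increases from 1 on. The hypothesis on c_2 gives
   r + b kappa(s) <= r sum_i kappa(a_i). As kappa(a_i) <= kappa(s) for a_i > 0, this forces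
   kappa(s) = 0: either s = 1, A = R + R(-1) and X is a quadric, or s = 2 and m = -1. *)
From HB Require Import structures.
Require Import Defs.
From mathcomp Require Import all_boot all_order all_algebra.
From mathcomp Require Import mpoly ring zify.
From mathcomp Require classical_sets.
From Stdlib Require Import Classical ClassicalEpsilon FunctionalExtensionality PropExtensionality.

Set Implicit Arguments.
Unset Strict Implicit.
Unset Printing Implicit Defensive.
Import GRing.Theory.
Local Open Scope ring_scope.

(** * Dimension of subspaces given by predicates *)

(** No cohomology is used: Euler characteristics enter as values at 0 of Hilbert polynomials of
    explicit graded modules, which is where [kappa] comes from. The hypothesis on the canonical
    bundle is local, about 2-forms at points, whereas the count needs a global R-linear form on A.
    The bridge is the Noether different. Near the diagonal point over p, the differences of the two
    copies of the l_i in the tensor square are a matrix G times the differences for local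
    coordinates. Over R and up to a unit, det G annihilates the ideal of the diagonal, so it carries
    an R-linear form; its restriction to the diagonal is the Jacobian that compares the 2-forms.
    Wiebe's lemma shows that the form generates locally. Linearity of the resolution enters through
    one number: the Hilbert polynomials of S, S(-1), ..., S(-(n-2)) vanish at -2, while that of
    R(-a) takes there the value a (a + 1) / 2. For the degeneracy scheme a lower bound on the
    cokernel is enough; linkage by powers of two parameters provides it. *)

Lemma ord_choice (m : nat) (T : Type) (R : 'I_m -> T -> Prop) :
  (forall i, exists x, R i x) -> exists f : 'I_m -> T, forall i, R i (f i).
Proof.
move=> H; exists (fun i => proj1_sig (constructive_indefinite_description _ (H i))).
by move=> i; case: constructive_indefinite_description.
Qed.

Section Fdim.
Variables (K : fieldType) (V : lmodType K).
Implicit Types (W : V -> Prop).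

Definition subsp W := W 0 /\ forall (c : K) u v, W u -> W v -> W (c *: u + v).

Definition lfree m (b : 'I_m -> V) :=
  forall c : 'I_m -> K, \sum_i c i *: b i = 0 -> forall i, c i = 0.

Definition spanned m (b : 'I_m -> V) (v : V) :=
  exists c : 'I_m -> K, v = \sum_i c i *: b i.

Definition fdim W m := exists b : 'I_m -> V,
  [/\ forall i, W (b i), forall v, W v -> spanned b v & lfree b].

Lemma subsp_sum W m (c : 'I_m -> K) (b : 'I_m -> V) :
  subsp W -> (forall i, W (b i)) -> W (\sum_i c i *: b i).
Proof.
move=> [W0 WD] Wb; elim/big_ind: _ => // [u v Wu Wv|i _].
  by rewrite -[u]scale1r; apply: WD.
by rewrite -[_ *: _]addr0; apply: WD.
Qed.

Lemma subspZ W c u : subsp W -> W u -> W (c *: u).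
Proof. by move=> [W0 WD] Wu; rewrite -[_ *: _]addr0; apply: WD. Qed.

Lemma subspD W u v : subsp W -> W u -> W v -> W (u + v).
Proof. by move=> [W0 WD] Wu Wv; rewrite -[u]scale1r; apply: WD. Qed.

Lemma subspB W u v : subsp W -> W u -> W v -> W (u - v).
Proof. by move=> [W0 WD] Wu Wv; rewrite addrC -scaleN1r; apply: WD. Qed.

Lemma steinitz m n (b : 'I_m -> V) (g : 'I_n -> V) :
  lfree b -> (forall i, spanned g (b i)) -> (m <= n)%N.
Proof.
move=> fb sp; have [c Hc] := ord_choice sp.
rewrite leqNgt; apply/negP => lt_nm.
pose C : 'M[K]_(m, n) := \matrix_(i, j) c i j.
have : kermx C != 0.
  by rewrite -mxrank_eq0 mxrank_ker subn_eq0 -ltnNge (leq_ltn_trans (rank_leq_col C)).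
case/rowV0Pn => u /sub_kermxP uC /rV0Pn[i ui].
case/eqP: ui; apply: (fb (fun i => u 0 i)).
transitivity (\sum_j (u *m C) 0 j *: g j).
  under eq_bigr => i0 _ do rewrite Hc scaler_sumr.
  rewrite exchange_big; apply: eq_bigr => j _.
  rewrite mxE scaler_suml; apply: eq_bigr => i0 _.
  by rewrite mxE scalerA.
by rewrite uC big1 // => j _; rewrite mxE scale0r.
Qed.

Lemma lfree_cons m (b : 'I_m -> V) v : lfree b -> ~ spanned b v ->
  lfree (fun i : 'I_(m + 1) => match split i with inl j => b j | inr _ => v end).
Proof.
move=> fb nv c; rewrite big_split_ord /= big_ord1.
under eq_bigr => i _ do rewrite (unsplitK (inl i)).
rewrite (unsplitK (inr _)) => H.
have cv : c (rshift m ord0) = 0.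
  apply/eqP/negP => /negP nz; apply: nv.
  exists (fun i => - (c (rshift m ord0))^-1 * c (lshift 1 i)).
  apply: (scalerI nz); rewrite scaler_sumr.
  under eq_bigr => i _ do rewrite scalerA mulNr mulrN mulrA divff // mul1r scaleNr.
  by rewrite sumrN; apply/eqP; rewrite -addr_eq0 addrC H.
move=> i; rewrite -(splitK i); case: (split i) => j /=; last by rewrite [j]ord1.
by apply: (fb (fun j => c (lshift 1 j))); rewrite -[RHS]H cv scale0r addr0.
Qed.

(** The ambient space is usually infinite dimensional, so a longest independent family in [W] is
    taken; [steinitz] bounds its length, and being longest it spans. *)
Lemma fdim_exists W n (g : 'I_n -> V) : subsp W ->
  (forall v, W v -> spanned g v) -> exists2 e, (e <= n)%N & fdim W e.
Proof.
move=> sW sp.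
pose P m := exists b : 'I_m -> V, (forall i, W (b i)) /\ lfree b.
have P0 : P 0%N by exists (fun=> 0); split=> [[]|? ? []].
have Pn m : P m -> (m <= n)%N.
  by move=> [b [Wb fb]]; apply: steinitz fb _ => i; apply: sp.
have [e Pe PSe] : exists2 e, P e & ~ P (e + 1)%N.
  apply: NNPP => H.
  have PS m : P m.
    elim: m => // m IH; apply: NNPP => nP; apply: H; exists m => //.
    by rewrite addn1.
  by have := Pn _ (PS n.+1); rewrite ltnn.
exists e; first exact: Pn.
case: Pe => b [Wb fb]; exists b; split=> // v Wv; apply: NNPP => nv.
apply: PSe; exists (fun i : 'I_(e + 1) => match split i with inl j => b j | inr _ => v end).
by split; [move=> i; case: split | apply: lfree_cons].
Qed.

Lemma fdim_le W W' m m' : (forall v, W v -> W' v) -> fdim W m -> fdim W' m' -> (m <= m')%N.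
Proof.
move=> sWW' [b [Wb _ fb]] [b' [_ sp' _]].
by apply: steinitz fb _ => i; apply/sp'/sWW'.
Qed.

Lemma fdim_unique W m m' : fdim W m -> fdim W m' -> m = m'.
Proof.
by move=> H H'; apply/eqP; rewrite eqn_leq (fdim_le _ H H') // (fdim_le _ H' H).
Qed.

Lemma fdim_sub W W' m : subsp W -> (forall v, W v -> W' v) -> fdim W' m ->
  exists2 e, (e <= m)%N & fdim W e.
Proof. by move=> sW sWW' [b [_ sp _]]; apply: (@fdim_exists W m b) => // v /sWW'/sp. Qed.

Lemma fdim_ext W W' m : (forall v, W v <-> W' v) -> fdim W m -> fdim W' m.
Proof.
move=> e [b [Wb sp fb]]; exists b; split=> // [i|v]; first exact/e.
by move=> /e; apply: sp.
Qed.

End Fdim.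

(** Rank-nullity for a map that is only known to be linear on [W]: a basis of the kernel is
    completed by lifts of a basis of the image. *)
Lemma fdim_ker_im (K : fieldType) (V V' : lmodType K) (W : V -> Prop) (f : V -> V') m m' :
  subsp W -> (forall c u v, W u -> W v -> f (c *: u + v) = c *: f u + f v) ->
  fdim (fun v => W v /\ f v = 0) m -> fdim (fun w => exists2 v, W v & w = f v) m' ->
  fdim W (m + m')%N.
Proof.
move=> sW fl [b [Wb spb fb]] [b' [Wb' spb' fb']].
have f0 : f 0 = 0.
  have [W0 _] := sW; have := fl 1 0 0 W0 W0.
  by rewrite !scale1r addr0 => /esym/eqP; rewrite -subr_eq0 addrK => /eqP.
have fs q (c : 'I_q -> K) (u : 'I_q -> V) : (forall i, W (u i)) ->
    f (\sum_i c i *: u i) = \sum_i c i *: f (u i).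
  elim: q c u => [|q IH] c u Wu; first by rewrite !big_ord0.
  rewrite !big_ord_recl fl // ?IH //; exact: subsp_sum.
have [d Hd] : exists d : 'I_m' -> V, forall i, W (d i) /\ b' i = f (d i).
  by apply: (@ord_choice m' V (fun i v => W v /\ b' i = f v)) => i; have [v ? ?] := Wb' i; exists v.
exists (fun i => match split i with inl j => b j | inr j => d j end); split.
- by move=> i; case: split => j; [have [] := Wb j | have [] := Hd j].
- move=> v Wv; have [c' Hc'] := spb' (f v) (ex_intro2 _ _ v Wv erefl).
  have Wd i : W (d i) by have [] := Hd i.
  have [c Hc] : spanned b (v - \sum_i c' i *: d i).
    apply: spb; split; first by apply: subspB => //; apply: subsp_sum.
    rewrite addrC -scaleN1r fl //; last exact: subsp_sum.
    rewrite fs // Hc' scaleN1r.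
    by under eq_bigr => i _ do rewrite -(Hd i).2; rewrite addNr.
  exists (fun i => match split i with inl j => c j | inr j => c' j end).
  rewrite big_split_ord /=.
  under eq_bigr => i _ do rewrite (unsplitK (inl i)).
  under [in X in _ + X]eq_bigr => i _ do rewrite (unsplitK (inr i)).
  by rewrite -Hc subrK.
- move=> c; rewrite big_split_ord /=.
  under eq_bigr => i _ do rewrite (unsplitK (inl i)).
  under [in X in _ + X]eq_bigr => i _ do rewrite (unsplitK (inr i)).
  move=> H.
  have c'0 : forall j, c (rshift m j) = 0.
    apply: (fb' (fun j => c (rshift m j))).
    have Wd i : W (d i) by have [] := Hd i.
    have WB i : W (b i) by have [] := Wb i.
    have E : f (\sum_i c (lshift m' i) *: b i + \sum_i c (rshift m i) *: d i) = 0.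
      by rewrite H f0.
    rewrite -[X in f (X + _)]scale1r fl in E; try exact: subsp_sum.
    rewrite !fs // scale1r [X in X + _ = _]big1 ?add0r in E => [|i _]; last first.
      by rewrite (Wb i).2 scaler0.
    by rewrite -[RHS]E; apply: eq_bigr => i _; rewrite (Hd i).2.
  move=> i; rewrite -(splitK i); case: (split i) => j /=; last exact: c'0.
  apply: (fb (fun j => c (lshift m' j))); rewrite -[RHS]H.
  by rewrite [X in _ = _ + X]big1 ?addr0 // => i0 _; rewrite c'0 scale0r.
Qed.

(** A family in [W] that is as long as possible while independent modulo [B]. Independence modulo
    [B] implies independence, so [n] bounds its length. *)
Lemma quot_basis (K : fieldType) (V : lmodType K) (W B : V -> Prop) n (g : 'I_n -> V) :
  subsp W -> subsp B -> (forall v, W v -> spanned g v) ->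
  exists m (b : 'I_m -> V), [/\ forall i, W (b i),
    forall v, W v -> exists c : 'I_m -> K, B (v - \sum_i c i *: b i) &
    forall c : 'I_m -> K, B (\sum_i c i *: b i) -> forall i, c i = 0].
Proof.
move=> sW sB sp; have [B0 _] := sB.
pose P m := exists b : 'I_m -> V, (forall i, W (b i)) /\
  forall c : 'I_m -> K, B (\sum_i c i *: b i) -> forall i, c i = 0.
have P0 : P 0%N by exists (fun=> 0); split=> [[]|? ? []].
have Pn m : P m -> (m <= n)%N.
  move=> [b [Wb fb]]; apply: (@steinitz _ _ m n b) => [c E|i]; last exact: sp.
  by apply: fb; rewrite E.
have [e Pe PSe] : exists2 e, P e & ~ P (e + 1)%N.
  apply: NNPP => H.
  have PS m : P m.
    elim: m => // m IH; apply: NNPP => nP; apply: H; exists m => //.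
    by rewrite addn1.
  by have := Pn _ (PS n.+1); rewrite ltnn.
case: Pe => b [Wb fb]; exists e, b; split=> // v Wv; apply: NNPP => nv; apply: PSe.
exists (fun i : 'I_(e + 1) => match split i with inl j => b j | inr _ => v end).
split; first by move=> i; case: split.
move=> c; rewrite big_split_ord /= big_ord1.
under eq_bigr => i _ do rewrite (unsplitK (inl i)).
rewrite (unsplitK (inr _)) => H.
have cv : c (rshift e ord0) = 0.
  apply/eqP/negP => /negP nz; apply: nv.
  exists (fun i => - (c (rshift e ord0))^-1 * c (lshift 1 i)).
  have := subspZ (c (rshift e ord0))^-1 sB H.
  rewrite scalerDr scalerA mulVf // scale1r addrC scaler_sumr.
  congr (B (_ + _)); rewrite -sumrN; apply: eq_bigr => i _.
  by rewrite scalerA mulNr scaleNr opprK.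
move=> i; rewrite -(splitK i); case: (split i) => j /=; last by rewrite [j]ord1.
by apply: (fb (fun j => c (lshift 1 j))); move: H; rewrite cv scale0r addr0.
Qed.

Lemma fdim_spanned (K : fieldType) (V : lmodType K) (W : V -> Prop) m :
  fdim W m -> exists g : 'I_m -> V, forall v, W v -> spanned g v.
Proof. by move=> [b [_ sp _]]; exists b. Qed.

Lemma fdim_fin (K : fieldType) (V : lmodType K) (W : V -> Prop) (I : finType) (b : I -> V) :
  (forall i, W (b i)) -> (forall v, W v -> exists c : I -> K, v = \sum_i c i *: b i) ->
  (forall c : I -> K, \sum_i c i *: b i = 0 -> forall i, c i = 0) -> fdim W #|I|.
Proof.
move=> Wb sp fb; exists (fun j => b (enum_val j)); split=> // [v /sp[c ->]|c H i].
  exists (fun j => c (enum_val j)).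
  by rewrite (reindex (@enum_val I I)) //; apply: onW_bij; apply: enum_val_bij.
rewrite -[i]enum_valK; apply: (fb (fun x => c (enum_rank x))).
rewrite (reindex (@enum_val I I)) /=; last by apply: onW_bij; apply: enum_val_bij.
by rewrite -[RHS]H; apply: eq_bigr => j _; rewrite enum_valK.
Qed.

Lemma fdim_homog (K : fieldType) n t :
  fdim (fun F : {mpoly K[n.+1]} => F \is t.-homog) 'C(t + n, n).
Proof.
have E : \dim (fullv : {vspace dhomog n.+1 K t}) = 'C(t + n, n).
  by rewrite dimvf /dim /= -[in RHS](bin_sub (leq_addl t n)) addnK.
rewrite -E; pose b := vbasis (fullv : {vspace dhomog n.+1 K t}).
exists (fun i => (b`_i : {mpoly K[n.+1]})); split.
- by move=> i; apply: dhomog_is_dhomog.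
- move=> F hF; exists (fun i => coord b i (DHomog hF)).
  have := coord_vbasis (memvf (DHomog hF)) => /(congr1 (@mpoly_of_dhomog _ _ _)) /= {1}->.
  by rewrite raddf_sum.
- move=> c H i; have := vbasisP (fullv : {vspace dhomog n.+1 K t}) => /basis_free/freeP; apply.
  apply: val_inj; rewrite /= raddf_sum /= -[RHS]H; by apply: eq_bigr.
Qed.

Lemma sum_over_enum (I : finType) (W : nmodType) (F : I -> W) :
  \sum_p F p = \sum_(i < #|I|) F (enum_val i).
Proof. by rewrite (reindex (@enum_val I I)) //; apply: onW_bij; apply: enum_val_bij. Qed.

(** * Hilbert's Nullstellensatz *)
Section Elimination.
Import Pdiv.Ring Pdiv.RingMonic.

Definition ideal (R : comNzRingType) (J : R -> Prop) : Prop :=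
  [/\ J 0, forall x y, J x -> J y -> J (x + y) & forall a x, J x -> J (a * x)].

Lemma ideal_sum (R : comNzRingType) (J : R -> Prop) (T : Type) (s : seq T) (P : pred T)
    (F : T -> R) : ideal J -> (forall i, P i -> J (F i)) -> J (\sum_(i <- s | P i) F i).
Proof. by move=> [J0 JD _] H; elim/big_ind: _. Qed.

Lemma mpoly_rmorph_ext (R S : comNzRingType) (n : nat) (f g : {rmorphism {mpoly R[n]} -> S}) :
  (forall c, f c%:MP = g c%:MP) -> (forall i, f 'X_i = g 'X_i) -> f =1 g.
Proof.
move=> HC HX p; rewrite [p]mpolyE !rmorph_sum; apply: eq_bigr => m _.
rewrite -mul_mpolyC !rmorphM HC mpolyXE_id !rmorph_prod; congr (_ * _).
by apply: eq_bigr => i _; rewrite !rmorphXn HX.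
Qed.

(* For [f] monic, the determinant of multiplication by [g] on [R[X]/(f)] lies in the ideal
   [(f, g)]: it plays the role of the resultant and is compatible with specialization. *)
Lemma norm_mod_monic (R : comNzRingType) (f g : {poly R}) : f \is monic ->
  exists c : R, (exists u v, c%:P = u * f + v * g) /\
    forall (K : fieldType) (h : {rmorphism R -> K}), map_poly h g = 1 -> h c = 1.
Proof.
move=> mf; case szf : (size f) => [|D].
  by have := monic_neq0 mf; rewrite -size_poly_eq0 szf eqxx.
have mod_small p : (size (rmodp p f) <= D)%N.
  by rewrite -ltnS -szf ltn_rmodpN0 ?monic_neq0.
have expand (S : nzRingType) (p : {poly S}) : (size p <= D)%N -> p = \sum_(j < D) (p`_j)%:P * 'X^j.
  move=> sz; rewrite -[LHS]coefK poly_def (big_ord_widen D (fun j => p`_j *: 'X^j)) //.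
  rewrite big_mkcond; apply: eq_bigr => j _; rewrite mul_polyC.
  by case: ltnP => // /(nth_default 0) ->; rewrite scale0r.
pose G : 'M[R]_D := \matrix_(i, j) (rmodp ('X^i * g) f)`_j.
have eqG (i : 'I_D) : 'X^i * g = rdivp ('X^i * g) f * f + \sum_(j < D) (G i j)%:P * 'X^j.
  rewrite {1}(Pdiv.RingMonic.rdivp_eq mf ('X^i * g)); congr (_ + _).
  by rewrite [LHS]expand //; apply: eq_bigr => j _; rewrite mxE.
exists (\det G); split.
  (* Degree 0 is separate because row [ord0] of the adjugate is used below; here [f] is 1. *)
  case: D => [|D] in szf mod_small expand G eqG *.
    have -> : f = 1.
      have := monicP mf; rewrite lead_coefE szf /= => f0.
      by rewrite [LHS]size1_polyC ?szf // f0.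
    by exists (\det G)%:P, 0; rewrite mul0r addr0 mulr1.
  pose G' := map_mx polyC G.
  pose a (i : 'I_D.+1) := \adj G' ord0 i.
  have E : (\det G)%:P = \sum_i a i * \sum_j G' i j * 'X^j.
    (* Row 0 of the adjugate combines the relations [eqG] into the determinant times X^0. *)
    transitivity (\sum_j (\adj G' *m G') ord0 j * 'X^j).
      rewrite mul_adj_mx big_ord_recl big1 ?addr0 => [|j _].
        by rewrite !mxE eqxx mulr1n det_map_mx expr0 mulr1.
      by rewrite !mxE mulr0n mul0r.
    under eq_bigr => j _ do rewrite mxE mulr_suml.
    rewrite exchange_big; apply: eq_bigr => i _; rewrite mulr_sumr.
    by apply: eq_bigr => j _; rewrite mulrA.
  exists (- \sum_i a i * rdivp ('X^i * g) f), (\sum_i a i * 'X^i).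
  rewrite E mulNr !mulr_suml -sumrN -big_split; apply: eq_bigr => i _ /=.
  rewrite -!mulrA [X in _ = - _ + _ * X]eqG mulrDr addrA addNr add0r; congr (_ * _).
  by apply: eq_bigr => j _; rewrite mxE.
move=> K h hg; rewrite -det_map_mx.
(* When [g] specializes to 1, multiplication by it is the identity, and so is its matrix in the
   basis of powers of X. *)
suff -> : map_mx h G = 1%:M by rewrite det1.
apply/matrixP => i j; rewrite !mxE.
have f1 : f`_D = 1 by rewrite -(monicP mf) lead_coefE szf.
have szhf : size (map_poly h f) = D.+1.
  by rewrite size_map_poly_id0 // (monicP mf) rmorph1 oner_neq0.
have mhf : map_poly h f \is monic by rewrite monicE lead_coefE szhf coef_map /= f1 rmorph1.
have := congr1 (map_poly h) (eqG i).
rewrite rmorphM /= hg mulr1 map_polyXn rmorphD rmorphM /= => E.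
pose r := \poly_(j < D) (if insub j is Some j' then h (G i j') else 0).
have Er : map_poly h (\sum_(j < D) (G i j)%:P * 'X^j) = r.
  rewrite [r]expand ?size_poly // rmorph_sum; apply: eq_bigr => l _ /=.
  by rewrite rmorphM /= map_polyC map_polyXn coef_poly ltn_ord valK.
have : rmodp 'X^i (map_poly h f) = r.
  by rewrite E Er Pdiv.RingMonic.rmodp_addl_mul_small // szhf ltnS size_poly.
rewrite rmodp_small ?size_polyXn ?szhf ?ltnS // => /(congr1 (fun p : {poly K} => p`_j)).
by rewrite coefXn coef_poly ltn_ord valK mxE => <-; rewrite eq_sym.
Qed.

Lemma linear_coef (R : nzRingType) (a b : R) :
  (size (a%:P + b%:P * 'X)%R <= 2)%N /\ (a%:P + b%:P * 'X)`_1 = b.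
Proof.
rewrite addrC; split; last by rewrite coefD coefMX !coefC /= addr0.
by rewrite size_MXaddC; case: ifP => // _; rewrite ltnS size_polyC leq_b1.
Qed.

Section LinearChange.
Variables (K : fieldType) (n : nat) (c : 'I_n -> K).
Local Notation P := {poly {mpoly K[n]}}.

(* [shear] and [unshear] are the isomorphism [K[x_0..x_n] = K[x_0..x_(n-1)][X]] for which [x_n]
   is [X] and [x_j] is [x_j + c_j X]. *)
Definition shear_var (i : 'I_n.+1) : P :=
  if unlift ord_max i is Some j then ('X_j : {mpoly K[n]})%:P + (c j)%:MP%:P * 'X else 'X.

Definition shear : {mpoly K[n.+1]} -> P := mmap (polyC \o @mpolyC n K) shear_var.
HB.instance Definition _ := GRing.RMorphism.on shear.

Definition unshear_coef : {mpoly K[n]} -> {mpoly K[n.+1]} :=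
  mmap (@mpolyC n.+1 K) (fun j => 'X_(lift ord_max j) - (c j)%:MP * 'X_ord_max).
HB.instance Definition _ := GRing.RMorphism.on unshear_coef.

Lemma unshear_comm : commr_rmorph unshear_coef ('X_ord_max : {mpoly K[n.+1]}).
Proof. by move=> x; apply: mulrC. Qed.

Definition unshear : P -> {mpoly K[n.+1]} := horner_morph unshear_comm.
HB.instance Definition _ := GRing.RMorphism.on unshear.

Lemma shearC a : shear a%:MP = a%:MP%:P. Proof. by rewrite /shear mmapC. Qed.

Lemma shearX i : shear 'X_i = shear_var i. Proof. by rewrite /shear mmapX mmap1U. Qed.

Lemma unshearC a : unshear a%:P = unshear_coef a. Proof. by rewrite /unshear horner_morphC. Qed.

Lemma unshearX : unshear 'X = 'X_ord_max. Proof. by rewrite /unshear horner_morphX. Qed.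

Lemma unshear_coefC a : unshear_coef a%:MP = a%:MP.
Proof. by rewrite /unshear_coef mmapC. Qed.

Lemma unshear_coefX j : unshear_coef 'X_j = 'X_(lift ord_max j) - (c j)%:MP * 'X_ord_max.
Proof. by rewrite /unshear_coef mmapX mmap1U. Qed.

Lemma unshear_coefD : {morph unshear_coef : x y / x + y}. Proof. exact: rmorphD. Qed.
Lemma unshear_coefM : {morph unshear_coef : x y / x * y}. Proof. exact: rmorphM. Qed.
Lemma shearD : {morph shear : x y / x + y}. Proof. exact: rmorphD. Qed.
Lemma shearM : {morph shear : x y / x * y}. Proof. exact: rmorphM. Qed.
Lemma unshearD : {morph unshear : x y / x + y}. Proof. exact: rmorphD. Qed.
Lemma unshearM : {morph unshear : x y / x * y}. Proof. exact: rmorphM. Qed.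

Lemma shearK : cancel shear unshear.
Proof.
move=> p; apply: (@mpoly_rmorph_ext _ _ _ (unshear \o shear) idfun) => [a|i] /=.
  by rewrite shearC unshearC unshear_coefC.
rewrite shearX /shear_var; case: unliftP => [j|] ->; last by rewrite unshearX.
by rewrite rmorphD rmorphM /= !unshearC unshearX unshear_coefC unshear_coefX subrK.
Qed.

Lemma unshearK : cancel unshear shear.
Proof.
have HC a : shear (unshear a%:P) = a%:P.
  apply: (@mpoly_rmorph_ext _ _ _ (shear \o unshear \o polyC) polyC) => [b|j] /=.
    by rewrite unshearC unshear_coefC shearC.
  rewrite unshearC unshear_coefX rmorphB rmorphM /= shearC !shearX /shear_var.
  by rewrite liftK unlift_none addrK.
elim/poly_ind => [|p a IH]; first by rewrite !rmorph0.
by rewrite !rmorphD !rmorphM /= IH HC unshearX shearX /shear_var unlift_none.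
Qed.

Definition shear_point (a : 'I_n -> K) (b : K) (i : 'I_n.+1) : K :=
  if unlift ord_max i is Some j then a j + c j * b else b.

Lemma shear_eval a b p : (map_poly (meval a) (shear p)).[b] = p.@[shear_point a b].
Proof.
apply: (@mpoly_rmorph_ext _ _ _
  (horner_eval b \o map_poly (meval a) \o shear) (meval (shear_point a b))) => [e|i] /=.
  by rewrite shearC /horner_eval map_polyC hornerC /= !mevalC.
rewrite shearX mevalXU /shear_var /shear_point /horner_eval.
case: unliftP => [j|] _; last by rewrite map_polyX hornerX.
rewrite rmorphD rmorphM /= !map_polyC map_polyX hornerD hornerM !hornerC hornerX /=.
by rewrite mevalXU mevalC.
Qed.

Lemma shear_eval_coef a b q : (map_poly (meval a) q).[b] = (unshear q).@[shear_point a b].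
Proof. by rewrite -shear_eval unshearK. Qed.

(** The degree is only bounded by [d] and [e] may be 0, so that the notion is stable under sums. *)
Definition top_coef (d : nat) (p : P) (e : K) := (size p <= d.+1)%N /\ p`_d = e%:MP.

Lemma top_coefM d1 d2 p1 p2 e1 e2 : top_coef d1 p1 e1 -> top_coef d2 p2 e2 ->
  top_coef (d1 + d2) (p1 * p2) (e1 * e2).
Proof.
move=> [s1 c1] [s2 c2]; split.
  by apply: (leq_trans (size_polyMleq _ _)); move: s1 s2; lia.
rewrite coefM (bigD1 (inord d1)) //= big1 => [|i].
  by rewrite inordK ?ltnS ?leq_addr // addnC addnK c1 c2 mpolyCM addr0.
rewrite -val_eqE /= inordK ?ltnS ?leq_addr // => ne.
have [lt|gt|eq] := ltngtP i d1; last by rewrite eq eqxx in ne.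
  by rewrite [X in _ * X]nth_default ?mulr0 // (leq_trans s2) //; lia.
by rewrite [X in X * _]nth_default ?mul0r // (leq_trans s1).
Qed.

Lemma top_coef_sum d (T : eqType) (s : seq T) (F : T -> P) (e : T -> K) :
  (forall i, i \in s -> top_coef d (F i) (e i)) ->
  top_coef d (\sum_(i <- s) F i) (\sum_(i <- s) e i).
Proof.
move=> H; rewrite big_seq [X in top_coef _ _ X]big_seq.
elim/big_rec2: _ => [|i e1 p1 /H[s1 c1] [s2 c2]]; first by rewrite /top_coef size_poly0 coef0.
split; last by rewrite coefD c1 c2 mpolyCD.
by apply: (leq_trans (size_polyD _ _)); rewrite geq_max s1 s2.
Qed.

Definition shear_dir (i : 'I_n.+1) : K := if unlift ord_max i is Some j then c j else 1.

Lemma top_coef_shearX m : top_coef (mdeg m) (shear 'X_[m]) ('X_[m]).@[shear_dir].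
Proof.
rewrite mevalX mpolyXE_id rmorph_prod mdegE.
elim/big_rec3: _ => [|i x y z _ IH]; first by split; rewrite ?size_poly1 // coef1.
apply: top_coefM IH; rewrite rmorphXn /= shearX.
elim: (m i) => [|q IHq]; first by rewrite !expr0; split; rewrite ?size_poly1 // coef1.
rewrite !exprS -[q.+1]add1n; apply: top_coefM IHq; rewrite /shear_var /shear_dir.
case: unliftP => [j|] _; last by split; rewrite ?size_polyX // coefX.
exact: linear_coef.
Qed.

(** As in Noether normalization: [x_n] becomes X and [x_j] becomes [x_j + c_j X], so the coefficient
    of X^d is the value of the form of degree [d] at the direction [(c, 1)]. It is a constant, and
    where it is not 0 the image is monic up to a scalar. *)
Lemma top_coef_shear d p : (msize p <= d.+1)%N ->
  top_coef d (shear p) (pihomog mdeg d p).@[shear_dir].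
Proof.
move=> sz; rewrite pihomogE rmorph_sum /= [X in shear X]mpolyE rmorph_sum /=.
rewrite [X in top_coef _ _ X]big_mkcond; apply: (@top_coef_sum d _ (msupp p) (fun m => shear (p@_m *: 'X_[m]))
  (fun m => if mdeg m == d then (p@_m *: 'X_[m]).@[shear_dir] else 0)) => m mp.
have Hm := top_coef_shearX m; have lem : (mdeg m <= d)%N.
  by rewrite -ltnS (leq_trans _ sz) // msize_mdeg_lt.
rewrite -mul_mpolyC rmorphM /= shearC.
have TC0 : top_coef 0 ((p@_m)%:MP%:P : P) p@_m.
  by split; rewrite ?size_polyC ?leq_b1 // coefC.
have := top_coefM TC0 Hm; rewrite add0n.
case: eqP => [<-|/eqP ne] [s1 c1]; first by split=> //; rewrite c1 mevalM mevalC.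
split; first by apply: (leq_trans s1); rewrite ltnS.
by rewrite nth_default // (leq_trans s1) // ltn_neqAle ne lem.
Qed.

End LinearChange.

Section Nullstellensatz.
Variable K : closedFieldType.

Lemma mpoly0_const (p : {mpoly K[0]}) : p = (p.@[fun=> 0])%:MP.
Proof.
have E : p = (p@_0%MM)%:MP.
  by apply/mpolyP => m; have -> : m = 0%MM by [apply/mnmP => -[]]; rewrite mcoeffC eqxx mulr1.
by rewrite [LHS]E [p in RHS]E mevalC.
Qed.

Lemma mpoly_nonroot n (p : {mpoly K[n]}) : p != 0 -> exists v, p.@[v] != 0.
Proof.
elim: n p => [|n IH] p p0.
  exists (fun=> 0); apply: contra p0 => /eqP pv; apply/eqP.
  by rewrite (mpoly0_const p) pv mpolyC0.
have sp0 : shear (fun=> 0) p != 0.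
  by apply: contra p0 => /eqP E; rewrite -(shearK (fun=> 0) p) E rmorph0.
have /IH[a Ha] : lead_coef (shear (fun=> 0) p) != 0 by rewrite lead_coef_eq0.
have : map_poly (meval a) (shear (fun=> 0) p) != 0.
  apply: contra Ha => /eqP/(congr1 (fun q : {poly K} => q`_(size (shear (fun=> 0) p)).-1)).
  by rewrite coef_map coef0 -lead_coefE => ->.
case/closed_nonrootP => b; rewrite /root shear_eval => Hb.
by exists (shear_point (fun=> 0) a b).
Qed.

Lemma dhomog_eval (R : comNzRingType) n (p : {mpoly R[n]}) d (v : 'I_n -> R) t :
  p \is d.-homog -> p.@[fun i => t * v i] = t ^+ d * p.@[v].
Proof.
move=> /dhomogP hp; rewrite !mevalE mulr_sumr; apply: eq_big_seq => m /hp /= <-.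
under eq_bigr => i _ do rewrite exprMn.
rewrite big_split /= mdegE.
rewrite (big_morph _ (exprD t) (expr0 t)).
by rewrite mulrCA.
Qed.

Lemma univariate_zero (J : {poly K} -> Prop) : ideal J -> ~ J 1 ->
  exists b, forall f, J f -> f.[b] = 0.
Proof.
move=> [J0 JD JM] J1.
have [Z|nZ] := classic (forall f, J f -> f = 0).
  by exists 0 => f /Z ->; rewrite horner0.
have [f [Jf f0 fmin]] : exists f, [/\ J f, f != 0 &
    forall g, J g -> g != 0 -> (size f <= size g)%N].
  apply: NNPP => H; apply: nZ => f Jf; apply: NNPP => /eqP f0.
  have [m] := ubnP (size f); elim: m f Jf f0 => // m IH f Jf f0 lt.
  apply: H; exists f; split=> // g Jg g0; rewrite leqNgt; apply/negP => lt'.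
  by apply: (IH g) => //; apply: leq_trans lt' _.
have dvd g : J g -> (f %| g)%R.
  move=> Jg; apply: contraT => nd.
  have : J (g %% f)%R.
    have -> : (g %% f)%R = g + (- (g %/ f)) * f.
      by rewrite {2}(divp_eq g f) mulNr addrC addKr.
    exact/JD/JM.
  move=> /fmin; rewrite -[_ != 0]/(~~ (f %| g)%R) nd leqNgt ltn_modp f0.
  by move/(_ isT).
have : size f != 1%N.
  apply/negP => /size_poly1P[a a0 E]; apply: J1.
  have -> : 1 = a^-1%:P * f by rewrite E -polyCM mulVf.
  exact: JM.
move=> /closed_rootP[b rb]; exists b => g /dvd/dvdpP[q ->].
by rewrite hornerM (eqP rb) mulr0.
Qed.

Lemma pihomog_top n (f : {mpoly K[n]}) : f != 0 -> pihomog mdeg (msize f).-1 f != 0.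
Proof.
move=> f0; apply/eqP => E.
move: (pihomog_partitionE (leqnn (msize f))) E; rewrite -(mlead_deg f0) /= => P E.
have := congr1 (mcoeff (mlead f)) P; rewrite big_ord_recr /= E addr0 raddf_sum /= big1 => [|i _].
  by move/eqP; rewrite mleadc_eq0 (negbTE f0).
by apply: (dhomog_nemf_coeff (pihomogP _ _ _)); rewrite /= gtn_eqF.
Qed.

(** Induction on the number of variables. After a change of coordinates the ideal contains a
    polynomial [F] monic in the last variable; a zero [a] of the elimination ideal is then completed
    by a common root of the ideal of K[X] obtained by specializing at [a]. *)
Theorem weak_nullstellensatz n (J : {mpoly K[n]} -> Prop) : ideal J -> ~ J 1 ->
  exists v, forall p, J p -> p.@[v] = 0.
Proof.
elim: n J => [|n IH] J iJ J1; have [J0 JD JM] := iJ.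
  exists (fun=> 0) => p Jp; apply: NNPP => /eqP nz; apply: J1.
  have -> : 1 = (p.@[fun=> 0])^-1%:MP * p.
    by rewrite [p in X in _ * X]mpoly0_const -mpolyCM mulVf.
  exact: JM.
have [Z|nZ] := classic (forall f, J f -> f = 0).
  by exists (fun=> 0) => f /Z ->; rewrite meval0.
have [f Jf f0] : exists2 f, J f & f != 0.
  apply: NNPP => H; apply: nZ => f Jf; apply: NNPP => /eqP f0; apply: H; by exists f.
set d := (msize f).-1.
have szf : msize f = d.+1 by rewrite prednK // lt0n msize_poly_eq0.
set fd := pihomog mdeg d f; have hfd : fd \is d.-homog by exact: pihomogP.
have fd0 : fd != 0 by exact: pihomog_top.
(* The leading form times the last variable has a nonroot; dividing it by its last coordinate gives
   a direction of the form [(c, 1)]. *)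
have [c Hc] : exists c : 'I_n -> K, fd.@[shear_dir c] != 0.
  have X0 : 'X_ord_max != 0 :> {mpoly K[n.+1]} by rewrite -msize_poly_eq0 msizeX.
  have [v] := mpoly_nonroot (mulf_neq0 fd0 X0).
  rewrite mevalM mevalXU mulf_eq0 negb_or => /andP[v1 v2].
  exists (fun j => (v ord_max)^-1 * v (lift ord_max j)).
  apply: contra v1 => /eqP E.
  have Ev : fd.@[v] = fd.@[fun i => v ord_max * shear_dir
      (fun j => (v ord_max)^-1 * v (lift ord_max j)) i].
    apply: meval_eq => i; rewrite /shear_dir; case: unliftP => [j|] ->; last by rewrite mulr1.
    by rewrite mulrA divff // mul1r.
  by rewrite Ev (dhomog_eval _ _ hfd) E mulr0.
have [szs cfs] := top_coef_shear c (eq_leq szf); rewrite -/fd in cfs.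
pose J1' (p : {poly {mpoly K[n]}}) := J (unshear c p).
have iJ1 : ideal J1'.
  split; rewrite /J1'; first by rewrite rmorph0.
    by move=> x y Jx Jy; rewrite unshearD; apply: JD.
  by move=> a x Jx; rewrite unshearM; apply: JM.
pose F := (fd.@[shear_dir c])^-1%:MP%:P * shear c f.
have JF : J1' F by case: iJ1 => _ _; apply; rewrite /J1' shearK.
have mF : F \is monic.
  have cF : F`_d = 1 by rewrite coefCM cfs -mpolyCM mulVf.
  have sF : (size F <= d.+1)%N.
    by rewrite /F mul_polyC; apply: leq_trans szs; apply: size_scale_leq.
  have Ed : size F = d.+1.
    apply/eqP; rewrite eqn_leq sF /= ltnNge; apply/negP => le.
    by move: cF; rewrite nth_default // => /esym/eqP; rewrite oner_eq0.
  by rewrite monicE lead_coefE Ed cF.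
pose J2 (a : {mpoly K[n]}) := J (unshear_coef c a).
have [a Ha] : exists a, forall p, J2 p -> p.@[a] = 0.
  apply: IH; last by rewrite /J2 rmorph1.
  split; rewrite /J2; first by rewrite rmorph0.
    by move=> x y Jx Jy; rewrite unshear_coefD; apply: JD.
  by move=> b x Jx; rewrite unshear_coefM; apply: JM.
have [b Hb] : exists b, forall p, (exists2 q, J1' q & p = map_poly (meval a) q) -> p.[b] = 0.
  have [I0 ID IM] := iJ1.
  apply: univariate_zero; first split.
  - by exists 0 => //; rewrite rmorph0.
  - by move=> x y [p Jp ->] [q Jq ->]; exists (p + q); rewrite ?rmorphD //; apply: ID.
  - move=> x y [q Jq ->]; exists (map_poly (@mpolyC n K) x * q); first exact: IM.
    rewrite rmorphM /=; congr (_ * _); rewrite -map_poly_comp.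
    by rewrite (eq_map_poly (g := idfun)) ?map_poly_id // => z /=; rewrite mevalC.
  (* If some [q] in the ideal specialized to 1, its norm modulo [F] would lie in the elimination
     ideal and take the value 1 at [a]. *)
  move=> [q Jq Eq].
  have [e [[u [v Ee]] He]] := norm_mod_monic q mF.
  have : e.@[a] = 1 by apply: (He K (meval a)).
  rewrite Ha; first by move/esym/eqP; rewrite oner_eq0.
  by rewrite /J2 -unshearC Ee; apply: ID; apply: IM.
exists (shear_point c a b) => p Jp; rewrite -shear_eval; apply: Hb.
by exists (shear c p) => //; rewrite /J1' shearK.
Qed.

Lemma weak_nullstellensatz_poly n (Q : {poly {mpoly K[n]}} -> Prop) : ideal Q -> ~ Q 1 ->
  exists a b, forall p, Q p -> (map_poly (meval a) p).[b] = 0.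
Proof.
move=> [Q0 QD QM] Q1; pose J' (p : {mpoly K[n.+1]}) := Q (shear (fun=> 0) p).
have [||v Hv] := @weak_nullstellensatz n.+1 J'.
- split; rewrite /J'; first by rewrite rmorph0.
    by move=> x y Qx Qy; rewrite shearD; apply: QD.
  by move=> a x Qx; rewrite shearM; apply: QM.
- by rewrite /J' rmorph1.
exists (fun j => v (lift ord_max j)), (v ord_max) => p Qp.
rewrite (shear_eval_coef (fun=> 0)) -[RHS](Hv (unshear (fun=> 0) p)) ?/J' ?unshearK //.
apply: meval_eq => i; rewrite /shear_point.
by case: unliftP => [j|] ->; rewrite ?mul0r ?addr0.
Qed.

(* The Rabinowitsch trick: substituting [1/G] for the new variable and clearing denominators
   turns a polynomial [p] into [rabin G N p]. *)
Definition rabin n (G : {mpoly K[n]}) (N : nat) (p : {poly {mpoly K[n]}}) : {mpoly K[n]} :=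
  \sum_(i < N.+1) p`_i * G ^+ (N - i).

(** The polynomials [p] whose cleared form lies in [J] for all large exponents form an ideal [Q]
    containing [J] and [1 - G X]. It has no zero, so it contains 1, and this says that powers of [G]
    lie in [J]. All large exponents are asked for so that two elements have one in common. *)
Theorem nullstellensatz n (J : {mpoly K[n]} -> Prop) (G : {mpoly K[n]}) : ideal J ->
  (forall v, (forall p, J p -> p.@[v] = 0) -> G.@[v] = 0) ->
  exists N, forall N', (N <= N')%N -> J (G ^+ N').
Proof.
move=> iJ H; have [J0 JD JM] := iJ.
pose Q p := exists N, forall N', (N <= N')%N -> J (rabin G N' p).
have QD p q : Q p -> Q q -> Q (p + q).
  move=> [N HN] [N1 HN1]; exists (maxn N N1) => N'; rewrite geq_max => /andP[h h1].
  have -> : rabin G N' (p + q) = rabin G N' p + rabin G N' q.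
    by rewrite -big_split; apply: eq_bigr => i _; rewrite coefD mulrDl.
  by apply: JD; [apply: HN | apply: HN1].
have Q0 : Q 0 by exists 0%N => N' _; rewrite /rabin big1 // => i _; rewrite coef0 mul0r.
have QC a p : Q p -> Q (a%:P * p).
  move=> [N HN]; exists N => N' /HN h.
  have -> : rabin G N' (a%:P * p) = a * rabin G N' p; last exact: JM.
  by rewrite mulr_sumr; apply: eq_bigr => i _; rewrite coefCM mulrA.
have QX p : Q p -> Q ('X * p).
  move=> [N HN]; exists N.+1 => -[//|N'] h.
  have -> : rabin G N'.+1 ('X * p) = rabin G N' p; last exact: HN.
  rewrite /rabin big_ord_recl coefXM mul0r add0r; apply: eq_bigr => i _.
  by rewrite coefXM.
have QM a p : Q p -> Q (a * p).
  move=> Qp; elim/poly_ind: a => [|a b IH]; first by rewrite mul0r.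
  by rewrite mulrDl [a * 'X]mulrC -mulrA; apply: QD; [apply: QX | apply: QC].
have Q1 : Q (1 - G%:P * 'X).
  exists 1%N => -[//|N'] _; suff -> : rabin G N'.+1 (1 - G%:P * 'X) = 0 by [].
  rewrite /rabin big_ord_recl big_ord_recl big1 => [|i _].
    by rewrite !coefB !coefCM !coef1 !coefX /= /bump /= subn0 subn1 exprS mulr0 subr0 mul1r mulr1 sub0r mulNr addr0 subrr.
  by rewrite coefB coefCM coef1 coefX /= mulr0 subr0 mul0r.
have QJ p : J p -> Q p%:P.
  move=> Jp; exists 0%N => N' _; rewrite /rabin big_ord_recl big1 => [|i _].
    by rewrite coefC addr0 /= mulrC; apply: JM.
  by rewrite coefC mul0r.
have [Q11|nQ1] := classic (Q 1).
  have [N HN] := Q11; exists N => N' /HN; rewrite /rabin big_ord_recl big1 => [|i _].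
    by rewrite coef1 mul1r addr0 subn0.
  by rewrite coef1 mul0r.
have [a [b HQ]] := weak_nullstellensatz_poly (And3 Q0 QD QM) nQ1; exfalso.
have Ga : G.@[a] = 0.
  by apply: H => p /QJ/HQ; rewrite map_polyC hornerC.
have := HQ _ Q1; rewrite rmorphB rmorph1 rmorphM /= map_polyC map_polyX.
rewrite hornerD hornerN hornerM !hornerC /= Ga mul0r subr0 => /eqP.
by rewrite oner_eq0.
Qed.

End Nullstellensatz.
End Elimination.

(** * Cones over projective varieties *)

Lemma pihomog_sum (K : fieldType) n d (T : Type) (s : seq T) (P : pred T) (F : T -> {mpoly K[n]}) :
  pihomog mdeg d (\sum_(i <- s | P i) F i) = \sum_(i <- s | P i) pihomog mdeg d (F i).
Proof. exact: raddf_sum. Qed.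

Lemma pihomog_component (K : fieldType) n d e (F : {mpoly K[n]}) :
  F \is d.-homog -> pihomog mdeg e F = if e == d then F else 0.
Proof.
by move=> hF; case: eqP => [->|/eqP ne]; [apply: pihomog_dE|apply: pihomog_ne0 hF; rewrite eq_sym].
Qed.

(* The fraction field of the homogeneous coordinate ring, with its field structure kept abstract:
   [L X] itself unfolds to a quotient, on which unification is prohibitively slow. *)
Record cone (k : closedFieldType) (n : nat) := Cone {
  cfield :> fieldType;
  cproj : {rmorphism {mpoly k[n.+1]} -> cfield};
  cone_homog : forall d F, cproj F = 0 -> cproj (pihomog mdeg d F) = 0;
  cone_frac : forall a, exists F G, cproj G != 0 /\ a = cproj F / cproj G;
  cone_rel : exists i, cproj 'X_i != 0 }.

Section Cone.
Variables (k : closedFieldType) (n : nat) (Y : cone k n).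
Local Notation S := {mpoly k[n.+1]}.
Local Notation L := (cfield Y).
Local Notation "'π' F" := (@cproj k n Y F) (at level 8, F at level 2).

Lemma piD F G : π (F + G) = π F + π G. Proof. exact: rmorphD. Qed.
Lemma piB F G : π (F - G) = π F - π G. Proof. exact: rmorphB. Qed.
Lemma piN F : π (- F) = - π F. Proof. exact: rmorphN. Qed.
Lemma piM F G : π (F * G) = π F * π G. Proof. exact: rmorphM. Qed.
Lemma piX F m : π (F ^+ m) = π F ^+ m. Proof. exact: rmorphXn. Qed.
Lemma pi0 : π 0 = 0. Proof. exact: rmorph0. Qed.
Lemma pi1 : π 1 = 1. Proof. exact: rmorph1. Qed.
Lemma pi_sum (T : Type) (s : seq T) (P : pred T) (F : T -> S) :
  π (\sum_(i <- s | P i) F i) = \sum_(i <- s | P i) π (F i).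
Proof. exact: rmorph_sum. Qed.

Definition scal (c : k) : L := π c%:MP.
Lemma scalD c d : scal (c + d) = scal c + scal d. Proof. by rewrite /scal mpolyCD piD. Qed.
Lemma scalM c d : scal (c * d) = scal c * scal d. Proof. by rewrite /scal mpolyCM piM. Qed.
Lemma scal1 : scal 1 = 1. Proof. exact: pi1. Qed.
Lemma scal0 : scal 0 = 0. Proof. by rewrite /scal mpolyC0 pi0. Qed.
Lemma scalN c : scal (- c) = - scal c. Proof. by rewrite /scal mpolyCN piN. Qed.
Lemma scal_eq0 c : (scal c == 0) = (c == 0).
Proof.
apply/eqP/eqP => [h|->]; last exact: scal0.
apply/eqP/negP => /negP c0; have := oner_neq0 L.
by rewrite -scal1 -(mulfV c0) scalM h mul0r eqxx.
Qed.
Lemma piZ c F : π (c *: F) = scal c * π F. Proof. by rewrite -mul_mpolyC piM. Qed.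

(** ** Restriction of scalars *)

(** An alias, so that the scaling by [k] through [scal] does not clash with the scaling by the field
    itself. *)
Definition kmod (V : lmodType L) : Type := V.
Section Kmod.
Variable V : lmodType L.
HB.instance Definition _ := GRing.Zmodule.on (kmod V).
Definition kscale (c : k) (v : kmod V) : kmod V := (scal c *: (v : V))%R.
Lemma kscaleA a b v : kscale a (kscale b v) = kscale (a * b) v.
Proof. by rewrite /kscale scalerA scalM. Qed.
Lemma kscale1 : left_id 1 kscale.
Proof. by move=> v; rewrite /kscale scal1 scale1r. Qed.
Lemma kscaleDr : right_distributive kscale +%R.
Proof. by move=> c u v; rewrite /kscale -scalerDr. Qed.
Lemma kscaleDl v : {morph kscale^~ v : a b / a + b}.
Proof. by move=> a b; rewrite /kscale scalD scalerDl. Qed.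
HB.instance Definition _ :=
  GRing.Zmodule_isLmodule.Build k (kmod V) kscaleA kscale1 kscaleDr kscaleDl.
Lemma kscaleE c (v : kmod V) : c *: v = scal c *: (v : V). Proof. by []. Qed.
End Kmod.

(** ** Homogeneous fractions *)

Definition onv (p : 'I_n.+1 -> k) : Prop :=
  (exists i, p i != 0) /\ forall F, π F = 0 -> F.@[p] = 0.

Lemma onv_eval p F G : onv p -> π F = π G -> F.@[p] = G.@[p].
Proof.
move=> [_ hp] E; apply/eqP; rewrite -subr_eq0 -mevalB; apply/eqP/hp.
by rewrite piB E subrr.
Qed.

Lemma onv_nz p F : onv p -> F.@[p] != 0 -> π F != 0.
Proof. by move=> [_ hp]; apply: contra => /eqP/hp ->. Qed.

Lemma dhomogXi i : ('X_i : S) \is 1.-homog.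
Proof. by rewrite dhomogX /= mdeg1. Qed.

Definition den_class (D : S -> Prop) : Prop :=
  [/\ D 1, forall G H, D G -> D H -> D (G * H), forall G, D G -> π G != 0 &
      exists i, D 'X_i].

Definition nzden (G : S) : Prop := π G != 0.
Definition ptden (p : 'I_n.+1 -> k) (G : S) : Prop := G.@[p] != 0.

Lemma nzden_class : den_class nzden.
Proof.
split; rewrite /nzden; [by rewrite pi1 oner_eq0 | | by [] | exact: (cone_rel Y)].
by move=> G H h h'; rewrite piM mulf_neq0.
Qed.

Lemma ptden_class p : onv p -> den_class (ptden p).
Proof.
move=> hp; split; rewrite /ptden ?meval1 ?oner_eq0 //.
- by move=> G H h h'; rewrite mevalM mulf_neq0.
- by move=> G; apply: onv_nz.
- by case: hp => -[i pi] _; exists i; rewrite mevalXU.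
Qed.

(* Degree [m] fractions whose denominators lie in [D]; this covers both the homogeneous elements
   of [L] and the stalks of the twisted structure sheaves. *)
Definition hloc (D : S -> Prop) (m : int) (a : L) : Prop :=
  exists F G : S, exists d e : nat,
    [/\ F \is d.-homog, G \is e.-homog, d%:Z - e%:Z = m, D G & a = π F / π G].

Definition hdg := hloc nzden.
Definition stk m p := hloc (ptden p) m.

Lemma hloc_sub (D D' : S -> Prop) m a : (forall G, D G -> D' G) -> hloc D m a -> hloc D' m a.
Proof. by move=> h [F [G [d [e [? ? ? /h ? ?]]]]]; exists F, G, d, e. Qed.

Lemma stk_hdg m p a : onv p -> stk m p a -> hdg m a.
Proof. by move=> hp; apply: hloc_sub => G; apply: onv_nz. Qed.

Section Hloc.
Variable D : S -> Prop.
Hypothesis hD : den_class D.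

Lemma hloc_pi d F : F \is d.-homog -> hloc D d (π F).
Proof.
by move=> hF; exists F, 1, d, 0%N; case: hD => *; split=> //;
  rewrite ?dhomog1 ?pi1 ?divr1 ?subr0.
Qed.

Lemma hlocM m m' a b : hloc D m a -> hloc D m' b -> hloc D (m + m') (a * b).
Proof.
move=> [F [G [d [e [hF hG E DG ->]]]]] [F' [G' [d' [e' [hF' hG' E' DG' ->]]]]].
exists (F * F'), (G * G'), (d + d')%N, (e + e')%N; case: hD => _ DM _ _.
split; [exact: dhomogM|exact: dhomogM| |exact: DM|].
  by rewrite -E -E' !PoszD; lia.
by rewrite !piM mulf_div.
Qed.

Lemma hlocD m a b : hloc D m a -> hloc D m b -> hloc D m (a + b).
Proof.
move=> [F [G [d [e [hF hG E DG ->]]]]] [F' [G' [d' [e' [hF' hG' E' DG' ->]]]]].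
have [_ DM Dnz _] := hD.
exists (F * G' + F' * G), (G * G'), (d + e')%N, (e + e')%N.
split; [|exact: dhomogM| |exact: DM|].
- apply: dhomogD; first exact: dhomogM.
  have -> : (d + e' = d' + e)%N by move: E E'; lia.
  exact: dhomogM.
- by rewrite -E !PoszD; lia.
- by rewrite !(piD, piM) addf_div ?Dnz.
Qed.

Lemma hloc_scal c : hloc D 0 (scal c).
Proof.
by apply: (hloc_pi (d := 0%N)); rewrite -[c%:MP]mulr1 mul_mpolyC; apply: dhomogZ; apply: dhomog1.
Qed.

Lemma hlocZ m c a : hloc D m a -> hloc D m (scal c * a).
Proof. by move=> h; rewrite -[m]add0r; apply: hlocM => //; apply: hloc_scal. Qed.

Lemma hlocN m a : hloc D m a -> hloc D m (- a).
Proof. by move=> h; rewrite -mulN1r -scal1 -scalN; apply: hlocZ. Qed.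

Lemma hlocB m a b : hloc D m a -> hloc D m b -> hloc D m (a - b).
Proof. by move=> h h'; apply: hlocD => //; apply: hlocN. Qed.

Lemma hloc_inv e G : G \is e.-homog -> D G -> hloc D (- e%:Z) (π G)^-1.
Proof.
move=> hG DG; exists 1, G, 0%N, e; split=> //; rewrite ?dhomog1 ?pi1 ?div1r ?sub0r //.
Qed.

Lemma hloc0 m : hloc D m 0.
Proof.
have [D1 DM _ [i Di]] := hD; have hX := dhomogXi i.
have DX q : D ('X_i ^+ q).
  by elim: q => [|q IH]; rewrite ?expr0 // exprS; apply: DM.
have hXq q : ('X_i ^+ q : S) \is q.-homog by rewrite -[X in X.-homog]mul1n; apply: dhomogMn.
case: m => q.
  by exists 0, 1, q, 0%N; split; rewrite ?dhomog0 ?dhomog1 ?subr0 ?pi0 ?mul0r.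
by exists 0, ('X_i ^+ q.+1), 0%N, q.+1; split; rewrite ?dhomog0 ?sub0r ?NegzE ?pi0 ?mul0r.
Qed.

Lemma hloc_sum m (T : Type) (s : seq T) (P : pred T) (a : T -> L) :
  (forall i, P i -> hloc D m (a i)) -> hloc D m (\sum_(i <- s | P i) a i).
Proof.
move=> H; elim/big_ind: _ => //; first exact: hloc0.
by move=> x y; apply: hlocD.
Qed.

Lemma hloc1 : hloc D 0 1.
Proof. by rewrite -scal1; apply: hloc_scal. Qed.

Lemma hlocX m a q : hloc D m a -> hloc D (m * q%:Z) (a ^+ q).
Proof.
move=> h; elim: q => [|q IH]; first by rewrite expr0 mulr0; apply: hloc1.
by rewrite exprS -[q.+1]add1n PoszD mulrDr mulr1; apply: hlocM.
Qed.

Lemma hloc_prod (T : finType) (P : pred T) (a : T -> L) :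
  (forall i, P i -> hloc D 0 (a i)) -> hloc D 0 (\prod_(i | P i) a i).
Proof.
move=> H; elim/big_ind: _ => //; first exact: hloc1.
by move=> x y hx hy; rewrite -[0]addr0; apply: hlocM.
Qed.

Lemma hloc_det q (A : 'M[L]_q) : (forall i j, hloc D 0 (A i j)) -> hloc D 0 (\det A).
Proof.
move=> H; apply: hloc_sum => s _; rewrite -[0]addr0; apply: hlocM; last exact: hloc_prod.
by case: (perm.odd_perm s); rewrite ?expr1 ?expr0; try apply: hlocN; apply: hloc1.
Qed.

Lemma hloc_den q (m : 'I_q -> int) (a : 'I_q -> L) : (forall i, hloc D (m i) (a i)) ->
  exists G e, [/\ G \is e.-homog, D G & forall i, exists F (d : nat),
    [/\ F \is d.-homog, d%:Z = m i + e%:Z & π G * a i = π F]].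
Proof.
have [D1 DM Dnz _] := hD.
elim: q m a => [|q IH] m a H.
  by exists 1, 0%N; split=> [||[]] //; apply: dhomog1.
have [G [e [hG DG HG]]] := IH _ _ (fun i => H (lift ord0 i)).
have [F0 [G0 [d0 [e0 [hF0 hG0 E0 DG0 Ea]]]]] := H ord0.
exists (G0 * G), (e0 + e)%N; split; [exact: dhomogM|exact: DM|] => i.
case: (unliftP ord0 i) => [j|] ->.
  have [F [d [hF Ed EF]]] := HG j.
  exists (G0 * F), (e0 + d)%N; split; [exact: dhomogM| |].
    by rewrite PoszD Ed PoszD; lia.
  by rewrite !piM -mulrA EF.
exists (F0 * G), (d0 + e)%N; split; [exact: dhomogM| |].
  by rewrite !PoszD -E0; lia.
rewrite !piM Ea; have := Dnz _ DG0; set x := π G0 => x0; by field.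
Qed.

End Hloc.

(** After clearing a common denominator the terms are forms of distinct degrees, that is, the
    components of an element of the kernel, which is homogeneous by [cone_homog]. *)
Lemma hdg_indep q (m : 'I_q -> int) (a : 'I_q -> L) : injective m ->
  (forall i, hdg (m i) (a i)) -> \sum_i a i = 0 -> forall i, a i = 0.
Proof.
move=> im H s0.
have [G [e [hG DG HG]]] := hloc_den nzden_class H.
have [F HF] : exists F : 'I_q -> S, forall i, exists d : nat,
   [/\ F i \is d.-homog, d%:Z = m i + e%:Z & π G * a i = π (F i)].
  exact: (@ord_choice q S (fun i F => exists d : nat,
    [/\ F \is d.-homog, d%:Z = m i + e%:Z & π G * a i = π F])).
have [d Hd] := ord_choice HF.
have piF : π (\sum_i F i) = 0.
  transitivity (π G * \sum_i a i); last by rewrite s0 mulr0.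
  by rewrite pi_sum mulr_sumr; apply: eq_bigr => i _; have [_ _ ->] := Hd i.
move=> i; have := cone_homog (d i) piF; rewrite pihomog_sum (bigD1 i) //= big1 ?addr0 => [|j ji].
  have [hF _ E] := Hd i; rewrite (pihomog_component _ hF) eqxx -E => /eqP.
  by rewrite mulf_eq0 (negbTE DG) => /eqP.
have [hF Ej _] := Hd j; have [_ Ei _] := Hd i; rewrite (pihomog_component _ hF).
case: eqP => // E; have : m j = m i by move: Ei Ej; rewrite E => -> /addIr ->.
by move/im => ji'; rewrite ji' eqxx in ji.
Qed.


(** ** The homogeneous coordinate ring *)

Definition inA (a : L) : Prop := exists F, a = π F.
Definition inAt (t : nat) (a : L) : Prop := exists2 F, F \is t.-homog & a = π F.

Lemma inAtA t a : inAt t a -> inA a. Proof. by move=> [F _ ->]; exists F. Qed.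
Lemma inAD a b : inA a -> inA b -> inA (a + b).
Proof. by move=> [F ->] [G ->]; exists (F + G); rewrite piD. Qed.
Lemma inAN a : inA a -> inA (- a). Proof. by move=> [F ->]; exists (- F); rewrite piN. Qed.
Lemma inAM a b : inA a -> inA b -> inA (a * b).
Proof. by move=> [F ->] [G ->]; exists (F * G); rewrite piM. Qed.
Lemma inApi F : inA (π F). Proof. by exists F. Qed.
Lemma inA0 : inA 0. Proof. by exists 0; rewrite pi0. Qed.
Lemma inA1 : inA 1. Proof. by exists 1; rewrite pi1. Qed.
Lemma inA_sum (T : Type) (s : seq T) (P : pred T) (a : T -> L) :
  (forall i, P i -> inA (a i)) -> inA (\sum_(i <- s | P i) a i).
Proof. by move=> H; elim/big_ind: _ => //; [exact: inA0|move=> x y; exact: inAD]. Qed.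

Lemma inAt0 t : inAt t 0. Proof. by exists 0; rewrite ?dhomog0 ?pi0. Qed.
Lemma inAtD t a b : inAt t a -> inAt t b -> inAt t (a + b).
Proof. by move=> [F h ->] [G h' ->]; exists (F + G); rewrite ?piD //; apply: dhomogD. Qed.
Lemma inAtM t u a b : inAt t a -> inAt u b -> inAt (t + u) (a * b).
Proof. by move=> [F h ->] [G h' ->]; exists (F * G); rewrite ?piM //; apply: dhomogM. Qed.
Lemma inAtZ t c a : inAt t a -> inAt t (scal c * a).
Proof. by move=> [F h ->]; exists (c *: F); rewrite ?piZ //; apply: dhomogZ. Qed.
Lemma inAt_pi t F : F \is t.-homog -> inAt t (π F). Proof. by exists F. Qed.
Lemma inAt_hdg t a : inAt t a -> hdg t a.
Proof. by move=> [F h ->]; apply: (hloc_pi nzden_class). Qed.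
Lemma inAt_sum t (T : Type) (s : seq T) (P : pred T) (a : T -> L) :
  (forall i, P i -> inAt t (a i)) -> inAt t (\sum_(i <- s | P i) a i).
Proof. by move=> H; elim/big_ind: _ => //; [exact: inAt0|move=> x y; exact: inAtD]. Qed.

Lemma hdg_proj T (w : 'I_T -> L) m a : hdg m a -> (forall d : 'I_T, hdg d (w d)) ->
  a = \sum_d w d ->
  (forall d : 'I_T, w d = if (d : nat)%:Z == m then a else 0) /\
  ((forall d : 'I_T, (d : nat)%:Z != m) -> a = 0).
Proof.
move=> h hw Ea.
have [/existsP[t /eqP E]|/existsPn no] := boolP [exists t : 'I_T, (t : nat)%:Z == m].
  split=> [d|/(_ t)]; last by rewrite E eqxx.
  apply/eqP; rewrite -subr_eq0; apply/eqP; move: d.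
  apply: (@hdg_indep T (fun i => (i : nat)%:Z)).
  - by move=> i j [] /val_inj.
  - move=> i; apply: (hlocB nzden_class); first exact: hw.
    by case: eqP => [->|_] //; exact: (hloc0 nzden_class).
  - rewrite sumrB -Ea (bigD1 t) //= E eqxx big1 ?addr0 ?subrr // => i it.
    by rewrite -E; case: eqP => // -[] /val_inj ie; rewrite ie eqxx in it.
(* If no index equals [m], then [- a] is one more term, alone in its degree, and independence makes
   it 0. *)
pose mm (i : 'I_T.+1) : int := if unlift ord0 i is Some j then (j : nat)%:Z else m.
pose aa (i : 'I_T.+1) : L := if unlift ord0 i is Some j then w j else - a.
have H : forall i, aa i = 0.
  apply: (@hdg_indep _ mm).
  - move=> i j; rewrite /mm; case: (unliftP ord0 i) => [i'|] ->; case: (unliftP ord0 j) => [j'|] -> //.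
    + by move=> [] /val_inj ->.
    + by move=> E; have := no i'; rewrite E eqxx.
    + by move=> E; have := no j'; rewrite -E eqxx.
  - move=> i; rewrite /mm /aa; case: (unliftP ord0 i) => [i'|] _; first exact: hw.
    exact: (hlocN nzden_class).
  - rewrite big_ord_recl {1}/aa unlift_none.
    under eq_bigr => i _ do rewrite /aa liftK.
    by rewrite -Ea addNr.
have a0 : a = 0 by have := H ord0; rewrite /aa unlift_none => /eqP; rewrite oppr_eq0 => /eqP.
split=> // d; rewrite a0 if_same; by have := H (lift ord0 d); rewrite /aa liftK.
Qed.

Lemma inA_hdg m a : a != 0 -> inA a -> hdg m a -> exists2 t : nat, m = t%:Z & inAt t a.
Proof.
move=> a0 [F EF] h.
have EF' := pihomog_partitionE (leqnn (msize F)); rewrite EF' pi_sum in EF.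
have [|H1 H2] := hdg_proj h _ EF.
  by move=> d; apply/(hloc_pi nzden_class)/pihomogP.
have [/existsP[t /eqP E]|/existsPn no] := boolP [exists t : 'I_(msize F), (t : nat)%:Z == m].
  exists t => //; exists (pihomog mdeg t F); first exact: pihomogP.
  by rewrite H1 E eqxx.
by rewrite H2 ?eqxx // in a0.
Qed.

(** ** Zeros on the variety *)

(** [G] has to vanish at the origin because the affine zeros of [J] may include the vertex of the
    cone, which is not a point of the variety. *)
Lemma nullstellensatz_open (J : S -> Prop) (G : S) : ideal J -> (forall F, π F = 0 -> J F) ->
  G.@[fun=> 0] = 0 -> (forall p, onv p -> G.@[p] != 0 -> exists2 H, J H & H.@[p] != 0) ->
  exists N, forall N', (N <= N')%N -> J (G ^+ N').
Proof.
move=> iJ kJ G0 H; apply: nullstellensatz => // v Hv.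
apply/eqP/negP => /negP Gv.
have vY : onv v.
  split; last by move=> F /kJ/Hv.
  apply: NNPP => nz; case/eqP: Gv; rewrite -G0; apply: meval_eq => i.
  by apply/eqP/negP => /negP vi; apply: nz; exists i.
have [F JF] := H v vY Gv; by rewrite Hv ?eqxx.
Qed.

(** Pigeonhole: in a monomial whose degree is at least the sum of the [N i], some exponent reaches
    its [N i]. *)
Lemma monomials_in_ideal (J : S -> Prop) : ideal J ->
  (forall i, exists N, forall N', (N <= N')%N -> J ('X_i ^+ N')) ->
  exists N, forall t F, (N <= t)%N -> F \is t.-homog -> J F.
Proof.
move=> iJ HX; have [J0 JD JM] := iJ; have [N HN] := ord_choice HX.
pose NN := (\sum_i N i)%N; exists NN => t F le hF.
rewrite [F]mpolyE big_seq; apply: ideal_sum => // m mF.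
rewrite -mul_mpolyC; apply: (JM).
have [i lei] : exists i, (N i <= m i)%N.
  apply: NNPP => no.
  have lt i : (m i < N i)%N by rewrite ltnNge; apply/negP => h; apply: no; exists i.
  have : (mdeg m < NN)%N.
    rewrite mdegE /NN (bigD1 ord0) //= [X in (_ < X)%N](bigD1 ord0) //=.
    by rewrite -addSn; apply: leq_add => //; apply: leq_sum => i _; apply: ltnW.
  by rewrite (dhomog_mf hF mF) ltnNge le.
rewrite mpolyXE_id (bigD1 i) //= mulrC; apply: (JM); exact: HN.
Qed.

Lemma projective_nullstellensatz (J : S -> Prop) : ideal J -> (forall F, π F = 0 -> J F) ->
  (forall p, onv p -> exists2 H, J H & H.@[p] != 0) ->
  exists N, forall t F, (N <= t)%N -> F \is t.-homog -> J F.
Proof.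
move=> iJ kJ H; apply: monomials_in_ideal => // i.
apply: nullstellensatz_open => //; first by rewrite mevalXU.
by move=> p hp _; apply: H.
Qed.

End Cone.

(** * Regular sequences and freeness *)

Section Transfer.
Variables (k : closedFieldType) (n : nat) (Y : cone k n) (r : nat) (M : 'rV[Y]_r -> Prop).
Local Notation V := 'rV[Y]_r.
Hypothesis MD : forall u v, M u -> M v -> M (u + v).
Hypothesis MA : forall a v, inA a -> M v -> M (a *: v).

Lemma modN v : M v -> M (- v).
Proof. by move=> h; rewrite -scaleN1r; apply: MA => //; apply/inAN/inA1. Qed.
Lemma modB u v : M u -> M v -> M (u - v).
Proof. by move=> hu hv; apply/MD/modN. Qed.

(** In a submodule of a vector space every nonzero element is regular, so only the second and the
    third element of a sequence carry a condition. *)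
Definition reg2 (f0 f1 : Y) := forall v w, M v -> M w -> f1 *: v = f0 *: w ->
  exists2 v', M v' & v = f0 *: v'.
Definition reg3 (f0 f1 f2 : Y) := forall v w0 w1, M v -> M w0 -> M w1 ->
  f2 *: v = f0 *: w0 + f1 *: w1 ->
  exists v0 v1, [/\ M v0, M v1 & v = f0 *: v0 + f1 *: v1].

(** A device to prove an identity of vectors from two known ones: [c1] and [c2] are the multipliers,
    and [ring] checks the coordinates. *)
Lemma row_lin (c1 c2 : Y) (x1 y1 x2 y2 u v : V) : x1 = y1 -> x2 = y2 ->
  (forall j, u 0 j - v 0 j = c1 * (x1 0 j - y1 0 j) + c2 * (x2 0 j - y2 0 j)) -> u = v.
Proof.
move=> -> -> H; apply/rowP => j; apply/eqP; rewrite -subr_eq0.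
by rewrite H !subrr !mulr0 addr0.
Qed.

Lemma inAX (a : Y) q : inA a -> inA (a ^+ q).
Proof. by move=> [F ->]; exists (F ^+ q); rewrite piX. Qed.

(** Only powers of the given regular sequence are known to lie in the ideal of the parameters
    ([power_in_l]), so regularity has to pass to powers. *)
Lemma reg2_powr f0 f1 b : inA f1 -> reg2 f0 f1 -> reg2 f0 (f1 ^+ b).
Proof.
move=> A1 R; elim: b => [|b IH] v w Mv Mw.
  by rewrite expr0 scale1r => ->; exists w.
rewrite exprS -scalerA => /R[] //; first by apply: MA => //; apply: inAX.
by move=> v' Mv' /IH; apply.
Qed.

Ltac memA := repeat first [assumption | apply: inAX | apply: inAM | apply: inAD | apply: inAN].
Ltac memM := repeat first [assumption | apply: modB | apply: MD | apply: modN | apply: MA; memA].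

Lemma reg2_powl f0 f1 a : f0 != 0 -> inA f0 -> reg2 f0 f1 -> reg2 (f0 ^+ a) f1.
Proof.
move=> n0 A0 R; elim: a => [|a IH] v w Mv Mw E.
  by exists v => //; rewrite expr0 scale1r.
have [||v' Mv' Ev] := R v (f0 ^+ a *: w) Mv; first by memM.
  by rewrite scalerA -exprS.
have [|y My Ey] := IH v' w Mv' Mw.
  by apply: (scalerI n0); rewrite scalerA mulrC -scalerA -Ev E exprS scalerA.
by exists y => //; rewrite Ev Ey exprS scalerA.
Qed.

Lemma reg3_pow2 f0 f1 f2 c : inA f2 -> reg3 f0 f1 f2 -> reg3 f0 f1 (f2 ^+ c).
Proof.
move=> A2 R; elim: c => [|c IH] v w0 w1 Mv Mw0 Mw1.
  by rewrite expr0 scale1r => ->; exists w0, w1.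
rewrite exprS -scalerA => /R[] //; first by memM.
by move=> v0 [v1 [Mv0 Mv1 /IH]]; apply.
Qed.

Lemma reg3_pow1 f0 f1 f2 b : f0 != 0 -> f1 != 0 -> inA f0 -> inA f1 -> inA f2 ->
  reg2 f0 f1 -> reg3 f0 f1 f2 -> reg3 f0 (f1 ^+ b) f2.
Proof.
move=> n0 n1 A0 A1 A2 R2 R; elim: b => [|b IH] v w0 w1 Mv Mw0 Mw1 E.
  exists (f0 *: v - f0 *: v), v; split=> //; first by memM.
  by rewrite subrr scaler0 add0r expr0 scale1r.
have [||||v0 [v1 [Mv0 Mv1 Ev]]] := R v w0 (f1 ^+ b *: w1); rewrite ?E ?exprS ?scalerA //; first by memM.
have [|||z Mz Ez] := R2 (f2 *: v1 - f1 ^+ b *: w1) (w0 - f2 *: v0); first by memM.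
- by memM.
- apply: (row_lin (c1 := 1) (c2 := - f2) E Ev) => j; rewrite !mxE exprS; ring.
have [|y0 [y1 [My0 My1 Ey]]] := IH v1 z w1 Mv1 Mz Mw1.
  by rewrite -Ez subrK.
exists (v0 + f1 *: y0), y1; split=> //; first by memM.
by apply: (row_lin (c1 := 1) (c2 := f1) Ev Ey) => j; rewrite !mxE; ring.
Qed.

Lemma reg3_pow0 f0 f1 f2 a : f0 != 0 -> f1 != 0 -> inA f0 -> inA f1 -> inA f2 ->
  reg2 f0 f1 -> reg3 f0 f1 f2 -> reg3 (f0 ^+ a) f1 f2.
Proof.
move=> n0 n1 A0 A1 A2 R2 R; elim: a => [|a IH] v w0 w1 Mv Mw0 Mw1 E.
  exists v, (f1 *: v - f1 *: v); split=> //; first by memM.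
  by rewrite subrr scaler0 addr0 expr0 scale1r.
have [||||v0 [v1 [Mv0 Mv1 Ev]]] := R v (f0 ^+ a *: w0) w1; rewrite ?E ?exprS ?scalerA //; first by memM.
have [|||z Mz Ez] := R2 (w1 - f2 *: v1) (f2 *: v0 - f0 ^+ a *: w0); first by memM.
- by memM.
- apply: (row_lin (c1 := -1) (c2 := f2) E Ev) => j; rewrite !mxE exprS; ring.
have [|y0 [y1 [My0 My1 Ey]]] := IH v0 w0 z Mv0 Mw0 Mz.
  apply: (scalerI n0).
  rewrite Ev in E.
  by apply: (row_lin (c1 := 1) (c2 := f1) E Ez) => j; rewrite !mxE exprS; ring.
exists y0, (v1 + f0 *: y1); split=> //; first by memM.
by apply: (row_lin (c1 := 1) (c2 := f0) Ev Ey) => j; rewrite !mxE; ring.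
Qed.

Section Exchange.
Variables (g0 g1 g2 l0 l1 l2 a0 a1 a2 b0 b1 b2 c0 c1 c2 : Y).
Hypotheses (ng0 : g0 != 0) (nl0 : l0 != 0) (nl1 : l1 != 0) (nl2 : l2 != 0).
Hypotheses (Al0 : inA l0) (Al1 : inA l1) (Al2 : inA l2).
Hypotheses (Aa0 : inA a0) (Aa1 : inA a1) (Aa2 : inA a2) (Ab0 : inA b0) (Ab1 : inA b1)
  (Ab2 : inA b2) (Ac0 : inA c0) (Ac1 : inA c1) (Ac2 : inA c2).
Hypotheses (Eg0 : g0 = a0 * l0 + b0 * l1 + c0 * l2) (Eg1 : g1 = a1 * l0 + b1 * l1 + c1 * l2)
  (Eg2 : g2 = a2 * l0 + b2 * l1 + c2 * l2).
Hypotheses (Rg2 : reg2 g0 g1) (Rg3 : reg3 g0 g1 g2).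

Lemma memg : [/\ inA g0, inA g1 & inA g2].
Proof. by rewrite Eg0 Eg1 Eg2; split; memA. Qed.

(* The module [(M : (l0, l1)) / M] is [H_1] of the Koszul complex of [l0, l1]; a regular sequence
   [g0, g1, g2] in [(l0, l1, l2)] makes [l2] act surjectively on it. *)
Lemma exchange_surj x : M (l0 *: x) -> M (l1 *: x) ->
  exists h z, [/\ M h, M (l0 *: z), M (l1 *: z) & x = h + l2 *: z].
Proof.
move=> M0x M1x; have [Ag0 Ag1 Ag2] := memg.
pose y0 := a0 *: (l0 *: x) + b0 *: (l1 *: x).
pose y1 := a1 *: (l0 *: x) + b1 *: (l1 *: x).
pose y2 := a2 *: (l0 *: x) + b2 *: (l1 *: x).
have My0 : M y0 by rewrite /y0; memM.
have My1 : M y1 by rewrite /y1; memM.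
have My2 : M y2 by rewrite /y2; memM.
have [||||v0 [v1 [Mv0 Mv1 Ev]]] := Rg3 (v := c1 *: y0 - c0 *: y1) (w0 := c1 *: y2 - c2 *: y1)
   (w1 := c2 *: y0 - c0 *: y2); try by memM.
  by apply/rowP => j; rewrite /y0 /y1 /y2 !mxE Eg0 Eg1 Eg2; ring.
have [|||h Mh Eh] := Rg2 (v := y0 - l2 *: v1) (w := y1 + l2 *: v0); try by memM.
  apply: (row_lin (c1 := l2) (c2 := 0) Ev (erefl x)) => j.
  by rewrite /y0 /y1 !mxE Eg0 Eg1; ring.
have Ex : g0 *: x = g0 *: h + l2 *: (v1 + c0 *: x).
  apply: (row_lin (c1 := 1) (c2 := 0) Eh (erefl x)) => j.
  by rewrite /y0 !mxE Eg0; ring.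
have Eh1 : y1 + l2 *: v0 = g1 *: h.
  apply: (scalerI ng0); apply: (row_lin (c1 := g1) (c2 := - l2) Eh Ev) => j.
  by rewrite /y0 /y1 !mxE Eg0 Eg1; ring.
have Ex1 : g1 *: x = g1 *: h + l2 *: (c1 *: x - v0).
  apply: (row_lin (c1 := 1) (c2 := 0) Eh1 (erefl x)) => j.
  by rewrite /y1 !mxE Eg1; ring.
pose z := g0^-1 *: (v1 + c0 *: x).
have Ez : g0 *: z = v1 + c0 *: x by rewrite scalerA divff // scale1r.
have Exz : x = h + l2 *: z.
  apply: (scalerI ng0); apply: (row_lin (c1 := 1) (c2 := - l2) Ex Ez) => j.
  by rewrite !mxE; ring.
have Ez1 : g1 *: z = c1 *: x - v0.
  apply: (scalerI nl2); apply: (row_lin (c1 := 1) (c2 := - g1) Ex1 Exz) => j.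
  by rewrite !mxE; ring.
have Mz l : inA l -> M (l *: x) -> M (l *: z).
  move=> Al Mlx.
  have [|||w Mw Ew] := Rg2 (v := l *: v1 + c0 *: (l *: x)) (w := c1 *: (l *: x) - l *: v0); try by memM.
    apply: (row_lin (c1 := - l * g1) (c2 := l * g0) Ez Ez1) => j.
    by rewrite !mxE; ring.
  suff -> : l *: z = w by [].
  apply: (scalerI ng0); apply: (row_lin (c1 := 1) (c2 := l) Ew Ez) => j.
  by rewrite !mxE; ring.
by exists h, z; split=> //; apply: Mz.
Qed.

(** The relation for [v] turns each [g_i v] into [l0 p_i + l1 q_i]. For two indices these
    expressions yield a syzygy of [l0, l1], which is [c_ij] times the Koszul one. Regularity of
    [g0, g1, g2] applied to the [c_ij] then divides [p0] and [q0], corrected by a Koszul syzygy, by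
    [g0]. *)
Lemma exchange_reg3 : reg2 l0 l1 -> reg3 l0 l1 l2.
Proof.
move=> Rl v w0 w1 Mv Mw0 Mw1 E; have [Ag0 Ag1 Ag2] := memg.
pose p0 := a0 *: v + c0 *: w0; pose q0 := b0 *: v + c0 *: w1.
pose p1 := a1 *: v + c1 *: w0; pose q1 := b1 *: v + c1 *: w1.
pose p2 := a2 *: v + c2 *: w0; pose q2 := b2 *: v + c2 *: w1.
have [Mp0 Mp1 Mp2] : [/\ M p0, M p1 & M p2] by split; rewrite /p0 /p1 /p2; memM.
have [Mq0 Mq1 Mq2] : [/\ M q0, M q1 & M q2] by split; rewrite /q0 /q1 /q2; memM.
have G0 : g0 *: v = l0 *: p0 + l1 *: q0.
  by apply: (row_lin (c1 := c0) (c2 := 0) E (erefl v)) => j; rewrite /p0 /q0 !mxE Eg0; ring.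
have G1 : g1 *: v = l0 *: p1 + l1 *: q1.
  by apply: (row_lin (c1 := c1) (c2 := 0) E (erefl v)) => j; rewrite /p1 /q1 !mxE Eg1; ring.
have G2 : g2 *: v = l0 *: p2 + l1 *: q2.
  by apply: (row_lin (c1 := c2) (c2 := 0) E (erefl v)) => j; rewrite /p2 /q2 !mxE Eg2; ring.
have koszul gi gj pi pj qi qj : inA gi -> inA gj -> M pi -> M pj -> M qi -> M qj ->
    gi *: v = l0 *: pi + l1 *: qi -> gj *: v = l0 *: pj + l1 *: qj ->
    exists c, [/\ M c, gi *: qj - gj *: qi = l0 *: c & gj *: pi - gi *: pj = l1 *: c].
  move=> Agi Agj Mpi Mpj Mqi Mqj Gi Gj.
  have [|||c Mc Ec] := Rl (gi *: qj - gj *: qi) (gj *: pi - gi *: pj); try by memM.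
    apply: (row_lin (c1 := gj) (c2 := - gi) Gi Gj) => j; rewrite !mxE; ring.
  exists c; split=> //; apply: (scalerI nl0).
  have H : l0 *: (gj *: pi - gi *: pj) = l1 *: (gi *: qj - gj *: qi).
    apply: (row_lin (c1 := - gj) (c2 := gi) Gi Gj) => j; rewrite !mxE; ring.
  apply: (row_lin (c1 := 1) (c2 := l1) H Ec) => j; rewrite !mxE; ring.
have [c01 [Mc01 C01 D01]] := koszul _ _ _ _ _ _ Ag0 Ag1 Mp0 Mp1 Mq0 Mq1 G0 G1.
have [c12 [Mc12 C12 D12]] := koszul _ _ _ _ _ _ Ag1 Ag2 Mp1 Mp2 Mq1 Mq2 G1 G2.
have [c20 [Mc20 C20 D20]] := koszul _ _ _ _ _ _ Ag2 Ag0 Mp2 Mp0 Mq2 Mq0 G2 G0.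
have [||||v0 [v1 [Mv0 Mv1 Ev]]] := Rg3 (v := c01) (w0 := - c12) (w1 := - c20); try by memM.
  apply: (scalerI nl1).
  have H : l1 *: c01 + l1 *: c01 = l1 *: c01 + (g1 *: p0 - g0 *: p1) by rewrite D01.
  have H2 : g0 *: (l1 *: c12) + g1 *: (l1 *: c20) =
            g0 *: (g2 *: p1 - g1 *: p2) + g1 *: (g0 *: p2 - g2 *: p0) by rewrite D12 D20.
  apply: (row_lin (c1 := g2) (c2 := 1) H H2) => j; rewrite !mxE; ring.
have [|||h Mh Eh] := Rg2 (v := p0 - l1 *: v1) (w := p1 + l1 *: v0); try by memM.
  apply: (row_lin (c1 := 1) (c2 := l1) D01 Ev) => j; rewrite !mxE; ring.
have [|||h' Mh' Eh'] := Rg2 (v := q0 + l0 *: v1) (w := q1 - l0 *: v0); try by memM.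
  apply: (row_lin (c1 := -1) (c2 := - l0) C01 Ev) => j; rewrite !mxE; ring.
exists h, h'; split=> //; apply: (scalerI ng0); rewrite G0.
apply: (row_lin (c1 := l0) (c2 := l1) Eh Eh') => j; rewrite !mxE; ring.
Qed.

End Exchange.
End Transfer.

Section Rho.
Variables (k : closedFieldType) (n : nat) (Y : cone k n) (q : nat).
Local Notation S := {mpoly k[n.+1]}.
Variable l : 'I_q -> S.

Definition subst_forms : {mpoly k[q]} -> S := mmap (@mpolyC n.+1 k) l.
HB.instance Definition _ := GRing.RMorphism.on subst_forms.

Definition rho (c : {mpoly k[q]}) : Y := cproj Y (subst_forms c).

Lemma rhoD c d : rho (c + d) = rho c + rho d. Proof. by rewrite /rho rmorphD rmorphD. Qed.
Lemma rhoM c d : rho (c * d) = rho c * rho d. Proof. by rewrite /rho rmorphM rmorphM. Qed.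
Lemma rho0 : rho 0 = 0. Proof. by rewrite /rho !rmorph0. Qed.
Lemma rho1 : rho 1 = 1. Proof. by rewrite /rho !rmorph1. Qed.
Lemma rhoN c : rho (- c) = - rho c. Proof. by rewrite /rho rmorphN rmorphN. Qed.
Lemma rhoB c d : rho (c - d) = rho c - rho d. Proof. by rewrite rhoD rhoN. Qed.
Lemma rhoC a : rho a%:MP = scal Y a. Proof. by rewrite /rho /subst_forms mmapC. Qed.
Lemma rhoXi i : rho 'X_i = cproj Y (l i). Proof. by rewrite /rho /subst_forms mmapX mmap1U. Qed.
Lemma rhoX c m : rho (c ^+ m) = rho c ^+ m. Proof. by rewrite /rho !rmorphXn. Qed.
HB.instance Definition _ := GRing.isZmodMorphism.Build {mpoly k[q]} Y rho rhoB.
HB.instance Definition _ := GRing.isMonoidMorphism.Build {mpoly k[q]} Y rho (rho1, rhoM).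
Lemma rho_sum (T : Type) (s : seq T) (P : pred T) (F : T -> {mpoly k[q]}) :
  rho (\sum_(i <- s | P i) F i) = \sum_(i <- s | P i) rho (F i).
Proof. exact: rmorph_sum. Qed.

Lemma subst_forms_homog t c : (forall i, l i \is 1.-homog) -> c \is t.-homog ->
  subst_forms c \is t.-homog.
Proof.
move=> hl hc; rewrite /subst_forms [c]mpolyE rmorph_sum /= big_seq; apply: rpred_sum => m mc.
rewrite -mul_mpolyC rmorphM /= mmapC mul_mpolyC; apply: dhomogZ.
rewrite mmapX /mmap1 -(dhomog_mf hc mc) /= mdegE.
elim/big_rec2: _ => [|i y1 y2 _ IH]; first exact: dhomog1.
apply: dhomogM => //; rewrite -[X in X.-homog]mul1n; exact: dhomogMn.
Qed.

Lemma rho_inAt t c : (forall i, l i \is 1.-homog) -> c \is t.-homog -> inAt t (rho c).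
Proof. by move=> hl hc; apply/inAt_pi/subst_forms_homog. Qed.
End Rho.

Lemma rho_unshear (k : closedFieldType) (n : nat) (Y : cone k n) (q : nat)
    (l : 'I_q.+1 -> {mpoly k[n.+1]}) p :
  rho Y l (unshear (fun=> 0) p) =
  (map_poly (rho Y (fun i => l (lift ord_max i))) p).[cproj Y (l ord_max)].
Proof.
have HC a : rho Y l (unshear (fun=> 0) a%:P) = rho Y (fun i => l (lift ord_max i)) a.
  rewrite unshearC.
  apply: (@mpoly_rmorph_ext _ _ _ (rho Y l \o unshear_coef (fun=> 0))
           (rho Y (fun i => l (lift ord_max i)))) => [c|i] /=.
    by rewrite unshear_coefC !rhoC.
  by rewrite unshear_coefX mpolyC0 mul0r subr0 !rhoXi.
elim/poly_ind: p => [|p a IH]; first by rewrite !rmorph0 horner0.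
rewrite unshearD unshearM rhoD rhoM IH HC unshearX rhoXi.
by rewrite rmorphD rmorphM /= map_polyX map_polyC hornerD hornerMX hornerC.
Qed.

Section Graded.
Variables (k : closedFieldType) (n : nat) (Y : cone k n) (r b : nat) (s : 'M[Y]_(b, r)).
Hypothesis hs : forall i j, hdg 0 (s i j).
Local Notation S := {mpoly k[n.+1]}.
Local Notation V := 'rV[Y]_r.
Local Notation "'π' F" := (@cproj k n Y F) (at level 8, F at level 2).

Definition mpi (u : 'rV[S]_b) : V := map_mx (cproj Y) u *m s.
Definition modS (v : V) : Prop := exists u, v = mpi u.
Definition modSt (t : nat) (v : V) : Prop :=
  exists2 u : 'rV[S]_b, forall j, u 0 j \is t.-homog & v = mpi u.

Lemma mpiD u u' : mpi (u + u') = mpi u + mpi u'.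
Proof. by rewrite /mpi map_mxD mulmxDl. Qed.
Lemma mpiZ F u : mpi (F *: u) = π F *: mpi u.
Proof. by rewrite /mpi map_mxZ scalemxAl. Qed.
Lemma mpi0 : mpi 0 = 0. Proof. by rewrite /mpi map_mx0 mul0mx. Qed.
Lemma mpi_sum (T : Type) (ss : seq T) (P : pred T) F :
  mpi (\sum_(i <- ss | P i) F i) = \sum_(i <- ss | P i) mpi (F i).
Proof. by elim/big_rec2: _ => [|i y x _ <-]; rewrite ?mpi0 ?mpiD. Qed.

Lemma mpiE u : mpi u = \sum_j π (u 0 j) *: row j s.
Proof. by rewrite /mpi mulmx_sum_row; apply: eq_bigr => j _; rewrite mxE. Qed.

Lemma modS0 : modS 0. Proof. by exists 0; rewrite mpi0. Qed.
Lemma modSD u v : modS u -> modS v -> modS (u + v).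
Proof. by move=> [x ->] [y ->]; exists (x + y); rewrite mpiD. Qed.
Lemma modSA a v : inA a -> modS v -> modS (a *: v).
Proof. by move=> [F ->] [x ->]; exists (F *: x); rewrite mpiZ. Qed.
Lemma modS_sum (T : Type) (ss : seq T) (P : pred T) (F : T -> V) :
  (forall i, P i -> modS (F i)) -> modS (\sum_(i <- ss | P i) F i).
Proof. by move=> H; elim/big_ind: _ => //; [exact: modS0|exact: modSD]. Qed.

Lemma modStS t v : modSt t v -> modS v. Proof. by move=> [u _ ->]; exists u. Qed.
Lemma modSt0 t : modSt t 0.
Proof. by exists 0; rewrite ?mpi0 // => j; rewrite mxE dhomog0. Qed.
Lemma modStD t u v : modSt t u -> modSt t v -> modSt t (u + v).
Proof.
move=> [x hx ->] [y hy ->]; exists (x + y); rewrite ?mpiD // => j.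
by rewrite mxE; apply: dhomogD.
Qed.
Lemma modStA t e a v : inAt e a -> modSt t v -> modSt (e + t) (a *: v).
Proof.
move=> [F hF ->] [x hx ->]; exists (F *: x); rewrite ?mpiZ // => j.
by rewrite mxE; apply: dhomogM.
Qed.
Lemma inAt_scal c : inAt (Y := Y) 0 (scal Y c).
Proof.
by apply: inAt_pi; rewrite -[c%:MP]mulr1 mul_mpolyC; apply: dhomogZ; apply: dhomog1.
Qed.
Lemma modStZ t c v : modSt t v -> modSt t (scal Y c *: v).
Proof. by move=> h; apply: (@modStA t 0) => //; exact: inAt_scal. Qed.
Lemma modSt_sum t (T : Type) (ss : seq T) (P : pred T) (F : T -> V) :
  (forall i, P i -> modSt t (F i)) -> modSt t (\sum_(i <- ss | P i) F i).
Proof. by move=> H; elim/big_ind: _ => //; [exact: modSt0|exact: modStD]. Qed.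
Lemma subsp_modSt t : subsp (V := kmod V) (modSt t).
Proof. split; first exact: modSt0. by move=> c u v hu hv; apply: modStD => //; apply: modStZ. Qed.

Lemma modSt_hdg t v j : modSt t v -> hdg t (v 0 j).
Proof.
move=> [u hu ->]; rewrite mxE; apply: (hloc_sum (nzden_class Y)) => i _.
rewrite mxE -[t%:Z]addr0; apply: (hlocM (nzden_class Y)); last exact: hs.
exact: (hloc_pi (nzden_class Y)).
Qed.

Definition dec (v : V) (w : nat -> V) : Prop :=
  (forall d, modSt d (w d)) /\
  exists T, (forall d, (T <= d)%N -> w d = 0) /\ v = \sum_(d < T) w d.

Lemma dec_sum v w T : dec v w -> (forall d, (T <= d)%N -> w d = 0) -> v = \sum_(d < T) w d.
Proof.
move=> [_ [T' [h' ->]]] h.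
have E : forall A B, (A <= B)%N -> (forall d, (A <= d)%N -> w d = 0) ->
    \sum_(d < A) w d = \sum_(d < B) w d.
  move=> A B leAB hA; rewrite (big_ord_widen B (fun d => w d)) // big_mkcond.
  by apply: eq_bigr => i _; case: ltnP => // /hA.
by case: (leqP T T') => hT; [rewrite -(E T T')|rewrite (E T' T) // ltnW].
Qed.

Lemma dec_ex v : modS v -> exists w, dec v w.
Proof.
move=> [u ->]; pose T := (\max_j msize (u ord0 j))%N.
exists (fun d => mpi (map_mx (pihomog mdeg d) u)); split.
  by move=> d; exists (map_mx (pihomog mdeg d) u) => // j; rewrite mxE pihomogP.
exists T; split.
  move=> d le; rewrite -[RHS]mpi0; congr mpi; apply/rowP => j; rewrite !mxE pihomogE big_seq_cond.
  rewrite big1 // => m /andP[mu /eqP E].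
  have := msize_mdeg_lt mu; rewrite E ltnNge => /negP[]; apply: leq_trans le.
  exact: (leq_bigmax j).
rewrite -mpi_sum; congr mpi; apply/rowP => j; rewrite summxE.
under eq_bigr => d _ do rewrite mxE.
by rewrite -(pihomog_partitionE (leq_bigmax j)).
Qed.

Lemma dec_unique v w w' : dec v w -> dec v w' -> forall d, w d = w' d.
Proof.
move=> H H' d; have [hw [T [hT _]]] := H; have [hw' [T' [hT' _]]] := H'.
pose B := (maxn (maxn T T') d.+1)%N.
have leT e : (B <= e)%N -> (T <= e)%N.
  by apply: leq_trans; rewrite /B !leq_max leqnn.
have leT' e : (B <= e)%N -> (T' <= e)%N.
  by apply: leq_trans; rewrite /B !leq_max leqnn orbT.
have E := dec_sum H (fun e h => hT e (leT e h)).
have E' := dec_sum H' (fun e h => hT' e (leT' e h)).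
have dB : (d < B)%N by rewrite /B leq_max ltnSn orbT.
apply/rowP => j; apply/eqP; rewrite -subr_eq0; apply/eqP.
apply: (@hdg_indep k n Y B (fun i => (i : nat)%:Z) (fun i => w i 0 j - w' i 0 j) _ _ _ (Ordinal dB)).
- by move=> x y [] /val_inj.
- by move=> i; apply: (hlocB (nzden_class Y)); apply: modSt_hdg.
- rewrite sumrB -!summxE -E -E' subrr //.
Qed.

Lemma decD v w v' w' : dec v w -> dec v' w' -> dec (v + v') (fun d => w d + w' d).
Proof.
move=> H H'; have [hw [T [hT _]]] := H; have [hw' [T' [hT' _]]] := H'.
split; first by move=> d; apply: modStD.
exists (maxn T T'); split=> [d|].
  by rewrite geq_max => /andP[h h']; rewrite hT // hT' // addr0.
rewrite big_split; congr (_ + _); apply: dec_sum => // d; rewrite geq_max => /andP[h h'].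
  exact: hT.
exact: hT'.
Qed.

Lemma decA e a v w : inAt e a -> dec v w ->
  dec (a *: v) (fun d => if (d < e)%N then 0 else a *: w (d - e)%N).
Proof.
move=> ha [hw [T [hT ->]]]; split=> [d|].
  case: ltnP => h; first exact: modSt0.
  by rewrite -{1}(subnKC h); apply: modStA.
exists (e + T)%N; split=> [d h|].
  by rewrite ltnNge (leq_trans (leq_addr _ _) h) /= hT ?scaler0 // leq_subRL // (leq_trans (leq_addr _ _) h).
rewrite big_split_ord /= [X in _ = X + _]big1 ?add0r => [|i _]; last by case: ltnP => //; rewrite leqNgt ltn_ord.
rewrite scaler_sumr; apply: eq_bigr => i _.
by rewrite ltnNge leq_addr /= addKn.
Qed.

Lemma mod_hdg m v : v != 0 -> modS v -> (forall j, hdg m (v 0 j)) ->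
  exists2 t : nat, m = t%:Z & modSt t v.
Proof.
move=> v0 /dec_ex[w [hw [T [_ Ev]]]] hv.
have P j := hdg_proj (hv j) (fun d : 'I_T => modSt_hdg j (hw d)) (w := fun d => w d 0 j).
have Ej j : v 0 j = \sum_(d < T) w d 0 j by rewrite Ev summxE.
have [/existsP[t /eqP E]|/existsPn no] := boolP [exists t : 'I_T, (t : nat)%:Z == m].
  exists t => //; suff -> : v = w t by [].
  by apply/rowP => j; have [-> _] := P j (Ej j); rewrite E eqxx.
case/eqP: v0; apply/rowP => j; have [_ ->] := P j (Ej j); by rewrite ?mxE.
Qed.

Section Free.
Variable l : 'I_3 -> S.
Hypothesis hl : forall i, l i \is 1.-homog.
Hypothesis nl : forall i, π (l i) != 0.
Variable K : nat.
Hypothesis pK : (0 < K)%N.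
Hypothesis hK : forall t F, (K <= t)%N -> F \is t.-homog ->
  exists2 G : 'I_3 -> S, forall i, G i \is t.-1.-homog & π F = \sum_i π (l i) * π (G i).
Variables (F0 F1 F2 : S) (d0 d1 d2 : nat).
Hypotheses (hF0 : F0 \is d0.-homog) (hF1 : F1 \is d1.-homog) (hF2 : F2 \is d2.-homog).
Hypotheses (p0 : (0 < d0)%N) (p1 : (0 < d1)%N) (p2 : (0 < d2)%N).
Hypotheses (nF0 : π F0 != 0) (nF1 : π F1 != 0).
Hypotheses (RF2 : reg2 modS (π F0) (π F1)) (RF3 : reg3 modS (π F0) (π F1) (π F2)).

Let o0 : 'I_3 := ord0.
Let o1 : 'I_3 := lift ord0 ord0.
Let o2 : 'I_3 := ord_max.

Lemma sum3 (W : nmodType) (f : 'I_3 -> W) : \sum_i f i = f o0 + f o1 + f o2.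
Proof.
rewrite !big_ord_recl big_ord0 addr0 addrA; congr (_ + _ + _); congr f; exact: val_inj.
Qed.

Lemma power_in_l F d : (0 < d)%N -> F \is d.-homog -> exists a c e,
  [/\ inA a, inA c, inA e & π F ^+ K.+1 = a * π (l o2) + c * π (l o1) + e * π (l o0)].
Proof.
move=> pd hF; have [|G _] := hK (t := (d * K.+1)%N) _ (dhomogMn K.+1 hF).
  by apply: leq_trans (leq_pmull _ pd).
rewrite piX sum3 => ->; exists (π (G o2)), (π (G o1)), (π (G o0)).
split; [exact: inApi..|]; ring.
Qed.

(** For two parameters this is Nakayama's lemma by degrees: [exchange_surj] says that the third
    parameter acts surjectively on the obstruction, and high powers of it have no component in the
    finitely many degrees where [v] lives. For three, [exchange_reg3] applies. *)
Lemma transfer_reg : reg2 modS (π (l o2)) (π (l o1)) /\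
  reg3 modS (π (l o2)) (π (l o1)) (π (l o0)).
Proof.
have [a0 [b0 [c0 [Aa0 Ab0 Ac0 E0]]]] := power_in_l p0 hF0.
have [a1 [b1 [c1 [Aa1 Ab1 Ac1 E1]]]] := power_in_l p1 hF1.
have [a2 [b2 [c2 [Aa2 Ab2 Ac2 E2]]]] := power_in_l p2 hF2.
have MD := modSD; have MA := modSA.
have R2 : reg2 modS (π F0 ^+ K.+1) (π F1 ^+ K.+1).
  by apply: reg2_powl => //; [exact: inApi|apply: reg2_powr => //; exact: inApi].
have R3 : reg3 modS (π F0 ^+ K.+1) (π F1 ^+ K.+1) (π F2 ^+ K.+1).
  apply: reg3_pow2 => //; first exact: inApi.
  apply: reg3_pow0 => //; try exact: inApi.
  - exact: expf_neq0.
  - by apply: inAX; exact: inApi.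
  - by apply: reg2_powr => //; exact: inApi.
  - by apply: reg3_pow1 => //; exact: inApi.
have nG0 : π F0 ^+ K.+1 != 0 by exact: expf_neq0.
have Al i : inA (π (l i)) by exact: inApi.
suff RR : reg2 modS (π (l o2)) (π (l o1)).
  split=> //.
  exact: (exchange_reg3 modSD modSA nG0 (nl o2) (nl o1) (Al o2) (Al o1) (Al o0)
    Aa0 Aa1 Aa2 Ab0 Ab1 Ab2 Ac0 Ac1 Ac2 E0 E1 E2 R2 R3).
have surj x := exchange_surj modSD modSA nG0 (nl o0) (Al o2) (Al o1) (Al o0)
    Aa0 Aa1 Aa2 Ab0 Ab1 Ab2 Ac0 Ac1 Ac2 E0 E1 E2 R2 R3 (x := x).
move=> v w Mv Mw E; pose x := (π (l o2))^-1 *: v.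
have xv : π (l o2) *: x = v by rewrite scalerA divff // scale1r.
have xw : π (l o1) *: x = w.
  by apply: (scalerI (nl o2)); rewrite scalerA mulrC -scalerA xv.
(* Iterating [exchange_surj]: modulo the module, [x] is divisible by every power of the third
   parameter. *)
have iter N : exists h z, [/\ modS h, modS (π (l o2) *: z), modS (π (l o1) *: z) &
    x = h + π (l o0) ^+ N *: z].
  elim: N => [|N [h [z [Mh M2z M1z Ex]]]].
    by exists 0, x; rewrite xv xw add0r expr0 scale1r; split=> //; exact: modS0.
  have [h' [z' [Mh' M2z' M1z' Ez]]] := surj z M2z M1z.
  exists (h + π (l o0) ^+ N *: h'), z'; split=> //.
    by apply: modSD => //; apply: modSA => //; apply: inAX.
  by rewrite Ex Ez scalerDr scalerA addrA exprSr.
have [u du] := dec_ex Mv; have [hu [T [hT Ev]]] := du.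
have [h [z [/dec_ex[wh dh] /dec_ex[wz dz] _ Ex]]] := iter T.
have hll i : inAt 1 (π (l i)) by exact: inAt_pi.
have hlT : inAt T (π (l o0) ^+ T).
  rewrite -piX; apply: inAt_pi; rewrite -[X in X.-homog]mul1n; exact: dhomogMn.
have dv : dec v (fun d => (if (d < 1)%N then 0 else π (l o2) *: wh (d - 1)%N) +
                          (if (d < T)%N then 0 else π (l o0) ^+ T *: wz (d - T)%N)).
  have -> : v = π (l o2) *: h + π (l o0) ^+ T *: (π (l o2) *: z).
    by rewrite -xv Ex scalerDr !scalerA mulrC.
  by apply: decD; apply: decA.
(* Below degree [T], where all of [v] lives, the term with the [T]-th power does not contribute, so
   the low components of [h] suffice. *)
exists (\sum_(d < T) if (d < 1)%N then 0 else wh (d - 1)%N).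
  apply: modS_sum => d _; case: ifP => _; first exact: modS0.
  by case: dh => dh _; apply: modStS.
rewrite Ev scaler_sumr; apply: eq_bigr => d _.
rewrite (dec_unique du dv) ltn_ord addr0; case: ifP => // _; by rewrite scaler0.
Qed.

Definition lM (v : V) : Prop :=
  exists2 w : 'I_3 -> V, forall i, modS (w i) & v = \sum_i π (l i) *: w i.
Definition lMt (t : nat) (v : V) : Prop :=
  if t is t'.+1 then exists2 w : 'I_3 -> V, forall i, modSt t' (w i) & v = \sum_i π (l i) *: w i
  else v = 0.

Lemma subsp_lMt t : subsp (V := kmod V) (lMt t).
Proof.
case: t => [|t]; split=> //=.
- by move=> c u v -> ->; rewrite addr0; rewrite kscaleE scaler0.
- exists (fun=> 0) => [i|]; first exact: modSt0.
  by rewrite big1 // => i _; rewrite scaler0.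
- move=> c u v [w hw ->] [w' hw' ->]; exists (fun i => scal Y c *: w i + w' i).
    by move=> i; apply: modStD => //; apply: modStZ.
  rewrite kscaleE scaler_sumr -big_split; apply: eq_bigr => i _ /=.
  by rewrite scalerDr !scalerA [π _ * scal Y c]mulrC.
Qed.

Lemma modSt_span t : exists m (g : 'I_m -> kmod V), forall v, modSt t v -> spanned g v.
Proof.
have [g Hg] := fdim_spanned (fdim_homog k n t).
exists #|{: 'I_('C(t + n, n)) * 'I_b}|,
  (fun i => π (g (enum_val i).1) *: row (enum_val i).2 s) => v [u hu ->].
have [c Hc] : exists c : 'I_b -> 'I_('C(t + n, n)) -> k,
    forall j, u 0 j = \sum_i c j i *: g i.
  by apply: (@ord_choice b _ (fun j c => u 0 j = \sum_i c i *: g i)) => j; apply: Hg.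
exists (fun i => c (enum_val i).2 (enum_val i).1).
rewrite mpiE; transitivity (\sum_(p : 'I_('C(t + n, n)) * 'I_b)
    scal Y (c p.2 p.1) *: (π (g p.1) *: row p.2 s)).
  rewrite -(pair_bigA _ (fun i j => scal Y (c j i) *: (π (g i) *: row j s))) /= exchange_big.
  apply: eq_bigr => j _; rewrite Hc pi_sum scaler_suml; apply: eq_bigr => i _.
  by rewrite piZ scalerA.
by rewrite sum_over_enum.
Qed.

Lemma modSt_lMt t v : (K <= t)%N -> modSt t v -> lMt t v.
Proof.
case: t => [|t] le [u hu ->]; first by rewrite leqNgt pK in le.
have [G HG] : exists G : 'I_b -> 'I_3 -> S, forall j, (forall i, G j i \is t.-homog) /\
    π (u 0 j) = \sum_i π (l i) * π (G j i).
  apply: (@ord_choice b ('I_3 -> S) (fun j G => (forall i, G i \is t.-homog) /\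
    π (u 0 j) = \sum_i π (l i) * π (G i))) => j.
  by have [G hG E] := hK le (hu j); exists G.
exists (fun i => mpi (\row_j G j i)).
  by move=> i; exists (\row_j G j i) => // j; rewrite mxE; have [] := HG j.
rewrite mpiE; under [RHS]eq_bigr => i _ do rewrite mpiE scaler_sumr.
rewrite exchange_big; apply: eq_bigr => j _.
have [_ ->] := HG j; rewrite scaler_suml; apply: eq_bigr => i _.
by rewrite scalerA mxE.
Qed.

(** Coefficients, in degree [t], of a generator of degree [a]; below [a] only 0 is allowed, which
    truncated subtraction would not enforce. *)
Definition homd (t a : nat) (c : {mpoly k[3]}) : Prop :=
  if (a <= t)%N then is_true (c \is (t - a).-homog) else c = 0.

Lemma homdD t a c d : homd t a c -> homd t a d -> homd t a (c + d).
Proof. by rewrite /homd; case: ifP => _; [apply: dhomogD|move=> -> ->; rewrite addr0]. Qed.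

Lemma homd_sum t a (J : finType) (c : J -> {mpoly k[3]}) :
  (forall j, homd t a (c j)) -> homd t a (\sum_j c j).
Proof.
move=> H; elim/big_ind: _ => //; last by move=> x y; exact: homdD.
by rewrite /homd; case: ifP => // _; apply: dhomog0.
Qed.

Lemma homdX t a i c : homd t a c -> homd t.+1 a ('X_i * c).
Proof.
rewrite /homd; case: ifP => le hc.
  rewrite (leqW le) (_ : (t.+1 - a = 1 + (t - a))%N); last by rewrite subSn.
  apply: dhomogM => //.
  by rewrite dhomogX /= mdeg1.
case: ifP => _; rewrite hc mulr0 //; exact: dhomog0.
Qed.

(* One variable at a time: [l_q] is regular modulo [N], and freeness modulo [N + l_q M] over
   [k[y_0..y_(q-1)]] gives freeness modulo [N] over [k[y_0..y_q]]. *)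
Lemma free_step q (ll : 'I_q.+1 -> S) (N : V -> Prop) (I : finType) (e : I -> V) :
  (forall i, modS (e i)) ->
  (forall v, modS v -> N (π (ll ord_max) *: v) -> N v) ->
  (forall c : I -> {mpoly k[q]}, (exists2 w, modS w &
     N (\sum_i rho Y (fun j => ll (lift ord_max j)) (c i) *: e i - π (ll ord_max) *: w)) ->
     forall i, c i = 0) ->
  forall c : I -> {mpoly k[q.+1]}, N (\sum_i rho Y ll (c i) *: e i) -> forall i, c i = 0.
Proof.
move=> he H1 H2.
(* Induction on the degree in the last variable: modulo the last parameter only the constant
   coefficients remain, and they vanish by [H2]; then [H1] cancels the parameter from the rest. *)
suff main D (p : I -> {poly {mpoly k[q]}}) : (forall i, (size (p i) <= D)%N) ->
    N (\sum_i rho Y ll (unshear (fun=> 0) (p i)) *: e i) -> forall i, p i = 0.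
  move=> c Nc i; rewrite -(shearK (fun=> 0) (c i)).
  rewrite (main (\max_i size (shear (fun=> 0%R) (c i)))%N (fun i => shear (fun=> 0) (c i))) ?rmorph0 //.
    by move=> j; apply: (leq_bigmax j).
  by move: Nc; congr N; apply: eq_bigr => j _; rewrite shearK.
elim: D p => [|D IH] p szp Np.
  by move=> i; apply/eqP; rewrite -size_poly_leq0.
pose pc i := (p i)`_0; pose p' i := \poly_(j < D) (p i)`_j.+1.
have Ep i : p i = p' i * 'X + (pc i)%:P.
  apply/polyP => -[|j]; rewrite coefD coefMX coefC /= ?add0r // addr0 coef_poly.
  by case: ltnP => // le; rewrite nth_default // (leq_trans (szp i)).
have Er i : rho Y ll (unshear (fun=> 0) (p i)) =
    rho Y (fun j => ll (lift ord_max j)) (pc i) +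
    π (ll ord_max) * rho Y ll (unshear (fun=> 0) (p' i)).
  rewrite Ep !rho_unshear rmorphD rmorphM /= map_polyX map_polyC hornerD hornerMX hornerC.
  by rewrite addrC mulrC.
pose w := \sum_i rho Y ll (unshear (fun=> 0) (p' i)) *: e i.
have Mw : modS w by apply: modS_sum => i _; apply: modSA => //; exact: inApi.
have E : \sum_i rho Y ll (unshear (fun=> 0) (p i)) *: e i =
    \sum_i rho Y (fun j => ll (lift ord_max j)) (pc i) *: e i + π (ll ord_max) *: w.
  rewrite scaler_sumr -big_split; apply: eq_bigr => i _.
  by rewrite Er scalerDl scalerA.
have pc0 : forall i, pc i = 0.
  apply: H2; exists (- w); first by rewrite -scaleN1r; apply: modSA => //; apply/inAN/inA1.
  by rewrite scalerN opprK -E.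
have p'0 : forall i, p' i = 0.
  apply: IH => [i|]; first exact: size_poly.
  apply: H1 => //; move: Np; rewrite E big1 ?add0r // => i _.
  by rewrite pc0 rho0 scale0r.
by move=> i; rewrite Ep pc0 p'0 mul0r add0r.
Qed.

(** In each degree below [K] a basis is chosen modulo the part coming from the parameters; from [K]
    on nothing is missing. Spanning is an induction on the degree. Independence goes up from the
    ground field by three uses of [free_step], each consuming one term of the regular sequence. *)
Theorem free_basis : exists (I : finType) (a : I -> nat) (e : I -> V),
  [/\ forall i, modSt (a i) (e i),
      forall t v, modSt t v -> exists2 c : I -> {mpoly k[3]},
        forall i, homd t (a i) (c i) & v = \sum_i rho Y l (c i) *: e i &
      forall c : I -> {mpoly k[3]}, \sum_i rho Y l (c i) *: e i = 0 -> forall i, c i = 0].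
Proof.
pose P t (x : {m : nat & 'I_m -> kmod V}) := [/\ forall i, modSt t (projT2 x i),
    forall v, modSt t v -> exists c : 'I_(projT1 x) -> k,
      lMt t (v - \sum_i c i *: projT2 x i) &
    forall c : 'I_(projT1 x) -> k, lMt t (\sum_i c i *: projT2 x i) -> forall i, c i = 0].
have exX t : exists x, P t x.
  have [m [g Hg]] := modSt_span t.
  have [m' [f [H1 H2 H3]]] := quot_basis (subsp_modSt t) (subsp_lMt t) Hg.
  by exists (existT _ m' f).
pose X t := proj1_sig (constructive_indefinite_description _ (exX t)).
have HX t : P t (X t) by rewrite /X; case: constructive_indefinite_description.
pose I : finType := {t : 'I_K & 'I_(projT1 (X t))}.
pose a (i : I) : nat := tag i.
pose e (i : I) : V := projT2 (X (tag i)) (tagged i).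
have he i : modSt (a i) (e i) by have [H _ _] := HX (tag i); exact: (H (tagged i)).
have Me i : modS (e i) by apply: modStS (he i).
pose tg (t : 'I_K) (j : 'I_(projT1 (X t))) : I := Tagged (fun t : 'I_K => 'I_(projT1 (X t))) j.
have tagsum (t : 'I_K) (F : I -> V) :
    \sum_(i : I | tag i == t) F i = \sum_j F (tg t j).
  transitivity (\sum_(t' | t' == t) \sum_(j : 'I_(projT1 (X t')) | true)
      F (tg t' j)); last by rewrite big_pred1_eq.
  rewrite sig_big_dep; apply: eq_big => [i|i _]; first by rewrite andbT.
  by case: i.
exists I, a, e; split=> //.
- elim/ltn_ind => t IH v Mv.
  have step v' : lMt t v' -> exists2 c : I -> {mpoly k[3]},
      forall i, homd t (a i) (c i) & v' = \sum_i rho Y l (c i) *: e i.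
    case: t IH {Mv} => [|t] IH /=.
      move=> ->; exists (fun=> 0) => [i|]; last by rewrite big1 // => i _; rewrite rho0 scale0r.
      by rewrite /homd; case: ifP => // _; exact: dhomog0.
    move=> [w hw ->].
    have [c Hc] : exists c : 'I_3 -> I -> {mpoly k[3]}, forall j,
        (forall i, homd t (a i) (c j i)) /\ w j = \sum_i rho Y l (c j i) *: e i.
      apply: (@ord_choice 3 (I -> {mpoly k[3]}) (fun j c => (forall i, homd t (a i) (c i)) /\
         w j = \sum_i rho Y l (c i) *: e i)) => j.
      by have [c h1 h2] := IH t (ltnSn t) (w j) (hw j); exists c.
    exists (fun i => \sum_j 'X_j * c j i).
      by move=> i; apply: homd_sum => j; apply: homdX; have [] := Hc j.
    under [RHS]eq_bigr => i _ do rewrite rho_sum scaler_suml.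
    rewrite exchange_big; apply: eq_bigr => j _; have [_ ->] := Hc j.
    rewrite scaler_sumr; apply: eq_bigr => i _.
    by rewrite scalerA rhoM rhoXi.
  case: (ltnP t K) => [lt|le]; last by apply/step/modSt_lMt.
  have [_ sp _] := HX t; have [c Hc] := sp _ Mv.
  have [c' h1 h2] := step _ Hc.
  pose cc (i : I) : k := \sum_j if i == tg (Ordinal lt) j then c j else 0.
  have cc0 i : tag i != Ordinal lt -> cc i = 0.
    move=> ti; rewrite /cc big1 // => j _; case: eqP => // E.
    by rewrite E eqxx in ti.
  have ccj j : cc (tg (Ordinal lt) j) = c j.
    rewrite /cc (bigD1 j) //= eqxx big1 ?addr0 // => j' jj'.
    by rewrite /tg eq_Tagged /= eq_sym (negbTE jj').
  exists (fun i => (cc i)%:MP + c' i) => [i|].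
    apply: homdD => //; rewrite /homd /a.
    have [E|/cc0 ->] := eqVneq (tag i) (Ordinal lt); last first.
      by rewrite mpolyC0; case: ifP => // _; exact: dhomog0.
    by rewrite E /= leqnn subnn -[_%:MP]mulr1 mul_mpolyC; apply: dhomogZ; exact: dhomog1.
  under eq_bigr => i _ do rewrite rhoD scalerDl.
  rewrite big_split -h2 /=; rewrite (bigID (fun i : I => tag i == Ordinal lt)) /=.
  rewrite [X in _ + X + _]big1 => [|i /cc0 ->]; last by rewrite mpolyC0 rho0 scale0r.
  rewrite addr0 tagsum addrC.
  transitivity (v - \sum_i c i *: projT2 (X t) i + \sum_i c i *: projT2 (X t) i).
    by rewrite subrK.
  by congr (_ + _); apply: eq_bigr => j _; rewrite ccj rhoC.
(* Independence modulo all three parameters, the case without variables; it is read off one degree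
   at a time. *)
- have base (c : I -> k) : lM (\sum_i scal Y (c i) *: e i) -> forall i, c i = 0.
    move=> [w hw Ev] i0.
    have D1 : dec (\sum_i scal Y (c i) *: e i)
        (fun d => \sum_(i : I | (tag i : nat) == d) scal Y (c i) *: e i).
      split=> [d|].
        by apply: modSt_sum => i /eqP <-; apply: modStZ; exact: he.
      exists K; split=> [d le|].
        by rewrite big1 // => i /eqP E; have := ltn_ord (tag i); rewrite E ltnNge le.
      by rewrite (partition_big (fun i : I => tag i) predT).
    have [W HW] : exists W : 'I_3 -> nat -> V, forall j, dec (w j) (W j).
      by apply: (@ord_choice 3 (nat -> V) (fun j W => dec (w j) W)) => j; apply: dec_ex.
    have D2 : dec (\sum_i scal Y (c i) *: e i)
        (fun d => \sum_j if (d < 1)%N then 0 else π (l j) *: W j (d - 1)%N).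
      rewrite Ev sum3.
      have := decD (decD (decA (inAt_pi Y (hl o0)) (HW o0)) (decA (inAt_pi Y (hl o1)) (HW o1)))
               (decA (inAt_pi Y (hl o2)) (HW o2)).
      move=> [h1 [T [h2 h3]]]; split=> [d|]; first by rewrite sum3.
      exists T; split=> [d le|]; first by rewrite sum3 h2.
      by rewrite h3; apply: eq_bigr => d _; rewrite sum3.
    have E := dec_unique D1 D2 (tag i0); rewrite /= in E.
    have lt0 : lMt (tag i0) (\sum_j scal Y (c (tg (tag i0) j)) *: projT2 (X (tag i0)) j).
      rewrite -(tagsum (tag i0) (fun i => scal Y (c i) *: e i)).
      have -> : \sum_(i : I | tag i == tag i0) scal Y (c i) *: e i =
          \sum_(i : I | (tag i : nat) == tag i0) scal Y (c i) *: e i by exact: eq_bigl.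
      rewrite E; case: (nat_of_ord (tag i0)) => [|t] /=; first by rewrite big1.
      exists (fun j => W j t) => [j|]; first by have [] := HW j.
      by apply: eq_bigr => j _; rewrite subSS subn0.
    have [_ _ ind] := HX (tag i0).
    have := ind (fun j => c (tg (tag i0) j)) lt0 (tagged i0).
    by case: i0 {E lt0 ind}.
  have [R2 R3] := transfer_reg.
  have e1 : l (lift ord_max ord_max) = l o1 by congr l; apply: val_inj.
  have e0 : l (lift ord_max (lift ord_max ord_max)) = l o0 by congr l; apply: val_inj.
  apply: (@free_step 2 l (fun v => v = 0)) => //.
    by move=> v _ h; apply: (scalerI (nl o2)); rewrite h scaler0.
  apply: (@free_step 1 _ (fun v => exists2 w, modS w & v - π (l ord_max) *: w = 0)) => //.
    move=> v Mv [w Mw]; rewrite e1 => /eqP; rewrite subr_eq0 => /eqP /(R2 _ _ Mv Mw)[v' Mv' ->].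
    by exists v' => //; rewrite subrr.
  apply: (@free_step 0 _ (fun v => exists2 w', modS w' &
     exists2 w, modS w & v - π (l (lift ord_max ord_max)) *: w' - π (l ord_max) *: w = 0)) => //.
    move=> v Mv [w' Mw' [w Mw]]; rewrite e0 e1 => /eqP; rewrite -addrA -opprD subr_eq0 addrC => /eqP.
    case/(R3 _ _ _ Mv Mw Mw') => v0 [v1 [Mv0 Mv1 ->]].
    by exists v1 => //; exists v0 => //; rewrite addrK subrr.
  move=> c [w0 Mw0 [w1 Mw1 [w2 Mw2]]]; rewrite e0 e1 => E i.
  rewrite (mpoly0_const (c i)) (base (fun i => (c i).@[fun=> 0])) ?mpolyC0 //.
  exists (fun j : 'I_3 => if j == o0 then w0 else if j == o1 then w1 else w2).
    by move=> j; case: ifP => // _; case: ifP.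
  rewrite sum3 /= ; apply/eqP; rewrite -subr_eq0; apply/eqP; rewrite -[RHS]E.
  rewrite !opprD !addrA; do 3 congr (_ - _).
  by apply: eq_bigr => j _; rewrite [X in rho _ _ X]mpoly0_const rhoC.
Qed.

End Free.
End Graded.

(** * Dimension *)

(** An ideal that is maximal among those containing [J] and disjoint from the multiplicative set [T]
    is prime. *)
Lemma krull_avoid (R : comNzRingType) (J T : R -> Prop) : ideal J ->
  T 1 -> (forall x y, T x -> T y -> T (x * y)) -> (forall x, J x -> ~ T x) ->
  exists Q : R -> Prop, [/\ ideal Q, forall x, J x -> Q x, forall x, Q x -> ~ T x &
    forall x y, Q (x * y) -> Q x \/ Q y].
Proof.
move=> iJ T1 TM JT; have [J0 JD JM] := iJ.
(* The disjunction with [J] admits the union of the empty chain: it gives [J]. *)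
pose P (X : R -> Prop) := ideal (fun x => X x \/ J x) /\ forall x, X x \/ J x -> ~ T x.
have [|A [[iA AT] Amax]] := @classical_sets.Zorn_bigcup R P.
  move=> F FP tot.
  have pick x : classical_sets.bigcup F id x \/ J x ->
      J x \/ exists2 X, F X & X x.
    by case=> [[X FX Xx]|Jx]; [right; exists X|left].
  split; last first.
    move=> x /pick[/JT //|[X FX Xx]].
    by have [_ h] := FP X FX; apply: h; left.
  split; first by right.
    move=> x y /pick[Jx|[X FX Xx]] /pick[Jy|[Z FZ Zy]].
    - by right; apply: JD.
    - have [[_ ZD _] _] := FP Z FZ.
      by case: (ZD x y (or_intror Jx) (or_introl Zy)) => h; [left; exists Z|right].
    - have [[_ XD _] _] := FP X FX.
      by case: (XD x y (or_introl Xx) (or_intror Jy)) => h; [left; exists X|right].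
    - have [XZ|ZX] := tot X Z FX FZ.
        have [[_ ZD _] _] := FP Z FZ.
        by case: (ZD x y (or_introl (XZ _ Xx)) (or_introl Zy)) => h; [left; exists Z|right].
      have [[_ XD _] _] := FP X FX.
      by case: (XD x y (or_introl Xx) (or_introl (ZX _ Zy))) => h; [left; exists X|right].
  move=> a x /pick[Jx|[X FX Xx]]; first by right; apply: JM.
  have [[_ _ XM] _] := FP X FX.
  by case: (XM a x (or_introl Xx)) => h; [left; exists X|right].
exists (fun x => A x \/ J x); split=> // [x Jx|x y Axy]; first by right.
have [A0 AD AM] := iA.
apply: NNPP => /not_or_and[nx ny].
have ext u : ~ (A u \/ J u) -> exists q a, (A q \/ J q) /\ T (q + a * u).
  move=> nu; apply: NNPP => H.
  apply: (Amax (fun z => exists q a, (A q \/ J q) /\ z = q + a * u)).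
    split=> [z Az|h]; first by exists z, 0; rewrite mul0r addr0; split=> //; left.
    apply: nu; left; apply: h; exists 0, 1; rewrite mul1r add0r; split=> //; exact: A0.
  have red z : (exists q a, (A q \/ J q) /\ z = q + a * u) \/ J z ->
      exists q a, (A q \/ J q) /\ z = q + a * u.
    by case=> // Jz; exists z, 0; rewrite mul0r addr0; split=> //; right.
  split; last first.
    by move=> z /red[q [a [hq ->]]] Tz; apply: H; exists q, a.
  split; first by left; exists 0, 0; rewrite mul0r addr0; split=> //; exact: A0.
    move=> z z' /red[q [a [hq ->]]] /red[q' [a' [hq' ->]]].
    left; exists (q + q'), (a + a'); split; first exact: AD.
    by rewrite mulrDl addrACA.
  move=> c z /red[q [a [hq ->]]]; left; exists (c * q), (c * a); split; first exact: AM.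
  by rewrite mulrDr mulrA.
have [q [a [hq Tq]]] := ext x nx; have [q' [a' [hq' Tq']]] := ext y ny.
have /AT := TM _ _ Tq Tq'; apply.
have -> : (q + a * x) * (q' + a' * y) = (q' + a' * y) * q + (a * x) * q' + (a * a') * (x * y).
  ring.
by apply: (AD); [apply: (AD); exact: AM|exact: AM].
Qed.

Section HomogPart.
Variables (K : fieldType) (n : nat).
Local Notation S := {mpoly K[n]}.

(** For an ideal [Q], the largest homogeneous ideal inside it. *)
Definition hpart (Q : S -> Prop) (F : S) : Prop := forall d, Q (pihomog mdeg d F).

Lemma coeff_pihomog d (F : S) m :
  (pihomog mdeg d F)@_m = if mdeg m == d then F@_m else 0.
Proof.
rewrite pihomogE raddf_sum /= [F in RHS]mpolyE.
under eq_bigr => m' _ do rewrite mcoeffZ mcoeffX.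
rewrite raddf_sum /=; under [in RHS]eq_bigr => m' _ do rewrite mcoeffZ mcoeffX.
case: eqP => E; rewrite [LHS]big_mkcond /=.
  apply: eq_bigr => m' _; case: eqP => // ne; case: eqP => [E'|_]; rewrite ?mulr0 //.
  by case: ne; rewrite E'.
by rewrite big1 // => m' _; case: eqP => // E'; case: eqP => [E2|_]; rewrite ?mulr0 //; case: E; rewrite -E2.
Qed.

Lemma pihomogM_hom d e (F G : S) : F \is d.-homog ->
  pihomog mdeg e (F * G) = if (d <= e)%N then F * pihomog mdeg (e - d) G else 0.
Proof.
move=> hF; rewrite {1}(pihomog_partitionE (leqnn (msize G))) mulr_sumr pihomog_sum.
have E (i : nat) : pihomog mdeg e (F * pihomog mdeg i G) =
    if (d + i)%N == e then F * pihomog mdeg i G else 0.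
  by rewrite (pihomog_component _ (dhomogM hF (pihomogP mdeg i G))) eq_sym.
under eq_bigr => i _ do rewrite E.
case: leqP => le; last first.
  by rewrite big1 // => i _; rewrite gtn_eqF // (leq_trans le) // leq_addr.
have [lt|ge] := ltnP (e - d) (msize G).
  rewrite (bigD1 (Ordinal lt)) //= subnKC // eqxx big1 ?addr0 // => i ii.
  case: eqP => // Ei; case/eqP: ii; apply: val_inj => /=; by rewrite -Ei addKn.
rewrite big1 => [|i _].
  rewrite pihomogE big_seq_cond big1 ?mulr0 // => m /andP[mG /eqP Em].
  by have := msize_mdeg_lt mG; rewrite Em ltnNge ge.
case: eqP => // Ei; have := ltn_ord i; rewrite -(addKn d i) Ei ltnNge => /negP[]; exact: ge.
Qed.

Lemma ideal_hpart (Q : S -> Prop) : ideal Q -> ideal (hpart Q).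
Proof.
move=> iQ; have [Q0 QD QM] := iQ; split=> [d|F G hF hG d|F G hG d].
- by rewrite pihomog0.
- by rewrite pihomogD; apply: QD.
- rewrite (pihomog_partitionE (leqnn (msize F))) mulr_suml pihomog_sum.
  apply: ideal_sum => // i _; rewrite (pihomogM_hom _ _ (pihomogP mdeg i F)).
  by case: ifP => // _; apply: QM.
Qed.

Lemma hpart_sub (Q : S -> Prop) F : ideal Q -> hpart Q F -> Q F.
Proof.
by move=> iQ h; rewrite (pihomog_partitionE (leqnn (msize F))); apply: ideal_sum.
Qed.

Lemma hpart_homog (Q : S -> Prop) d F : ideal Q -> F \is d.-homog -> Q F -> hpart Q F.
Proof.
move=> [Q0 _ _] hF QF e; rewrite (pihomog_component e hF); by case: eqP.
Qed.

(** Take the components of [F] and [G] of highest degree outside [Q]. Modulo [Q] their product is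
    the component of [F * G] in the sum of the two degrees. *)
Lemma hpart_prime (Q : S -> Prop) : ideal Q -> (forall F G, Q (F * G) -> Q F \/ Q G) ->
  forall F G, hpart Q (F * G) -> hpart Q F \/ hpart Q G.
Proof.
move=> iQ pQ F G hFG; have [Q0 QD QM] := iQ; apply: NNPP => /not_or_and[nF nG].
have top H : ~ hpart Q H -> exists a, ~ Q (pihomog mdeg a H) /\
    forall i, (a < i)%N -> Q (pihomog mdeg i H).
  move=> nH; apply: NNPP => no; apply: nH.
  suff main m i : (msize H <= i + m)%N -> Q (pihomog mdeg i H).
    by move=> i; apply: (main (msize H)); rewrite leq_addl.
  elim: m i => [|m IH] i le.
    rewrite pihomogE big_seq_cond big1 // => M /andP[mH /eqP E].
    by have := msize_mdeg_lt mH; rewrite E ltnNge -[i]addn0 le.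
  apply: NNPP => nQ; apply: no; exists i; split=> // j lt; apply: IH.
  by apply: (leq_trans le); rewrite addnS -addSn leq_add2r.
have [a [na Ha]] := top F nF; have [c [nc Hc]] := top G nG.
have := hFG (a + c)%N.
rewrite {1}(pihomog_partitionE (leqnn (msize F))) mulr_suml pihomog_sum.
have lta : (a < msize F)%N.
  rewrite ltnNge; apply/negP => le; apply: na.
  rewrite pihomogE big_seq_cond big1 // => M /andP[mF /eqP E].
  by have := msize_mdeg_lt mF; rewrite E ltnNge le.
rewrite (bigD1 (Ordinal lta)) //= (pihomogM_hom _ _ (pihomogP mdeg a F)) leq_addr addKn.
set rest := \sum_(i < _ | _) _ => h.
have Qrest : Q rest.
  apply: ideal_sum => // i ia; rewrite (pihomogM_hom _ _ (pihomogP mdeg i F)).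
  case: leqP => // le; case: (ltngtP i a) => [lt|gt|E].
  - by apply: QM; apply: Hc; move: lt le; lia.
  - by rewrite mulrC; apply: QM; apply: Ha.
  - by case/eqP: ia; apply: val_inj.
have : Q (pihomog mdeg a F * pihomog mdeg c G).
  rewrite -[X in Q X](addrK rest) -mulN1r; apply: QD => //; exact: QM.
by case/pQ.
Qed.
End HomogPart.

Definition pr (T : Type) (P : T -> Prop) : {pred T} :=
  fun x => if excluded_middle_informative (P x) then true else false.

Lemma prP (T : Type) (P : T -> Prop) x : reflect (P x) (x \in pr P).
Proof. by rewrite unfold_in /pr; case: excluded_middle_informative => h; constructor. Qed.

Section ConeDim.
Variables (k : closedFieldType) (n : nat) (Y : cone k n).
Local Notation S := {mpoly k[n.+1]}.
Local Notation "'π' F" := (@cproj k n Y F) (at level 8, F at level 2).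

Definition hprime (Q : S -> Prop) : Prop :=
  [/\ ideal Q, ~ Q 1, forall F G, Q (F * G) -> Q F \/ Q G,
      forall d F, Q F -> Q (pihomog mdeg d F) & forall F, π F = 0 -> Q F].

Lemma hprime_closed Q : hprime Q -> [/\ idealr_closed (pr Q), prime_idealr_closed (pr Q),
  homogeneous_ideal (pr Q) & forall F, π F = 0 -> F \in pr Q].
Proof.
move=> [[Q0 QD QM] Q1 Qp Qh Qk]; split.
- split; first exact/prP.
    by apply/prP.
  by move=> a u v /prP Qu /prP Qv; apply/prP/QD => //; apply: QM.
- by move=> u v /prP/Qp[h|h]; apply/orP; [left|right]; apply/prP.
- by move=> d F /prP/Qh h; apply/prP.
- by move=> F /Qk h; apply/prP.
Qed.

Definition reg_mod (J : S -> Prop) (F : S) := forall G, J (F * G) -> J G.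

Definition gen_ideal (Fs : seq S) (G : S) : Prop :=
  exists w : nat -> S, π G = π (\sum_(j < size Fs) nth 0 Fs j * w j).

Lemma ideal_gen Fs : ideal (gen_ideal Fs).
Proof.
split.
- by exists (fun=> 0); rewrite big1 // => j _; rewrite mulr0.
- move=> F G [w Ew] [w' Ew']; exists (fun j => w j + w' j).
  by rewrite piD Ew Ew' -piD -big_split; congr (cproj Y _); apply: eq_bigr => j _; rewrite mulrDr.
- move=> a F [w Ew]; exists (fun j => a * w j).
  by rewrite piM Ew -piM mulr_sumr; congr (cproj Y _); apply: eq_bigr => j _; rewrite mulrCA.
Qed.

Lemma gen_in Fs j : (j < size Fs)%N -> gen_ideal Fs (nth 0 Fs j).
Proof.
move=> lt; exists (fun i => if i == j then 1 else 0).
rewrite (bigD1 (Ordinal lt)) //= eqxx mulr1 big1 ?addr0 // => i ij.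
by case: eqP => [E|_]; rewrite ?mulr0 //; case/eqP: ij; apply: val_inj.
Qed.

Lemma gen_ker Fs F : π F = 0 -> gen_ideal Fs F.
Proof. by move=> h; exists (fun=> 0); rewrite h big1 ?pi0 // => j _; rewrite mulr0. Qed.

Lemma gen_min Fs (Q : S -> Prop) : ideal Q -> (forall F, π F = 0 -> Q F) ->
  (forall j, (j < size Fs)%N -> Q (nth 0 Fs j)) -> forall F, gen_ideal Fs F -> Q F.
Proof.
move=> iQ kQ gQ F [w E]; have [_ QD QM] := iQ.
set G := \sum_(j < _) _ in E; rewrite -[F](subrK G); apply: QD.
  by apply: kQ; rewrite piB E subrr.
by apply: ideal_sum => // j _; rewrite mulrC; apply: QM; apply: gQ.
Qed.

(** A prime avoiding all [F^m H] with [H] outside [P] lies in [P] and misses [F]. By regularity of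
    [F] the ideal of [Fs] avoids these products, so [krull_avoid] applies; it takes the place of
    localizing at [P]. Passing to [hpart] restores homogeneity. *)
Lemma hprime_below Fs F P : (forall j, (j < size Fs)%N -> exists d, nth 0 Fs j \is d.-homog) ->
  hprime P -> (forall j, (j < size Fs)%N -> P (nth 0 Fs j)) -> P F ->
  reg_mod (gen_ideal Fs) F ->
  exists Q, [/\ hprime Q, forall G, Q G -> P G, exists2 G, P G & ~ Q G &
    forall j, (j < size Fs)%N -> Q (nth 0 Fs j)].
Proof.
move=> hFs [iP P1 pP hP kP] FsP PF RF; have [P0 PD PM] := iP.
have iG := ideal_gen Fs.
pose T (G : S) := exists m H, ~ P H /\ G = F ^+ m * H.
have T1 : T 1 by exists 0%N, 1; rewrite expr0 mul1r.
have [|G JG TG|Q [iQ JQ QT pQ]] := @krull_avoid _ _ T iG T1.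
- move=> G G' [m [H [nH ->]]] [m' [H' [nH' ->]]].
  exists (m + m')%N, (H * H'); split; first by case/pP.
  by rewrite exprD mulrACA.
- case: TG => m [H [nH EG]]; have : gen_ideal Fs H.
    have : gen_ideal Fs (F ^+ m * H) by rewrite -EG.
    by elim: m {EG} => [|m IH]; rewrite ?expr0 ?mul1r // exprS -mulrA => /RF.
  by move/(gen_min iP kP FsP).
have iH := ideal_hpart iQ.
have QP G : Q G -> P G.
  by move=> QG; apply: NNPP => nP; apply: (QT G) => //; exists 0%N, G; rewrite expr0 mul1r.
have kQ G : π G = 0 -> hpart Q G by move=> h d; apply/JQ/gen_ker/cone_homog.
exists (hpart Q); split.
- split=> //.
  + by move/(hpart_sub iQ)/QP.
  + exact: hpart_prime.
  + by move=> d G hG e; rewrite (pihomog_component e (pihomogP mdeg d G)); case: eqP => // _; case: iQ.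
- by move=> G /(hpart_sub iQ)/QP.
- exists F => // /(hpart_sub iQ) QF; apply: (QT F) => //.
  by exists 1%N, 1; rewrite expr1 mulr1.
- by move=> j lt; have [d hd] := hFs j lt; apply: (hpart_homog iQ hd); apply/JQ/gen_in.
Qed.

Definition hchain (P : S -> Prop) (c : nat) : Prop := exists Q : nat -> S -> Prop,
  [/\ forall i, (i <= c)%N -> hprime (Q i), Q c = P &
      forall i, (i < c)%N -> (forall F, Q i F -> Q i.+1 F) /\ exists2 F, Q i.+1 F & ~ Q i F].

Lemma hchain_rcons P P' c : hchain P c -> hprime P' -> (forall F, P F -> P' F) ->
  (exists2 F, P' F & ~ P F) -> hchain P' c.+1.
Proof.
move=> [Q [HQ EQ Hi]] hP' sub ne.
exists (fun i => if (i <= c)%N then Q i else P'); split.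
- by move=> i _; case: leqP => // le; apply: HQ.
- by rewrite ltnn.
- move=> i; rewrite ltnS => le; rewrite le; case: (ltnP i c) => lt; first exact: Hi.
  have -> : i = c by apply/eqP; rewrite eqn_leq le lt.
  by rewrite EQ.
Qed.

Lemma hchain_regular Fs P : (forall F, F \in Fs -> exists d, F \is d.-homog) ->
  hprime P -> (forall F, F \in Fs -> P F) ->
  (forall i, (i < size Fs)%N -> reg_mod (gen_ideal (take i Fs)) (nth 0 Fs i)) ->
  hchain P (size Fs).
Proof.
elim/last_ind: Fs P => [|Fs F IH] P hFs hP FsP R.
  by exists (fun=> P); split.
have lenF j : (j < size Fs)%N -> nth 0 Fs j \in Fs by move=> lt; apply: mem_nth.
have [|//||||Q [hQ QP ne QF]] := @hprime_below Fs F P.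
- by move=> j /lenF h; apply: hFs; rewrite mem_rcons inE h orbT.
- by move=> j /lenF h; apply: FsP; rewrite mem_rcons inE h orbT.
- by apply: FsP; rewrite mem_rcons inE eqxx.
- by have := R (size Fs); rewrite size_rcons ltnSn nth_rcons ltnn eqxx -cats1 take_size_cat //; apply.
rewrite size_rcons; apply: (hchain_rcons _ hP QP ne); apply: IH => //.
- by move=> G h; apply: hFs; rewrite mem_rcons inE h orbT.
- by move=> G /(nthP 0)[j lt <-]; apply: QF.
- move=> i lt; have := R i; rewrite size_rcons ltnS (ltnW lt) => /(_ isT).
  by rewrite nth_rcons lt -cats1 takel_cat // ltnW.
Qed.

(** All components have to vanish, so this is the ideal of the line through [p] and not the maximal
    ideal of a point of the affine cone. *)
Definition point_ideal (p : 'I_n.+1 -> k) (F : S) : Prop := forall d, (pihomog mdeg d F).@[p] = 0.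

Lemma hprime_point p : onv Y p -> hprime (point_ideal p) /\ exists i, ~ point_ideal p 'X_i.
Proof.
move=> hp; have [[i pi] kp] := hp.
pose Z (F : S) := F.@[p] = 0.
have iZ : ideal Z.
  split; [by rewrite /Z meval0|move=> x y; rewrite /Z mevalD|move=> a x; rewrite /Z mevalM].
    by move=> -> ->; rewrite addr0.
  by move=> ->; rewrite mulr0.
have pZ F G : Z (F * G) -> Z F \/ Z G.
  by rewrite /Z mevalM => /eqP; rewrite mulf_eq0 => /orP[] /eqP; [left|right].
have hX : ('X_i : S) \is 1.-homog by rewrite dhomogX /= mdeg1.
split; last first.
  exists i => /(_ 1%N); rewrite (pihomog_component _ hX) mevalXU => h.
  by rewrite h eqxx in pi.
split.
- exact: (ideal_hpart iZ).
- move/(hpart_sub iZ); rewrite /Z meval1 => /eqP; by rewrite oner_eq0.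
- exact: (hpart_prime iZ pZ).
- by move=> d G hG e; rewrite (pihomog_component e (pihomogP mdeg d G)); case: eqP => // _; rewrite meval0.
- by move=> F h d; apply: kp; apply: cone_homog.
Qed.

Definition irrelevant (F : S) : Prop := pihomog mdeg 0 F = 0.

Lemma hprime_irrelevant : hprime irrelevant.
Proof.
have cE (F : S) : irrelevant F <-> F@_0%MM = 0.
  rewrite /irrelevant; split=> [h|h].
    by have := congr1 (fun G : S => G@_0%MM) h; rewrite coeff_pihomog mdeg0 eqxx mcoeff0.
  apply/mpolyP => m; rewrite coeff_pihomog mcoeff0; case: eqP => // /eqP.
  by rewrite mdeg_eq0 => /eqP ->.
have cM (F G : S) : (F * G)@_0%MM = F@_0%MM * G@_0%MM by exact: (rmorphM (@mcoeff _ _ 0%MM)).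
split=> //.
- split; first by apply/cE; rewrite mcoeff0.
    by move=> x y /cE hx /cE hy; apply/cE; rewrite mcoeffD hx hy addr0.
  by move=> a x /cE h; apply/cE; rewrite cM h mulr0.
- by move/cE => /eqP; rewrite mcoeff1 eqxx oner_eq0.
- move=> F G /cE; rewrite cM => /eqP; rewrite mulf_eq0.
  by case/orP => /eqP h; [left|right]; apply/cE.
- move=> d F h; rewrite /irrelevant (pihomog_component 0 (pihomogP mdeg d F)).
  by case: eqP => // <-.
- move=> F h; have h0 := cone_homog 0 h; apply/cE.
  have E : pihomog mdeg 0 F = (F@_0%MM)%:MP.
    apply/mpolyP => m; rewrite coeff_pihomog mcoeffC.
    by rewrite mdeg_eq0 eq_sym; case: eqP => [<-|_]; rewrite ?mulr1 ?mulr0.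
  by apply/eqP; rewrite -(scal_eq0 Y) /scal -E h0.
Qed.

End ConeDim.

Lemma prime_chain_le (R : comNzRingType) (Q : {pred R} -> Prop) (J : R -> Prop) e e' :
  (e <= e')%N -> prime_chain Q J e' -> prime_chain Q J e.
Proof.
move=> le [P [H1 H2]]; exists P; split=> i hi.
  by apply: H1; apply: leq_trans le.
by apply: H2; apply: leq_trans le.
Qed.

Lemma max_prime_chain_unique (R : comNzRingType) (Q : {pred R} -> Prop) (J : R -> Prop) e e' :
  max_prime_chain Q J e -> max_prime_chain Q J e' -> e = e'.
Proof.
case=> H N [H' N']; have [lt|lt|//] := ltngtP e e'.
  by have := prime_chain_le lt H'; move/N.
by have := prime_chain_le lt H; move/N'.
Qed.

Lemma ord3P (i : 'I_3) : i = ord0 \/ i = lift ord0 ord0 \/ i = ord_max.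
Proof.
by case: i => -[|[|[|//]]] lt; [left|right; left|right; right]; apply: val_inj.
Qed.

Section ConeDim2.
Variables (k : closedFieldType) (n : nat) (Y : cone k n).
Local Notation S := {mpoly k[n.+1]}.
Local Notation "'π' F" := (@cproj k n Y F) (at level 8, F at level 2).
Let ker (F : S) : Prop := π F = 0.
Definition relevant_chain := prime_chain
  (fun P : {pred S} => homogeneous_ideal P /\ relevant P) (fun F : S => π F = 0).
Let all_chain := prime_chain (fun P : {pred S} => True) (fun F : S => π F = 0).

Lemma hchain_relevant P c : hchain Y P c -> (exists i, ~ P 'X_i) -> relevant_chain c.
Proof.
move=> [Q [HQ EQ Hi]] [i0 ni]; exists (fun i => pr (Q i)); split=> i hi.
  have [h1 h2 h3 h4] := hprime_closed (HQ i hi); split=> //; split=> //.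
  exists i0; apply/prP => h; apply: ni; rewrite -EQ.
  have : forall j, (i + j <= c)%N -> Q (i + j)%N 'X_i0.
    elim=> [|j IH] le; first by rewrite addn0.
    by rewrite addnS; apply: (Hi _ _).1; [rewrite addnS in le|apply: IH; rewrite addnS in le; apply: ltnW].
  by move/(_ (c - i)%N); rewrite subnKC // => /(_ (leqnn _)).
have [h1 [F h2 h3]] := Hi i hi; split; first by move=> G /prP h; apply/prP; apply: h1.
by exists F; [apply/prP|apply/prP].
Qed.

Lemma pihomog0C (F : S) : pihomog mdeg 0 F = (F@_0%MM)%:MP.
Proof.
apply/mpolyP => m; rewrite coeff_pihomog mcoeffC.
by rewrite mdeg_eq0 eq_sym; case: eqP => [<-|_]; rewrite ?mulr1 ?mulr0.
Qed.

(** The irrelevant ideal is added at the end: elements of a proper homogeneous ideal have no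
    constant term, and a relevant ideal misses some variable. *)
Lemma relevant_chain_irrelevant e : relevant_chain e -> all_chain e.+1.
Proof.
move=> [P [H1 H2]]; have [i1 i2 _ i4] := hprime_closed (hprime_irrelevant Y).
exists (fun i => if (i <= e)%N then P i else pr (@irrelevant k n)); split=> i.
  by move=> _; case: leqP => hi; [have [] := H1 i hi|].
rewrite ltnS => hi; rewrite hi; case: (ltnP i e) => lt; first exact: H2.
have -> : i = e by apply/eqP; rewrite eqn_leq hi lt.
have [[P0 P1 PD] _ [Ph [j nj]] _] := H1 e (leqnn e); split.
  move=> F FP; apply/prP; rewrite /irrelevant; have := Ph 0%N F FP; rewrite pihomog0C.
  have [->|nz] := eqVneq F@_0%MM 0; first by rewrite mpolyC0.
  move=> h; case/negP: P1; have := PD ((F@_0%MM)^-1)%:MP _ 0 h P0.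
  by rewrite addr0 -mpolyCM mulVf.
exists 'X_j => //; apply/prP; rewrite /irrelevant (pihomog_component 0 (dhomogXi k j)) //.
Qed.

Lemma point_chain Fs p : (forall F, F \in Fs -> exists2 d, (0 < d)%N & F \is d.-homog) ->
  (forall i, (i < size Fs)%N -> reg_mod (gen_ideal Y (take i Fs)) (nth 0 Fs i)) ->
  onv Y p -> (forall F, F \in Fs -> F.@[p] = 0) -> relevant_chain (size Fs).
Proof.
move=> hFs R hp Fp; have [hP ri] := hprime_point hp.
apply: (hchain_relevant (P := point_ideal p)) => //; apply: hchain_regular => //.
  by move=> F /hFs[d _ hd]; exists d.
by move=> F FF d; have [e _ he] := hFs F FF; rewrite (pihomog_component d he); case: eqP => _; rewrite ?meval0 // Fp.
Qed.

(** The length is the Krull dimension of the affine cone by hypothesis. A common zero on the variety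
    would give a relevant chain of that length, one longer with the irrelevant ideal. If the length
    exceeded 3, then either the first three elements have a common zero, which gives a relevant
    chain of length 3, or their ideal contains a power of the fourth, against its regularity. *)
Lemma cm_length Fs : (forall F, F \in Fs -> exists2 d, (0 < d)%N & F \is d.-homog) ->
  (forall i, (i < size Fs)%N -> reg_mod (gen_ideal Y (take i Fs)) (nth 0 Fs i)) ->
  ~ gen_ideal Y Fs 1 -> relevant_chain 2 -> ~ relevant_chain 3 ->
  all_chain (size Fs) -> ~ all_chain (size Fs).+1 ->
  size Fs = 3%N /\ forall p, onv Y p -> exists2 F, F \in Fs & F.@[p] != 0.
Proof.
move=> hFs R n1 r2 r3 a1 a2.
have empty p : onv Y p -> exists2 F, F \in Fs & F.@[p] != 0.
  move=> hp; apply: NNPP => no; apply: a2; apply: relevant_chain_irrelevant.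
  apply: (point_chain hFs R hp) => F FF; apply/eqP; apply: contra_notT no => nz.
  by exists F.
split=> //; have := relevant_chain_irrelevant r2 => a3.
have le3 : (3 <= size Fs)%N.
  by rewrite leqNgt; apply/negP => lt; exact: a2 (prime_chain_le lt a3).
apply/eqP; rewrite eqn_leq le3 andbT leqNgt; apply/negP => lt4.
have [d pd hd] := hFs _ (mem_nth 0 lt4).
have takeF F : F \in take 3 Fs -> F \in Fs by exact: mem_take.
case: (classic (exists2 p, onv Y p & forall F, F \in take 3 Fs -> F.@[p] = 0)).
  move=> [p hp Fp]; apply: r3; have sz : size (take 3 Fs) = 3%N by rewrite size_takel.
  rewrite -sz.
  apply: (point_chain _ _ hp) => // [F /takeF/hFs //|i].
  rewrite size_takel // => lt; rewrite nth_take // take_takel ?(ltnW lt) //.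
  by apply: R; apply: ltn_trans lt4.
move=> no; have [p hp|N hN] := projective_nullstellensatz (ideal_gen Y (take 3 Fs)) (@gen_ker _ _ Y _).
  apply: NNPP => nH; apply: no; exists p => // F FF; apply/eqP; apply: contra_notT nH => nz.
  exists F => //; have [j lt <-] := nthP 0 FF; exact: gen_in.
have R3 := R 3 lt4.
have : gen_ideal Y (take 3 Fs) (nth 0 Fs 3 ^+ N * 1).
  rewrite mulr1; apply: (hN (d * N)%N); first by rewrite leq_pmull.
  exact: dhomogMn.
have : ~ gen_ideal Y (take 3 Fs) 1.
  move/(gen_min (ideal_gen Y Fs) (@gen_ker _ _ Y Fs)) => h; apply: n1; apply: h => j.
  by rewrite size_takel // => lt; rewrite nth_take //; apply/gen_in/(ltn_trans lt).
elim: N {hN} => [|N IH] nn; rewrite ?expr0 ?mul1r // exprS -mulrA => /R3; exact: IH.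
Qed.

Lemma homogenize (T : finType) t (F : S) (f w : T -> S) (d : T -> nat) : F \is t.-homog ->
  (forall j, f j \is (d j).-homog) -> π F = π (\sum_j f j * w j) ->
  π F = π (\sum_j (if (d j <= t)%N then f j * pihomog mdeg (t - d j) (w j) else 0)).
Proof.
move=> hF hf E; have E0 : π (F - \sum_j f j * w j) = 0 by rewrite piB E subrr.
have := cone_homog t E0; rewrite pihomogB (pihomog_component t hF) eqxx pihomog_sum piB => /eqP.
rewrite subr_eq0 => /eqP ->; congr (cproj Y _); apply: eq_bigr => j _.
by rewrite (pihomogM_hom _ _ (hf j)).
Qed.

Lemma exists_point : exists p, onv Y p.
Proof.
apply: NNPP => no; have [i ni] := cone_rel Y.
have iK : ideal ker.
  split; [by rewrite /ker pi0|move=> x y; rewrite /ker piD|move=> a x; rewrite /ker piM].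
    by move=> -> ->; rewrite addr0.
  by move=> ->; rewrite mulr0.
have [//|p hp|N hN] := projective_nullstellensatz (Y := Y) iK; first by case: no; exists p.
have := hN N ('X_i ^+ N) (leqnn _); have := dhomogMn N (dhomogXi k i).
rewrite mul1n => -> /(_ isT); rewrite /ker piX => /eqP; rewrite expf_eq0 (negPf ni) andbF //.
Qed.

Section Growth.
Variables (F : 'I_3 -> S) (d : 'I_3 -> nat).
Hypotheses (hF : forall i, F i \is (d i).-homog) (pd : forall i, (0 < d i)%N).
Hypothesis empty : forall p, onv Y p -> exists i, (F i).@[p] != 0.

Lemma generated : exists N, forall t G, (N <= t)%N -> G \is t.-homog ->
  exists2 w : 'I_3 -> S, forall i, if (d i <= t)%N then is_true (w i \is (t - d i).-homog) else w i = 0 &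
  π G = π (\sum_i F i * w i).
Proof.
pose J G := exists w : 'I_3 -> S, π G = π (\sum_i F i * w i).
have iJ : ideal J.
  split.
  - by exists (fun=> 0); rewrite big1 // => j _; rewrite mulr0.
  - move=> G H [w Ew] [w' Ew']; exists (fun j => w j + w' j).
    by rewrite piD Ew Ew' -piD -big_split; congr (cproj Y _); apply: eq_bigr => j _; rewrite mulrDr.
  - move=> a G [w Ew]; exists (fun j => a * w j).
    by rewrite piM Ew -piM mulr_sumr; congr (cproj Y _); apply: eq_bigr => j _; rewrite mulrCA.
have [G h|p hp|N hN] := projective_nullstellensatz (Y := Y) iJ.
- by exists (fun=> 0); rewrite h big1 ?pi0 // => j _; rewrite mulr0.
- have [i ni] := empty hp; exists (F i) => //; exists (fun j => if j == i then 1 else 0).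
  rewrite (bigD1 i) //= eqxx mulr1 big1 ?addr0 // => j /negPf ->; exact: mulr0.
exists N => t G le hG; have [w Ew] := hN t G le hG.
exists (fun i => if (d i <= t)%N then pihomog mdeg (t - d i) (w i) else 0).
  by move=> i; case: (d i <= t)%N => //; apply: pihomogP.
rewrite (homogenize hG hF Ew); congr (cproj Y _); apply: eq_bigr => i _.
by case: ifP => // _; rewrite mulr0.
Qed.

(** The ring is spanned over [k[F_0, F_1, F_2]] by the monomials of degree below [N]. In a product
    of degree [t] the first two exponents are at most [t], and the degree determines the third. *)
Lemma growth : exists C, forall t, exists m (g : 'I_m -> kmod Y^o), (m <= C * t.+1 ^ 2)%N /\
  forall a, inAt t a -> spanned g a.
Proof.
have [N hN] := generated; pose B := 'X_{1.. n.+1 < N}.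
exists #|{: B}| => t.
(* Membership in the span of these products, phrased as membership in every subspace that contains
   them, so that no coefficients have to be carried along. *)
pose U t (a : Y) := forall W : kmod Y^o -> Prop, subsp W ->
  (forall a0 a1 a2 (m : B), (a0 * d ord0 + a1 * d (lift ord0 ord0) + a2 * d ord_max + mdeg m = t)%N ->
     W (π (F ord0) ^+ a0 * π (F (lift ord0 ord0)) ^+ a1 * π (F ord_max) ^+ a2 * π 'X_[m])) -> W a.
have UZ e c x : U e x -> U e (scal Y c * x).
  by move=> h W sW hW; apply: (subspZ c sW); apply: h.
have UD e x y : U e x -> U e y -> U e (x + y).
  by move=> h h' W sW hW; apply: (subspD sW); [apply: h|apply: h'].
have U0 e : U e 0 by move=> W [].
have UF i e x : U e x -> U (d i + e)%N (π (F i) * x).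
  move=> h W sW hW; pose W' (y : kmod Y^o) := W (π (F i) * y).
  apply: (h W').
    split; rewrite /W' ?mulr0; first by case: sW.
    move=> c u v hu hv; have [_ /(_ c _ _ hu hv)] := sW.
    by rewrite !kscaleE mulrDr /GRing.scale /= mulrCA.
  move=> a0 a1 a2 m E; rewrite /W'.
  have [Ei|[Ei|Ei]] : i = ord0 \/ i = lift ord0 ord0 \/ i = ord_max.
    exact: ord3P.
  - rewrite Ei (_ : _ * _ = π (F ord0) ^+ a0.+1 * π (F (lift ord0 ord0)) ^+ a1 * π (F ord_max) ^+ a2 * π 'X_[m]).
      by apply: hW; rewrite mulSn -E Ei; lia.
    by rewrite exprS; ring.
  - rewrite Ei (_ : _ * _ = π (F ord0) ^+ a0 * π (F (lift ord0 ord0)) ^+ a1.+1 * π (F ord_max) ^+ a2 * π 'X_[m]).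
      by apply: hW; rewrite mulSn -E Ei; lia.
    by rewrite exprS; ring.
  - rewrite Ei (_ : _ * _ = π (F ord0) ^+ a0 * π (F (lift ord0 ord0)) ^+ a1 * π (F ord_max) ^+ a2.+1 * π 'X_[m]).
      by apply: hW; rewrite mulSn -E Ei; lia.
    by rewrite exprS; ring.
have main e a : inAt e a -> U e a.
  elim/ltn_ind: e a => e IH a [G hG ->].
  case: (ltnP e N) => le.
    rewrite [G]mpolyE pi_sum big_seq; elim/big_rec: _ => [|m x mG Ux]; first exact: U0.
    apply: UD => //; rewrite piZ; apply: UZ => W sW hW.
    have dm : mdeg m = e by exact: (dhomog_mf hG mG).
    have lt : (mdeg m < N)%N by rewrite dm.
    have := hW 0 0 0 (BMultinom lt); rewrite !expr0 !mul1r !mul0n !add0n; exact.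
  have [w hw ->] := hN e G le hG; rewrite pi_sum.
  elim/big_rec: _ => [|i x _ Ux]; first exact: U0.
  apply: UD => //; rewrite piM; have := hw i; case: leqP => lei h; last by rewrite h pi0 mulr0.
  rewrite -(subnKC lei); apply: UF; apply: IH; last exact: inAt_pi.
  by rewrite ltn_subrL pd; apply: leq_trans lei.
pose T := ('I_t.+1 * 'I_t.+1 * B)%type.
pose h (i : T) : kmod Y^o := let: (a0, a1, m) := i in
  π (F ord0) ^+ a0 * π (F (lift ord0 ord0)) ^+ a1 *
  π (F ord_max) ^+ ((t - (a0 * d ord0 + a1 * d (lift ord0 ord0) + mdeg m)) %/ d ord_max) * π 'X_[m].
exists #|{: T}|, (fun i => h (enum_val i)); split.
  by rewrite !card_prod !card_ord mulnC mulnn.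
move=> a /main; apply.
  split; first by exists (fun=> 0); rewrite big1 // => i _; rewrite scale0r.
  move=> c u v [cu ->] [cv ->]; exists (fun i => c * cu i + cv i).
  rewrite scaler_sumr -big_split; apply: eq_bigr => i _; by rewrite scalerDl scalerA.
move=> a0 a1 a2 m E.
have lt0 : (a0 < t.+1)%N by have := pd ord0; rewrite ltnS -E; nia.
have lt1 : (a1 < t.+1)%N by have := pd (lift ord0 ord0); rewrite ltnS -E; nia.
pose i0 : T := (Ordinal lt0, Ordinal lt1, m).
exists (fun i => if i == enum_rank i0 then 1 else 0).
rewrite (bigD1 (enum_rank i0)) //= eqxx big1 ?addr0 => [|i /negPf ->]; last by rewrite scale0r.
rewrite enum_rankK scale1r /=; congr (_ * _ ^+ _ * _).
rewrite (_ : (t - _)%N = (a2 * d ord_max)%N) ?mulnK //; move: E; lia.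
Qed.
End Growth.
End ConeDim2.

Lemma binom_growth C q : exists2 t, (0 < t)%N & (C * t.+1 ^ 2 < 'C(t + q.+3, q.+3))%N.
Proof.
(* [6 * 'C(t + 3, 3)] is at least the cube of [t + 1], which exceeds [6 * C] times its square for
   this [t]. *)
exists (6 * C).+1 => //; set t := (6 * C).+1.
have le : ('C(t + 3, 3) <= 'C(t + q.+3, q.+3))%N.
  by elim: q => // q IH; rewrite (addnS t q.+3) binS; apply: (leq_trans IH); exact: leq_addl.
apply: leq_trans le; have := bin_ffact (t + 3) 3.
rewrite !ffactnS ffactn0 !addn3 /= => E; have E3 : 3`! = 6%N by [].
rewrite E3 in E.
move: E; rewrite /t; nia.
Qed.

(** * Linear systems of parameters *)

Section LinearForms.
Variables (k : closedFieldType) (n : nat) (Y : cone k n).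
Local Notation S := {mpoly k[n.+1]}.
Local Notation "'π' F" := (@cproj k n Y F) (at level 8, F at level 2).

Lemma subst_eval q (y : 'I_q -> S) (G : {mpoly k[q]}) p :
  (subst_forms y G).@[p] = G.@[fun i => (y i).@[p]].
Proof.
pose f : {rmorphism _ -> _} := meval p \o mmap (@mpolyC n.+1 k) y.
apply: (mpoly_rmorph_ext (f := f) (g := meval (fun i => (y i).@[p]))) => [c|i] /=.
  by rewrite mmapC !mevalC.
by rewrite mmapX mmap1U mevalXU.
Qed.

Hypothesis growthA : exists C, forall t, exists m (g : 'I_m -> kmod Y^o), (m <= C * t.+1 ^ 2)%N /\
  forall a, inAt t a -> spanned g a.
Let empty q (y : 'I_q -> S) := forall p, onv Y p -> exists i, (y i).@[p] != 0.

(** In four or more variables there are more monomials of some degree [t] than the quadratic bound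
    on the ring allows. *)
Lemma relation_exists q (y : 'I_q.+4 -> S) : (forall i, y i \is 1.-homog) ->
  exists t (G : {mpoly k[q.+4]}), [/\ (0 < t)%N, G \is t.-homog, G != 0 & rho Y y G = 0].
Proof.
move=> hy; have [C hC] := growthA; have [t t0 lt] := binom_growth C q.
have [m [g [le sp]]] := hC t; exists t; apply: NNPP => no.
have [b [hb _ fb]] := fdim_homog k q.+3 t.
suff h : ('C(t + q.+3, q.+3) <= m)%N by move: (leq_trans h le); rewrite leqNgt lt.
apply: (@steinitz k (kmod Y^o) _ _ (fun i => rho Y y (b i)) g) => [c E i|i]; last first.
  by apply: sp; apply: rho_inAt.
  have hG : \sum_i c i *: b i \is t.-homog by apply: rpred_sum => j _; apply: rpredZ.
  have : rho Y y (\sum_i c i *: b i) = 0.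
    rewrite rho_sum -[RHS]E; apply: eq_bigr => j _.
    by rewrite -mul_mpolyC rhoM rhoC.
  have [/fb //|nz E0] := eqVneq (\sum_i c i *: b i) 0.
  by case: no; exists (\sum_i c i *: b i); split.
Qed.

(** Projection from a point [c] outside the zeros of the relation [G]: the new forms vanish together
    only where the [y i] are proportional to [c], and there [G] forces all of them to be 0. *)
Lemma reduce_forms q (y : 'I_q.+4 -> S) : (forall i, y i \is 1.-homog) -> empty y ->
  exists2 y' : 'I_q.+3 -> S, forall i, y' i \is 1.-homog & empty y'.
Proof.
move=> hy ey; have [t [G [t0 hG nG EG]]] := relation_exists hy.
have [c nc] := mpoly_nonroot nG.
have [j nj] : exists j, c j != 0.
  apply: NNPP => no; have := dhomog_eval c 0 hG.
  rewrite expr0n gtn_eqF // mul0r => E; case/eqP: nc; rewrite -[RHS]E; apply: meval_eq => j.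
  by rewrite mul0r; apply/eqP; apply: contra_notT no => nz; exists j.
exists (fun i => c j *: y (lift j i) - c (lift j i) *: y j).
  by move=> i; apply: rpredB; apply: rpredZ.
move=> p hp; apply: NNPP => no.
have z i : c j * (y i).@[p] = c i * (y j).@[p].
  case: (unliftP j i) => [i'|] -> //; apply/eqP; rewrite -subr_eq0; apply: contra_notT no => nz.
  by exists i'; rewrite mevalB !mevalZ.
pose la := (y j).@[p] / c j.
have zz i : (y i).@[p] = la * c i.
  by apply: (mulfI nj); rewrite z /la mulrCA mulrA mulfVK // mulrC.
have [_ hp2] := hp; have := hp2 _ EG; rewrite subst_eval.
have -> : G.@[fun i => (y i).@[p]] = G.@[fun i => la * c i] by apply: meval_eq.
rewrite (dhomog_eval _ _ hG).
move/eqP; rewrite mulf_eq0 (negPf nc) orbF expf_eq0 => /andP[_ /eqP l0].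
by have [i] := ey p hp; rewrite zz l0 mul0r eqxx.
Qed.

Lemma three_forms : exists l : 'I_3 -> S,
  [/\ forall i, l i \is 1.-homog, forall i, π (l i) != 0 & empty l].
Proof.
have [i0 ni0] := cone_rel Y.
suff main q (y : 'I_q -> S) : (forall i, y i \is 1.-homog) -> empty y ->
    exists2 l : 'I_3 -> S, forall i, l i \is 1.-homog & empty l.
  have [|p hp|l hl el] := main n.+1 (fun i => 'X_i).
  - by move=> i; apply: dhomogXi.
  - by have [[i ni] _] := hp; exists i; rewrite mevalXU.
  (* A form that is 0 on the variety does not help to avoid common zeros; replacing it by a variable
     makes all three nonzero. *)
  exists (fun i => if π (l i) == 0 then 'X_i0 else l i); split.
  - by move=> i; case: ifP => _ //; apply: dhomogXi.
  - by move=> i; case: ifP => // ->.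
  - move=> p hp; have [i ni] := el p hp; exists i.
    by rewrite (negPf (onv_nz hp ni)).
elim: q y => [|q IH] y hy ey.
  by have [p hp] := exists_point Y; have [[]] := ey p hp.
have [lt|le] := leqP q 2; last first.
  have [q' Eq] : exists q', q = q'.+3 by exists (q - 3)%N; lia.
  subst q; have [y' hy' ey'] := reduce_forms hy ey; exact: IH hy' ey'.
exists (fun i => y (inord i)) => // p hp; have [i ni] := ey p hp.
have lti : (i < 3)%N by apply: leq_trans (ltn_ord i) _.
by exists (Ordinal lti); rewrite /= inord_val.
Qed.

Lemma system_of_parameters (l : 'I_3 -> S) : (forall i, l i \is 1.-homog) -> empty l ->
  exists2 K, (0 < K)%N & forall t F, (K <= t)%N -> F \is t.-homog ->
  exists2 G : 'I_3 -> S, forall i, G i \is t.-1.-homog & π F = \sum_i π (l i) * π (G i).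
Proof.
move=> hl el; have [N hN] := generated (d := fun=> 1%N) hl el.
exists N.+1 => // t F lt hF; have [w hw ->] := hN t F (ltnW lt) hF.
exists w; last by rewrite pi_sum; apply: eq_bigr => i _; rewrite piM.
by move=> i; have := hw i; rewrite (leq_ltn_trans _ lt) // subn1.
Qed.

Section Regular.
Variables (r : nat) (M : 'rV[Y]_r -> Prop).

Definition cann (F : S) : Prop := forall v, M v -> π F *: v = 0.

Definition cseq_mul (Fs : seq S) (v : 'rV[Y]_r) : Prop :=
  exists w : nat -> 'rV[Y]_r, (forall j, M (w j)) /\
    v = \sum_(j < size Fs) π (nth 0 Fs j) *: w j.

Definition cregular (Fs : seq S) : Prop :=
  (forall i v, (i < size Fs)%N -> M v ->
     cseq_mul (take i Fs) (π (nth 0 Fs i) *: v) -> cseq_mul (take i Fs) v) /\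
  (exists2 v, M v & ~ cseq_mul Fs v).

Definition ccm : Prop :=
  exists Fs : seq S,
    [/\ forall F, F \in Fs -> exists2 d, (0 < d)%N & F \is d.-homog,
        cregular Fs & krull_dim cann (size Fs)].

Lemma cregular3 F0 F1 F2 : M 0 -> cregular [:: F0; F1; F2] ->
  [/\ π F0 != 0, π F1 != 0, reg2 M (π F0) (π F1) & reg3 M (π F0) (π F1) (π F2)].
Proof.
move=> M0 [R [u Mu nu]]; have R0 := R 0 _ isT; have R1 := R 1 _ isT; have R2 := R 2 _ isT.
have s1 v : cseq_mul [:: F0] v <-> exists2 w, M w & v = π F0 *: w.
  split=> [[w [hw ->]]|[w hw ->]]; first by exists (w 0); rewrite ?big_ord1.
  by exists (fun=> w); rewrite big_ord1.
have s2 v : cseq_mul [:: F0; F1] v <-> exists w w', [/\ M w, M w' & v = π F0 *: w + π F1 *: w'].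
  split=> [[w [hw ->]]|[w [w' [hw hw' ->]]]].
    by exists (w 0), (w 1); rewrite !big_ord_recl big_ord0 addr0.
  exists (fun i => if i is 0 then w else w'); split; first by case.
  by rewrite !big_ord_recl big_ord0 addr0.
have z0 Fs : cseq_mul Fs 0.
  by exists (fun=> 0); split=> //; rewrite big1 // => j _; rewrite scaler0.
have nzu : ~ u = 0 by move=> E; apply: nu; rewrite E.
have n0 : π F0 != 0.
  apply/eqP => E; apply: nzu; have /= := R0 u Mu; rewrite E scale0r => /(_ (z0 _)).
  by move=> [w [_ ->]]; rewrite big_ord0.
split=> //.
- apply/eqP => E; apply: nu; have /= := R1 u Mu; rewrite E scale0r => /(_ (z0 _))/s1[w hw ->].
  exists (fun i => if i == 0%N then w else 0); split; first by case.
  by rewrite !big_ord_recl big_ord0 /= !scaler0 !addr0.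
- by move=> v w hv hw E; apply/s1; apply: (R1 v hv); apply/s1; exists w.
- move=> v w0 w1 hv hw0 hw1 E; have /s2[x [y [hx hy ->]]] : cseq_mul [:: F0; F1] v.
    by apply: (R2 v hv); apply/s2; exists w0, w1.
  by exists x, y.
Qed.
End Regular.

Definition modA (v : 'rV[Y]_1) : Prop := exists F, v = const_mx (π F).

Lemma cregular_gen Fs : cregular modA Fs ->
  (forall i, (i < size Fs)%N -> reg_mod (gen_ideal Y (take i Fs)) (nth 0 Fs i)) /\
  ~ gen_ideal Y Fs 1.
Proof.
move=> [R [u [U ->] nu]].
have conv Gs G : cseq_mul modA Gs (const_mx (π G)) <-> gen_ideal Y Gs G.
  split=> [[w [hw E]]|[w E]].
    pose W j := proj1_sig (constructive_indefinite_description _ (hw j)).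
    have hW j : w j = const_mx (π (W j)) by rewrite /W; case: constructive_indefinite_description.
    exists W; have := congr1 (fun v : 'rV[Y]_1 => v 0 0) E; rewrite mxE => ->.
    by rewrite summxE pi_sum; apply: eq_bigr => j _; rewrite hW !mxE piM.
  exists (fun j => const_mx (π (w j))); split=> [j|]; first by exists (w j).
  by apply/rowP => j; rewrite mxE E pi_sum summxE; apply: eq_bigr => i _; rewrite !mxE piM.
split=> [i lt G h|h].
  apply/conv; apply: R => //; first by exists G.
  rewrite (_ : _ *: _ = const_mx (π (nth 0 Fs i * G))); first exact/conv.
  by apply/rowP => j; rewrite !mxE piM.
apply: nu; apply/conv; rewrite -[U]mulr1; have [_ _ h'] := ideal_gen Y Fs; exact: h'.
Qed.

End LinearForms.

Section CohenMacaulay.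
Variables (k : closedFieldType) (n : nat) (Y : cone k n).
Local Notation S := {mpoly k[n.+1]}.
Local Notation "'π' F" := (@cproj k n Y F) (at level 8, F at level 2).

Lemma modS_one (v : 'rV[Y]_1) : modS (1%:M : 'M[Y]_1) v <-> modA v.
Proof.
split=> [[u ->]|[F ->]].
  by exists (u 0 0); apply/rowP => j; rewrite !mxE big_ord1 !mxE !ord1 eqxx mulr1n mulr1.
by exists (const_mx F); apply/rowP => j; rewrite !mxE big_ord1 !mxE !ord1 eqxx mulr1n mulr1.
Qed.

Lemma hdg_one q i j : hdg 0 ((1%:M : 'M[Y]_q) i j).
Proof.
rewrite mxE; case: eqP => _; first exact: (hloc1 (nzden_class Y)).
exact: (hloc0 (nzden_class Y)).
Qed.

Lemma krull_dim_ext (R : comNzRingType) (J J' : R -> Prop) e :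
  (forall x, J x <-> J' x) -> krull_dim J e -> krull_dim J' e.
Proof.
move=> E; have ext Q (I I' : R -> Prop) f : (forall x, I x <-> I' x) ->
    prime_chain Q I f -> prime_chain Q I' f.
  move=> EI [P [H1 H2]]; exists P; split=> // i hi; have [h1 h2 h3 h4] := H1 i hi.
  by split=> // F /EI/h4.
case=> h1 h2; split; first exact: ext h1.
by move=> h; apply: h2; apply: ext h => x; split=> /E.
Qed.

(** All nonzero modules here sit in vector spaces over the fraction field, so they have the
    dimension of the ring. *)
Lemma cann_ker r (M : 'rV[Y]_r -> Prop) v : M v -> v != 0 ->
  forall F, cann M F <-> π F = 0.
Proof.
move=> Mv nv F; split=> [/(_ v Mv)/eqP|E w _]; last by rewrite E scale0r.
by rewrite scaler_eq0 (negPf nv) orbF => /eqP.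
Qed.

Lemma cregular_nz r (M : 'rV[Y]_r -> Prop) Fs : M 0 -> cregular M Fs -> exists2 v, M v & v != 0.
Proof.
move=> M0 [_ [v Mv nv]]; exists v => //; apply/eqP => E; apply: nv; rewrite E.
by exists (fun=> 0); split=> //; rewrite big1 // => j _; rewrite scaler0.
Qed.

Hypothesis cmA : ccm (@modA k n Y).
Hypotheses (dim2 : relevant_chain Y 2%N) (ndim3 : ~ relevant_chain Y 3%N).

Lemma modA0 : @modA k n Y 0.
Proof. by exists 0; apply/rowP => j; rewrite !mxE pi0. Qed.

Lemma cm_dim : krull_dim (fun F : S => π F = 0) 3%N /\
  exists2 F : 'I_3 -> S, (exists2 d : 'I_3 -> nat, forall i, (0 < d i)%N & forall i, F i \is (d i).-homog)
  & forall p, onv Y p -> exists i, (F i).@[p] != 0.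
Proof.
have [Fs [hFs RFs KFs]] := cmA; have [v Mv nv] := cregular_nz modA0 RFs.
have {}KFs := krull_dim_ext (cann_ker Mv nv) KFs.
have [R1 R2] := cregular_gen RFs; have [K1 K2] := KFs.
have [sz empty] := cm_length hFs R1 R2 dim2 ndim3 K1 K2.
rewrite -sz; split=> //; rewrite sz.
have lt i : (i < 3)%N -> (i < size Fs)%N by rewrite sz.
have pick (i : 'I_3) := hFs _ (mem_nth 0 (lt i (ltn_ord i))).
exists (fun i : 'I_3 => nth 0 Fs i).
  have [d hd] := ord_choice (R := fun i d => (0 < d)%N /\ nth 0 Fs i \is d.-homog)
    (fun i => let: ex_intro2 d h1 h2 := pick i in ex_intro _ d (conj h1 h2)).
  by exists d => i; case: (hd i).
move=> p /empty[F /(nthP 0)[j]]; rewrite sz => ltj <- nz; by exists (Ordinal ltj).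
Qed.

Record parameters (l : 'I_3 -> S) (K : nat) : Prop := IsParameters {
  par_homog : forall i, l i \is 1.-homog;
  par_nz : forall i, π (l i) != 0;
  par_empty : forall p, onv Y p -> exists i, (l i).@[p] != 0;
  par_pos : (0 < K)%N;
  par_gen : forall t F, (K <= t)%N -> F \is t.-homog ->
    exists2 G : 'I_3 -> S, forall i, G i \is t.-1.-homog & π F = \sum_i π (l i) * π (G i) }.

Lemma parameters_exist : exists l K, parameters l K.
Proof.
have [_ [F [d pd hF] eF]] := cm_dim.
have [l [hl nl el]] := three_forms (growth hF pd eF).
by have [K pK hK] := system_of_parameters hl el; exists l, K; split.
Qed.

Lemma cm_free l K r b (s : 'M[Y]_(b, r)) : parameters l K -> (forall i j, hdg 0 (s i j)) ->
  ccm (modS s) ->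
  [/\ reg2 (modS s) (π (l ord_max)) (π (l (lift ord0 ord0))),
      reg3 (modS s) (π (l ord_max)) (π (l (lift ord0 ord0))) (π (l ord0)) &
  exists (I : finType) (a : I -> nat) (e : I -> 'rV[Y]_r),
  [/\ forall i, modSt s (a i) (e i),
      forall t v, modSt s t v -> exists2 c : I -> {mpoly k[3]},
        forall i, homd t (a i) (c i) & v = \sum_i rho Y l (c i) *: e i &
      forall c : I -> {mpoly k[3]}, \sum_i rho Y l (c i) *: e i = 0 -> forall i, c i = 0]].
Proof.
move=> [hl nl el pK hK] hs [Fs [hFs RFs KFs]].
have [v Mv nv] := cregular_nz (modS0 s) RFs.
have KFs' := krull_dim_ext (cann_ker Mv nv) KFs; have [K3 _] := cm_dim.
have sz := max_prime_chain_unique KFs' K3.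
case: Fs sz hFs RFs {KFs KFs'} => [|F0 [|F1 [|F2 [|//]]]] // _ hFs RFs.
have [nF0 nF1 RF2 RF3] := cregular3 (modS0 s) RFs.
have [|d0 p0 h0] := hFs F0; first by rewrite !inE eqxx.
have [|d1 p1 h1] := hFs F1; first by rewrite !inE eqxx orbT.
have [|d2 p2 h2] := hFs F2; first by rewrite !inE eqxx !orbT.
have [T1 T2] := transfer_reg hs hl nl hK h0 h1 h2 p0 p1 p2 nF0 nF1 RF2 RF3.
split=> //; exact: (free_basis hs hl nl pK hK h0 h1 h2 p0 p1 p2 nF0 nF1 RF2 RF3).
Qed.

End CohenMacaulay.

(** * Derivations *)

Definition sel (T : Type) (x0 : T) (P : T -> Prop) : T := epsilon (inhabits x0) P.
Lemma selP (T : Type) (x0 : T) (P : T -> Prop) : (exists x, P x) -> P (sel x0 P).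
Proof. exact: epsilon_spec. Qed.

Section ExtDer.
Variable L : fieldType.
Hypothesis charL : [pchar L] =i pred0.

Definition sring (F : L -> Prop) :=
  [/\ F 1, forall a b, F a -> F b -> F (a - b) & forall a b, F a -> F b -> F (a * b)].
Definition der_on (F : L -> Prop) (D : L -> L) := forall a b, F a -> F b ->
  D (a + b) = D a + D b /\ D (a * b) = a * D b + b * D a.
Definition algebraic_over (F : L -> Prop) (z : L) :=
  exists p : {poly L}, [/\ forall i, F p`_i, p != 0 & p.[z] = 0].

Section Step.
Variables (F : L -> Prop) (D : L -> L) (z v : L).
Hypotheses (sF : sring F) (dD : der_on F D).

Lemma sr0 : F 0. Proof. by have [F1 FB _] := sF; rewrite -(subrr 1); apply: FB. Qed.
Lemma srN a : F a -> F (- a).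
Proof. by move=> Fa; have [_ FB _] := sF; rewrite -sub0r; apply: FB => //; apply: sr0. Qed.
Lemma srD a b : F a -> F b -> F (a + b).
Proof. by move=> Fa Fb; have [_ FB _] := sF; rewrite -[b]opprK; apply: FB => //; apply: srN. Qed.
Lemma srM a b : F a -> F b -> F (a * b). Proof. by case: sF => _ _; apply. Qed.
Lemma sr_sum (T : Type) (s : seq T) (P : pred T) (f : T -> L) :
  (forall i, P i -> F (f i)) -> F (\sum_(i <- s | P i) f i).
Proof. by move=> h; elim/big_rec: _ => [|i x Pi Fx]; [apply: sr0|apply: srD => //; apply: h]. Qed.
Lemma srMn a m : F a -> F (a *+ m).
Proof. by move=> Fa; elim: m => [|m IH]; rewrite ?mulr0n ?mulrS; [apply: sr0|apply: srD]. Qed.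

Lemma dr0 : D 0 = 0.
Proof.
have [E _] := dD sr0 sr0; rewrite addr0 in E.
by rewrite -[LHS](addrK (D 0)) -E subrr.
Qed.
Lemma dr1 : D 1 = 0.
Proof.
have [F1 _ _] := sF; have [_ E] := dD F1 F1; rewrite !mul1r in E.
by rewrite -[LHS](addrK (D 1)) -E subrr.
Qed.
Lemma dr_sum (T : finType) (f : T -> L) : (forall i, F (f i)) -> D (\sum_i f i) = \sum_i D (f i).
Proof.
move=> h; suff [] : D (\sum_i f i) = \sum_i D (f i) /\ F (\sum_i f i) by [].
elim/big_rec2: _ => [|i x y _ [<- Fy]]; first by split; [apply: dr0|apply: sr0].
by have [-> _] := dD (h i) Fy; split=> //; apply: srD.
Qed.

Definition pF (p : {poly L}) := forall i, F p`_i.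

Lemma pFD p q : pF p -> pF q -> pF (p + q).
Proof. by move=> hp hq i; rewrite coefD; apply: srD. Qed.
Lemma pFM p q : pF p -> pF q -> pF (p * q).
Proof. by move=> hp hq i; rewrite coefM; apply: sr_sum => j _; apply: srM. Qed.
Lemma pFC c : F c -> pF c%:P.
Proof. by move=> hc i; rewrite coefC; case: ifP => // _; apply: sr0. Qed.
Lemma pFXn j : pF 'X^j.
Proof. by move=> i; rewrite coefXn; case: eqP => _; [case: sF|apply: sr0]. Qed.
Lemma pF_deriv p : pF p -> pF p^`().
Proof. by move=> hp i; rewrite coef_deriv; apply: srMn. Qed.

Definition pD (p : {poly L}) := \poly_(i < size p) D p`_i.
Lemma pDE p i : (pD p)`_i = D p`_i.
Proof. by rewrite coef_poly; case: ltnP => // le; rewrite nth_default // dr0. Qed.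

(** The derivation of F[X] that extends [D] and sends X to [v], followed by evaluation at [z]. *)
Definition pder (p : {poly L}) := (pD p).[z] + p^`().[z] * v.

Lemma pderD p q : pF p -> pF q -> pder (p + q) = pder p + pder q.
Proof.
move=> hp hq; have E : pD (p + q) = pD p + pD q.
  by apply/polyP => i; rewrite coefD !pDE coefD; have [] := dD (hp i) (hq i).
by rewrite /pder E derivD !hornerD; ring.
Qed.

Lemma pderM p q : pF p -> pF q -> pder (p * q) = p.[z] * pder q + q.[z] * pder p.
Proof.
move=> hp hq; have E : pD (p * q) = p * pD q + pD p * q.
  apply/polyP => i; rewrite coefD !pDE !coefM dr_sum -?big_split /=; last by move=> j; apply: srM.
  apply: eq_bigr => j _; rewrite !pDE.
  by have [_ ->] := dD (hp j) (hq (i - j)%N); congr (_ + _); rewrite mulrC.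
by rewrite /pder E derivM !(hornerD, hornerM); ring.
Qed.

Lemma pderC c : pder c%:P = D c.
Proof.
rewrite /pder derivC horner0 mul0r addr0; have -> : pD c%:P = (D c)%:P.
  by apply/polyP => i; rewrite pDE !coefC; case: ifP => // _; apply: dr0.
by rewrite hornerC.
Qed.

Variable g : {poly L}.
Hypotheses (hg : pF g) (ng : g != 0) (gz : g.[z] = 0) (Pg : pder g = 0).
Hypothesis ming : forall p, pF p -> p != 0 -> p.[z] = 0 -> (size g <= size p)%N.

(** Pseudo-division: multiplying by the leading coefficient of [g] and subtracting a multiple of [g]
    lowers the degree. The coefficients form only a ring, so [g] need not divide [p]. *)
Lemma pder_zero p : pF p -> p.[z] = 0 -> pder p = 0.
Proof.
move: {2}(size p) (leqnn (size p)) => m; elim: m p => [|m IH] p le hp pz.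
  move: le; rewrite leqn0 size_poly_eq0 => /eqP ->.
  by rewrite -polyC0 pderC dr0.
have [->|np] := eqVneq p 0; first by rewrite -polyC0 pderC dr0.
have leg := ming hp np pz; set c := lead_coef g; set d := lead_coef p.
have sg : (0 < size g)%N by rewrite lt0n size_poly_eq0.
pose j := (size p - size g)%N.
have Fc : F c by apply: hg. have Fd : F (- d) by apply: srN; apply: hp.
have hXg : pF ('X^j * g) by apply: pFM => //; apply: pFXn.
pose p2 := c%:P * p + (- d)%:P * ('X^j * g).
have h1 : pF (c%:P * p) by apply: pFM => //; apply: pFC.
have h2 : pF ((- d)%:P * ('X^j * g)) by apply: pFM => //; apply: pFC.
have sz : (size p2 <= m)%N.
  apply/leq_sizeP => i lei; rewrite coefD !coefCM coefXnM.
  have jle : (j <= (size p).-1)%N by rewrite /j; move: sg leg; clear; lia.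
  have plei : ((size p).-1 <= i)%N by apply: leq_trans lei; move: le; clear; lia.
  rewrite ltnNge (leq_trans jle plei) /=.
  have [Ei|nei] := eqVneq i (size p).-1.
    have -> : (i - j)%N = (size g).-1 by rewrite Ei /j; move: sg leg; clear; lia.
    by rewrite Ei -/(lead_coef p) -/(lead_coef g) -/c -/d mulNr mulrC subrr.
  have ltp : (size p <= i)%N by move/eqP: nei; move: plei sg leg; clear; lia.
  have ltg : (size g <= i - j)%N by rewrite /j; move: ltp sg leg; clear; lia.
  by rewrite (nth_default 0 ltp) (nth_default 0 ltg) !mulr0 addr0.
have zp2 : p2.[z] = 0 by rewrite /p2 hornerD !hornerM pz gz !mulr0 addr0.
have Ec : pder (c%:P * p) = c * pder p.
  by rewrite (pderM (pFC Fc) hp) pz mul0r addr0 hornerC.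
have Ed : pder ((- d)%:P * ('X^j * g)) = 0.
  rewrite (pderM (pFC Fd) hXg) (pderM (pFXn j) hg) Pg gz hornerM gz.
  by rewrite !(mulr0, mul0r, addr0).
have := IH p2 sz (pFD h1 h2) zp2; rewrite /p2 (pderD h1 h2) Ec Ed addr0.
by move/eqP; rewrite mulf_eq0 lead_coef_eq0 (negPf ng) => /eqP.
Qed.

End Step.

Lemma minimal_nat (P : nat -> Prop) : (exists m, P m) -> exists2 m, P m & forall j, (j < m)%N -> ~ P j.
Proof.
move=> [m Pm]; apply: NNPP => no.
suff h j : ~ P j by exact: (h m Pm).
by elim/ltn_ind: j => j IH Pj; apply: no; exists j.
Qed.

Lemma ext_der F D z : sring F -> der_on F D -> algebraic_over F z ->
  exists F' D', [/\ sring F', der_on F' D', forall a, F a -> F' a, F' z & forall a, F a -> D' a = D a].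
Proof.
move=> sF dD alg.
have [m [g [[hg ng gz] sg]] minm] := @minimal_nat
    (fun m => exists g : {poly L}, [/\ forall i, F g`_i, g != 0 & g.[z] = 0] /\ size g = m)
    (let: ex_intro p h := alg in ex_intro _ (size p) (ex_intro _ p (conj h erefl))).
have ming p : pF F p -> p != 0 -> p.[z] = 0 -> (size g <= size p)%N.
  by move=> hp np pz; rewrite leqNgt sg; apply/negP => lt; apply: (minm _ lt); exists p.
have s2 : (1 < size g)%N.
  rewrite ltnNge; apply/negP => /size1_polyC E; move: gz ng; rewrite E hornerC => ->.
  by rewrite polyC0 eqxx.
have nd : g^`() != 0.
  apply/eqP => E; have := congr1 (fun p : {poly L} => p`_(size g).-2) E.
  rewrite coef0 coef_deriv; have -> : (size g).-2.+1 = (size g).-1 by move: s2; clear; lia.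
  rewrite -/(lead_coef g) -mulr_natr => /eqP; rewrite mulf_eq0 lead_coef_eq0 (negPf ng) /=.
  by rewrite ((pcharf0P L).1 charL); move: s2; clear; case: (size g) => [|[]].
have ndz : g^`().[z] != 0.
  apply/eqP => E; have := ming _ (pF_deriv sF hg) nd E.
  by rewrite leqNgt lt_size_deriv.
(* The value that differentiating [g(z) = 0] forces on [z]; the denominator is nonzero by
   characteristic zero and minimality of [g]. *)
pose v := - (pD D g).[z] / g^`().[z].
have Pg : pder D z v g = 0 by rewrite /pder /v mulrC divfK // subrr.
have wd p : pF F p -> p.[z] = 0 -> pder D z v p = 0.
  exact: (pder_zero sF dD hg ng gz Pg ming).
pose F' x := exists2 p, pF F p & x = p.[z].
pose rep x (p : {poly L}) := pF F p /\ x = p.[z].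
pose D' x := pder D z v (sel 0 (rep x)).
have D'E p : pF F p -> D' p.[z] = pder D z v p.
  move=> hp; rewrite /D'; have [] := selP 0 (ex_intro (rep p.[z]) p (conj hp erefl)).
  move: (sel 0 _) => q hq Eq; have F1 : F 1 by case: sF.
  have Fm : F (-1) by apply: (srN sF).
  have hm := pFC sF Fm; have hmp := pFM sF hm hp.
  have := wd (q + (-1)%:P * p); rewrite hornerD hornerM hornerC -Eq mulN1r subrr.
  move=> /(_ (pFD sF hq hmp) erefl); rewrite (pderD _ _ sF dD) // (pderM _ _ sF dD) //.
  have [D1 _] := dD _ _ F1 Fm; rewrite subrr (dr0 sF dD) (dr1 sF dD) add0r in D1.
  rewrite (pderC _ _ sF dD) -D1 mulr0 addr0 hornerC mulN1r => /eqP; rewrite subr_eq0 => /eqP.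
  exact.
exists F', D'; split.
- split.
  + by exists 1%:P; [apply: (pFC sF); case: sF|rewrite hornerC].
  + move=> a b [p hp ->] [q hq ->]; exists (p - q); last by rewrite hornerD hornerN.
    by move=> i; rewrite coefB; case: sF => _ h _; apply: h.
  + by move=> a b [p hp ->] [q hq ->]; exists (p * q); [apply: (pFM sF)|rewrite hornerM].
- move=> a b [p hp ->] [q hq ->]; rewrite -hornerD -hornerM !D'E //; first last.
  + exact: (pFD sF).
  + exact: (pFM sF).
  by rewrite (pderD _ _ sF dD) // (pderM _ _ sF dD).
- by move=> a Fa; exists a%:P; rewrite ?hornerC //; apply: (pFC sF).
- by exists 'X; [rewrite -['X]expr1; apply: (pFXn sF)|rewrite hornerX].
- move=> a Fa; rewrite -[in LHS](hornerC a z) D'E; last exact: (pFC sF).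
  by rewrite (pderC _ _ sF dD).
Qed.

Lemma ext_der_seq F D (zs : seq L) : sring F -> der_on F D -> (forall z, z \in zs -> algebraic_over F z) ->
  exists F' D', [/\ sring F', der_on F' D', forall a, F a -> F' a,
    forall z, z \in zs -> F' z & forall a, F a -> D' a = D a].
Proof.
elim: zs F D => [|z zs IH] F D sF dD alg; first by exists F, D; split.
have [|F1 [D1 [s1 d1 i1 z1 e1]]] := @ext_der F D z sF dD; first by apply: alg; rewrite inE eqxx.
have [|F2 [D2 [s2 d2 i2 z2 e2]]] := IH F1 D1 s1 d1.
  move=> y hy; have [|p [hp np yp]] := alg y; first by rewrite inE hy orbT.
  by exists p; split=> // i; apply: i1.
exists F2, D2; split=> //.
- by move=> a /i1/i2.
- by move=> y; rewrite inE => /orP[/eqP ->|]; [apply: i2|apply: z2].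
- by move=> a Fa; rewrite e2 ?e1 //; apply: i1.
Qed.

End ExtDer.

Section Tangent.
Variables (k : closedFieldType) (n : nat) (Y : cone k n).
Local Notation S := {mpoly k[n.+1]}.
Local Notation "'π' F" := (@cproj k n Y F) (at level 8, F at level 2).

(** The vector field with coordinates [v] applied to a polynomial; [tangent] says that it descends
    to the coordinate ring. *)
Definition dvec (v : 'I_n.+1 -> Y) (F : S) : Y := \sum_i π (mderiv i F) * v i.
Definition tangent (v : 'I_n.+1 -> Y) : Prop := forall F, π F = 0 -> dvec v F = 0.
Definition kder (D : Y -> Y) : Prop := [/\ forall a b, D (a + b) = D a + D b,
  forall a b, D (a * b) = a * D b + b * D a & forall c, D (scal Y c) = 0].

Lemma dvecD v F G : dvec v (F + G) = dvec v F + dvec v G.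
Proof. by rewrite /dvec -big_split; apply: eq_bigr => i _; rewrite mderivD piD mulrDl. Qed.

Lemma dvecN v F : dvec v (- F) = - dvec v F.
Proof. by rewrite /dvec -sumrN; apply: eq_bigr => i _; rewrite mderivN piN mulNr. Qed.

Lemma dvecB v F G : dvec v (F - G) = dvec v F - dvec v G.
Proof. by rewrite dvecD dvecN. Qed.

Lemma dvecM v F G : dvec v (F * G) = π F * dvec v G + π G * dvec v F.
Proof.
rewrite /dvec !mulr_sumr -big_split; apply: eq_bigr => i _ /=.
by rewrite mderivM piD !piM; ring.
Qed.

Lemma dvecC v c : dvec v c%:MP = 0.
Proof. by rewrite /dvec big1 // => i _; rewrite mderivC pi0 mul0r. Qed.

Lemma dvecX v i : dvec v 'X_i = v i.
Proof.
rewrite /dvec (bigD1 i) //= big1 => [|j ji]; rewrite mderivX mnmE.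
  have -> : (U_(i) - U_(i))%MM = 0%MM by apply/mnmP => j; rewrite mnmBE subnn mnm0E.
  by rewrite eqxx mpolyX0 scale1r pi1 mul1r addr0.
by rewrite eq_sym (negPf ji) scale0r pi0 mul0r.
Qed.

Lemma dvec_sum v (T : Type) (s : seq T) (P : pred T) (F : T -> S) :
  dvec v (\sum_(i <- s | P i) F i) = \sum_(i <- s | P i) dvec v (F i).
Proof.
elim/big_rec2: _ => [|i x y _ E]; first by rewrite -mpolyC0 dvecC.
by rewrite dvecD E.
Qed.

Section Cder.
Variable v : 'I_n.+1 -> Y.
Hypothesis tv : tangent v.

Definition frac_rep (a : Y) (FG : S * S) : Prop := π FG.2 != 0 /\ a = π FG.1 / π FG.2.
Definition cder (a : Y) : Y :=
  let FG := sel (0, 1) (frac_rep a) in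
  (dvec v FG.1 * π FG.2 - π FG.1 * dvec v FG.2) / π FG.2 ^+ 2.

Lemma cder_frac F G : π G != 0 ->
  cder (π F / π G) = (dvec v F * π G - π F * dvec v G) / π G ^+ 2.
Proof.
move=> nG; rewrite /cder.
have := selP (0, 1) (ex_intro (frac_rep (π F / π G)) (F, G) (conj nG erefl)).
case: (sel _ _) => F' G' [/= nH E].
have E0 : π F * π G' = π F' * π G by apply/eqP; rewrite -eqr_div // E.
have : dvec v (F * G' - F' * G) = 0 by apply: tv; rewrite piB !piM E0 subrr.
rewrite dvecB !dvecM => E1.
have EF : π F' = π F * π G' / π G by rewrite E0 mulfK.
have E2 : dvec v F' = (π F * dvec v G' + π G' * dvec v F - π F' * dvec v G) / π G.
  apply: (mulIf nG); rewrite divfK //; apply/eqP; rewrite -subr_eq0; apply/eqP.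
  by rewrite -[RHS]oppr0 -[X in _ = - X]E1; ring.
by rewrite E2 EF; field; rewrite nG nH.
Qed.

Lemma cder_pi F : cder (π F) = dvec v F.
Proof.
have n1 : π (1 : S) != 0 by rewrite pi1 oner_eq0.
have := cder_frac F n1; rewrite pi1 divr1 => ->.
by rewrite -mpolyC1 dvecC mulr0 subr0 expr1n mulr1 divr1.
Qed.

Lemma kder_cder : kder cder.
Proof.
split=> [a b|a b|c]; last by rewrite /scal cder_pi dvecC.
  have [F [G [nG ->]]] := cone_frac a; have [F' [G' [nH ->]]] := cone_frac b.
  have nGH : π (G * G') != 0 by rewrite piM mulf_neq0.
  have -> : π F / π G + π F' / π G' = π (F * G' + F' * G) / π (G * G').
    by rewrite piD !piM; field; rewrite nG nH.
  rewrite !cder_frac // dvecD !dvecM piD !piM; field; by rewrite nG nH.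
have [F [G [nG ->]]] := cone_frac a; have [F' [G' [nH ->]]] := cone_frac b.
have nGH : π (G * G') != 0 by rewrite piM mulf_neq0.
have -> : π F / π G * (π F' / π G') = π (F * F') / π (G * G').
  by rewrite !piM; field; rewrite nG nH.
rewrite !cder_frac // !dvecM !piM; field; by rewrite nG nH.
Qed.
End Cder.

End Tangent.

Lemma mpoly_alg_ind (K : comNzRingType) n (P : {mpoly K[n]} -> Prop) :
  (forall c, P c%:MP) -> (forall i, P 'X_i) -> (forall F G, P F -> P G -> P (F + G)) ->
  (forall F G, P F -> P G -> P (F * G)) -> forall F, P F.
Proof.
move=> PC PX PD PM F.
have P0 : P 0 by rewrite -mpolyC0.
have P1 : P 1 by rewrite -mpolyC1.
rewrite [F]mpolyE; elim/big_rec: _ => [|m x _ Px]; first exact: P0.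
apply: (PD) => //; rewrite -mul_mpolyC; apply: (PM) => //; rewrite mpolyXE_id.
elim/big_rec: _ => [|i y _ Py]; first exact: P1.
by apply: (PM) => //; elim: (m i) => [|j IH]; rewrite ?expr0 // exprS; apply: (PM).
Qed.

Section FreeAlgebra.
Variables (k : closedFieldType) (n : nat) (Y : cone k n).
Local Notation S := {mpoly k[n.+1]}.
Local Notation "'π' F" := (@cproj k n Y F) (at level 8, F at level 2).
Variable l : 'I_3 -> S.
Hypothesis hl : forall i, l i \is 1.-homog.

Record free_algebra (I : finType) (a : I -> nat) (e : I -> Y) : Prop := FreeAlgebra {
  fa_deg : forall i, inAt (a i) (e i);
  fa_span : forall t x, inAt t x -> exists2 c : I -> {mpoly k[3]},
    forall i, homd t (a i) (c i) & x = \sum_i rho Y l (c i) * e i;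
  fa_free : forall c : I -> {mpoly k[3]}, \sum_i rho Y l (c i) * e i = 0 -> forall i, c i = 0 }.

Variables (I : finType) (a : I -> nat) (e : I -> Y).
Hypothesis fa : free_algebra a e.

Lemma fa_spanA x : inA x -> exists c : I -> {mpoly k[3]}, x = \sum_i rho Y l (c i) * e i.
Proof.
move=> [F ->]; rewrite (pihomog_partitionE (leqnn (msize F))) pi_sum.
elim/big_rec: _ => [|d y _ [c ->]].
  by exists (fun=> 0); rewrite big1 // => i _; rewrite rho0 mul0r.
have [c' _ ->] := fa_span fa (inAt_pi Y (pihomogP mdeg d F)).
by exists (fun i => c' i + c i); rewrite -big_split; apply: eq_bigr => i _; rewrite rhoD mulrDl.
Qed.

Definition co (x : Y) : I -> {mpoly k[3]} :=
  sel (fun=> 0) (fun c => x = \sum_i rho Y l (c i) * e i).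

Lemma coE x : inA x -> x = \sum_i rho Y l (co x i) * e i.
Proof. by move=> /fa_spanA h; exact: (selP (fun=> 0) h). Qed.

Lemma fa_uniq (c c' : I -> {mpoly k[3]}) :
  \sum_i rho Y l (c i) * e i = \sum_i rho Y l (c' i) * e i -> forall i, c i = c' i.
Proof.
move=> E i; apply/eqP; rewrite -subr_eq0; apply/eqP.
apply: (fa_free fa (c := fun i => c i - c' i)).
under eq_bigr => j _ do rewrite rhoB mulrBl.
by rewrite big_split sumrN /= E subrr.
Qed.

Lemma co_uniq x c : x = \sum_i rho Y l (c i) * e i -> forall i, co x i = c i.
Proof.
move=> E; apply: fa_uniq; rewrite -coE //.
rewrite E; apply: inA_sum => i _; apply: inAM; first exact: inApi.
by apply: inAtA (fa_deg fa i).
Qed.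

Lemma inAe i : inA (e i). Proof. exact: inAtA (fa_deg fa i). Qed.

Lemma inA_rho c : inA (rho Y l c). Proof. exact: inApi. Qed.

Lemma coD x y i : inA x -> inA y -> co (x + y) i = co x i + co y i.
Proof.
move=> hx hy; apply: (co_uniq (c := fun i => co x i + co y i)).
rewrite {1}(coE hx) {1}(coE hy) -big_split.
by apply: eq_bigr => j _; rewrite rhoD mulrDl.
Qed.

Lemma co_rho c x i : inA x -> co (rho Y l c * x) i = c * co x i.
Proof.
move=> hx; apply: (co_uniq (c := fun i => c * co x i)).
rewrite {1}(coE hx) mulr_sumr.
by apply: eq_bigr => j _; rewrite rhoM mulrA.
Qed.

Lemma coZ c x i : inA x -> co (scal Y c * x) i = c%:MP * co x i.
Proof. by rewrite -(rhoC Y l); apply: co_rho. Qed.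

Lemma co_homd t x i : inAt t x -> homd t (a i) (co x i).
Proof. by move=> /(fa_span fa)[c hc E]; rewrite (co_uniq E). Qed.

Lemma rho_inj c : rho Y l c = 0 -> c = 0.
Proof.
move=> E; have [i0 _] : exists i0, co 1 i0 != 0.
  apply: NNPP => no; have := coE (inA1 Y); rewrite big1 => [/eqP|i _]; first by rewrite oner_eq0.
  have [->|nz] := eqVneq (co 1 i) 0; first by rewrite rho0 mul0r.
  by case: no; exists i.
have := @fa_free _ _ _ fa (fun i => if i == i0 then c else 0) _ i0; rewrite eqxx; apply.
by rewrite big1 // => i _; case: eqP => _; rewrite ?E ?rho0 mul0r.
Qed.

(** Cayley-Hamilton: [x] is an eigenvalue of the matrix of its multiplication, the basis [e] being
    an eigenvector. *)
Lemma algebraic_A x : inA x -> algebraic_over (fun y => exists c, y = rho Y l c) x.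
Proof.
move=> hx; pose q := #|I|; pose ev (i : 'I_q) : I := enum_val i.
pose N : 'M[{mpoly k[3]}]_q := \matrix_(i, j) co (x * e (ev j)) (ev i).
exists (map_poly (rho Y l) (char_poly N)); split.
- by move=> i; rewrite coef_map; exists ((char_poly N)`_i).
- by apply: monic_neq0; rewrite map_char_poly char_poly_monic.
apply/eqP; rewrite -/(root _ x) map_char_poly -eigenvalue_root_char; apply/eigenvalueP.
exists (\row_i e (ev i)).
  apply/rowP => j; rewrite !mxE [RHS](coE (inAM hx (inAe (ev j)))) [RHS]sum_over_enum.
  by apply: eq_bigr => i _; rewrite !mxE mulrC.
apply/eqP => E; have := coE (inA1 Y); rewrite sum_over_enum big1 => [/eqP|i _].
  by rewrite oner_eq0.
by have := congr1 (fun v : 'rV[Y]_q => v 0 i) E; rewrite !mxE => ->; rewrite mulr0.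
Qed.

Hypothesis chark : [pchar k] =i pred0.

Lemma charY : [pchar Y] =i pred0.
Proof.
apply/pcharf0P => m; have -> : (m%:R : Y) = scal Y m%:R.
  by elim: m => [|m IH]; rewrite ?scal0 // -addn1 !natrD scalD IH scal1.
by rewrite scal_eq0 ((pcharf0P k).1 chark).
Qed.

(** The partial derivative on [k[l_0, l_1, l_2]] extends to the images of the variables, which are
    algebraic, by characteristic zero. Its values there are the coordinates of the field. *)
Lemma tangent_dual i0 : exists2 v : 'I_n.+1 -> Y, tangent v &
  forall j, dvec v (l j) = (i0 == j)%:R.
Proof.
pose F0 (y : Y) := exists c, y = rho Y l c.
pose D0 (y : Y) : Y := rho Y l (mderiv i0 (sel 0 (fun c => y = rho Y l c))).
have D0E c : D0 (rho Y l c) = rho Y l (mderiv i0 c).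
  rewrite /D0; set c' := sel _ _.
  have E : rho Y l c = rho Y l c' := selP 0 (ex_intro (fun c' => rho Y l c = rho Y l c') c erefl).
  have -> // : c' = c by apply/eqP; rewrite -subr_eq0; apply/eqP/rho_inj; rewrite rhoB -E subrr.
have sF0 : sring F0.
  split=> [|x y [c ->] [d ->]|x y [c ->] [d ->]]; first by exists 1; rewrite rho1.
    by exists (c - d); rewrite rhoB.
  by exists (c * d); rewrite rhoM.
have dD0 : der_on F0 D0.
  move=> x y [c ->] [d ->]; rewrite -rhoD -rhoM !D0E mderivD mderivM !rhoD !rhoM; split=> //.
  by rewrite addrC [rho Y l d * _]mulrC.
have [|F' [D [sF' dD i' z' e']]] := ext_der_seq charY (zs := [seq π 'X_i | i <- enum 'I_n.+1]) sF0 dD0.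
  by move=> z /mapP[i _ ->]; apply: algebraic_A; apply: inApi.
have FX i : F' (π 'X_i) by apply: z'; apply: map_f; rewrite mem_enum.
have FC c : F' (π c%:MP) by apply: i'; exists c%:MP; rewrite rhoC.
pose v i := D (π 'X_i).
have main F : F' (π F) /\ D (π F) = dvec v F.
  elim/mpoly_alg_ind: F => [c|i|F G [hF EF] [hG EG]|F G [hF EF] [hG EG]].
  - split=> //; rewrite dvecC e'; last by exists c%:MP; rewrite rhoC.
    by rewrite -/(scal Y c) -(rhoC Y l) D0E mderivC rho0.
  - by rewrite dvecX.
  - by rewrite piD dvecD -EF -EG; split; [apply: (srD sF')|case: (dD _ _ hF hG)].
  - by rewrite piM dvecM -EF -EG; split; [apply: (srM sF')|case: (dD _ _ hF hG)].
exists v => [F E|j].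
  by have [_ <-] := main F; rewrite E (dr0 sF' dD).
have [_ <-] := main (l j); rewrite -(rhoXi Y l) e'; last by exists 'X_j.
rewrite D0E mderivX mnmE eq_sym; case: eqP => [->|_]; last by rewrite scale0r rho0.
have -> : (U_(j) - U_(j))%MM = 0%MM by apply/mnmP => j'; rewrite mnmBE subnn mnm0E.
by rewrite mpolyX0 scale1r rho1.
Qed.

End FreeAlgebra.

Section Homogeneous.
Variables (k : closedFieldType) (n : nat) (Y : cone k n).
Local Notation S := {mpoly k[n.+1]}.
Local Notation "'π' F" := (@cproj k n Y F) (at level 8, F at level 2).

Definition det3 (x y z : 'I_3 -> Y) : Y :=
  let o0 : 'I_3 := ord0 in let o1 : 'I_3 := lift ord0 ord0 in let o2 : 'I_3 := ord_max in
  x o0 * (y o1 * z o2 - y o2 * z o1) - x o1 * (y o0 * z o2 - y o2 * z o0) +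
  x o2 * (y o0 * z o1 - y o1 * z o0).

Lemma det3_sum2 T x (y : 'I_T -> 'I_3 -> Y) z :
  det3 x (fun j => \sum_d y d j) z = \sum_d det3 x (y d) z.
Proof.
rewrite /det3 big_split sumrB /= -!mulr_sumr !sumrB -!mulr_suml.
by congr (_ * _ - _ * _ + _ * _).
Qed.

Lemma det3_sum3 T x y (z : 'I_T -> 'I_3 -> Y) :
  det3 x y (fun j => \sum_d z d j) = \sum_d det3 x y (z d).
Proof.
rewrite /det3 big_split sumrB /= -!mulr_sumr !sumrB -!mulr_sumr.
by congr (_ * _ - _ * _ + _ * _).
Qed.

Lemma common_den q (x : 'I_q -> Y) : exists2 H, π H != 0 & forall i, inA (π H * x i).
Proof.
have [FG hFG] := ord_choice (R := fun i (FG : S * S) => π FG.2 != 0 /\ x i = π FG.1 / π FG.2)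
  (fun i => let: ex_intro F (ex_intro G h) := cone_frac (x i) in ex_intro _ (F, G) h).
exists (\prod_i (FG i).2).
  by rewrite rmorph_prod; apply/prodf_neq0 => i _; case: (hFG i).
move=> i; have [ni ->] := hFG i; rewrite (bigD1 i) //= piM [X in inA X](_ : _ = π (FG i).1 * π (\prod_(j < q | j != i) (FG j).2)).
  by apply: inAM; apply: inApi.
by field.
Qed.

Lemma dvecZ (h : Y) v (F : S) : dvec (fun i => h * v i) F = h * dvec v F.
Proof. by rewrite /dvec mulr_sumr; apply: eq_bigr => i _; rewrite mulrCA. Qed.

Lemma mderiv_homog (F : S) c i : F \is c.-homog -> mderiv i F \is c.-1.-homog.
Proof.
move=> hF; apply/dhomogP => m; rewrite mcoeff_msupp mcoeff_mderiv => nz.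
have : (m + U_(i))%MM \in msupp F.
  by rewrite mcoeff_msupp; apply: contraNneq nz => ->; rewrite mul0rn.
by move/(dhomog_mf hF) => /= <-; rewrite mdegD mdeg1 addn1.
Qed.

Lemma tangent_component (V : 'I_n.+1 -> S) d : tangent (fun i => π (V i)) ->
  tangent (fun i => π (pihomog mdeg d (V i))).
Proof.
move=> tV F F0; rewrite (pihomog_partitionE (leqnn (msize F))) dvec_sum big1 // => c _.
set Fc := pihomog mdeg c F; have hc : Fc \is (c : nat).-homog by apply: pihomogP.
have := tV _ (cone_homog c F0); rewrite -/Fc /dvec.
under eq_bigr => i _ do rewrite -piM.
rewrite -pi_sum => /(cone_homog (c.-1 + d)); rewrite pihomog_sum => E.
under eq_bigr => i _ do rewrite -piM.
rewrite -pi_sum -[RHS]E; congr (cproj Y _); apply: eq_bigr => i _.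
by rewrite (pihomogM_hom _ _ (mderiv_homog i hc)) leq_addr addKn.
Qed.

(** [Psi] is additive, so it is nonzero on some homogeneous component of the field, and the
    components are again tangent. *)
Lemma component_split (v : 'I_n.+1 -> Y) (V : 'I_n.+1 -> S) (Psi : ('I_3 -> Y) -> Y) (l : 'I_3 -> S) :
  (forall i, v i = π (V i)) -> tangent v ->
  (forall T (y : 'I_T -> 'I_3 -> Y), Psi (fun j => \sum_d y d j) = \sum_d Psi (y d)) ->
  (forall y y', y =1 y' -> Psi y = Psi y') ->
  Psi (fun j => dvec v (l j)) != 0 -> exists d (W : 'I_n.+1 -> S),
  [/\ forall i, W i \is d.-homog, tangent (fun i => π (W i)) &
      Psi (fun j => dvec (fun i => π (W i)) (l j)) != 0].
Proof.
move=> hv tv lin ext nz; apply: NNPP => no; case/eqP: nz.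
have tV : tangent (fun i => π (V i)).
  by move=> F h; rewrite -[RHS](tv F h); apply: eq_bigr => i _; rewrite hv.
pose T := \max_i msize (V i).
rewrite (ext _ (fun j => \sum_(d < T) dvec (fun i => π (pihomog mdeg d (V i))) (l j))).
  rewrite lin big1 // => d _; apply/eqP; apply: contra_notT no => nz.
  exists d, (fun i => pihomog mdeg d (V i)); split=> // [i|]; first exact: pihomogP.
  exact: tangent_component.
move=> j; rewrite /dvec exchange_big; apply: eq_bigr => i _ /=; rewrite -mulr_sumr -pi_sum hv.
by rewrite -pihomog_partitionE // leq_bigmax.
Qed.

Lemma dvec_hdg (W : 'I_n.+1 -> S) d F c : (forall i, W i \is d.-homog) -> F \is c.-homog ->
  hdg (c%:Z - 1 + d%:Z) (dvec (fun i => π (W i)) F).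
Proof.
move=> hW hF; have hN := nzden_class Y; case: c hF => [|c] hF.
  rewrite (_ : dvec _ _ = 0); first exact: (hloc0 hN).
  by rewrite -(pihomog_dE hF) pihomog0C dvecC.
apply: (hloc_sum hN) => i _.
rewrite (_ : c.+1%:Z - 1 + d%:Z = c%:Z + d%:Z); last by lia.
by apply: (hlocM hN); apply: (hloc_pi hN) => //; apply: (mderiv_homog i hF).
Qed.

Lemma cder_hdg (W : 'I_n.+1 -> S) d m x : (forall i, W i \is d.-homog) ->
  tangent (fun i => π (W i)) -> hdg m x -> hdg (m - 1 + d%:Z) (cder (fun i => π (W i)) x).
Proof.
move=> hW tW [F [G [c [c' [hF hG <- nG ->]]]]]; have hN := nzden_class Y.
rewrite cder_frac //.
have [hF' hG'] := (dvec_hdg hW hF, dvec_hdg hW hG).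
rewrite (_ : _ - 1 + d%:Z = (c%:Z - 1 + d%:Z + c'%:Z) + (- (c' + c')%N%:Z)); last by lia.
have hi : hdg (- (c' + c')%N%:Z) (π G ^+ 2)^-1.
  have nGG : nzden Y (G * G) by rewrite /nzden piM mulf_neq0.
  by rewrite expr2 -piM; apply: hloc_inv => //; apply: dhomogM.
apply: (hlocM hN) hi.
apply: (hlocB hN); first by apply: (hlocM hN) => //; apply: (hloc_pi hN).
rewrite (_ : _ + c'%:Z = c%:Z + (c'%:Z - 1 + d%:Z)); last by lia.
by apply: (hlocM hN) => //; apply: (hloc_pi hN).
Qed.

Lemma tangent_euler : tangent (fun i => π 'X_i) /\
  forall d F, F \is d.-homog -> dvec (fun i => π 'X_i) F = d%:R * π F.
Proof.
have H d F : F \is d.-homog -> dvec (fun i => π 'X_i) F = d%:R * π F.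
  move=> hF; rewrite [F]mpolyE dvec_sum pi_sum mulr_sumr big_seq [RHS]big_seq.
  apply: eq_bigr => m mF; have dm : mdeg m = d by exact: (dhomog_mf hF mF).
  rewrite -mul_mpolyC dvecM dvecC mulr0 addr0 piM mulrCA; congr (_ * _).
  rewrite /dvec -dm mdegE natr_sum mulr_suml; apply: eq_bigr => i _.
  rewrite mderivX piZ -mulrA -piM -mpolyXD.
  case E : (m i) => [|mi]; first by rewrite scal0 !mul0r.
  have -> : (m - U_(i) + U_(i))%MM = m.
    by rewrite submK // lep1mP E.
  congr (_ * _); elim: mi.+1 => [|q IH]; first exact: scal0.
  by rewrite -addn1 !natrD scalD IH scal1.
split=> // F F0; rewrite (pihomog_partitionE (leqnn (msize F))) dvec_sum big1 // => d _.
by rewrite (H _ _ (pihomogP mdeg d F)) (cone_homog d F0) mulr0.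
Qed.

Lemma kderZ h D : kder D -> @kder k n Y (fun x => h * D x).
Proof.
move=> [D1 D2 D3]; split=> [x y|x y|c]; rewrite ?D1 ?D2 ?D3; ring.
Qed.

(** Fields dual to [l_1] and [l_2] have determinant [l_0] together with the row of the [l_j].
    Clearing denominators and passing to homogeneous components keep a nonzero determinant; a power
    of [l_0] then brings both fields to degree 0, so that they act on the function field. *)
Theorem derivations_exist (chark : [pchar k] =i pred0) (l : 'I_3 -> S) (I : finType) (a : I -> nat) (e : I -> Y) :
  (forall i, l i \is 1.-homog) -> (forall i, π (l i) != 0) -> free_algebra l a e ->
  exists D1 D2, [/\ kder D1, kder D2, forall m x, hdg m x -> hdg m (D1 x),
    forall m x, hdg m x -> hdg m (D2 x) &
    det3 (fun j => π (l j)) (fun j => D1 (π (l j))) (fun j => D2 (π (l j))) != 0].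
Proof.
move=> hl nl fa; have hN := nzden_class Y.
have [v1 t1 E1] := tangent_dual fa chark (lift ord0 ord0).
have [v2 t2 E2] := tangent_dual fa chark ord_max.
have den v : tangent v -> exists h V, [/\ h != 0, forall i, h * v i = π (V i) & tangent (fun i => h * v i)].
  move=> tv; have [H nH hH] := common_den v.
  have [V hV] := ord_choice (R := fun i V => π H * v i = π V) hH.
  by exists (π H), V; split=> // F F0; rewrite dvecZ tv ?mulr0.
have [h1 [V1 [n1 EV1 t1']]] := den v1 t1; have [h2 [V2 [n2 EV2 t2']]] := den v2 t2.
have nz : det3 (fun j => π (l j)) (fun j => dvec (fun i => h1 * v1 i) (l j))
    (fun j => dvec (fun i => h2 * v2 i) (l j)) != 0.
  have b1 : (lift ord0 ord0 == ord0 :> 'I_3) = false by [].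
  have b2 : (lift ord0 ord0 == ord_max :> 'I_3) = false by [].
  have b3 : (ord_max == ord0 :> 'I_3) = false by [].
  have b4 : (ord_max == lift ord0 ord0 :> 'I_3) = false by [].
  rewrite (_ : det3 _ _ _ = π (l ord0) * (h1 * h2)); first by rewrite !mulf_neq0.
  by rewrite /det3 !dvecZ !E1 !E2 b1 b2 b3 b4 !eqxx /=; ring.
have [|y y' Ey|d1 [W1 [hW1 tW1 nz1]]] := component_split
    (Psi := fun y => det3 (fun j => π (l j)) y (fun j => dvec (fun i => h2 * v2 i) (l j))) EV1 t1' _ _ nz.
- by move=> T y; apply: det3_sum2.
- by rewrite /det3 !Ey.
have [|y y' Ey|d2 [W2 [hW2 tW2 nz2]]] := component_split
    (Psi := fun y => det3 (fun j => π (l j)) (fun j => dvec (fun i => π (W1 i)) (l j)) y) EV2 t2' _ _ nz1.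
- by move=> T y; apply: det3_sum3.
- by rewrite /det3 !Ey.
(* [u / u ^+ d] stands for the power [1 - d] of [u]: a field with coordinates of degree [d] raises
   degrees by [d - 1]. *)
pose u := π (l ord0); pose g d := u / u ^+ d.
have ng d : g d != 0 by rewrite mulf_neq0 ?invr_eq0 ?expf_neq0 // nl.
have hg d : hdg (1 - d%:Z) (g d).
  apply: (hlocM hN); first exact: (hloc_pi hN).
  rewrite /u -piX; apply: hloc_inv; last by rewrite /nzden piX expf_neq0 // nl.
  by have := dhomogMn d (hl ord0); rewrite mul1n.
exists (fun x => g d1 * cder (fun i => π (W1 i)) x), (fun x => g d2 * cder (fun i => π (W2 i)) x).
have dg d (W : 'I_n.+1 -> S) : (forall i, W i \is d.-homog) -> tangent (fun i => π (W i)) ->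
    forall m x, hdg m x -> hdg m (g d * cder (fun i => π (W i)) x).
  move=> hW tW m x hx; rewrite (_ : m = (1 - d%:Z) + (m - 1 + d%:Z)); last by lia.
  exact: (hlocM hN (hg d) (cder_hdg hW tW hx)).
split; [exact/kderZ/kder_cder|exact/kderZ/kder_cder|exact: dg|exact: dg|].
rewrite (_ : det3 _ _ _ = g d1 * g d2 * det3 (fun j => π (l j)) (fun j => dvec (fun i => π (W1 i)) (l j))
    (fun j => dvec (fun i => π (W2 i)) (l j))).
  by apply: mulf_neq0 nz2; apply: mulf_neq0; apply: ng.
by rewrite /det3 !(cder_pi tW1) !(cder_pi tW2); ring.
Qed.

End Homogeneous.

(** * Tensor square of the coordinate ring and its traces *)

Section LinExt.
Variables (K : comNzRingType) (N : nat) (W : lmodType K) (beta : 'X_{1.. N} -> W).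

Definition linext (Q : {mpoly K[N]}) : W := \sum_(m <- msupp Q) Q@_m *: beta m.

Lemma linext_super s (Q : {mpoly K[N]}) : uniq s -> {subset msupp Q <= s} ->
  \sum_(m <- s) Q@_m *: beta m = linext Q.
Proof.
move=> us sub; rewrite /linext (bigID (mem (msupp Q))) /= [X in _ + X]big1 ?addr0 => [|m nm].
  rewrite -big_filter; apply: perm_big; apply: uniq_perm; rewrite ?filter_uniq ?msupp_uniq //.
  by move=> m; rewrite mem_filter; apply: andb_idr; apply: sub.
by rewrite memN_msupp_eq0 ?scale0r.
Qed.

Lemma linextD Q Q' : linext (Q + Q') = linext Q + linext Q'.
Proof.
pose s := undup (msupp Q ++ msupp Q' ++ msupp (Q + Q')).
have us : uniq s by apply: undup_uniq.
rewrite -!(linext_super us) -?big_split => [|m h|m h|m h]; rewrite ?mem_undup ?mem_cat ?h ?orbT //.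
by apply: eq_bigr => m _; rewrite mcoeffD scalerDl.
Qed.

Lemma linext_mono m : linext 'X_[m] = beta m.
Proof. by rewrite /linext msuppX big_seq1 mcoeffX eqxx scale1r. Qed.

Lemma linextZ c Q : linext (c *: Q) = c *: linext Q.
Proof.
rewrite -(linext_super (msupp_uniq Q)); last exact: msuppZ_le.
by rewrite scaler_sumr; apply: eq_bigr => m _; rewrite mcoeffZ scalerA.
Qed.
End LinExt.

(** Nakayama's lemma at a point: the matrix of the relations becomes diagonal and invertible under
    [eps], and its determinant is a unit there that kills the [x i] modulo [I]. *)
Lemma determinant_trick (R : comNzRingType) (K : fieldType) (eps : {rmorphism R -> K})
    (I : R -> Prop) q (x : 'I_q -> R) (c : 'I_q -> R) (N : 'I_q -> 'I_q -> R) :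
  ideal I -> (forall i, eps (c i) != 0) -> (forall i j, eps (N i j) = 0) ->
  (forall i, I (c i * x i - \sum_j N i j * x j)) ->
  exists2 w, eps w != 0 & forall i, I (w * x i).
Proof.
move=> iI hc hN hI; pose M : 'M[R]_q := \matrix_(i, j) ((if i == j then c i else 0) - N i j).
exists (\det M).
  rewrite -det_map_mx (_ : map_mx _ _ = diag_mx (\row_i eps (c i))).
    by rewrite det_diag; apply/prodf_neq0 => i _; rewrite mxE.
  apply/matrixP => i j; rewrite !mxE rmorphB hN subr0.
  by case: eqP => [->|_]; rewrite ?mulr1n // rmorph0 mulr0n.
move=> i; have E j : \sum_i0 M j i0 * x i0 = c j * x j - \sum_j' N j j' * x j'.
  rewrite (_ : c j * x j = \sum_j' (if j == j' then c j else 0) * x j').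
    by rewrite -sumrB; apply: eq_bigr => j' _; rewrite mxE mulrBl.
  rewrite (bigD1 j) //= eqxx big1 ?addr0 // => j' /negPf h; rewrite eq_sym h mul0r //.
have -> : \det M * x i = \sum_j \adj M i j * (c j * x j - \sum_j' N j j' * x j').
  have <- : \sum_j (\adj M *m M) i j * x j = \det M * x i.
    rewrite mul_adj_mx (bigD1 i) //= big1 => [|j ji]; first by rewrite mxE eqxx mulr1n addr0.
    by rewrite mxE eq_sym (negPf ji) mulr0n mul0r.
  under eq_bigr => j _ do rewrite mxE mulr_suml.
  rewrite exchange_big /=; apply: eq_bigr => j _; rewrite -E mulr_sumr.
  by apply: eq_bigr => j' _; rewrite mulrA.
by apply: ideal_sum => // j _; have [_ _ h] := iI; apply: h.
Qed.

Lemma sub_mul (R : comNzRingType) (a b c d : R) : a * b - c * d = a * (b - d) + d * (a - c).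
Proof. ring. Qed.

Lemma sub_tensor (R : comNzRingType) (a b c d : R) : (a - b) * (c * d) = c * (a * d) + - (b * c) * d.
Proof. ring. Qed.

Section TensorSquare.
Variables (k : closedFieldType) (n : nat).
Local Notation S := {mpoly k[n.+1]}.
Definition square := {mpoly k[n.+1 + n.+1]}.
HB.instance Definition _ := GRing.ComNzRing.on square.
HB.instance Definition _ := GRing.Lmodule.on square.
Local Notation B := {mpoly k[n.+1 + n.+1]}.

Definition in0 : S -> B := mmap (@mpolyC (n.+1 + n.+1) k) (fun i => 'X_(lshift n.+1 i)).
Definition in1 : S -> B := mmap (@mpolyC (n.+1 + n.+1) k) (fun i => 'X_(rshift n.+1 i)).
HB.instance Definition _ := GRing.RMorphism.on in0.
HB.instance Definition _ := GRing.RMorphism.on in1.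

Definition fold2 (T : Type) (x y : 'I_n.+1 -> T) (i : 'I_(n.+1 + n.+1)) : T :=
  match split i with inl j => x j | inr j => y j end.
Lemma fold2l T (x y : 'I_n.+1 -> T) j : fold2 x y (lshift _ j) = x j.
Proof. by rewrite /fold2 (unsplitK (inl j)). Qed.
Lemma fold2r T (x y : 'I_n.+1 -> T) j : fold2 x y (rshift _ j) = y j.
Proof. by rewrite /fold2 (unsplitK (inr j)). Qed.

Definition mu : B -> S := mmap (@mpolyC n.+1 k) (fold2 (fun j => 'X_j) (fun j => 'X_j)).
HB.instance Definition _ := GRing.RMorphism.on mu.

Lemma in0C c : in0 c%:MP = c%:MP. Proof. by rewrite /in0 mmapC. Qed.
Lemma in1C c : in1 c%:MP = c%:MP. Proof. by rewrite /in1 mmapC. Qed.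
Lemma in0X i : in0 'X_i = 'X_(lshift _ i). Proof. by rewrite /in0 mmapX mmap1U. Qed.
Lemma in1X i : in1 'X_i = 'X_(rshift _ i). Proof. by rewrite /in1 mmapX mmap1U. Qed.
Lemma in0D F G : in0 (F + G) = in0 F + in0 G. Proof. exact: rmorphD. Qed.
Lemma in1D F G : in1 (F + G) = in1 F + in1 G. Proof. exact: rmorphD. Qed.
Lemma in0B F G : in0 (F - G) = in0 F - in0 G. Proof. exact: rmorphB. Qed.
Lemma in0N F : in0 (- F) = - in0 F. Proof. exact: rmorphN. Qed.
Lemma in1B F G : in1 (F - G) = in1 F - in1 G. Proof. exact: rmorphB. Qed.
Lemma in0M F G : in0 (F * G) = in0 F * in0 G. Proof. exact: rmorphM. Qed.
Lemma in1M F G : in1 (F * G) = in1 F * in1 G. Proof. exact: rmorphM. Qed.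
Lemma in0E F m : in0 (F ^+ m) = in0 F ^+ m. Proof. exact: rmorphXn. Qed.
Lemma in1E F m : in1 (F ^+ m) = in1 F ^+ m. Proof. exact: rmorphXn. Qed.
Lemma muD F G : mu (F + G) = mu F + mu G. Proof. exact: rmorphD. Qed.
Lemma muB F G : mu (F - G) = mu F - mu G. Proof. exact: rmorphB. Qed.
Lemma muM F G : mu (F * G) = mu F * mu G. Proof. exact: rmorphM. Qed.
Lemma mu1 : mu 1 = 1. Proof. exact: rmorph1. Qed.

Definition lmon (m : 'X_{1.. n.+1 + n.+1}) : 'X_{1.. n.+1} := [multinom m (lshift _ i) | i < n.+1].
Definition rmon (m : 'X_{1.. n.+1 + n.+1}) : 'X_{1.. n.+1} := [multinom m (rshift _ i) | i < n.+1].

Lemma mono_split m : 'X_[m] = in0 'X_[lmon m] * in1 'X_[rmon m].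
Proof.
rewrite mpolyXE_id big_split_ord /in0 /in1 !mmapX /mmap1 /=.
by congr (_ * _); apply: eq_bigr => i _; rewrite mnmE.
Qed.

Lemma mono_join a b : in0 'X_[a] * in1 'X_[b] = 'X_[[multinom fold2 a b i | i < n.+1 + n.+1]].
Proof.
rewrite mono_split; congr (in0 'X_[_] * in1 'X_[_]); apply/mnmP => i; rewrite !mnmE.
  by rewrite fold2l.
by rewrite fold2r.
Qed.

Lemma tensor_ind (P : B -> Prop) : (forall F G, P (in0 F * in1 G)) ->
  (forall Q Q', P Q -> P Q' -> P (Q + Q')) -> forall Q, P Q.
Proof.
move=> h hD Q; rewrite [Q]mpolyE; elim/big_rec: _ => [|m x _ Px].
  by have := h 0 0; rewrite rmorph0 mul0r.
apply: (hD) => //; rewrite mono_split -mul_mpolyC mulrA -in0C -in0M; exact: h.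
Qed.

Lemma muin0 F : mu (in0 F) = F.
Proof.
pose f : {rmorphism _ -> _} := mu \o in0.
apply: (mpoly_rmorph_ext (f := f) (g := idfun)) => [c|i] /=.
  by rewrite in0C /mu mmapC.
by rewrite in0X /mu mmapX mmap1U fold2l.
Qed.

Lemma muin1 F : mu (in1 F) = F.
Proof.
pose f : {rmorphism _ -> _} := mu \o in1.
apply: (mpoly_rmorph_ext (f := f) (g := idfun)) => [c|i] /=.
  by rewrite in1C /mu mmapC.
by rewrite in1X /mu mmapX mmap1U fold2r.
Qed.

Definition delta (F : S) : B := in1 F - in0 F.

Lemma deltaM F G : delta (F * G) = in1 F * delta G + in0 G * delta F.
Proof. by rewrite /delta in1M in0M; apply: sub_mul. Qed.

Lemma delta_telescope F : exists q, delta F = \sum_j q j * delta 'X_j.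
Proof.
elim/mpoly_alg_ind: F => [c|i|F G [q Eq] [q' Eq']|F G [q Eq] [q' Eq']].
- by exists (fun=> 0); rewrite /delta in0C in1C subrr big1 // => j _; rewrite mul0r.
- exists (fun j => if j == i then 1 else 0); rewrite (bigD1 i) //= eqxx mul1r big1 ?addr0 //.
  by move=> j /negPf ->; rewrite mul0r.
- exists (fun j => q j + q' j); rewrite (_ : delta _ = delta F + delta G).
    by rewrite Eq Eq' -big_split; apply: eq_bigr => j _; rewrite mulrDl.
  by rewrite /delta in0D in1D opprD addrACA.
- exists (fun j => in1 F * q' j + in0 G * q j); rewrite deltaM Eq Eq' !mulr_sumr -big_split.
  by apply: eq_bigr => j _ /=; rewrite mulrDl !mulrA.
Qed.

Lemma diagonal Q : exists q, Q - in0 (mu Q) = \sum_j q j * delta 'X_j.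
Proof.
elim/tensor_ind: Q => [F G|Q Q' [q Eq] [q' Eq']].
  have [q Eq] := delta_telescope G; exists (fun j => in0 F * q j).
  rewrite muM muin0 muin1 in0M -mulrBr -/(delta G) Eq mulr_sumr.
  by apply: eq_bigr => j _; rewrite mulrA.
exists (fun j => q j + q' j); rewrite muD in0D opprD addrACA Eq Eq' -big_split.
by apply: eq_bigr => j _; rewrite mulrDl.
Qed.

Variable p : 'I_n.+1 -> k.
Definition eps : B -> k := meval p \o mu.
HB.instance Definition _ := GRing.RMorphism.on eps.
Lemma eps0 F : eps (in0 F) = F.@[p]. Proof. by rewrite /eps /= muin0. Qed.
Lemma eps1 F : eps (in1 F) = F.@[p]. Proof. by rewrite /eps /= muin1. Qed.
Definition spec : B -> S := mmap (@mpolyC n.+1 k) (fold2 (fun j => (p j)%:MP) (fun j => 'X_j)).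
HB.instance Definition _ := GRing.RMorphism.on spec.

Lemma spec0 F : spec (in0 F) = (F.@[p])%:MP.
Proof.
pose f : {rmorphism _ -> _} := spec \o in0; pose g : {rmorphism _ -> _} := @mpolyC n.+1 k \o meval p.
apply: (mpoly_rmorph_ext (f := f) (g := g)) => [c|i] /=.
  by rewrite in0C /spec mmapC mevalC.
by rewrite in0X /spec mmapX mmap1U fold2l mevalXU.
Qed.

Lemma spec1 F : spec (in1 F) = F.
Proof.
pose f : {rmorphism _ -> _} := spec \o in1.
apply: (mpoly_rmorph_ext (f := f) (g := idfun)) => [c|i] /=.
  by rewrite in1C /spec mmapC.
by rewrite in1X /spec mmapX mmap1U fold2r.
Qed.

Lemma eps_spec Q : (spec Q).@[p] = eps Q.
Proof.
elim/tensor_ind: Q => [F G|Q Q' E E'].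
  by rewrite !rmorphM /= spec0 spec1 mevalC eps0 eps1.
by rewrite !rmorphD /= E E'.
Qed.
End TensorSquare.

Section Trace.
Variables (k : closedFieldType) (n : nat) (Y : cone k n).
Local Notation S := {mpoly k[n.+1]}.
Local Notation B := {mpoly k[n.+1 + n.+1]}.
Local Notation "'π' F" := (@cproj k n Y F) (at level 8, F at level 2).
Variable l : 'I_3 -> S.
Variables (I : finType) (a : I -> nat) (e : I -> Y).
Hypothesis fa : free_algebra l a e.

(* The functional of [L (x)_R A] induced by the j-th coordinate A -> R, lifted to S (x) S. *)
Definition trace (j : I) : B -> S :=
  linext (fun m => 'X_[lmon m] * subst_forms l (co l e (π 'X_[rmon m]) j)).

Lemma traceD j Q Q' : trace j (Q + Q') = trace j Q + trace j Q'.
Proof. exact: linextD. Qed.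

Lemma subst_coD j x y : inA x -> inA y ->
  subst_forms l (co l e (x + y) j) = subst_forms l (co l e x j) + subst_forms l (co l e y j).
Proof. by move=> hx hy; rewrite (coD fa) // rmorphD. Qed.

Lemma trace_tensor j F G : trace j (in0 F * in1 G) = F * subst_forms l (co l e (π G) j).
Proof.
have T0 : trace j 0 = 0 by rewrite /trace /linext msupp0 big_nil.
have C0 : subst_forms l (co l e 0 j) = 0.
  by have := co_rho fa 0 j (inA0 Y); rewrite mulr0 mul0r => ->; rewrite rmorph0.
have TZ c Q : trace j (c%:MP * Q) = c%:MP * trace j Q by rewrite !mul_mpolyC; apply: linextZ.
have step1 b : trace j (in0 F * in1 'X_[b]) = F * subst_forms l (co l e (π 'X_[b]) j).
  rewrite [F]mpolyE; elim/big_rec: _ => [|m x _ IH]; first by rewrite rmorph0 !mul0r T0.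
  rewrite in0D !mulrDl traceD IH; congr (_ + _).
  rewrite -!mul_mpolyC in0M in0C -mulrA TZ -mulrA; congr (_ * _).
  rewrite mono_join /trace linext_mono.
  rewrite (_ : lmon _ = m); last by apply/mnmP => i; rewrite !mnmE fold2l.
  by rewrite (_ : rmon _ = b) //; apply/mnmP => i; rewrite !mnmE fold2r.
rewrite [G]mpolyE; elim: (msupp G) => [|m s IH].
  by rewrite !big_nil rmorph0 mulr0 T0 pi0 C0 mulr0.
rewrite !big_cons in1D piD mulrDr traceD IH (subst_coD j (inApi _ _) (inApi _ _)) mulrDr.
congr (_ + _); rewrite -!mul_mpolyC in1M in1C mulrCA TZ step1 piM -/(scal Y _) (coZ fa).
  by rewrite rmorphM /= /subst_forms mmapC mulrCA.
exact: inApi.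
Qed.

Lemma trace_in0 j F Q : trace j (in0 F * Q) = F * trace j Q.
Proof.
elim/tensor_ind: Q => [G H|Q Q' E E'].
  by rewrite mulrA -in0M !trace_tensor mulrA.
by rewrite mulrDr !traceD E E' mulrDr.
Qed.

Lemma trace_ker j F Q : π F = 0 -> trace j (in1 F * Q) = 0.
Proof.
move=> F0; elim/tensor_ind: Q => [G H|Q Q' E E'].
  rewrite mulrCA -in1M trace_tensor piM F0 mul0r.
  by have := co_rho fa 0 j (inA0 Y); rewrite mulr0 mul0r => ->; rewrite rmorph0 mulr0.
by rewrite mulrDr traceD E E' addr0.
Qed.

Lemma trace_l j i Q : trace j (delta (l i) * Q) = 0.
Proof.
elim/tensor_ind: Q => [G H|Q Q' E E'].
  have -> : delta (l i) * (in0 G * in1 H) = in0 G * in1 (l i * H) + in0 (- (l i * G)) * in1 H.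
    by rewrite /delta in1M in0N in0M; apply: sub_tensor.
  rewrite traceD !trace_tensor piM -(rhoXi Y l) (co_rho fa) ?rmorphM /=; last exact: inApi.
  by rewrite /subst_forms mmapX mmap1U mulNr mulrA [G * l i]mulrC -mulrA subrr.
by rewrite mulrDr traceD E E' addr0.
Qed.

Lemma trace_in1 j C Q : trace j (in1 C * Q) =
  \sum_i subst_forms l (co l e (π C * e i) j) * trace i Q.
Proof.
elim/tensor_ind: Q => [G H|Q Q' E E'].
  rewrite mulrCA -in1M trace_tensor piM.
  have hH := inApi Y H; have hC := inApi Y C.
  rewrite [in LHS](coE fa hH) mulr_sumr.
  have -> : co l e (\sum_i π C * (rho Y l (co l e (π H) i) * e i)) j =
      \sum_i co l e (π H) i * co l e (π C * e i) j.
    apply: (co_uniq fa (c := fun j => \sum_i co l e (π H) i * co l e (π C * e i) j)).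
    under [RHS]eq_bigr => j' _ do rewrite rho_sum mulr_suml.
    rewrite exchange_big; apply: eq_bigr => i _ /=.
    rewrite mulrCA [in LHS](coE fa (inAM hC (inAe fa i))) mulr_sumr.
    by apply: eq_bigr => j' _; rewrite rhoM mulrA.
  rewrite rmorph_sum mulr_sumr; apply: eq_bigr => i _ /=.
  by rewrite rmorphM /= trace_tensor mulrA mulrC.
rewrite mulrDr traceD E E' -big_split; apply: eq_bigr => i _ /=.
by rewrite traceD mulrDr.
Qed.

(* Q (z, z') (z'_i - z_i) vanishes in L (x)_R A: such Q are multiples of the idempotent of the diagonal. *)
Definition diag_socle (Q : B) : Prop := forall j i Q', π (trace j (Q * delta 'X_i * Q')) = 0.

(** Modulo the ideal of the diagonal [Q'] equals [mu Q'] in the first factor ([diagonal]), and [Q]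
    kills that ideal. *)
Lemma socle_trace Q Q' j : diag_socle Q -> π (trace j (Q * Q')) = π (mu Q') * π (trace j Q).
Proof.
move=> hQ; have [q Eq] := diagonal Q'.
have -> : Q * Q' = in0 (mu Q') * Q + \sum_i Q * delta 'X_i * q i.
  rewrite -[in LHS](subrK (in0 (mu Q')) Q') Eq mulrDr addrC mulrC mulr_sumr; congr (_ + _).
  by apply: eq_bigr => i _; rewrite -mulrA [q i * _]mulrC.
rewrite traceD piD trace_in0 piM -[RHS]addr0; congr (_ + _).
elim/big_rec: _ => [|i x _ E]; last by rewrite traceD piD hQ E addr0.
by have := trace_in0 j 0 0; rewrite rmorph0 !mul0r => ->; rewrite pi0.
Qed.

(** The trace vectors of two socle elements are proportional. This lets the local choices at the
    points be compared with one global choice. *)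
Lemma socle_sym Q Q' j : diag_socle Q -> diag_socle Q' ->
  π (mu Q') * π (trace j Q) = π (mu Q) * π (trace j Q').
Proof. by move=> h h'; rewrite -!socle_trace // mulrC. Qed.
End Trace.

Section Ideals.
Variables (R : comNzRingType) (J : R -> Prop).
Hypothesis iJ : ideal J.

Lemma idD x y : J x -> J y -> J (x + y). Proof. by case: iJ => _ h _; apply: h. Qed.
Lemma idM a x : J x -> J (a * x). Proof. by case: iJ => _ _; apply. Qed.
Lemma idN x : J x -> J (- x). Proof. by rewrite -mulN1r; apply: idM. Qed.
Lemma idB x y : J x -> J y -> J (x - y). Proof. by move=> hx hy; apply: idD => //; apply: idN. Qed.
Lemma id_eq x y : J y -> J (x - y) -> J x.
Proof. by move=> hy h; rewrite -(subrK y x); apply: idD. Qed.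

Lemma ideal_extend (C : R -> Prop) q (y : 'I_q -> R) : ideal C ->
  ideal (fun x => exists al, (forall j, C (al j)) /\ J (x - \sum_j al j * y j)).
Proof.
move=> [C0 CD CM]; split.
- exists (fun=> 0); split=> //; rewrite big1 => [|j _]; first by rewrite subr0; case: iJ.
  by rewrite mul0r.
- move=> x x' [al [ha hx]] [al' [ha' hx']]; exists (fun j => al j + al' j).
  split=> [j|]; first exact: CD.
  rewrite (_ : _ - _ = (x - \sum_j al j * y j) + (x' - \sum_j al' j * y j)); first exact: idD.
  rewrite addrACA -opprD -big_split; congr (_ - _).
  by apply: eq_bigr => j _; rewrite mulrDl.
- move=> c x [al [ha hx]]; exists (fun j => c * al j); split=> [j|]; first exact: CM.
  rewrite (_ : _ - _ = c * (x - \sum_j al j * y j)); first exact: idM.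
  by rewrite mulrBr mulr_sumr; congr (_ - _); apply: eq_bigr => j _; rewrite mulrA.
Qed.

Lemma extend_sub (C : R -> Prop) q (y : 'I_q -> R) x : ideal C -> J x ->
  exists al, (forall j, C (al j)) /\ J (x - \sum_j al j * y j).
Proof.
move=> [C0 _ _] Jx; exists (fun=> 0); split=> //.
by rewrite big1 ?subr0 // => j _; rewrite mul0r.
Qed.

Lemma extend_gen (C : R -> Prop) q (y : 'I_q -> R) i c : ideal C -> C c ->
  exists al, (forall j, C (al j)) /\ J (c * y i - \sum_j al j * y j).
Proof.
move=> [C0 _ _] Cc; exists (fun j => if j == i then c else 0); split=> [j|]; first by case: ifP.
rewrite (bigD1 i) //= eqxx big1 ?addr0 ?subrr; first by case: iJ.
by move=> j /negPf ->; rewrite mul0r.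
Qed.

Lemma adj_comb q (M : 'M[R]_q) (y z : 'I_q -> R) : (forall i, J (z i - \sum_j M i j * y j)) ->
  forall j, J (\det M * y j - \sum_i \adj M j i * z i).
Proof.
move=> h j; have -> : \det M * y j = \sum_i \adj M j i * \sum_i0 M i i0 * y i0.
  have <- : \sum_i (\adj M *m M) j i * y i = \det M * y j.
    rewrite mul_adj_mx (bigD1 j) //= big1 => [|i ji]; first by rewrite mxE eqxx mulr1n addr0.
    by rewrite mxE eq_sym (negPf ji) mulr0n mul0r.
  under eq_bigr => i _ do rewrite mxE mulr_suml.
  rewrite exchange_big /=; apply: eq_bigr => i _; rewrite mulr_sumr.
  by apply: eq_bigr => j' _; rewrite mulrA.
rewrite -sumrB; apply: ideal_sum => // i _; rewrite -mulrBr -opprB mulrN.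
by apply: idN; apply: idM.
Qed.

(* [x0 x1] stand for the two copies of [x] in the tensor square. *)
Lemma delta_relation (w0 w1 a0 a1 b0 b1 F0 F1 G0 G1 H0 H1 : R) :
  J ((w1 * H1 - (a1 * F1 + b1 * G1)) - (w0 * H0 - (a0 * F0 + b0 * G0))) ->
  J ((w1 - w0) * H1) -> J ((a1 - a0) * F1) -> J ((b1 - b0) * G1) -> J (F1 - F0) -> J (G1 - G0) ->
  J (w0 * (H1 - H0)).
Proof.
move=> h1 h2 h3 h4 h5 h6.
have -> : w0 * (H1 - H0) = (((w1 * H1 - (a1 * F1 + b1 * G1)) - (w0 * H0 - (a0 * F0 + b0 * G0)))
  - (w1 - w0) * H1) + ((a1 - a0) * F1 + a0 * (F1 - F0)) + ((b1 - b0) * G1 + b0 * (G1 - G0)) by ring.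
by apply: idD; [apply: idD; [apply: idB|apply: idD => //; apply: idM]|apply: idD => //; apply: idM].
Qed.

Lemma solve_second (w a b b' x y : R) : J (w * (a * x - b * y)) -> J x -> b' * b = 1 -> J (w * y).
Proof.
move=> h hx E; have -> : w * y = (b' * w * a) * x - b' * (w * (a * x - b * y)).
  rewrite -[LHS]mul1r -E; ring.
by apply: idB; apply: idM.
Qed.

Lemma eliminate_second (c w a b x y : R) : J (w * (a * x - b * y)) -> J (c * y) -> J (c * w * a * x).
Proof.
move=> h hy; have -> : c * w * a * x = c * (w * (a * x - b * y)) + (w * b) * (c * y) by ring.
by apply: idD; apply: idM.
Qed.
End Ideals.

Lemma ideal_true (R : comNzRingType) : ideal (fun _ : R => True).
Proof. by []. Qed.

Lemma ideal_ker (R T : comNzRingType) (f : {rmorphism R -> T}) : ideal (fun x => f x = 0).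
Proof.
split=> [|x y hx hy|a x hx]; first exact: rmorph0.
  by rewrite rmorphD hx hy addr0.
by rewrite rmorphM hx mulr0.
Qed.

(** * Relations of the diagonal near a point *)

Section LocalRelation.
Variables (k : closedFieldType) (n : nat) (Y : cone k n).
Local Notation S := {mpoly k[n.+1]}.
Local Notation B := {mpoly k[n.+1 + n.+1]}.
Local Notation "'π' F" := (@cproj k n Y F) (at level 8, F at level 2).

Definition cmax (p : 'I_n.+1 -> k) (a : Y) : Prop :=
  exists F G : S, exists d : nat,
    [/\ F \is d.-homog, G \is d.-homog, F.@[p] = 0, G.@[p] != 0 & a = π F / π G].

Definition cparam (p : 'I_n.+1 -> k) (u v : Y) : Prop :=
  forall a, cmax p a <-> exists b c, [/\ stk 0 p b, stk 0 p c & a = b * u + c * v].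

Section Chi.
Variable D : Y -> Y.
Hypothesis hD : kder D.

(* [id (x) D] followed by multiplication. *)
Definition chi (Q : B) : Y := \sum_i π (mu (mderiv (rshift n.+1 i) Q)) * D (π 'X_i).

Lemma chiD Q Q' : chi (Q + Q') = chi Q + chi Q'.
Proof. by rewrite /chi -big_split; apply: eq_bigr => i _; rewrite mderivD muD piD mulrDl. Qed.

Lemma chiM Q Q' : chi (Q * Q') = π (mu Q) * chi Q' + π (mu Q') * chi Q.
Proof.
rewrite /chi !mulr_sumr -big_split; apply: eq_bigr => i _ /=.
by rewrite mderivM muD !muM piD !piM; ring.
Qed.

Lemma chiC c : chi c%:MP = 0.
Proof. by rewrite /chi big1 // => i _; rewrite mderivC rmorph0 pi0 mul0r. Qed.

Lemma chiN Q : chi (- Q) = - chi Q.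
Proof. by apply/eqP; rewrite -subr_eq0 opprK -chiD addNr -mpolyC0 chiC. Qed.

Lemma chi0 F : chi (in0 F) = 0.
Proof.
elim/mpoly_alg_ind: F => [c|i|F G hF hG|F G hF hG].
- by rewrite in0C chiC.
- rewrite in0X /chi big1 // => j _; rewrite mderivX mnmE.
  by rewrite (_ : (_ == _) = false) ?scale0r ?rmorph0 ?pi0 ?mul0r //; apply/eqP/eqP; rewrite eq_lrshift.
- by rewrite in0D chiD hF hG addr0.
- by rewrite in0M chiM hF hG !mulr0 addr0.
Qed.

Lemma chi1 F : chi (in1 F) = D (π F).
Proof.
have [hDD hDM hDC] := hD.
elim/mpoly_alg_ind: F => [c|i|F G hF hG|F G hF hG].
- by rewrite in1C chiC -/(scal Y c) hDC.
- rewrite in1X /chi (bigD1 i) //= big1 => [|j ji]; rewrite mderivX mnmE.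
    rewrite eqxx addr0 (_ : (_ - _)%MM = 0%MM) ?mpolyX0 ?scale1r ?mu1 ?pi1 ?mul1r //.
    by apply/mnmP => j; rewrite mnmBE subnn mnm0E.
  rewrite (_ : (_ == _) = false) ?scale0r ?rmorph0 ?pi0 ?mul0r //.
  by rewrite (inj_eq (@rshift_inj _ _)) eq_sym; apply: negPf.
- by rewrite in1D chiD hF hG piD hDD.
- by rewrite in1M chiM hF hG !muin1 piM hDM.
Qed.

Lemma chi_delta F : chi (delta F) = D (π F).
Proof. by rewrite /delta chiD chiN chi0 chi1 oppr0 addr0. Qed.
End Chi.

Variable l : 'I_3 -> S.
Variables (I : finType) (a : I -> nat) (e : I -> Y).
Hypothesis fa : free_algebra l a e.
Variable p : 'I_n.+1 -> k.
Hypothesis hp : onv Y p.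

(** This ideal contains the kernel of the map to the tensor square of the coordinate ring
    ([negligible0], [negligible1]) and stands in for it; it is cut out by the maps that are later
    applied to relations between differences. *)
Definition negligible (Q : B) : Prop :=
  [/\ forall j Q', π (trace l e j (Q * Q')) = 0, π (mu Q) = 0,
      forall D, kder D -> chi D Q = 0 & π (spec p Q) = 0].

Lemma trace0 j : trace l e j 0 = 0. Proof. by rewrite /trace /linext msupp0 big_nil. Qed.

Lemma ideal_negligible : ideal negligible.
Proof.
split.
- split=> [j Q'||D _|]; rewrite ?mul0r ?trace0 ?rmorph0 ?pi0 //.
  by rewrite -mpolyC0 chiC.
- move=> x y [h1 h2 h3 h4] [h1' h2' h3' h4']; split=> [j Q'||D hD|].
  + by rewrite mulrDl traceD piD h1 h1' addr0.
  + by rewrite muD piD h2 h2' addr0.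
  + by rewrite chiD h3 // h3' // addr0.
  + by rewrite rmorphD piD h4 h4' addr0.
- move=> c x [h1 h2 h3 h4]; split=> [j Q'||D hD|].
  + by rewrite -mulrA mulrCA h1.
  + by rewrite muM piM h2 mulr0.
  + by rewrite chiM h3 // h2 mulr0 mul0r addr0.
  + by rewrite rmorphM piM h4 mulr0.
Qed.

Lemma negligible0 F : π F = 0 -> negligible (in0 F).
Proof.
move=> F0; split=> [j Q'||D hD|]; first by rewrite (trace_in0 fa) piM F0 mul0r.
- by rewrite muin0.
- exact: chi0.
- by have [_ h] := hp; rewrite spec0 -/(scal Y _) (h F F0) scal0.
Qed.

Lemma negligible1 F : π F = 0 -> negligible (in1 F).
Proof.
move=> F0; split=> [j Q'||D hD|]; first by rewrite (trace_ker fa) // pi0.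
- by rewrite muin1.
- rewrite chi1 // F0; have [hDD _ _] := hD.
  by have := hDD 0 0; rewrite addr0 => E; rewrite -[LHS](addrK (D 0)) -E subrr.
- by rewrite spec1.
Qed.

Section Forms.
Variables (f : 'I_3 -> S) (q : nat).
Hypothesis chark : [pchar k] =i pred0.
Hypotheses (q0 : (0 < q)%N) (hf : forall j, f j \is q.-homog).
Let o0 : 'I_3 := ord0.
Let o1 : 'I_3 := lift ord0 ord0.
Let o2 : 'I_3 := ord_max.
Hypotheses (f0 : (f o0).@[p] = 0) (f1 : (f o1).@[p] = 0) (f2 : (f o2).@[p] != 0).
Hypothesis loc : forall H d, H \is d.-homog -> H.@[p] = 0 -> exists w b c,
  w.@[p] != 0 /\ π (w * H) = π (b * f o0 + c * f o1).

(** [dd] is generated by the differences of the [f j]. [qq] adds the differences of the variables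
    with coefficients vanishing at [p], the error term of Nakayama's lemma. The vacuous condition
    makes [dd] an instance of [ideal_extend]. *)
Let dd (Q : B) := exists al : 'I_3 -> B, (forall j : 'I_3, True) /\ negligible (Q - \sum_j al j * delta (f j)).
Let idd : ideal dd := ideal_extend ideal_negligible _ (ideal_true _).
Let qq (Q : B) := exists N : 'I_n.+1 -> B, (forall j, eps p (N j) = 0) /\ dd (Q - \sum_j N j * delta 'X_j).
Let iqq : ideal qq := ideal_extend idd _ (ideal_ker (eps p)).

Lemma neg_dd Q : negligible Q -> dd Q.
Proof. exact: (extend_sub (fun j => delta (f j)) (ideal_true _)). Qed.
Lemma dd_qq Q : dd Q -> qq Q.
Proof. exact: (extend_sub (fun j => delta 'X_j) (ideal_ker (eps p))). Qed.
Lemma dd_delta j : dd (delta (f j)).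
Proof. by rewrite -[delta _]mul1r; apply: (extend_gen ideal_negligible (fun j => delta (f j)) j (ideal_true _)). Qed.

Lemma qq_small c H : eps p c = 0 -> qq (delta H * c).
Proof.
move=> c0; have [t ->] := delta_telescope H; rewrite mulr_suml.
apply: ideal_sum => // j _; rewrite mulrC mulrA.
by apply: (extend_gen idd (fun j => delta 'X_j) j (ideal_ker (eps p))); rewrite rmorphM /= c0 mul0r.
Qed.

(** Up to a unit [w] at [p], the form [H] is a combination of [f_0] and [f_1]. Taking differences of
    this relation, every error is a difference times a factor that vanishes at [p]. *)
Lemma qq_form H d : H \is d.-homog -> H.@[p] = 0 -> exists2 w, w.@[p] != 0 & qq (in0 w * delta H).
Proof.
move=> hH H0; have [w [b [c [nw E]]]] := loc hH H0; exists w => //.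
have R0 : π (w * H - (b * f o0 + c * f o1)) = 0 by rewrite piB E subrr.
apply: (delta_relation iqq (w1 := in1 w) (a0 := in0 b) (a1 := in1 b) (b0 := in0 c) (b1 := in1 c)
   (F0 := in0 (f o0)) (F1 := in1 (f o0)) (G0 := in0 (f o1)) (G1 := in1 (f o1))).
- by rewrite -!in0M -!in1M -!in0D -!in1D -in0B -in1B; apply/dd_qq/neg_dd/(idB ideal_negligible);
    [apply: negligible1|apply: negligible0].
- by apply: (@qq_small (in1 H) w); rewrite eps1.
- by apply: (@qq_small (in1 (f o0)) b); rewrite eps1.
- by apply: (@qq_small (in1 (f o1)) c); rewrite eps1.
- exact/dd_qq/dd_delta.
- exact/dd_qq/dd_delta.
Qed.

Lemma deltaD (F G : S) : delta (F + G) = delta F + delta G.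
Proof. by rewrite /delta in0D in1D opprD addrACA. Qed.
Lemma deltaZ c (F : S) : delta (c *: F) = c%:MP * delta F.
Proof. by rewrite /delta -!mul_mpolyC in0M in1M in0C in1C mulrBr. Qed.
Lemma deltaB (F G : S) : delta (F - G) = delta F - delta G.
Proof. by rewrite deltaD -scaleN1r deltaZ mpolyCN mulN1r. Qed.

(** Near the diagonal point over [p] the differences of the [f j] generate the ideal of the
    diagonal. Forms vanishing at [p] are covered by [qq_form], the radial direction comes from [f_2]
    and a power of a variable nonzero at [p], and [determinant_trick] absorbs the errors. *)
Lemma local_coordinates : exists2 w, eps p w != 0 & forall H, dd (w * delta H).
Proof.
have [[i0 ni0] _] := hp; pose U : S := 'X_i0.
have hU : U ^+ q \is q.-homog by have := dhomogMn q (dhomogXi k i0); rewrite mul1n.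
pose HP := (p i0 ^+ q) *: f o2 - (f o2).@[p] *: U ^+ q.
have hHP : HP \is q.-homog by apply: rpredB; apply: rpredZ.
have HP0 : HP.@[p] = 0 by rewrite mevalB !mevalZ [(U ^+ q).@[p]]rmorphXn /= mevalXU mulrC subrr.
have [wP nwP hwP] := qq_form hHP HP0.
(* At [p] this cofactor takes the value [q] times a power of [p i0], nonzero in characteristic
   zero. *)
pose cof : B := \sum_(i < q) in1 U ^+ (q.-1 - i) * in0 U ^+ i.
have EU : delta (U ^+ q) = delta U * cof by rewrite /delta in0E in1E subrXX.
have q1 : qq (in0 wP * cof * delta U).
  have b1 : ((f o2).@[p]^-1)%:MP * ((f o2).@[p])%:MP = 1 :> B by rewrite -mpolyCM mulVf.
  have := hwP; rewrite deltaB !deltaZ => h.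
  have := solve_second iqq h (dd_qq (dd_delta o2)) b1.
  by rewrite EU [delta U * _]mulrC mulrA.
have e1 : eps p (in0 wP * cof) != 0.
  rewrite rmorphM /= eps0 mulf_neq0 // /cof rmorph_sum /=.
  under eq_bigr => i _ do rewrite rmorphM !rmorphXn /= eps0 eps1 mevalXU -exprD.
  rewrite (eq_bigr (fun=> p i0 ^+ q.-1)) => [|i _]; last first.
    by rewrite subnK // -ltnS prednK.
  by rewrite sumr_const card_ord -mulr_natr mulf_neq0 ?expf_neq0 // ((pcharf0P k).1 chark) -lt0n.
have key i : exists cN : B * ('I_n.+1 -> B), [/\ eps p cN.1 != 0, forall j, eps p (cN.2 j) = 0 &
    dd (cN.1 * delta 'X_i - \sum_j cN.2 j * delta 'X_j)].
  pose Hi : S := p i0 *: 'X_i - p i *: U.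
  have hHi : Hi \is 1.-homog by apply: rpredB; apply: rpredZ; apply: dhomogXi.
  have Hi0 : Hi.@[p] = 0 by rewrite mevalB !mevalZ !mevalXU mulrC subrr.
  have [w nw hw] := qq_form hHi Hi0.
  have h : qq (in0 wP * cof * in0 w * (p i0)%:MP * delta 'X_i).
    by have := hw; rewrite deltaB !deltaZ => hw'; apply: (eliminate_second iqq hw' q1).
  have [N [hN hd]] := h; exists (in0 wP * cof * in0 w * (p i0)%:MP, N); split=> //=.
  have eM x y : eps p (x * y) = eps p x * eps p y by exact: rmorphM.
  rewrite -in0C eM [eps p (_ * in0 w)]eM !eps0 mevalC.
  by apply: mulf_neq0 => //; apply: mulf_neq0.
have [cN hcN] := ord_choice key.
have [|||w nw hw] := @determinant_trick _ _ (eps p) dd _ (fun i => delta 'X_i)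
   (fun i => (cN i).1) (fun i => (cN i).2) idd.
- by move=> i; case: (hcN i).
- by move=> i; case: (hcN i).
- by move=> i; case: (hcN i).
exists w => // H; have [t ->] := delta_telescope H; rewrite mulr_sumr.
by apply: ideal_sum => // j _; rewrite mulrCA; apply: (idM idd).
Qed.

(** By the adjugate, [\det G] times a difference of the [f j] is a combination of differences of the
    [l i], which the traces kill; and [w] times any difference is a combination of those of the
    [f j]. *)
Theorem local_relation : exists (w : B) (G : 'M[B]_3), [/\ eps p w != 0,
  forall i, negligible (w * delta (l i) - \sum_j G i j * delta (f j)) &
  diag_socle l e (\det G * w)].
Proof.
have [w nw hw] := local_coordinates.
have [G hG] := ord_choice (fun i => hw (l i)).
pose M : 'M[B]_3 := \matrix_(i, j) G i j.
have hM i : negligible (w * delta (l i) - \sum_j M i j * delta (f j)).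
  by have [_] := hG i; under eq_bigr => j _ do rewrite -[G i j](mxE matrix_key (fun i j => G i j)).
exists w, M; split=> // j i Q'.
pose kk (Q : B) := forall j Q', π (trace l e j (Q * Q')) = 0.
have ikk : ideal kk.
  split=> [j' Q|x y hx hy j' Q|c x hx j' Q]; first by rewrite mul0r trace0 pi0.
    by rewrite mulrDl traceD piD hx hy addr0.
  by rewrite -mulrA mulrCA hx.
have nkk Q : negligible Q -> kk Q by case.
have lkk i' : kk (delta (l i')) by move=> j' Q; rewrite (trace_l fa) pi0.
have fkk j' : kk (\det M * delta (f j')).
  have := adj_comb ideal_negligible (M := M) (y := fun j => delta (f j)) hM j'.
  move/nkk; apply: (id_eq ikk); apply: ideal_sum => // i' _.
  by apply: (idM ikk); apply: (idM ikk).
have : kk (\det M * w * delta 'X_i).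
  have [al [_ h]] := hw 'X_i; rewrite -mulrA.
  have := idM ikk (\det M) (nkk _ h); rewrite mulrBr; apply: (id_eq ikk).
  rewrite mulr_sumr; apply: ideal_sum => // j' _; rewrite mulrCA.
  exact: (idM ikk).
exact.
Qed.
End Forms.
End LocalRelation.

(** * Determinants of order three and Wiebe's lemma *)

Section Det3.
Variable K : comNzRingType.
Let o0 : 'I_3 := ord0.
Let o1 : 'I_3 := lift ord0 ord0.
Let o2 : 'I_3 := ord_max.

Definition cdet (x y z : 'I_3 -> K) : K :=
  x o0 * (y o1 * z o2 - y o2 * z o1) - x o1 * (y o0 * z o2 - y o2 * z o0) +
  x o2 * (y o0 * z o1 - y o1 * z o0).

Definition mat3 (x y z : 'I_3 -> K) : 'M[K]_3 :=
  \matrix_(i, j) (if j == o0 then x i else if j == o1 then y i else z i).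

Lemma det_mx2 (M : 'M[K]_2) : \det M = M ord0 ord0 * M ord_max ord_max - M ord_max ord0 * M ord0 ord_max.
Proof.
rewrite (expand_det_col _ ord0) !big_ord_recl big_ord0 /cofactor !det_mx11 !mxE /= addr0.
rewrite expr0 mul1r expr1 mulN1r mulrN; congr (_ * M _ _ - M _ _ * M _ _); exact: val_inj.
Qed.

Lemma det_mx3 (M : 'M[K]_3) :
  \det M = cdet (fun i => M i o0) (fun i => M i o1) (fun i => M i o2).
Proof.
have E i : row' i (col' ord0 M) = \matrix_(i', j') M (lift i i') (lift ord0 j').
  by apply/matrixP => i' j'; rewrite !mxE.
rewrite (expand_det_col _ ord0) !big_ord_recl big_ord0 /cofactor !E !det_mx2 !mxE.
have e1 : lift ord0 (ord0 : 'I_2) = o1 by apply: val_inj.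
have e2 : lift ord0 (ord_max : 'I_2) = o2 by apply: val_inj.
have e3 : lift (lift ord0 ord0 : 'I_3) (ord0 : 'I_2) = o0 by apply: val_inj.
have e4 : lift (lift ord0 ord0 : 'I_3) (ord_max : 'I_2) = o2 by apply: val_inj.
have e5 : lift ord0 (lift ord0 (ord0 : 'I_1)) = o2 by apply: val_inj.
have e6 : lift o2 (ord0 : 'I_2) = o0 by apply: val_inj.
have e7 : lift o2 (ord_max : 'I_2) = o1 by apply: val_inj.
by rewrite ?e5 !e6 !e7 !e1 !e2 !e3 !e4 /cdet /= !exprS expr0; ring.
Qed.

Lemma det_mat3 x y z : \det (mat3 x y z) = cdet x y z.
Proof. by rewrite det_mx3 /cdet !mxE. Qed.

Lemma cdet_mul (w : K) (G : 'M[K]_3) (x y z x' y' z' : 'I_3 -> K) :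
  (forall i, w * x i = \sum_j G i j * x' j) -> (forall i, w * y i = \sum_j G i j * y' j) ->
  (forall i, w * z i = \sum_j G i j * z' j) -> w ^+ 3 * cdet x y z = \det G * cdet x' y' z'.
Proof.
move=> hx hy hz; rewrite -!det_mat3 -det_mulmx -detZ; congr (\det _).
apply/matrixP => i j; rewrite !mxE.
under eq_bigr => j' _ do rewrite mxE.
by do 2?[case: eqP => _].
Qed.

(** The rows are permuted cyclically, so that the expansion can start with row [i0] without a change
    of sign. *)
Lemma cdet_cyclic (G : 'M[K]_3) i0 : exists i1 i2, [/\ i0 != i1, i0 != i2, i1 != i2,
  (forall i, [\/ i = i0, i = i1 | i = i2]) &
  \det G = G i0 o2 * (G i1 o0 * G i2 o1 - G i1 o1 * G i2 o0)
     - G i1 o2 * (G i0 o0 * G i2 o1 - G i0 o1 * G i2 o0)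
     + G i2 o2 * (G i0 o0 * G i1 o1 - G i0 o1 * G i1 o0)].
Proof.
rewrite det_mx3 /cdet; have [->|[->|->]] := ord3P i0.
- by exists o1, o2; split=> //; [move=> i; case: (ord3P i) => [|[]]; [constructor 1|constructor 2|constructor 3]|ring].
- by exists o2, o0; split=> //; [move=> i; case: (ord3P i) => [|[]]; [constructor 3|constructor 1|constructor 2]|ring].
- by exists o0, o1; split=> //; [move=> i; case: (ord3P i) => [|[]]; [constructor 2|constructor 3|constructor 1]|ring].
Qed.
End Det3.

Section Wiebe.
Variables (R : comNzRingType) (J : R -> Prop) (x1 x2 : R).
Hypothesis iJ : ideal J.
Hypothesis reg1 : forall a, J (x1 * a) -> J a.
Hypothesis koszul : forall a b, J (a * x1 + b * x2) -> exists s, J (a - s * x2) /\ J (b + s * x1).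

(* Wiebe's lemma in two variables: if [w x = M (u, v)] with [x1, x2] regular, then
   [det M] is not in [(x1, x2)] at the zeros of [u, v]. *)
Lemma wiebe2 (w h al be ga de u v a b : R) :
  J (w * x1 - (al * u + be * v)) -> J (w * x2 - (ga * u + de * v)) ->
  J (h * (al * de - be * ga) - (a * x1 + b * x2)) ->
  exists s t, J (h * w ^+ 2 - (t * u + s * v)).
Proof.
move=> E1 E2 E3.
have K1 : J ((h * w * de - a * u) * x1 + - (h * w * be + b * u) * x2).
  have -> : (h * w * de - a * u) * x1 + - (h * w * be + b * u) * x2 =
    (h * de) * (w * x1 - (al * u + be * v)) - (h * be) * (w * x2 - (ga * u + de * v))
    + u * (h * (al * de - be * ga) - (a * x1 + b * x2)) by ring.
  by apply: (idD iJ); [apply: (idB iJ); apply: (idM iJ)|apply: (idM iJ)].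
have K2 : J ((h * w * ga + a * v) * x1 + (b * v - h * w * al) * x2).
  have -> : (h * w * ga + a * v) * x1 + (b * v - h * w * al) * x2 =
    (h * ga) * (w * x1 - (al * u + be * v)) - (h * al) * (w * x2 - (ga * u + de * v))
    - v * (h * (al * de - be * ga) - (a * x1 + b * x2)) by ring.
  by apply: (idB iJ); [apply: (idB iJ); apply: (idM iJ)|apply: (idM iJ)].
have [s [_ S2]] := koszul K1; have [t [_ T2]] := koszul K2.
exists s, t; apply: reg1.
have -> : x1 * (h * w ^+ 2 - (t * u + s * v)) =
   (h * w) * (w * x1 - (al * u + be * v)) - v * (- (h * w * be + b * u) + s * x1)
   - u * (b * v - h * w * al + t * x1) by ring.
by apply: (idB iJ); [apply: (idB iJ)|]; apply: (idM iJ).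
Qed.

(** Modulo [x0] the relation for [i0] expresses [g y] through [u] and [v]. Eliminating [y] from the
    two others, multiplied by [g], leaves the situation of [wiebe2], with [g] times the old
    determinant. *)
Lemma wiebe3 (w h x0 y g u v : R) (G : 'I_3 -> 'I_3 -> R) (i0 i1 i2 o0 o1 o2 : 'I_3) a b :
  J x0 -> g = G i0 o2 ->
  J (w * x0 - (G i0 o0 * u + G i0 o1 * v + G i0 o2 * y)) ->
  J (w * x1 - (G i1 o0 * u + G i1 o1 * v + G i1 o2 * y)) ->
  J (w * x2 - (G i2 o0 * u + G i2 o1 * v + G i2 o2 * y)) ->
  J ((G i0 o2 * (G i1 o0 * G i2 o1 - G i1 o1 * G i2 o0)
     - G i1 o2 * (G i0 o0 * G i2 o1 - G i0 o1 * G i2 o0)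
     + G i2 o2 * (G i0 o0 * G i1 o1 - G i0 o1 * G i1 o0)) * h - (a * x1 + b * x2)) ->
  exists s t, J (h * (g * w) ^+ 2 - (t * u + s * v)).
Proof.
move=> J0 -> E0 E1 E2 E3; set g0 := G i0 o2.
have F0 : J (G i0 o0 * u + G i0 o1 * v + g0 * y).
  rewrite -[X in J X](subKr (w * x0)); apply: (idB iJ) => //; exact: (idM iJ).
apply: (@wiebe2 (g0 * w) h (g0 * G i1 o0 - G i1 o2 * G i0 o0) (g0 * G i1 o1 - G i1 o2 * G i0 o1)
  (g0 * G i2 o0 - G i2 o2 * G i0 o0) (g0 * G i2 o1 - G i2 o2 * G i0 o1) u v (g0 * a) (g0 * b)).
- apply: (id_eq iJ (y := g0 * (w * x1 - (G i1 o0 * u + G i1 o1 * v + G i1 o2 * y)))); first exact: (idM iJ).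
  have -> : g0 * w * x1 - ((g0 * G i1 o0 - G i1 o2 * G i0 o0) * u + (g0 * G i1 o1 - G i1 o2 * G i0 o1) * v)
    - g0 * (w * x1 - (G i1 o0 * u + G i1 o1 * v + G i1 o2 * y)) =
    G i1 o2 * (G i0 o0 * u + G i0 o1 * v + g0 * y) by ring.
  exact: (idM iJ).
- apply: (id_eq iJ (y := g0 * (w * x2 - (G i2 o0 * u + G i2 o1 * v + G i2 o2 * y)))); first exact: (idM iJ).
  have -> : g0 * w * x2 - ((g0 * G i2 o0 - G i2 o2 * G i0 o0) * u + (g0 * G i2 o1 - G i2 o2 * G i0 o1) * v)
    - g0 * (w * x2 - (G i2 o0 * u + G i2 o1 * v + G i2 o2 * y)) =
    G i2 o2 * (G i0 o0 * u + G i0 o1 * v + g0 * y) by ring.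
  exact: (idM iJ).
- move: E3; rewrite -/g0 => /(idM iJ g0); congr J; ring.
Qed.
End Wiebe.

Section Coordinates.
Variable K : fieldType.
Local Notation P := {mpoly K[3]}.

Definition setvar (i : 'I_3) (c : K) : P -> P :=
  mmap (@mpolyC 3 K) (fun j => if j == i then c%:MP else 'X_j).
HB.instance Definition _ i c := GRing.RMorphism.on (setvar i c).

Lemma setvarM i c F G : setvar i c (F * G) = setvar i c F * setvar i c G.
Proof. exact: rmorphM. Qed.
Lemma setvarD i c F G : setvar i c (F + G) = setvar i c F + setvar i c G.
Proof. exact: rmorphD. Qed.
Lemma setvarX i c j : setvar i c 'X_j = if j == i then c%:MP else 'X_j.
Proof. by rewrite /setvar mmapX mmap1U. Qed.
Lemma setvarC i c d : setvar i c d%:MP = d%:MP.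
Proof. by rewrite /setvar mmapC. Qed.

Lemma setvar_div i c F : exists Q, F - setvar i c F = ('X_i - c%:MP) * Q.
Proof.
elim/mpoly_alg_ind: F => [d|j|F G [Q E] [Q' E']|F G [Q E] [Q' E']].
- by exists 0; rewrite setvarC subrr mulr0.
- rewrite setvarX; case: eqP => [->|_]; first by exists 1; rewrite mulr1.
  by exists 0; rewrite subrr mulr0.
- by exists (Q + Q'); rewrite setvarD opprD addrACA E E' mulrDr.
- exists (F * Q' + setvar i c G * Q); rewrite setvarM sub_mul E E'.
  by rewrite mulrDr mulrCA [RHS]addrC [in RHS]mulrCA addrC.
Qed.

Definition shift (c : 'I_3 -> K) i : P := 'X_i - (c i)%:MP.

Lemma shift_neq0 c i : shift c i != 0.
Proof.
apply/eqP => E; have := congr1 (fun F : P => F@_(U_(i))%MM) E.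
rewrite /shift mcoeffB mcoeffX eqxx mcoeffC mcoeff0 (_ : (_ == _) = false) ?mulr0 ?subr0.
  by move/eqP; rewrite oner_eq0.
by apply/eqP => h; have := congr1 (@mdeg 3) h; rewrite mdeg1 mdeg0.
Qed.

Lemma setvar_shift c i j : i != j -> setvar i (c i) (shift c j) = shift c j.
Proof.
move=> ij; rewrite /shift rmorphB /= setvarX setvarC eq_sym (negPf ij) //.
Qed.

Lemma setvar_shift0 c i : setvar i (c i) (shift c i) = 0.
Proof. by rewrite /shift rmorphB /= setvarX setvarC eqxx subrr. Qed.

Lemma setvar0_div c i F : setvar i (c i) F = 0 -> exists Q, F = shift c i * Q.
Proof. by move=> E; have [Q] := setvar_div i (c i) F; rewrite E subr0; exists Q. Qed.

Lemma shift_regular c i j F G : i != j -> shift c j * F = shift c i * G -> exists Q, F = shift c i * Q.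
Proof.
move=> ij E; apply: setvar0_div.
have := congr1 (setvar i (c i)) E; rewrite !setvarM setvar_shift0 mul0r setvar_shift // => /eqP.
by rewrite mulf_eq0 (negPf (shift_neq0 c j)) => /eqP.
Qed.

(** Modulo [shift c i] the two other linear forms stay coprime, which is seen by substituting [c i]
    for the variable. *)
Lemma shift_koszul c i j h F G H : i != j -> i != h -> j != h ->
  F * shift c j + G * shift c h = H * shift c i ->
  exists s Q Q', F = s * shift c h + shift c i * Q /\ G = - (s * shift c j) + shift c i * Q'.
Proof.
move=> ij ih jh E; pose s0 := setvar i (c i).
have E1 : s0 F * shift c j + s0 G * shift c h = 0.
  have := congr1 s0 E; rewrite /s0 setvarD !setvarM setvar_shift0 mulr0.
  by rewrite !setvar_shift.
have [Q EQ] : exists Q, s0 G = shift c j * Q.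
  apply: (@shift_regular c j h _ (- s0 F)) => //.
  by apply/eqP; rewrite mulrN -addr_eq0 addrC [shift c j * _]mulrC [shift c h * _]mulrC E1.
have EF : s0 F = - Q * shift c h.
  apply: (mulfI (shift_neq0 c j)); rewrite mulrC; apply/eqP; rewrite -subr_eq0 -[X in _ == X]E1 EQ.
  by apply/eqP; rewrite mulrA mulrN mulNr opprK.
have [QF EQF] := setvar_div i (c i) F; have [QG EQG] := setvar_div i (c i) G.
exists (- Q), QF, QG; split; first by rewrite -EF -[LHS](subrK (s0 F)) EQF addrC.
by rewrite mulNr opprK [Q * _]mulrC -EQ -[LHS](subrK (s0 G)) EQG addrC.
Qed.
End Coordinates.

(** * Jacobian and trace form at a point *)

Section LocalData.
Variables (k : closedFieldType) (n : nat) (Y : cone k n).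
Local Notation S := {mpoly k[n.+1]}.
Local Notation B := {mpoly k[n.+1 + n.+1]}.
Local Notation "'π' F" := (@cproj k n Y F) (at level 8, F at level 2).
Local Notation o0 := (ord0 : 'I_3).
Local Notation o1 := (lift ord0 ord0 : 'I_3).
Local Notation o2 := (ord_max : 'I_3).
Hypothesis chark : [pchar k] =i pred0.
Variable l : 'I_3 -> S.
Hypothesis hl : forall i, l i \is 1.-homog.
Variables (I : finType) (a : I -> nat) (e : I -> Y).
Hypothesis fa : free_algebra l a e.
Variable p : 'I_n.+1 -> k.
Hypothesis hp : onv Y p.
Hypothesis lp : exists i, (l i).@[p] != 0.

Lemma param_forms u v : cparam p u v -> exists (f : 'I_3 -> S) q,
  [/\ (0 < q)%N, forall j, f j \is q.-homog,
      [/\ (f o0).@[p] = 0, (f o1).@[p] = 0 & (f o2).@[p] != 0],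
      u = π (f o0) / π (f o2) /\ v = π (f o1) / π (f o2) &
      forall H d, H \is d.-homog -> H.@[p] = 0 -> exists w b c,
        w.@[p] != 0 /\ π (w * H) = π (b * f o0 + c * f o1)].
Proof.
move=> huv; have [[i0 ni0] _] := hp; pose U : S := 'X_i0.
have hU : U \is 1.-homog by apply: dhomogXi.
have [st0 st1] : stk 0 p (0 : Y) /\ stk 0 p (1 : Y).
  by split; [apply: (hloc0 (ptden_class hp))|apply: (hloc1 (ptden_class hp))].
have [F1 [G1 [d1 [hF1 hG1 F1p G1p Eu]]]] : cmax p u.
  by apply/huv; exists 1, 0; split=> //; rewrite mul1r mul0r addr0.
have [F2 [G2 [d2 [hF2 hG2 F2p G2p Ev]]]] : cmax p v.
  by apply/huv; exists 0, 1; split=> //; rewrite mul1r mul0r add0r.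
have [n1 n2] := (onv_nz hp G1p, onv_nz hp G2p).
have Up : U.@[p] != 0 by rewrite mevalXU.
have nU := onv_nz hp Up.
(* A common denominator of [u] and [v]; the factor [U] makes the common degree positive. *)
pose f (j : 'I_3) : S := if j == o0 then F1 * G2 * U else if j == o1 then F2 * G1 * U else G1 * G2 * U.
have Eu' : u = π (f o0) / π (f o2) by rewrite Eu /f !piM; field; rewrite n1 n2 nU.
have Ev' : v = π (f o1) / π (f o2) by rewrite Ev /f !piM; field; rewrite n1 n2 nU.
exists f, (d1 + d2 + 1)%N; split=> //; first by rewrite addn1.
- move=> j; rewrite /f; case: eqP => _; first by do 2?apply: dhomogM.
  case: eqP => _; first by rewrite [(d1 + d2)%N]addnC; do 2?apply: dhomogM.
  by do 2?apply: dhomogM.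
- by rewrite /f /= !mevalM F1p F2p !mul0r !mulf_neq0.
move=> H d hH Hp; have hUd : U ^+ d \is d.-homog by have := dhomogMn d hU; rewrite mul1n.
have Udp : (U ^+ d).@[p] != 0 by rewrite rmorphXn /= expf_neq0.
have /huv[b [c [[b2 [b3 [? [? [_ _ _ b3p Eb]]]]] [c2 [c3 [? [? [_ _ _ c3p Ec]]]]] E]]] :
    cmax p (π H / π (U ^+ d)) by exists H, (U ^+ d), d.
exists (b3 * c3 * f o2), (b2 * c3 * U ^+ d), (c2 * b3 * U ^+ d); split.
  by rewrite /f /= !mevalM !mulf_neq0.
have [nb nc] := (onv_nz hp b3p, onv_nz hp c3p); have nUd := onv_nz hp Udp.
have n3 : π (f o2) != 0 by rewrite /f /= !piM !mulf_neq0.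
clearbody f.
have -> : π (b3 * c3 * f o2 * H) = π b3 * π c3 * π (f o2) * π (U ^+ d) * (π H / π (U ^+ d)).
  by rewrite !piM; field.
by rewrite E Eb Ec Eu' Ev' piD !piM; field; rewrite nb nc n3.
Qed.

Variables (u v : Y).
Hypothesis huv : cparam p u v.

(* [w], [G] express the differences of the [l i] through those of [F, G, P] with [u = F/P], [v = G/P]. *)
Record local_data (w : B) (G : 'M[B]_3) (f : 'I_3 -> S) (q : nat) : Prop := LocalData {
  ld_pos : (0 < q)%N;
  ld_homog : forall j, f j \is q.-homog;
  ld_val : [/\ (f o0).@[p] = 0, (f o1).@[p] = 0 & (f o2).@[p] != 0];
  ld_frac : u = π (f o0) / π (f o2) /\ v = π (f o1) / π (f o2);
  ld_unit : eps p w != 0;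
  ld_rel : forall i, negligible l e p (w * delta (l i) - \sum_j G i j * delta (f j));
  ld_socle : diag_socle l e (\det G * w) }.

Lemma local_data_exists : exists w G f q, local_data w G f q.
Proof.
have [f [q [q0 hf [f0 f1 f2] fr loc]]] := param_forms huv.
have [w [G [nw hG sc]]] := local_relation fa hp chark q0 hf f0 f1 f2 loc.
by exists w, G, f, q; split.
Qed.

Variables (w : B) (G : 'M[B]_3) (f : 'I_3 -> S) (q : nat).
Hypothesis ld : local_data w G f q.

Lemma ld_chi D i : kder D -> π (mu w) * D (π (l i)) = \sum_j π (mu (G i j)) * D (π (f j)).
Proof.
move=> hD; have [_ _ /(_ D hD) h _] := ld_rel ld i.
have mud H : mu (delta H) = 0 :> S by rewrite /delta muB muin0 muin1 subrr.
move: h; rewrite chiD chiN chiM mud pi0 mul0r addr0 (chi_delta hD) => /eqP.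
rewrite subr_eq0 => /eqP ->; elim/big_rec2: _ => [|j x y _ E]; first by rewrite -mpolyC0 chiC.
by rewrite chiD E chiM mud pi0 mul0r addr0 (chi_delta hD).
Qed.

Lemma ld_theta D0 D1 D2 : kder D0 -> kder D1 -> kder D2 ->
  π (mu w) ^+ 3 * cdet (fun i => D0 (π (l i))) (fun i => D1 (π (l i))) (fun i => D2 (π (l i))) =
  π (mu (\det G)) * cdet (fun i => D0 (π (f i))) (fun i => D1 (π (f i))) (fun i => D2 (π (f i))).
Proof.
move=> h0 h1 h2; pose f' := @cproj k n Y \o @mu k n.
have -> : π (mu (\det G)) = \det (map_mx f' G) by rewrite det_map_mx.
by apply: cdet_mul => i; rewrite (@ld_chi _ i) //; apply: eq_bigr => j _; rewrite mxE.
Qed.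

Lemma nf2 : π (f o2) != 0.
Proof. by have [_ _ h] := ld_val ld; apply: onv_nz hp h. Qed.

Lemma nmuw : π (mu w) != 0.
Proof. by apply: (onv_nz hp); rewrite -[_.@[p]]/(eps p w) (ld_unit ld). Qed.

(** [ld_theta] with the Euler field as first derivation: it multiplies the [l i] by 1 and the [f i]
    by [q], and the determinant of the [f i] becomes the wedge of the quotients [u] and [v]. So
    [\det G] on the diagonal is the Jacobian of the [l i], up to units. *)
Lemma ld_wedge D1 D2 : kder D1 -> kder D2 ->
  π (mu w) ^+ 3 * cdet (fun i => π (l i)) (fun i => D1 (π (l i))) (fun i => D2 (π (l i))) =
  π (mu (\det G)) * (q%:R * π (f o2) ^+ 3 * (D1 u * D2 v - D1 v * D2 u)).
Proof.
move=> h1 h2; have [tE EE] := tangent_euler Y.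
have := ld_theta (kder_cder tE) h1 h2.
have El i : cder (fun i => π 'X_i) (π (l i)) = π (l i).
  by rewrite cder_pi // (EE _ _ (hl i)) mul1r.
have Ef i : cder (fun i => π 'X_i) (π (f i)) = q%:R * π (f i).
  by rewrite cder_pi // (EE _ _ (ld_homog ld i)).
have -> : cdet (fun i => cder (fun i => π 'X_i) (π (l i))) (fun i => D1 (π (l i))) (fun i => D2 (π (l i))) =
   cdet (fun i => π (l i)) (fun i => D1 (π (l i))) (fun i => D2 (π (l i))) by rewrite /cdet !El.
move=> ->; congr (_ * _).
have [Eu Ev] := ld_frac ld; have n2 := nf2.
have F0 : π (f o0) = u * π (f o2) by rewrite Eu divfK.
have F1 : π (f o1) = v * π (f o2) by rewrite Ev divfK.
have [_ m1 _] := h1; have [_ m2 _] := h2.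
by rewrite /cdet !Ef F0 F1 !m1 !m2; ring.
Qed.

(* Euler's formula for the relation between [l i] and [P]. *)
Lemma ld_radial i : eps p w * (l i).@[p] = eps p (G i o2) * (q%:R * (f o2).@[p]).
Proof.
have [tE EE] := tangent_euler Y; have := ld_chi i (kder_cder tE).
rewrite cder_pi // (EE _ _ (hl i)) mul1r -piM.
have -> : \sum_j π (mu (G i j)) * cder (fun i => π 'X_i) (π (f j)) =
   π (\sum_j mu (G i j) * (q%:R%:MP * f j)).
  rewrite pi_sum; apply: eq_bigr => j _; rewrite cder_pi // (EE _ _ (ld_homog ld j)) !piM.
  by congr (_ * (_ * _)); rewrite -/(scal Y q%:R); elim: (q) => [|m IH]; rewrite ?scal0 // -addn1 !natrD scalD -IH scal1.
have [f0 f1 _] := ld_val ld.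
move/(onv_eval hp); rewrite mevalM sum3 !mevalD !mevalM !mevalC f0 f1 !mulr0 !add0r; exact.
Qed.

Let x i : S := l i - ((l i).@[p])%:MP.

Lemma ld_spec i : π (spec p w) * π (x i) =
  \sum_j π (spec p (G i j)) * π (f j - ((f j).@[p])%:MP).
Proof.
have [_ _ _] := ld_rel ld i.
have sd H : spec p (delta H) = H - (H.@[p])%:MP by rewrite rmorphB /= spec0 spec1.
rewrite rmorphB /= rmorphM /= sd piB piM => /eqP; rewrite subr_eq0 => /eqP ->.
rewrite [spec p (\sum_(j < 3) _)]rmorph_sum /= pi_sum; apply: eq_bigr => j _.
by rewrite rmorphM /= sd piM.
Qed.

Lemma ld_spec_rel i : π (spec p w * x i - (spec p (G i o0) * f o0 + spec p (G i o1) * f o1 +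
   spec p (G i o2) * (f o2 - ((f o2).@[p])%:MP))) = 0.
Proof.
have [f0 f1 _] := ld_val ld; rewrite piB piM ld_spec sum3 f0 f1 mpolyC0 !subr0.
by rewrite !(piD, piM) subrr.
Qed.

(* The [x i] generate the ideal of the fibre through [p] of the projection by [l]. *)
Lemma subst_shift (c : {mpoly k[3]}) : exists t : 'I_3 -> S,
  subst_forms l c - (c.@[fun i => (l i).@[p]])%:MP = \sum_i t i * x i.
Proof.
elim/mpoly_alg_ind: c => [d|i|F H [t E] [t' E']|F H [t E] [t' E']].
- by exists (fun=> 0); rewrite /subst_forms mmapC mevalC subrr big1 // => i _; rewrite mul0r.
- exists (fun j => (j == i)%:R); rewrite /subst_forms mmapX mmap1U mevalXU (bigD1 i) //=.
  by rewrite eqxx mul1r big1 ?addr0 // => j /negPf ->; rewrite mul0r.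
- exists (fun i => t i + t' i); rewrite rmorphD mevalD mpolyCD opprD addrACA /= E E' -big_split.
  by apply: eq_bigr => i _; rewrite mulrDl.
- exists (fun i => subst_forms l F * t' i + (H.@[fun i => (l i).@[p]])%:MP * t i).
  rewrite rmorphM mevalM mpolyCM sub_mul /= E E' !mulr_sumr -big_split.
  by apply: eq_bigr => i _; rewrite /= mulrDl !mulrA.
Qed.

(** On the fibre through [p] of the projection by [l], functions are combinations of the [e j] with
    constant coefficients; for [spec p Q] these constants are the traces at [p]. *)
Lemma spec_trace Q : exists t : 'I_3 -> S,
  π (spec p Q) = \sum_j scal Y (trace l e j Q).@[p] * e j + π (\sum_i t i * x i).
Proof.
elim/tensor_ind: Q => [F H|Q Q' [t E] [t' E']].
  have [t ht] := ord_choice (fun j : 'I_#|I| => subst_shift (co l e (π H) (enum_val j))).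
  have eE (j : 'I_#|I|) := inAe fa (enum_val j).
  have [Ej hE] := ord_choice eE.
  exists (fun i => (F.@[p])%:MP * \sum_j t j i * Ej j).
  rewrite rmorphM /= spec0 spec1 piM [in π H](_ : π H = \sum_j rho Y l (co l e (π H) j) * e j); last first.
    exact: (coE fa (inApi Y H)).
  rewrite (sum_over_enum (fun j => rho Y l (co l e (π H) j) * e j)).
  rewrite (sum_over_enum (fun j => scal Y (trace l e j (in0 F * in1 H)).@[p] * e j)) mulr_sumr.
  have -> : π (\sum_i (F.@[p])%:MP * (\sum_j t j i * Ej j) * x i) =
     \sum_j scal Y F.@[p] * (π (\sum_i t j i * x i) * e (enum_val j)).
    rewrite pi_sum [RHS](eq_bigr (fun j => \sum_i scal Y F.@[p] * (π (t j i * x i) * e (enum_val j)))).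
      rewrite exchange_big /=; apply: eq_bigr => i _.
      rewrite !piM pi_sum mulr_sumr mulr_suml; apply: eq_bigr => j _.
      by rewrite !piM hE /scal; ring.
    by move=> j _; rewrite pi_sum mulr_suml mulr_sumr.
  rewrite -big_split; apply: eq_bigr => j _ /=.
  rewrite (trace_tensor fa) mevalM scalM subst_eval -mulrA -mulrDr; congr (_ * _).
  rewrite -mulrDl; congr (_ * _); rewrite -ht piB /rho /scal addrC subrK //.
exists (fun i => t i + t' i); rewrite rmorphD piD E E' addrACA /=; congr (_ + _).
  by rewrite -big_split; apply: eq_bigr => j _; rewrite traceD mevalD scalD mulrDl.
by rewrite -piD -big_split; congr (cproj Y _); apply: eq_bigr => i _; rewrite mulrDl.
Qed.

Definition modx i (H : S) : Prop := exists c, π H = π (x i * c).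

Lemma ideal_modx i : ideal (modx i).
Proof.
split=> [|F H [c E] [c' E']|b F [c E]]; first by exists 0; rewrite mulr0.
  by exists (c + c'); rewrite piD E E' -piD mulrDr.
by exists (b * c); rewrite piM E -piM mulrCA.
Qed.

Lemma rho_x i : π (x i) = rho Y l (shift (fun i => (l i).@[p]) i).
Proof. by rewrite /shift rhoB rhoXi rhoC /x piB. Qed.

Lemma lift_coords (c : I -> {mpoly k[3]}) : exists H, π H = \sum_j rho Y l (c j) * e j.
Proof.
have : inA (\sum_j rho Y l (c j) * e j).
  by apply: inA_sum => j _; apply: inAM; [apply: inApi|apply: (inAe fa)].
by move=> [H ->]; exists H.
Qed.

Lemma co_x i H j : co l e (π (x i * H)) j = shift (fun i => (l i).@[p]) i * co l e (π H) j.
Proof. by rewrite piM rho_x (co_rho fa) //; apply: inApi. Qed.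

(** The ring is free over the polynomials in the [l i], so divisibility is tested on coordinates. *)
Lemma modx_regular i j H : i != j -> modx i (x j * H) -> modx i H.
Proof.
move=> ij [c E]; have h b : exists Q, co l e (π H) b = shift (fun i => (l i).@[p]) i * Q.
  apply: (@shift_regular _ _ i j _ (co l e (π c) b)) => //.
  by rewrite -!co_x E.
have [Q hQ] := ord_choice (fun b : 'I_#|I| => h (enum_val b)).
have [C EC] := lift_coords (fun b => Q (enum_rank b)); exists C.
rewrite piM EC (coE fa (inApi Y H)) mulr_sumr; apply: eq_bigr => b _.
by have := hQ (enum_rank b); rewrite enum_rankK => ->; rewrite rhoM -rho_x mulrA.
Qed.

Lemma modx_koszul i j h F H : i != j -> i != h -> j != h -> modx i (F * x j + H * x h) ->
  exists s, modx i (F - s * x h) /\ modx i (H + s * x j).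
Proof.
move=> ij ih jh [c E]; set la := fun i => (l i).@[p].
have K b : exists sQQ : {mpoly k[3]} * {mpoly k[3]} * {mpoly k[3]},
    co l e (π F) b = sQQ.1.1 * shift la h + shift la i * sQQ.1.2 /\
    co l e (π H) b = - (sQQ.1.1 * shift la j) + shift la i * sQQ.2.
  have [|s [Q [Q' E2]]] := @shift_koszul _ la i j h (co l e (π F) b) (co l e (π H) b) (co l e (π c) b) ij ih jh.
    rewrite ![_ * shift la _]mulrC -!co_x -E piD (coD fa) ?[F * _]mulrC ?[H * _]mulrC //; exact: inApi.
  by exists (s, Q, Q').
have [sQ hsQ] := ord_choice (fun b : 'I_#|I| => K (enum_val b)).
have [s Es] := lift_coords (fun b => (sQ (enum_rank b)).1.1).
have [Q EQ] := lift_coords (fun b => (sQ (enum_rank b)).1.2).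
have [Q' EQ'] := lift_coords (fun b => (sQ (enum_rank b)).2).
exists s; split; [exists Q|exists Q'].
  rewrite piB !piM Es EQ !rho_x (coE fa (inApi Y F)) mulr_suml mulr_sumr -sumrB; apply: eq_bigr => b _.
  have [] := hsQ (enum_rank b); rewrite enum_rankK => -> _; rewrite rhoD !rhoM; ring.
rewrite piD !piM Es EQ' !rho_x (coE fa (inApi Y H)) mulr_suml mulr_sumr -big_split; apply: eq_bigr => b _.
have [_] := hsQ (enum_rank b); rewrite enum_rankK /= => ->; rewrite rhoD rhoN !rhoM; ring.
Qed.

(** Otherwise [spec_trace] puts the specialization of [\det G * w] in the ideal of the fibre, and
    Wiebe's lemma puts a function not vanishing at [p] in the ideal of [f_0], [f_1] and [x i0],
    which all vanish there. So the trace form attached to [p] generates at [p]. *)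
Theorem trace_nonzero : exists j, (trace l e j (\det G * w)).@[p] != 0.
Proof.
apply: NNPP => no; have z j : (trace l e j (\det G * w)).@[p] = 0.
  by apply/eqP; apply: contra_notT no => nz; exists j.
have [t] := spec_trace (\det G * w); rewrite big1 ?add0r => [Et|j _]; last by rewrite z scal0 mul0r.
have [i0 ni0] := lp; pose g := spec p (G i0 o2).
(* Euler's formula [ld_radial], at an index where [l i0] does not vanish at [p]. *)
have gp : g.@[p] != 0.
  rewrite eps_spec; apply/eqP => E; have := ld_radial i0; rewrite E mul0r => /eqP.
  by rewrite mulf_eq0 (negPf (ld_unit ld)) (negPf ni0).
pose sG := map_mx (spec p) G.
have [i1 [i2 [h01 h02 h12 all Edet]]] := cdet_cyclic sG i0.
have iJ := ideal_modx i0.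
have kJ H : π H = 0 -> modx i0 H by move=> E; exists 0; rewrite mulr0 pi0.
have xJ : modx i0 (x i0) by exists 1; rewrite mulr1.
have [|||||||s [t' [c E]]] := @wiebe3 _ (modx i0) (x i1) (x i2) iJ _ _ (spec p w) (spec p w) (x i0)
   (f o2 - ((f o2).@[p])%:MP) g (f o0) (f o1) (fun i j => sG i j) i0 i1 i2 o0 o1 o2 (t i1) (t i2) xJ.
- by move=> H; apply: modx_regular.
- by move=> F H; apply: modx_koszul.
- by rewrite mxE.
- by apply: kJ; rewrite !mxE ld_spec_rel.
- by apply: kJ; rewrite !mxE ld_spec_rel.
- by apply: kJ; rewrite !mxE ld_spec_rel.
- rewrite -Edet det_map_mx -[spec p w]/(spec p w) -rmorphM.
  have E0 : π (spec p (\det G * w) - \sum_i t i * x i) = 0 by rewrite piB Et subrr.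
  apply: (id_eq iJ (y := spec p (\det G * w) - \sum_i t i * x i)); first exact: kJ.
  have -> : \sum_i t i * x i = t i0 * x i0 + (t i1 * x i1 + t i2 * x i2).
    rewrite (bigD1 i0) //= (bigD1 i1) 1?eq_sym //= (bigD1 i2) /=; last by rewrite !(eq_sym i2) h02 h12.
    by rewrite big1 ?addr0 // => i /andP[/andP[n0 n1] n2]; case: (all i) => E'; rewrite E' eqxx in n0 n1 n2.
  rewrite opprB addrA; apply: (id_eq iJ (y := t i0 * x i0)); first exact: (idM iJ).
  by rewrite (_ : _ - _ = 0); [case: iJ|ring].
have := onv_eval hp E; have [f0 f1 _] := ld_val ld.
rewrite mevalB mevalD !mevalM f0 f1 !mulr0 addr0 subr0 mevalB mevalC subrr mul0r => /eqP.
by rewrite !mulf_eq0 (negPf gp) !eps_spec (negPf (ld_unit ld)).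
Qed.

End LocalData.

Lemma monomial_coprime (K : fieldType) (i j : 'I_3) N M (F G : {mpoly K[3]}) : i != j ->
  'X_j ^+ N * F = 'X_i ^+ M * G -> exists Q, F = 'X_i ^+ M * Q.
Proof.
move=> ij; have sX h : 'X_h = shift (fun=> 0 : K) h by rewrite /shift mpolyC0 subr0.
have nX h : 'X_h != 0 :> {mpoly K[3]} by rewrite sX shift_neq0.
have one N' (F' G' : {mpoly K[3]}) : 'X_j ^+ N' * F' = 'X_i * G' -> exists Q, F' = 'X_i * Q.
  elim: N' F' G' => [|N' IH] F' G'; first by rewrite expr0 mul1r; exists G'.
  rewrite exprSr -mulrA => /IH[Q]; rewrite (sX i) (sX j) => E; exact: (shift_regular ij E).
elim: M F G => [|M IH] F G E; first by exists F; rewrite expr0 mul1r.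
have [|F' EF] := one N F ('X_i ^+ M * G); first by rewrite E exprS mulrA.
have [|Q EQ] := IH F' G; last by exists Q; rewrite EF EQ exprS mulrA.
by apply: (mulfI (nX i)); rewrite mulrCA -EF E exprS mulrA.
Qed.

(** * The canonical module of the coordinate ring *)

Section Dual.
Variables (k : closedFieldType) (n : nat) (Y : cone k n).
Local Notation S := {mpoly k[n.+1]}.
Local Notation B := {mpoly k[n.+1 + n.+1]}.
Local Notation "'π' F" := (@cproj k n Y F) (at level 8, F at level 2).

Definition cderivation (D : Y -> Y) : Prop :=
  [/\ forall a, hdg 0 a -> hdg 0 (D a),
      forall a b, hdg 0 a -> hdg 0 b -> D (a + b) = D a + D b,
      forall a b, hdg 0 a -> hdg 0 b -> D (a * b) = a * D b + b * D a &
      forall c : k, D (π c%:MP) = 0].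

Definition cwedge (u v : Y) (D1 D2 : Y -> Y) : Y := D1 u * D2 v - D1 v * D2 u.

Definition clocal_generator (m : int) (p : 'I_n.+1 -> k) (a : Y) : Prop :=
  [/\ a != 0, stk m p a & stk (- m) p a^-1].

Definition ccanonical (m : int) : Prop :=
  exists f a b : Y, [/\ hdg (- m) f, hdg 0 a, hdg 0 b &
    forall p, onv Y p -> exists u v t e : Y,
      [/\ cparam p u v, clocal_generator m p t, clocal_generator 0 p e &
      forall D1 D2, cderivation D1 -> cderivation D2 ->
        f * t * cwedge a b D1 D2 = e * cwedge u v D1 D2]].

Lemma hdgV m x : x != 0 -> hdg m x -> hdg (- m) (x^-1 : Y).
Proof.
move=> nx [F [G [d [e [hF hG <- nG E]]]]]; exists G, F, e, d; split=> //.
- by rewrite opprB.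
- by apply: contraNneq nx => h; rewrite E h mul0r.
- by rewrite E invf_div.
Qed.

Lemma generator_frac m p t : onv Y p -> clocal_generator m p t ->
  exists A C : S, [/\ A.@[p] != 0, C.@[p] != 0 & t = π A / π C].
Proof.
move=> hp [nt [A [C [? [? [_ _ _ Cp E]]]]] [A' [C' [? [? [_ _ _ Cp' E']]]]]].
exists A, C; split=> //; have [nC nC'] := (onv_nz hp Cp, onv_nz hp Cp').
have : π (A * A') = π (C * C').
  have nA : π A != 0 by apply: contraNneq nt => h; rewrite E h mul0r.
  by move: E'; rewrite E invf_div !piM => /eqP; rewrite eqr_div // => /eqP ->; rewrite mulrC.
move/(onv_eval hp); rewrite !mevalM => E2.
have : A.@[p] * A'.@[p] != 0 by rewrite E2 mulf_neq0.
by rewrite mulf_eq0 negb_or => /andP[].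
Qed.

(** Depth at least two: [f1^N (f0^N x) = f0^N (f1^N x)], and regularity of [f0^N, f1^N] makes
    [f0^N x] a multiple of [f0^N] in the ring. *)
Lemma saturation (f0 f1 : S) N x : π f0 != 0 -> π f1 != 0 -> f0 \is 1.-homog -> f1 \is 1.-homog ->
  reg2 (@modA k n Y) (π f0) (π f1) ->
  (forall F, F \is N.-homog -> inA (π F * x)) -> inA x.
Proof.
move=> n0 n1 h0 h1 R hx.
have hX (f : S) : f \is 1.-homog -> f ^+ N \is N.-homog by move=> h; have := dhomogMn N h; rewrite mul1n.
have mA (c v : Y) : inA c -> modA (const_mx v) -> modA (c *: const_mx v : 'rV[Y]_1).
  move=> [F ->] [G E]; exists (F * G); apply/rowP => j; rewrite !mxE piM.
  by have := congr1 (fun v : 'rV[Y]_1 => v 0 j) E; rewrite !mxE => ->.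
have MA (c : Y) (v : 'rV[Y]_1) : inA c -> modA v -> modA (c *: v).
  by move=> hc [G ->]; apply: mA => //; exists G.
have R' := reg2_powl MA (a := N) n0 (inApi _ _) (reg2_powr MA (b := N) (inApi _ _) R).
have mx F : F \is N.-homog -> modA (const_mx (π F * x) : 'rV[Y]_1).
  by move=> /hx[G E]; exists G; rewrite E.
have [|v' [G ->] E] := R' _ _ (mx _ (hX _ h0)) (mx _ (hX _ h1)).
  by apply/rowP => j; rewrite !mxE !piX; ring.
exists G; have := congr1 (fun v : 'rV[Y]_1 => v 0 0) E; rewrite !mxE piX.
by apply: mulfI; rewrite expf_neq0.
Qed.

Variable l : 'I_3 -> S.
Hypothesis hl : forall i, l i \is 1.-homog.
Hypothesis nl : forall i, π (l i) != 0.

Lemma subst_pihomog d c : pihomog mdeg d (subst_forms l c) = subst_forms l (pihomog mdeg d c).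
Proof.
have hs e := subst_forms_homog hl (pihomogP mdeg e c).
rewrite {1}(pihomog_partitionE (leqnn (msize c))) [subst_forms l (\sum_(_ < _) _)]rmorph_sum /= pihomog_sum.
under eq_bigr => e _ do rewrite (pihomog_component d (hs e)).
have [lt|le] := ltnP d (msize c).
  rewrite (bigD1 (Ordinal lt)) //= eqxx big1 ?addr0 // => e ne.
  by case: eqP => // E; case/eqP: ne; apply: val_inj.
rewrite big1 => [|e _]; last by rewrite gtn_eqF // (leq_trans (ltn_ord e)).
rewrite pihomogE big_seq_cond big1 ?rmorph0 // => m /andP[mc /eqP E].
by have := msize_mdeg_lt mc; rewrite E ltnNge le.
Qed.

Lemma homogeneous_span (I : finType) (s : I -> nat) (psi : I -> Y) (t : nat) x (c : I -> {mpoly k[3]}) :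
  (forall i, inAt (s i) (psi i)) -> inAt t x -> x = \sum_i rho Y l (c i) * psi i ->
  exists2 c', (forall i, homd t (s i) (c' i)) & x = \sum_i rho Y l (c' i) * psi i.
Proof.
move=> hpsi [X hX EX] E.
have [P hP] := ord_choice (R := fun (i : 'I_#|I|) P => P \is (s (enum_val i)).-homog /\ psi (enum_val i) = π P)
  (fun i => let: ex_intro2 P h1 h2 := hpsi (enum_val i) in ex_intro _ P (conj h1 h2)).
pose P' i := P (enum_rank i).
have hP' i : P' i \is (s i).-homog /\ psi i = π (P' i).
  by have := hP (enum_rank i); rewrite enum_rankK.
exists (fun i => if (s i <= t)%N then pihomog mdeg (t - s i) (c i) else 0).
  by move=> i; rewrite /homd; case: (s i <= t)%N => //; apply: pihomogP.
have E2 : π X = π (\sum_i P' i * subst_forms l (c i)).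
  by rewrite -EX E pi_sum; apply: eq_bigr => i _; rewrite piM mulrC; case: (hP' i) => _ ->.
rewrite EX (homogenize hX (fun i => (hP' i).1) E2) pi_sum; apply: eq_bigr => i _.
case: ifP => _; last by rewrite pi0 rho0 mul0r.
by rewrite piM subst_pihomog mulrC; case: (hP' i) => _ ->.
Qed.

Variables (I : finType) (a : I -> nat) (e : I -> Y).
Hypothesis fa : free_algebra l a e.

Lemma mu_homog d (Q : B) : Q \is d.-homog -> mu Q \is d.-homog.
Proof.
apply: (@subst_forms_homog k n _ (fold2 (fun j => 'X_j) (fun j => 'X_j))) => i.
by rewrite /fold2; case: split => j; apply: dhomogXi.
Qed.

Lemma trace_homog j d (Q : B) : Q \is d.-homog ->
  if (a j <= d)%N then is_true (trace l e j Q \is (d - a j).-homog) else trace l e j Q = 0.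
Proof.
move=> hQ.
have h m : m \in msupp Q -> if (a j <= d)%N
    then is_true ('X_[lmon m] * subst_forms l (co l e (π 'X_[rmon m]) j) \is (d - a j).-homog)
    else 'X_[lmon m] * subst_forms l (co l e (π 'X_[rmon m]) j) = 0.
  move=> mQ; have dm : (mdeg (lmon m) + mdeg (rmon m) = d)%N.
    rewrite -(dhomog_mf hQ mQ) /= !mdegE big_split_ord /=.
    by congr (_ + _)%N; apply: eq_bigr => i _; rewrite mnmE.
  have hr : ('X_[rmon m] : S) \is (mdeg (rmon m)).-homog by rewrite dhomogX.
  have := co_homd fa j (inAt_pi Y hr); rewrite /homd; case: leqP => le hc; last first.
    rewrite hc rmorph0 mulr0; case: ifP => // _; exact: dhomog0.
  have -> : (a j <= d)%N by rewrite -dm; apply: (leq_trans le); apply: leq_addl.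
  rewrite (_ : (d - a j)%N = (mdeg (lmon m) + (mdeg (rmon m) - a j))%N); last by rewrite -dm addnBA.
  by apply: dhomogM; [rewrite dhomogX|apply: subst_forms_homog].
case: ifP => le; rewrite le in h; rewrite /trace /linext big_seq.
  by apply: rpred_sum => m mQ; apply: rpredZ; apply: h.
by rewrite big1 // => m mQ; rewrite h // scaler0.
Qed.

Lemma trace_sum j T (s : seq T) (P : pred T) (F : T -> B) :
  trace l e j (\sum_(i <- s | P i) F i) = \sum_(i <- s | P i) trace l e j (F i).
Proof.
elim/big_rec2: _ => [|i x y _ <-]; first exact: trace0.
by rewrite traceD.
Qed.

(** The traces are graded, so the relations for [Q] split into relations for its components. *)
Lemma socle_component Q c : diag_socle l e Q -> diag_socle l e (pihomog mdeg c Q : B).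
Proof.
move=> hQ j i Q'.
rewrite [Q'](pihomog_partitionE (leqnn (msize Q'))) mulr_sumr trace_sum pi_sum big1 // => g _.
set Qg := pihomog mdeg g Q'; have hg : Qg \is (g : nat).-homog by apply: pihomogP.
have hd : delta ('X_i : S) \is 1.-homog.
  by rewrite /delta in0X in1X; apply: rpredB; rewrite dhomogX /= mdeg1.
have hT c' : pihomog mdeg c' Q * delta 'X_i * Qg \is (c' + 1 + g).-homog.
  by apply: dhomogM => //; apply: dhomogM => //; apply: pihomogP.
have := trace_homog j (hT c); case: leqP => le ht; last by rewrite ht pi0.
have [lt|ge] := ltnP c (msize Q); last first.
  rewrite [pihomog _ _ _](_ : _ = 0) ?mul0r ?trace0 ?pi0 //.
  rewrite pihomogE big_seq_cond big1 // => m /andP[mQ /eqP E].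
  by have := msize_mdeg_lt mQ; rewrite E ltnNge ge.
have := hQ j i Qg; set T := trace l e j _ in ht *.
rewrite {1}(pihomog_partitionE (leqnn (msize Q))) 2!mulr_suml trace_sum.
move/(cone_homog (c + 1 + g - a j)); rewrite pihomog_sum (bigD1 (Ordinal lt)) //= big1 => [|c' ne].
  by rewrite addr0 (pihomog_component _ ht) eqxx.
have := trace_homog j (hT c'); case: leqP => le' ht'; last by rewrite ht' pihomog0.
rewrite (pihomog_component _ ht'); case: eqP => // E; case/eqP: ne; apply: val_inj => /=.
move: le le' E; clear; lia.
Qed.

Hypothesis chark : [pchar k] =i pred0.
Hypothesis el : forall p, onv Y p -> exists i, (l i).@[p] != 0.
Hypothesis satA : forall N x, (forall F, F \is N.-homog -> inA (π F * x)) -> inA (x : Y).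

Variables (D1 D2 : Y -> Y).
Hypotheses (hD1 : kder D1) (hD2 : kder D2).
Hypotheses (gD1 : forall m x, hdg m x -> hdg m (D1 x)) (gD2 : forall m x, hdg m x -> hdg m (D2 x)).
Let Theta := cdet (fun i => π (l i)) (fun i => D1 (π (l i))) (fun i => D2 (π (l i))).
Hypothesis nTheta : Theta != 0.

Lemma kder_cderivation D : kder D -> (forall m x, hdg m x -> hdg m (D x)) -> cderivation D.
Proof. by move=> [h1 h2 h3] g; split=> *; [apply: g|apply: h1|apply: h2|apply: h3]. Qed.

Lemma hdg_Theta : hdg 3 Theta.
Proof.
have hN := nzden_class Y; have hl1 i : hdg 1 (π (l i)) by apply: (hloc_pi hN).
have h1 i : hdg 1 (D1 (π (l i))) by apply: gD1.
have h2 i : hdg 1 (D2 (π (l i))) by apply: gD2.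
have h3 x y z : hdg 1 x -> hdg 1 y -> hdg 1 z -> hdg 3 (x * (y * z) : Y).
  by move=> hx hy hz; apply: (hlocM hN (m := 1) (m' := 2)) => //; apply: (hlocM hN (m := 1) (m' := 1)).
rewrite /Theta /cdet !mulrBr.
apply: (hlocD hN); [apply: (hlocB hN)|]; apply: (hlocB hN); exact: h3.
Qed.

Variable m : int.
Variables (f ca cb : Y).
Hypotheses (hf : hdg (- m) f) (hca : hdg 0 ca) (hcb : hdg 0 cb).
Hypothesis can : forall p, onv Y p -> exists u v t e : Y,
  [/\ cparam p u v, clocal_generator m p t, clocal_generator 0 p e &
    forall D1 D2, cderivation D1 -> cderivation D2 ->
    f * t * cwedge ca cb D1 D2 = e * cwedge u v D1 D2].

(* [Theta] compared with the given generator of the canonical module. *)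
Let Jac := Theta / (f * cwedge ca cb D1 D2).

(** [can] compares the given 2-form with the wedge of [u] and [v], and [ld_wedge] compares that
    wedge with [Theta]. Together, [Jac] is the restriction of the socle element [\det G * w] to the
    diagonal, up to a unit at [p]. *)
Lemma local_dual p : onv Y p -> f * cwedge ca cb D1 D2 != 0 /\
  exists (Q : B) (A C : S), [/\ diag_socle l e Q, π (mu Q) != 0, A.@[p] != 0 /\ C.@[p] != 0,
    Jac * π C = π A * π (mu Q) & exists j, (trace l e j Q).@[p] != 0].
Proof.
move=> hp; have [u [v [t [ep [huv ht hep Ew]]]]] := can hp.
have [w [G [g [q ld]]]] := local_data_exists chark fa hp huv.
have {}Ew := Ew D1 D2 (kder_cderivation hD1 gD1) (kder_cderivation hD2 gD2).
have E3 := ld_wedge hl hp ld hD1 hD2; rewrite -/Theta -/(cwedge u v D1 D2) in E3.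
have nw := nmuw hp ld.
have nz : π (mu (\det G)) * (q%:R * π (g ord_max) ^+ 3 * cwedge u v D1 D2) != 0.
  by rewrite -E3 mulf_neq0 ?expf_neq0.
have [t1 [t2 [t1p t2p Et]]] := generator_frac hp ht.
have [e1 [e2 [e1p e2p Ee]]] := generator_frac hp hep.
have [[[nt1 nt2] ne1] ne2] := (onv_nz hp t1p, onv_nz hp t2p, onv_nz hp e1p, onv_nz hp e2p).
have nG : π (mu (\det G)) != 0 by apply: contraNneq nz => ->; rewrite mul0r.
have nuv : cwedge u v D1 D2 != 0 by apply: contraNneq nz => ->; rewrite !mulr0.
have Ew' : f * π t1 * π e2 * cwedge ca cb D1 D2 = π e1 * π t2 * cwedge u v D1 D2.
  have -> : f * π t1 * π e2 * cwedge ca cb D1 D2 = (f * t * cwedge ca cb D1 D2) * (π t2 * π e2).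
    by rewrite Et; field.
  by rewrite Ew Ee; field.
have nfw : f * cwedge ca cb D1 D2 != 0.
  have : f * π t1 * π e2 * cwedge ca cb D1 D2 != 0 by rewrite Ew' !mulf_neq0.
  by apply: contraNneq => h; rewrite mulrAC [f * _ * _]mulrAC h !mul0r.
split=> //; exists (\det G * w), (t1 * (q%:R)%:MP * g ord_max ^+ 3 * e2), (e1 * mu w ^+ 4 * t2).
have [_ _ gp] := ld_val ld.
have qp : (q%:R : k) != 0 by rewrite ((pcharf0P k).1 chark) -lt0n (ld_pos ld).
split.
- exact: (ld_socle ld).
- by rewrite muM piM mulf_neq0.
- have wp : (mu w).@[p] != 0 by exact: (ld_unit ld).
  by rewrite !mevalM mevalC; split; rewrite !mulf_neq0.
- apply: (mulIf nfw); rewrite /Jac.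
  have -> : Theta / (f * cwedge ca cb D1 D2) * π (e1 * mu w ^+ 4 * t2) * (f * cwedge ca cb D1 D2) =
     π e1 * π t2 * π (mu w) * (π (mu w) ^+ 3 * Theta).
    rewrite !piM; move: (f * cwedge ca cb D1 D2) nfw => z nz'; by field.
  have Eq : scal Y q%:R = q%:R :> Y.
    by elim: (q) => [|i IH]; rewrite ?scal0 // -addn1 !natrD scalD IH scal1.
  transitivity (q%:R * π (g ord_max) ^+ 3 * (π (mu (\det G)) * π (mu w)) *
      (f * π t1 * π e2 * cwedge ca cb D1 D2)); first by rewrite Ew' E3; ring.
  by rewrite muM !piM -/(scal Y q%:R) Eq; ring.
- exact: (trace_nonzero hl fa hp (el hp) ld).
Qed.

Lemma homogeneous_socle : exists Q d, [/\ (Q : B) \is d.-homog, diag_socle l e Q & π (mu Q) != 0].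
Proof.
have [p hp] := exists_point Y; have [_ [Q [_ [_ [sQ nQ _ _ _]]]]] := local_dual hp.
apply: NNPP => no; case/eqP: nQ.
rewrite (pihomog_partitionE (leqnn (msize Q))) [mu (\sum_(_ < _) _)]rmorph_sum /= pi_sum big1 // => c _.
apply/eqP; apply: contra_notT no => nz; exists (pihomog mdeg c Q), c; split=> //.
  exact: pihomogP.
exact: socle_component.
Qed.

Section Psi.
Variables (Q : B) (d : nat).
Hypotheses (hQ : Q \is d.-homog) (sQ : diag_socle l e Q) (nQ : π (mu Q) != 0).

(** [Q] is a multiple of the idempotent of the diagonal, so the quotient is the element dual to
    [e j] for the trace form of the field extension. The factor [Jac] makes these elements regular
    ([psi_A]) and leaves them no common zero ([psi_local]). *)
Definition psi j : Y := Jac * (π (trace l e j Q) / π (mu Q)).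

Lemma psi_local p : onv Y p -> exists (Qp : B) (A C : S), [/\ A.@[p] != 0, C.@[p] != 0,
  forall j, psi j * π C = π (A * trace l e j Qp) & exists j, (trace l e j Qp).@[p] != 0].
Proof.
move=> hp; have [_ [Qp [A [C [sp np [Ap Cp] E nz]]]]] := local_dual hp.
exists Qp, A, C; split=> // j; have E2 := socle_sym fa j sQ sp.
rewrite /psi mulrAC E piM -mulrA mulrA; apply: (mulIf nQ).
by rewrite -!mulrA mulVf // mulr1 E2 [π (mu Q) * _]mulrC.
Qed.

Lemma psi_A j : inA (psi j).
Proof.
pose J (F : S) := inA (π F * psi j).
have iJ : ideal J.
  split; rewrite /J; first by rewrite pi0 mul0r; apply: inA0.
    by move=> x y hx hy; rewrite piD mulrDl; apply: inAD.
  by move=> c x hx; rewrite piM -mulrA; apply: inAM => //; apply: inApi.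
have [F F0|p hp|N hN] := projective_nullstellensatz (Y := Y) iJ.
- by rewrite /J F0 mul0r; apply: inA0.
- have [Qp [A [C [_ Cp E _]]]] := psi_local hp; exists C => //.
  by rewrite /J mulrC E; apply: inApi.
by apply: (satA (N := N)) => F; apply: hN.
Qed.

Lemma psi_hdg j : psi j != 0 -> hdg (m + 3 - (a j)%:Z) (psi j).
Proof.
move=> nz; have hN := nzden_class Y.
have [p hp] := exists_point Y; have [nfw _] := local_dual hp.
have hJ : hdg (m + 3) Jac.
  rewrite (_ : m + 3 = 3 + - (- m + 0)); last by lia.
  apply: (hlocM hN hdg_Theta); apply: (hdgV nfw); apply: (hlocM hN hf).
  rewrite /cwedge; apply: (hlocB hN); rewrite -[0 : int]addr0; apply: (hlocM hN);
    by [apply: gD1|apply: gD2].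
apply: (hlocM hN hJ); have := trace_homog j hQ; case: leqP => le ht; last first.
  by rewrite /psi ht pi0 mul0r mulr0 eqxx in nz.
rewrite (_ : - (a j)%:Z = (d - a j)%N%:Z - d%:Z); last by move: le; clear; lia.
by exists (trace l e j Q), (mu Q), (d - a j)%N, d; split=> //; apply: mu_homog.
Qed.

(** Multiplication acts on the [psi] by the transpose of its matrix on the [e], as on a dual
    basis. *)
Lemma psi_mul C j : π C * psi j = \sum_i rho Y l (co l e (π C * e i) j) * psi i.
Proof.
have E := socle_trace fa (in1 C) j sQ; rewrite muin1 in E.
rewrite /psi mulrCA [π C * _]mulrA -E [Q * _]mulrC (trace_in1 fa) pi_sum mulr_suml mulr_sumr.
by apply: eq_bigr => i _; rewrite piM -/(rho Y l _); ring.
Qed.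

Definition psi_span (x : Y) : Prop := exists h : I -> {mpoly k[3]}, x = \sum_i rho Y l (h i) * psi i.

Lemma psi_spanD x y : psi_span x -> psi_span y -> psi_span (x + y).
Proof.
move=> [h ->] [h' ->]; exists (fun i => h i + h' i); rewrite -big_split.
by apply: eq_bigr => i _; rewrite rhoD mulrDl.
Qed.

Lemma psi_span_rho c x : psi_span x -> psi_span (rho Y l c * x).
Proof.
move=> [h ->]; exists (fun i => c * h i); rewrite mulr_sumr.
by apply: eq_bigr => i _; rewrite rhoM mulrA.
Qed.

Lemma psi_spanM x y : inA x -> psi_span y -> psi_span (x * y).
Proof.
move=> [C ->] [h ->]; rewrite mulr_sumr; elim/big_rec: _ => [|j z _ hz].
  by exists (fun=> 0); rewrite big1 // => i _; rewrite rho0 mul0r.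
apply: psi_spanD => //; rewrite mulrCA; apply: psi_span_rho; rewrite psi_mul.
by exists (fun i => co l e (π C * e i) j).
Qed.

(** The span of the [psi] is an ideal of the coordinate ring by [psi_mul], and has no zero on the
    variety by [psi_local]. *)
Lemma psi_span_forms : exists N, forall F, F \is N.-homog -> psi_span (π F).
Proof.
have iJ : ideal (fun F : S => psi_span (π F)).
  split; first by exists (fun=> 0); rewrite pi0 big1 // => i _; rewrite rho0 mul0r.
    by move=> x y hx hy; rewrite piD; apply: psi_spanD.
  by move=> c x hx; rewrite piM; apply: psi_spanM => //; apply: inApi.
have [F F0|p hp|N hN] := projective_nullstellensatz (Y := Y) iJ.
- by exists (fun=> 0); rewrite F0 big1 // => i _; rewrite rho0 mul0r.
- have [Qp [A [C [Ap Cp E [j nj]]]]] := psi_local hp; have [H EH] := psi_A j; exists H.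
    exists (fun i => (i == j)%:R); rewrite -EH (bigD1 j) //= eqxx rho1 mul1r big1 ?addr0 //.
    by move=> i /negPf ->; rewrite rho0 mul0r.
  have := E j; rewrite EH -piM => /(onv_eval hp); rewrite !mevalM => E2.
  have : H.@[p] * C.@[p] != 0 by rewrite E2 mulf_neq0.
  by rewrite mulf_eq0 negb_or => /andP[].
by exists N => F; apply: hN.
Qed.

Lemma rho_neq0 i N : rho Y l ('X_i ^+ N) != 0.
Proof. by rewrite rhoX rhoXi expf_neq0 // nl. Qed.

Lemma span_power i : exists N (G : I -> I -> {mpoly k[3]}), forall j,
  rho Y l ('X_i ^+ N) * e j = \sum_b rho Y l (G j b) * psi b.
Proof.
have [N hN] := psi_span_forms; exists N.
have h j : psi_span (rho Y l ('X_i ^+ N) * e j).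
  rewrite mulrC; apply: psi_spanM; first exact: (inAe fa).
  rewrite rhoX rhoXi -piX; apply: hN; have := dhomogMn N (hl i); rewrite mul1n; exact.
have [G hG] := ord_choice (fun j : 'I_#|I| => h (enum_val j)).
by exists (fun j => G (enum_rank j)) => j; have := hG (enum_rank j); rewrite enum_rankK.
Qed.

(** A power of [l_0] times each [e j] lies in the span of the [psi], so the matrix of the [psi] in
    the basis [e] divides a nonzero scalar matrix and has nonzero determinant. *)
Lemma psi_free (c : I -> {mpoly k[3]}) : \sum_i rho Y l (c i) * psi i = 0 -> forall i, c i = 0.
Proof.
move=> E; have [N [G hG]] := span_power ord0; pose q := #|I|; pose ev (i : 'I_q) : I := enum_val i.
pose MG : 'M[{mpoly k[3]}]_q := \matrix_(j, b) G (ev j) (ev b).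
pose MH : 'M[{mpoly k[3]}]_q := \matrix_(b, i) co l e (psi (ev b)) (ev i).
have GH : MG *m MH = ('X_ord0 ^+ N)%:M.
  apply/matrixP => j i; rewrite !mxE.
  have : \sum_i rho Y l (\sum_b G (ev j) b * co l e (psi b) i) * e i =
         \sum_i rho Y l ('X_ord0 ^+ N * (ev j == i)%:R) * e i.
    transitivity (rho Y l ('X_ord0 ^+ N) * e (ev j)).
      rewrite hG; under eq_bigr => i' _ do rewrite rho_sum mulr_suml.
      rewrite exchange_big; apply: eq_bigr => b _ /=.
      rewrite [in RHS](coE fa (psi_A b)) mulr_sumr; apply: eq_bigr => i' _.
      by rewrite rhoM mulrA.
    rewrite [RHS](bigD1 (ev j)) //= eqxx mulr1 big1 ?addr0 // => i' /negPf ne.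
    by rewrite eq_sym ne mulr0 rho0 mul0r.
  move/(fa_uniq fa)/(_ (ev i)); rewrite (sum_over_enum (fun b => G (ev j) b * co l e (psi b) (ev i))).
  move=> EE; have -> : (j == i) = (ev j == ev i) by rewrite (inj_eq enum_val_inj).
  by rewrite -mulr_natr -[RHS]EE; apply: eq_bigr => b _; rewrite !mxE.
have nH : \det MH != 0.
  have := congr1 determinant GH; rewrite det_mulmx det_scalar => ED; apply/eqP => E0.
  move/eqP: ED; rewrite E0 mulr0 eq_sym -exprM expf_eq0 => /andP[_ /eqP X0].
  by have := rho_neq0 ord0 1; rewrite expr1 X0 rho0 eqxx.
pose v : 'rV[{mpoly k[3]}]_q := \row_b c (ev b).
have vH : v *m MH = 0.
  apply/rowP => i; rewrite !mxE.
  have : \sum_i rho Y l (\sum_b c b * co l e (psi b) i) * e i = \sum_i rho Y l 0 * e i.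
    rewrite [RHS]big1 => [|i' _]; last by rewrite rho0 mul0r.
    rewrite -[RHS]E; under eq_bigr => i' _ do rewrite rho_sum mulr_suml.
    rewrite exchange_big; apply: eq_bigr => b _ /=.
    rewrite [in RHS](coE fa (psi_A b)) mulr_sumr; apply: eq_bigr => i' _.
    by rewrite rhoM mulrA.
  move/(fa_uniq fa)/(_ (ev i)); rewrite (sum_over_enum (fun b => c b * co l e (psi b) (ev i))) => EE.
  by rewrite -[RHS]EE; apply: eq_bigr => b _; rewrite !mxE.
move=> i; have := congr1 (fun u => u *m \adj MH) vH; rewrite -mulmxA mul_mx_adj mul0mx mul_mx_scalar.
move/rowP/(_ (enum_rank i)); rewrite !mxE /ev enum_rankK => /eqP.
by rewrite mulf_eq0 (negPf nH) => /eqP.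
Qed.

(** [e j] has coordinates in the [psi] after multiplication by a power of [l_0], and also by a power
    of [l_2]. By [psi_free] the two sets of coordinates are proportional, and the powers are
    coprime, so the coordinates are divisible. *)
Lemma psi_basis x : inA x -> psi_span x.
Proof.
move=> /(coE fa) ->; elim/big_rec: _ => [|j y _ hy].
  by exists (fun=> 0); rewrite big1 // => i _; rewrite rho0 mul0r.
apply: psi_spanD => //; apply: psi_span_rho.
have [N0 [G0 h0]] := span_power ord0; have [N1 [G1 h1]] := span_power ord_max.
have div b : exists g, G0 j b = 'X_ord0 ^+ N0 * g.
  apply: (@monomial_coprime _ ord0 ord_max N1 N0 _ (G1 j b)) => //; apply/eqP; rewrite -subr_eq0; apply/eqP.
  apply: (@psi_free (fun b => 'X_ord_max ^+ N1 * G0 j b - 'X_ord0 ^+ N0 * G1 j b)).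
  under eq_bigr => b' _ do rewrite rhoB !rhoM mulrBl -!mulrA.
  by rewrite sumrB -!mulr_sumr -h0 -h1 mulrCA subrr.
have [g hg] := ord_choice (fun b : 'I_#|I| => div (enum_val b)).
exists (fun b => g (enum_rank b)); apply: (mulfI (rho_neq0 ord0 N0)).
rewrite h0 mulr_sumr; apply: eq_bigr => b _.
have := hg (enum_rank b); rewrite enum_rankK => ->.
by rewrite (rhoM Y l ('X_ord0 ^+ N0) (g (enum_rank b))) -mulrA.
Qed.
End Psi.

(* The canonical module Hom (A, R) is A (m + 3): [psi] is the basis of A dual to [e] for [tau]. *)
Theorem dual_basis : exists (s : nat) (ps : I -> Y) (tau : I -> {mpoly k[3]}),
  [/\ m = s%:Z - 3, forall j, (a j <= s)%N, free_algebra l (fun j => (s - a j)%N) ps,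
      forall j, homd 0 (s - a j) (tau j) &
      forall c, inA c -> c = \sum_i rho Y l (\sum_j tau j * co l e (c * e i) j) * ps i].
Proof.
have [Q [d [hQ sQ nQ]]] := homogeneous_socle.
pose ps := psi Q; have ps_free := psi_free sQ nQ.
have nps j : ps j != 0.
  apply/eqP => E; have := ps_free (fun i => (i == j)%:R) _ j; rewrite eqxx => /(_ _)/eqP.
  rewrite oner_eq0 => h; suff : false by []. apply: h.
  rewrite (bigD1 j) //= eqxx rho1 mul1r -/(ps j) E big1 ?addr0 // => i /negPf ->.
  by rewrite rho0 mul0r.
have deg j : exists t : nat, m + 3 - (a j)%:Z = t%:Z /\ inAt t (ps j).
  have [t E ht] := inA_hdg (nps j) (psi_A sQ nQ j) (psi_hdg hQ nQ (nps j)).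
  by exists t.
have [i0 _] : exists i0, co l e 1 i0 != 0.
  apply: NNPP => no; have := coE fa (inA1 Y); rewrite big1 => [/eqP|i _]; first by rewrite oner_eq0.
  have [->|nz] := eqVneq (co l e 1 i) 0; first by rewrite rho0 mul0r.
  by case: no; exists i.
have [t0 [Et0 _]] := deg i0; pose s := (a i0 + t0)%N.
have ms : m = s%:Z - 3 by rewrite /s; move: Et0; clear; lia.
have les j : (a j <= s)%N by have [t [Et _]] := deg j; move: ms Et; clear; lia.
have hps j : inAt (s - a j) (ps j).
  have [t [Et ht]] := deg j; rewrite (_ : (s - a j)%N = t) //; move: ms Et; clear; lia.
have fps : free_algebra l (fun j => (s - a j)%N) ps.
  split=> // t x hx; have [c Ec] := psi_basis sQ nQ (inAtA hx).
  exact: (homogeneous_span hps hx Ec).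
have h1 : inAt 0 (1 : Y) by rewrite -(scal1 Y); apply: inAt_scal.
have [tau htau E1] := fa_span fps h1.
exists s, ps, tau; split=> // c [C Ec].
rewrite -[LHS]mulr1 {1}E1 mulr_sumr.
under [RHS]eq_bigr => i _ do rewrite rho_sum mulr_suml.
rewrite [RHS]exchange_big; apply: eq_bigr => j _ /=.
rewrite mulrCA Ec (psi_mul sQ) mulr_sumr; apply: eq_bigr => i _.
by rewrite rhoM mulrA.
Qed.

End Dual.

(** * Hilbert functions *)

Definition binp (q : nat) : {poly rat} := (q`!%:R)^-1 *: \prod_(i < q) ('X - (i%:R)%:P).

Lemma binpE q N : (binp q).[N%:R] = 'C(N, q)%:R.
Proof.
have nf : (q`!%:R : rat) != 0 by rewrite Num.Theory.pnatr_eq0 -lt0n fact_gt0.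
rewrite /binp hornerZ horner_prod; apply: (mulfI nf); rewrite mulVKf // -natrM mulnC bin_ffact.
under eq_bigr => i _ do rewrite hornerXsubC.
have [lt|le] := ltnP N q.
  by rewrite ffact_small // (bigD1 (Ordinal lt)) //= subrr mul0r.
elim: q {nf} le => [|q IH] le; first by rewrite big_ord0.
by rewrite big_ord_recr /= IH ?(ltnW le) // ffactnSr natrM natrB // ltnW.
Qed.

Lemma binp2E x : (binp 2).[x] = x * (x - 1) / 2%:R.
Proof.
by rewrite /binp hornerZ horner_prod !big_ord_recl big_ord0 !hornerXsubC /= subr0 mulr1 mulrC.
Qed.

Lemma poly_nat_zero (p : {poly rat}) t0 : (forall t : nat, (t0 <= t)%N -> p.[t%:R] = 0) -> p = 0.
Proof.
move=> h; apply/eqP; apply: contraT => np.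
have := @max_poly_roots rat p [seq (i + t0)%:R | i <- iota 0 (size p)] np.
rewrite size_map size_iota ltnn => H; apply: H.
  by apply/allP => x /mapP[i _ ->]; apply/rootP; rewrite h // leq_addl.
rewrite map_inj_uniq ?iota_uniq // => i j /eqP; rewrite Num.Theory.eqr_nat eqn_add2r.
by move/eqP.
Qed.

Lemma poly_nat_eq (p q : {poly rat}) t0 :
  (forall t : nat, (t0 <= t)%N -> p.[t%:R] = q.[t%:R]) -> p = q.
Proof.
move=> h; apply/eqP; rewrite -subr_eq0; apply/eqP; apply: (@poly_nat_zero _ t0) => t le.
by rewrite hornerD hornerN h // subrr.
Qed.

(** The Hilbert function of [R(-a)]. *)
Definition hd (t a : nat) : nat := if (a <= t)%N then 'C(t - a + 2, 2) else 0%N.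

Section GradedFree.
Variables (k : closedFieldType) (n : nat) (Y : cone k n) (l : 'I_3 -> {mpoly k[n.+1]}).
Local Notation S := {mpoly k[n.+1]}.
Local Notation "'π' F" := (@cproj k n Y F) (at level 8, F at level 2).

Lemma fdim_homd t a : fdim (homd (k := k) t a) (hd t a).
Proof.
rewrite /hd; case E : (a <= t)%N.
  have := fdim_homog k 2 (t - a); apply: fdim_ext => c; rewrite /homd E; split; exact.
exists (fun=> 0); split=> [[]//|c|c _ []//]; rewrite /homd E => ->.
by exists (fun=> 0); rewrite big_ord0.
Qed.

Lemma fdim_graded_free (V : lmodType Y) (W : V -> Prop) (I : finType) (a : I -> nat) (e : I -> V) t :
  (forall i c, homd t (a i) c -> W (rho Y l c *: e i)) ->
  (forall v, W v -> exists2 c : I -> {mpoly k[3]}, forall i, homd t (a i) (c i) &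
     v = \sum_i rho Y l (c i) *: e i) ->
  (forall c : I -> {mpoly k[3]}, \sum_i rho Y l (c i) *: e i = 0 -> forall i, c i = 0) ->
  fdim (V := kmod V) W (\sum_i hd t (a i)).
Proof.
move=> hW sp fr.
pose b i := proj1_sig (constructive_indefinite_description _ (fdim_homd t (a i))).
have hb i : [/\ forall x, homd t (a i) (b i x), forall v, homd t (a i) v -> spanned (b i) v & lfree (b i)].
  by rewrite /b; case: (constructive_indefinite_description _ _).
pose T := {i : I & 'I_(hd t (a i))}.
pose g (x : T) : kmod V := rho Y l (b (tag x) (tagged x)) *: e (tag x).
have -> : (\sum_i hd t (a i) = #|{: T}|)%N.
  by rewrite card_tagged sumnE big_map big_enum; apply: eq_bigr => i _; rewrite card_ord.
have lin (c : T -> k) : \sum_x c x *: g x =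
    \sum_i rho Y l (\sum_(y < hd t (a i)) c (Tagged (fun i => 'I_(hd t (a i))) y) *: b i y) *: e i.
  rewrite (eq_bigr (fun i => \sum_(y < hd t (a i)) c (Tagged (fun i => 'I_(hd t (a i))) y) *:
     g (Tagged (fun i => 'I_(hd t (a i))) y))) => [|i _]; last first.
    rewrite rho_sum scaler_suml; apply: eq_bigr => y _.
    by rewrite -mul_mpolyC rhoM rhoC kscaleE scalerA.
  rewrite sig_big_dep /=; apply: eq_bigr => -[i y] _; exact.
apply: (@fdim_fin k (kmod V) W _ g).
- by move=> x; apply: hW; case: (hb (tag x)).
- move=> v /sp[c hc ->].
  have ex i : exists d : 'I_(hd t (a i)) -> k, c i = \sum_y d y *: b i y.
    by have [_ sp' _] := hb i; apply: sp'.
  pose d i := proj1_sig (constructive_indefinite_description _ (ex i)).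
  have Ed i : c i = \sum_y d i y *: b i y by rewrite /d; case: (constructive_indefinite_description _ _).
  exists (fun x => d (tag x) (tagged x)); rewrite lin; apply: eq_bigr => i _.
  by rewrite Ed.
- move=> c; rewrite lin => /fr h [i y].
  have [_ _ fb] := hb i; exact: (fb _ (h i) y).
Qed.

Definition free_hilbert (I : finType) (a : I -> nat) : {poly rat} :=
  \sum_i (binp 2 \Po ('X + (2%:R - (a i)%:R)%:P)).

(** When [t + 2 - a] is 0 or 1 the binomial coefficient vanishes, so the polynomial is right already
    two degrees before [a]. *)
Lemma free_hilbertE (I : finType) (a : I -> nat) t : (forall i, a i <= t + 2)%N ->
  (free_hilbert a).[t%:R] = (\sum_i hd t (a i))%N%:R.
Proof.
move=> h; rewrite /free_hilbert horner_sum natr_sum; apply: eq_bigr => i _.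
rewrite horner_comp hornerD hornerX hornerC.
have -> : t%:R + (2%:R - (a i)%:R) = (t + 2 - a i)%N%:R :> rat.
  by rewrite natrB ?h // natrD addrA.
rewrite binpE /hd; case: leqP => le; first by rewrite addnBAC.
by rewrite bin_small //; move: le (h i); clear; lia.
Qed.

Section AlgebraNumbers.
Variables (K : nat) (par : parameters Y l K).
Variables (I : finType) (a : I -> nat) (e : I -> Y).
Hypothesis fa : free_algebra l a e.

Lemma fdim_A t : fdim (V := kmod Y^o) (inAt t) (\sum_i hd t (a i)).
Proof.
apply: (fdim_graded_free (V := Y^o) (e := e)).
- move=> i c; rewrite /homd; case: leqP => le hc; last first.
    by rewrite hc rho0 scale0r; apply: inAt0.
  rewrite -(subnK le); apply: inAtM; last exact: (fa_deg fa).
  by apply: rho_inAt => //; apply: (par_homog par).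
- by move=> v /(fa_span fa).
- exact: (fa_free fa).
Qed.

Lemma degree_zero x : inAt 0 x <-> exists c, x = scal Y c.
Proof.
split=> [[F hF ->]|[c ->]]; last exact: inAt_scal.
by exists F@_0%MM; rewrite /scal -pihomog0C pihomog_dE.
Qed.

Lemma fdim_A0 : fdim (V := kmod Y^o) (inAt 0) 1.
Proof.
exists (fun=> 1); split=> [_|x /degree_zero[c ->]|c].
- by apply/degree_zero; exists 1; rewrite scal1.
- by exists (fun=> c); rewrite big_ord1 kscaleE /GRing.scale /= mulr1.
rewrite big_ord1 kscaleE /GRing.scale /= mulr1 => /eqP; rewrite scal_eq0 => /eqP h i.
by rewrite ord1.
Qed.

Lemma unique_degree0 : (\sum_i (a i == 0) = 1)%N.
Proof.
rewrite -(fdim_unique (fdim_A 0) fdim_A0); apply: eq_bigr => i _.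
by rewrite /hd leqn0; case: eqP => // ->.
Qed.

(** The denominators of a section regular at all points form an ideal without zeros, so saturation
    applies. *)
Lemma linear_normality_at (satA : forall N x, (forall F, F \is N.-homog -> inA (π F * x)) -> inA (x : Y)) (m : nat) (x : Y) :
  (forall p, onv Y p -> stk m%:Z p x) -> inAt m x.
Proof.
move=> hx; have [->|nz] := eqVneq x 0; first exact: inAt0.
have hA : inA x.
  pose J (F : S) := inA (π F * x).
  have iJ : ideal J.
    split; rewrite /J; first by rewrite pi0 mul0r; apply: inA0.
      by move=> y z hy hz; rewrite piD mulrDl; apply: inAD.
    by move=> c y hy; rewrite piM -mulrA; apply: inAM => //; apply: inApi.
  have [F F0|p hp|N hN] := projective_nullstellensatz (Y := Y) iJ.
  - by rewrite /J F0 mul0r; apply: inA0.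
  - have [F [G [? [? [_ _ _ Gp E]]]]] := hx p hp; exists G => //.
    by rewrite /J E mulrC divfK ?(onv_nz hp Gp) //; apply: inApi.
  by apply: (satA N) => F; apply: hN.
have [p hp] := exists_point Y; have [t E ht] := inA_hdg nz hA (stk_hdg hp (hx p hp)).
by move: E ht => [->].
Qed.
End AlgebraNumbers.
End GradedFree.

(** The product of two normal forms, reduced by the equation for the square of [Z]; [E] is the
    constant one of the two generators. *)
Lemma quadric_identity (R : comNzRingType) (F G c c' d d' al be E Z : R) :
  F * G - ((E * (c * d) + be * (c' * d')) * E + (E * (c * d' + c' * d) + al * (c' * d')) * Z) =
  G * (F - (c * E + c' * Z)) + (c * E + c' * Z) * (G - (d * E + d' * Z)) +
  c' * d' * (Z ^+ 2 - (be * E + al * Z)).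
Proof. ring. Qed.

Lemma substD (k : closedFieldType) n q (l : 'I_q -> {mpoly k[n.+1]}) (c d : {mpoly k[q]}) :
  subst_forms l (c + d) = subst_forms l c + subst_forms l d.
Proof. exact: (rmorphD (subst_forms l)). Qed.
Lemma substM (k : closedFieldType) n q (l : 'I_q -> {mpoly k[n.+1]}) (c d : {mpoly k[q]}) :
  subst_forms l (c * d) = subst_forms l c * subst_forms l d.
Proof. exact: (rmorphM (subst_forms l)). Qed.
Lemma substC (k : closedFieldType) n q (l : 'I_q -> {mpoly k[n.+1]}) (c : k) :
  subst_forms l c%:MP = c%:MP.
Proof. by rewrite /subst_forms mmapC. Qed.

(** * Coordinate rings with two generators *)

Section Quadric.
Variables (k : closedFieldType) (n : nat) (Y : cone k n) (l : 'I_3 -> {mpoly k[n.+1]}).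
Local Notation S := {mpoly k[n.+1]}.
Local Notation "'π' F" := (@cproj k n Y F) (at level 8, F at level 2).
Variables (K : nat) (par : parameters Y l K).
Variables (I : finType) (a : I -> nat) (e : I -> Y).
Hypothesis fa : free_algebra l a e.
Hypothesis a1 : forall i, (a i <= 1)%N.
Hypotheses (s0 : (\sum_i (a i == 0) = 1)%N) (s1 : (\sum_i (a i == 1) = 1)%N).

Lemma fa_neq0 i : e i != 0.
Proof.
apply/eqP => E; have := @fa_free _ _ _ _ _ _ _ fa (fun j => (j == i)%:R).
rewrite (bigD1 i) //= E mulr0 add0r big1 => [/(_ erefl i)/eqP|j /negPf ->].
  by rewrite eqxx oner_eq0.
by rewrite rho0 mul0r.
Qed.

Lemma sum_one (P : pred I) : (\sum_i P i = 1)%N -> exists i, P i /\ forall j, P j -> j = i.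
Proof.
move=> h; have [i Pi] : exists i, P i.
  apply: NNPP => no; move: h; rewrite big1 // => i _; case Pi : (P i) => //.
  by case: no; exists i.
exists i; split=> // j Pj; apply/eqP; apply: contraT => ji.
by move: h; rewrite (bigD1 i) //= (bigD1 j) //= Pi Pj.
Qed.

Lemma quadric_basis : exists i0 i1 (c0 : k) (Z : S), [/\ i0 != i1, a i0 = 0%N /\ a i1 = 1%N,
  forall i, i = i0 \/ i = i1, c0 != 0 /\ e i0 = scal Y c0 & Z \is 1.-homog /\ e i1 = π Z].
Proof.
have [i0 [h0 u0]] := sum_one s0; have [i1 [h1 u1]] := sum_one s1.
have hd0 : inAt 0 (e i0) by have := fa_deg fa i0; rewrite (eqP h0).
have [c0 Ec] := (degree_zero _).1 hd0.
have [Z hZ EZ] : inAt 1 (e i1) by have := fa_deg fa i1; rewrite (eqP h1).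
exists i0, i1, c0, Z; split=> //.
- by apply/eqP => E; move: h0; rewrite E (eqP h1).
- by split; apply/eqP.
- move=> i; have := a1 i; rewrite leq_eqVlt ltnS leqn0 => /orP[/u1|/u0] ->; by [right|left].
split=> //; apply/eqP => E0.
by have := fa_neq0 i0; rewrite Ec E0 scal0 eqxx.
Qed.

(** Degree 1 of the ring has dimension 3 + 1, so [n - 3] independent linear forms vanish on the
    variety, and the square of [Z] written in the basis gives the quadric. These generate: modulo
    them every polynomial has a normal form [c E + c' Z], which freeness makes 0 for an element of
    the ideal. *)
Lemma quadric_equation : (3 <= n)%N /\ exists (l' : 'I_(n - 3) -> S) (q : S),
  [/\ forall i, l' i \is 1.-homog,
      forall c : 'I_(n - 3) -> k, \sum_i c i *: l' i = 0 -> forall i, c i = 0,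
      q \is 2.-homog &
      forall F, π F = 0 <-> exists (x : 'I_(n - 3) -> S) (y : S), F = \sum_i x i * l' i + y * q].
Proof.
have [i0 [i1 [c0 [Z [n01 [ha0 ha1] all [nc0 E0] [hZ EZ]]]]]] := quadric_basis.
have sumI (W : nmodType) (f : I -> W) : \sum_i f i = f i0 + f i1.
  rewrite (bigD1 i0) //= (bigD1 i1) 1?eq_sym //= big1 ?addr0 // => i /andP[h h'].
  by case: (all i) => E; rewrite E eqxx in h h'.
pose V1 (F : S) := F \is 1.-homog /\ π F = 0.
have [m hm] : exists m, fdim V1 m.
  have [| |m _ hm] := fdim_sub (W := V1) _ _ (fdim_homog k n 1); last by exists m.
    split; first by split; [apply: dhomog0|apply: pi0].
    move=> c u v [hu Eu] [hv Ev]; split; first by apply: rpredD => //; apply: rpredZ.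
    by rewrite piD piZ Eu Ev mulr0 addr0.
  by move=> F [].
have dimA : fdim (V := kmod Y^o) (inAt 1) 4.
  by have := fdim_A par fa 1; rewrite sumI /hd ha0 ha1.
have Em : (m + 4 = n.+1)%N.
  have h : fdim (fun F : S => F \is 1.-homog) (m + 4)%N.
    apply: (@fdim_ker_im k S (kmod Y^o) (fun F => F \is 1.-homog) (fun F => π F) m 4 _ _ hm).
    - split; first exact: dhomog0.
      by move=> c u v hu hv; apply: rpredD => //; apply: rpredZ.
    - by move=> c u v _ _; rewrite piD piZ.
    - exact: dimA.
  by rewrite (fdim_unique h (fdim_homog k n 1)) add1n binSn.
have n3 : (3 <= n)%N by move: Em; clear; lia.
have mE : m = (n - 3)%N by move: Em; clear; lia.
split=> //; move: hm; rewrite mE => -[l' [hl' sp fr]].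
pose E : S := c0%:MP.
have piE : π E = e i0 by rewrite E0.
have rep t x : inAt t x -> exists c c' : {mpoly k[3]}, [/\ c \is t.-homog,
    homd t 1 c' & x = π (subst_forms l c * E + subst_forms l c' * Z)].
  move=> /(fa_span fa)[c hc ->]; exists (c i0), (c i1).
  have := hc i0; have := hc i1; rewrite ha0 ha1 /homd leq0n subn0 => h1 h2; split=> //.
  by rewrite sumI piD !piM piE EZ /rho.
have hlf := par_homog par.
have hE : E \is 0.-homog.
  by rewrite /E -[c0%:MP]mulr1 mul_mpolyC; apply: dhomogZ; apply: dhomog1.
have h2 : inAt 2 (π (Z ^+ 2)) by apply: inAt_pi; have := dhomogMn 2 hZ.
have [be [al [hbe hal EZ2]]] := rep 2 _ h2.
pose q := Z ^+ 2 - (subst_forms l be * E + subst_forms l al * Z).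
have hq : q \is 2.-homog.
  have hsb := subst_forms_homog hlf hbe.
  have hsa := subst_forms_homog hlf (hal : al \is 1.-homog).
  apply: rpredB; first by have := dhomogMn 2 hZ.
  apply: rpredD; first by have := dhomogM hsb hE; rewrite addn0.
  exact: (dhomogM hsa hZ).
exists l', q; split=> //.
- by move=> i; case: (hl' i).
pose J F := exists (x : 'I_(n - 3) -> S) (y : S), F = \sum_i x i * l' i + y * q.
have iJ : ideal J.
  split; first by exists (fun=> 0), 0; rewrite mul0r addr0 big1 // => i _; rewrite mul0r.
    move=> F G [x [y ->]] [x' [y' ->]]; exists (fun i => x i + x' i), (y + y').
    rewrite addrACA -mulrDl -big_split; congr (_ + _); apply: eq_bigr => i _.
    by rewrite mulrDl.
  move=> c F [x [y ->]]; exists (fun i => c * x i), (c * y).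
  rewrite mulrDr mulrA mulr_sumr; congr (_ + _); apply: eq_bigr => i _.
  by rewrite mulrA.
have J1 F : V1 F -> J F.
  move=> /sp[c ->]; exists (fun i => (c i)%:MP), 0; rewrite mul0r addr0.
  by apply: eq_bigr => i _; rewrite mul_mpolyC.
have Jq : J q by exists (fun=> 0), 1; rewrite mul1r big1 ?add0r // => i _; rewrite mul0r.
pose nf (c c' : {mpoly k[3]}) : S := subst_forms l c * E + subst_forms l c' * Z.
have main F : exists c c', J (F - nf c c').
  elim/mpoly_alg_ind: F => [d|i|F G [c [c' h]] [d [d' h']]|F G [c [c' h]] [d [d' h']]].
  - exists (d / c0)%:MP, 0; rewrite /nf /subst_forms mmapC rmorph0 mul0r addr0 -mpolyCM divfK // subrr.
    by case: iJ.
  - have [c [c' [hc hc' Ei]]] := rep 1 _ (inAt_pi Y (dhomogXi k i)); exists c, c'.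
    apply: J1; split; last by rewrite piB Ei subrr.
    apply: rpredB; first exact: dhomogXi.
    apply: rpredD; first by have := dhomogM (subst_forms_homog hlf hc) hE; rewrite addn0.
    exact: (dhomogM (subst_forms_homog hlf (hc' : c' \is 0.-homog)) hZ).
  - exists (c + d), (c' + d').
    rewrite (_ : _ - _ = (F - nf c c') + (G - nf d d')); first exact: (idD iJ).
    by rewrite addrACA -opprD /nf !substD !mulrDl addrACA.
  - exists (c0%:MP * (c * d) + be * (c' * d')), (c0%:MP * (c * d' + c' * d) + al * (c' * d')).
    rewrite (_ : _ - _ = G * (F - nf c c') + nf c c' * (G - nf d d') +
       (subst_forms l c' * subst_forms l d') * q).
      by apply: (idD iJ); [apply: (idD iJ); apply: (idM iJ)|apply: (idM iJ)].
    rewrite /q /nf !substD !substM substC -/E !substD !substM.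
    exact: quadric_identity.
move=> F; split=> [F0|[x [y ->]]]; last first.
  rewrite piD piM (_ : π q = 0) ?mulr0 ?addr0; last by rewrite piB EZ2 subrr.
  by rewrite pi_sum big1 // => i _; rewrite piM; case: (hl' i) => _ ->; rewrite mulr0.
have [c [c' [x [y E1]]]] := main F.
have pl : π (\sum_i x i * l' i + y * q) = 0.
  rewrite piD piM (_ : π q = 0) ?mulr0 ?addr0; last by rewrite piB EZ2 subrr.
  by rewrite pi_sum big1 // => i _; rewrite piM; case: (hl' i) => _ ->; rewrite mulr0.
have nf0 : π (nf c c') = 0.
  by move: pl; rewrite -E1 piB F0 sub0r => /eqP; rewrite oppr_eq0 => /eqP.
have fr2 := @fa_free _ _ _ _ _ _ _ fa (fun i => if i == i0 then c else c').
have E2 : \sum_i rho Y l (if i == i0 then c else c') * e i = 0.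
  by rewrite sumI eqxx eq_sym (negPf n01) -[RHS]nf0 /nf piD !piM piE EZ /rho.
have h := fr2 E2; have hc := h i0; have hc' := h i1.
rewrite eqxx in hc; rewrite eq_sym (negPf n01) in hc'.
by exists x, y; rewrite -E1 hc hc' /nf /subst_forms !rmorph0 !mul0r addr0 subr0.
Qed.
End Quadric.

(** * Linear resolutions *)

Lemma fdim_image (K : fieldType) (V V' : lmodType K) (W : V -> Prop) (f : V -> V') D m :
  subsp W -> (forall c u v, f (c *: u + v) = c *: f u + f v) ->
  fdim W D -> fdim (fun v => W v /\ f v = 0) m ->
  exists m', (D = m + m')%N /\ fdim (fun w => exists2 v, W v & w = f v) m'.
Proof.
move=> sW fl hD hm; have [b [hb spb _]] := hD.
have f0 : f 0 = 0.
  by have := fl 1 0 0; rewrite !scale1r addr0 => /esym/eqP; rewrite -subr_eq0 addrK => /eqP.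
have fs q (c : 'I_q -> K) (u : 'I_q -> V) : f (\sum_i c i *: u i) = \sum_i c i *: f (u i).
  elim: q c u => [|q IH] c u; first by rewrite !big_ord0.
  by rewrite !big_ord_recl fl IH.
have [||m' _ hm'] := @fdim_exists K V' (fun w => exists2 v, W v & w = f v) D (fun i => f (b i)).
- split; first by exists 0; [case: sW|].
  by move=> c u v [u' hu ->] [v' hv ->]; exists (c *: u' + v'); [case: sW => _; apply|].
- by move=> w [v /spb[c ->] ->]; exists c; apply: fs.
exists m'; split=> //; apply: (fdim_unique hD); apply: (fdim_ker_im sW _ hm hm') => c u v _ _.
exact: fl.
Qed.

Section SMod.
Variables (k : closedFieldType) (n : nat).
Local Notation S := {mpoly k[n.+1]}.
Variable V : lmodType S.
Definition smod : Type := V.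
HB.instance Definition _ := GRing.Zmodule.on smod.
Definition sscale (c : k) (v : smod) : smod := (c%:MP *: (v : V))%R.
Lemma sscaleA a b v : sscale a (sscale b v) = sscale (a * b) v.
Proof. by rewrite /sscale scalerA mpolyCM. Qed.
Lemma sscale1 : left_id 1 sscale.
Proof. by move=> v; rewrite /sscale scale1r. Qed.
Lemma sscaleDr : right_distributive sscale +%R.
Proof. by move=> c u v; rewrite /sscale scalerDr. Qed.
Lemma sscaleDl v : {morph sscale^~ v : a b / a + b}.
Proof. by move=> a b; rewrite /sscale mpolyCD scalerDl. Qed.
HB.instance Definition _ :=
  GRing.Zmodule_isLmodule.Build k smod sscaleA sscale1 sscaleDr sscaleDl.
Lemma sscaleE c (v : smod) : c *: v = c%:MP *: (v : V). Proof. by []. Qed.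
End SMod.

Section Resolution.
Variables (k : closedFieldType) (n : nat).
Local Notation S := {mpoly k[n.+1]}.

Definition rowt b t (u : 'rV[S]_b) : Prop := forall j, u 0 j \is t.-homog.

Lemma subsp_rowt b t : subsp (V := smod 'rV[S]_b) (rowt t).
Proof.
split=> [j|c u v hu hv j]; first by rewrite mxE; apply: dhomog0.
by rewrite sscaleE !mxE mul_mpolyC; apply: rpredD => //; apply: rpredZ.
Qed.

Lemma fdim_rowt b t : fdim (V := smod 'rV[S]_b) (rowt t) (b * 'C(t + n, n)).
Proof.
have [h [hh sp fr]] := fdim_homog k n t.
pose g (x : 'I_b * 'I_('C(t + n, n))) : smod 'rV[S]_b := h x.2 *: delta_mx 0 x.1.
have lin (c : 'I_b * 'I_('C(t + n, n)) -> k) j :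
    (\sum_x c x *: g x : 'rV[S]_b) 0 j = \sum_y c (j, y) *: h y.
  rewrite summxE (eq_bigr (fun x => (c x *: g x : 'rV[S]_b) 0 j)) //.
  rewrite (eq_bigr (fun x => (fun i y => (c (i, y) *: g (i, y) : 'rV[S]_b) 0 j) x.1 x.2)) => [|[]//].
  rewrite -(pair_bigA _ (fun i y => (c (i, y) *: g (i, y) : 'rV[S]_b) 0 j)) /= (bigD1 j) //= [X in _ + X]big1 ?addr0 => [|i ij].
    by apply: eq_bigr => y _; rewrite sscaleE !mxE !eqxx mulr1 mul_mpolyC.
  by rewrite big1 // => y _; rewrite sscaleE !mxE eq_sym (negPf ij) andbF mulr0 mulr0.
have := @fdim_fin k (smod 'rV[S]_b) (rowt t) _ g; rewrite card_prod !card_ord; apply.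
- move=> [i y] j; rewrite /g !mxE eqxx /=; case: (j == i); rewrite ?mulr1 ?mulr0; first exact: hh.
  exact: dhomog0.
- move=> u hu; have ex j : exists c : 'I_('C(t + n, n)) -> k, u 0 j = \sum_y c y *: h y by apply: sp.
  have [c hc] := ord_choice ex.
  exists (fun x => c x.1 x.2); apply/rowP => j; rewrite lin; exact: hc.
- move=> c E [j y]; apply: (fr (fun y => c (j, y))); rewrite -lin E; exact: mxE.
Qed.

Lemma mulmx_smod b b' (phi : 'M[S]_(b, b')) (c : k) (u v : smod 'rV[S]_b) :
  (c *: u + v : 'rV[S]_b) *m phi = (c *: (u *m phi : smod 'rV[S]_b') + v *m phi : smod 'rV[S]_b').
Proof. by rewrite !sscaleE mulmxDl -scalemxAl. Qed.

Variables (c : nat) (b : nat -> nat) (phi : forall i, 'M[S]_(b i.+1, b i)).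
Hypothesis cn : (c + 2 <= n)%N.
Hypothesis hb : forall i, (c < i)%N -> b i = 0%N.
Hypothesis hphi : forall i x y, phi i x y \is 1.-homog.
Hypothesis ex : forall i (u : 'rV[S]_(b i.+1)), u *m phi i = 0 <-> exists w, u = w *m phi i.+1.

(* Degree [t] of [S(-i) ^ (b i)]. *)
Definition domt i t (u : smod 'rV[S]_(b i)) : Prop :=
  if (i <= t)%N then rowt (t - i) u else u = 0.
Definition imt i t (v : smod 'rV[S]_(b i)) : Prop :=
  exists2 w : smod 'rV[S]_(b i.+1), domt t w & v = w *m phi i.

(** The entries are linear, so only the component of degree [t - 1] of a preimage counts; for
    [t = 0] there is none. *)
Lemma im_component i t (w : 'rV[S]_(b i.+1)) : rowt t (w *m phi i) ->
  exists2 w', (if (0 < t)%N then rowt t.-1 w' else w' = 0) & w *m phi i = w' *m phi i.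
Proof.
move=> h; exists (if (0 < t)%N then \row_j pihomog mdeg t.-1 (w 0 j) else 0).
  by case: (0 < t)%N => // j; rewrite mxE; apply: pihomogP.
apply/rowP => y; have := pihomog_component t (h y); rewrite eqxx => <-.
rewrite mxE pihomog_sum mxE; apply: eq_bigr => x _.
rewrite mulrC (pihomogM_hom _ _ (hphi x y)).
by case: t h => [|t] h /=; rewrite ?mxE ?mul0r // subn1 mulrC.
Qed.

(** The Hilbert polynomial ['C(t + n - i, n)] of [S(-i)] vanishes at -2 because [n - 2 - i] lies
    between 0 and [n - 1]; here [c + 2 <= n] enters. It gives the Hilbert function in all degrees
    [t], so dimensions are subtracted degree by degree. *)
Lemma hilbert_step (V' : lmodType k) i (f : smod 'rV[S]_(b i) -> V') (p : {poly rat}) :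
  (forall c u v, f (c *: u + v) = c *: f u + f v) ->
  (forall t u, imt t u <-> domt t u /\ f u = 0) ->
  p.[- 2%:R] = 0 -> (forall t, exists e, fdim (imt (i := i) t) e /\ p.[t%:R] = e%:R) ->
  exists p' : {poly rat}, p'.[- 2%:R] = 0 /\
  forall t, exists e, fdim (fun w => exists2 u, domt (i := i) t u & w = f u) e /\ p'.[t%:R] = e%:R.
Proof.
move=> fl kf p2 hp; pose B := binp n \Po ('X + (n%:R - i%:R)%:P).
have Bn x N : x + n%:R - i%:R = N%:R -> B.[x] = 'C(N, n)%:R.
  by move=> E; rewrite /B horner_comp hornerD hornerX hornerC addrA E binpE.
have sD t : subsp (V := smod 'rV[S]_(b i)) (domt t).
  rewrite /domt; case: leqP => _; first exact: subsp_rowt.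
  by split=> // c' u v -> ->; rewrite scaler0 addr0.
have [ic|ci] := leqP i c; last first.
  exists 0; rewrite horner0; split=> // t; exists 0%N; rewrite horner0; split=> //.
  have u0 (u : smod 'rV[S]_(b i)) : u = 0.
    by apply/rowP => j; have := ltn_ord j; rewrite [in X in (_ < X)%N]hb.
  have f0 : f 0 = 0.
    by have := fl 1 0 0; rewrite !scale1r addr0 => /esym/eqP; rewrite -subr_eq0 addrK => /eqP.
  exists (fun=> 0); split=> [[]//|v [w _ ->]|c' _ []//].
  by exists (fun=> 0); rewrite big_ord0 (u0 w).
exists ((b i)%:R *: B - p); split.
  rewrite hornerD hornerN hornerZ p2 subr0 (Bn _ (n - 2 - i)%N) ?bin_small ?mulr0 //.
    by move: cn ic; clear; lia.
  have le : (i <= n - 2)%N by move: cn ic; clear; lia.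
  by rewrite natrB // natrB ?[- _ + _]addrC //; move: cn; clear; lia.
move=> t; have hD : fdim (V := smod 'rV[S]_(b i)) (domt t) (b i * 'C(t + n - i, n)).
  rewrite /domt; case: leqP => it; first by rewrite -addnBAC //; apply: fdim_rowt.
  rewrite bin_small ?muln0; last by move: it cn ic; clear; lia.
  by exists (fun=> 0); split=> [[]//|v ->|c' _ []//]; exists (fun=> 0); rewrite big_ord0.
have [m [hm Em]] := hp t.
have [m' [E hm']] := fdim_image (sD t) fl hD (fdim_ext (fun u => kf t u) hm).
exists m'; split=> //; rewrite hornerD hornerN hornerZ Em (Bn _ (t + n - i)%N).
  by rewrite -natrM E natrD addrAC subrr add0r.
rewrite natrB ?natrD //; move: cn ic; clear; lia.
Qed.

Lemma resolution_hilbert i : exists p : {poly rat}, p.[- 2%:R] = 0 /\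
  forall t, exists e, fdim (imt (i := i) t) e /\ p.[t%:R] = e%:R.
Proof.
have [q] : exists q, (c < i + q)%N by exists c.+1; rewrite addnS ltnS leq_addl.
elim: q i => [|q IH] i lt.
  rewrite addn0 in lt; exists 0; rewrite horner0; split=> // t; exists 0%N; rewrite horner0; split=> //.
  exists (fun=> 0); split=> [[]//|v [w _ ->]|c' _ []//].
  exists (fun=> 0); rewrite big_ord0; apply/rowP => j.
  by have := ltn_ord j; rewrite [in X in (_ < X)%N]hb.
have [|p [p2 hp]] := IH i.+1; first by rewrite addSnnS.
apply: (@hilbert_step (smod 'rV[S]_(b i)) i.+1 (fun w => w *m phi i) p) => //.
  by move=> c' u v; apply: mulmx_smod.
move=> t u; split=> [[w hw E]|[hu /ex[w E]]].
  split; last by apply/ex; exists w.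
  move: hw; rewrite E /domt; case: (ltnP i.+1 t) => it hw; last first.
    rewrite hw mul0mx; case: ifP => // _ j; rewrite mxE; exact: dhomog0.
  rewrite (ltnW it) => j; rewrite mxE; apply: rpred_sum => x _.
  have -> : (t - i.+1 = t - i.+2 + 1)%N by move: it; clear; lia.
  exact: dhomogM (hw x) (hphi _ _).
move: hu; rewrite /domt; have [it|it] := leqP i.+1 t => hu; last first.
  by exists 0; [rewrite /domt; case: ifP => // _ j; rewrite mxE; apply: dhomog0|rewrite hu mul0mx].
rewrite E in hu; have [w' hw' E'] := im_component hu; exists w'; last by rewrite E.
move: hw'; rewrite subn_gt0 /domt; case: ltnP => // _.
by rewrite -subnS.
Qed.

Variables (Y : cone k n) (r : nat) (s : 'M[Y]_(b 0%N, r)).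
Hypothesis h0 : forall u : 'rV[S]_(b 0%N), map_mx (cproj Y) u *m s = 0 <-> exists w, u = w *m phi 0%N.

Lemma module_hilbert : exists p : {poly rat}, p.[- 2%:R] = 0 /\
  forall t, exists e, fdim (V := kmod 'rV[Y]_r) (modSt s t) e /\ p.[t%:R] = e%:R.
Proof.
have [p [p2 hp]] := resolution_hilbert 0.
have [|t u|p' [p2' hp']] := @hilbert_step (kmod 'rV[Y]_r) 0 (fun u => map_mx (cproj Y) u *m s) p _ _ p2 hp.
- move=> c' u v; rewrite sscaleE kscaleE; have := mpiD s (c'%:MP *: (u : 'rV_ _)) v; rewrite /mpi => ->.
  by congr (_ + _); apply: (mpiZ s).
- split=> [[w hw E]|[hu /h0[w E]]].
    split; last by apply/h0; exists w.
    move: hw; rewrite E /domt subn0; case: t => [|t] /= hw.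
      by rewrite hw mul0mx => j; rewrite mxE; apply: dhomog0.
    move=> j; rewrite mxE; apply: rpred_sum => x _; rewrite -[t.+1]addn1.
    by rewrite subn1 in hw; apply: dhomogM (hw x) (hphi _ _).
  move: hu; rewrite /domt leq0n subn0 => hu.
  rewrite E in hu; have [w' hw' E'] := im_component hu; exists w'; last by rewrite E.
  by move: hw'; rewrite /domt subn1.
exists p'; split=> // t; have [e [he ?]] := hp' t; exists e; split=> //.
by apply: (fdim_ext _ he) => v; rewrite /modSt /domt leq0n subn0.
Qed.

(** At -2 the Hilbert polynomial of [R(-a)] has the value ['C(a + 1, 2)], which is 0 only for
    [a = 0]; by [module_hilbert] the sum of these natural numbers is 0. *)
Theorem generators_degree0 l K (I : finType) (a : I -> nat) (e : I -> 'rV[Y]_r) :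
  parameters Y l K ->
  (forall i, modSt s (a i) (e i)) ->
  (forall t v, modSt s t v -> exists2 c : I -> {mpoly k[3]},
        forall i, homd t (a i) (c i) & v = \sum_i rho Y l (c i) *: e i) ->
  (forall c : I -> {mpoly k[3]}, \sum_i rho Y l (c i) *: e i = 0 -> forall i, c i = 0) ->
  forall i, a i = 0%N.
Proof.
move=> par he sp fr; have [p [p2 hp]] := module_hilbert.
have Ep : p = free_hilbert a.
  apply: (@poly_nat_eq _ _ (\sum_i a i)) => t le.
  have [q [hq ->]] := hp t; rewrite free_hilbertE => [|i]; last first.
    by apply: (leq_trans (leq_trans _ le)) (leq_addr _ _); rewrite (bigD1 i) //= leq_addr.
  congr (_%:R); apply: (fdim_unique hq); apply: (fdim_graded_free (e := e)) => [i c'|v|]; [|exact: sp|exact: fr].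
  rewrite /homd; case: leqP => it hc'; last by rewrite hc' rho0 scale0r; apply: modSt0.
  by rewrite -(subnK it); apply: modStA => //; apply: rho_inAt => //; apply: (par_homog par).
have E i : (binp 2 \Po ('X + (2%:R - (a i)%:R)%:P)).[- 2%:R] = 'C((a i).+1, 2)%:R.
  rewrite horner_comp hornerD hornerX hornerC -binpE !binp2E addrA addNr add0r -[(a i).+1%:R]natr1.
  by set x : rat := (a i)%:R; field.
have := p2; rewrite Ep /free_hilbert horner_sum (eq_bigr _ (fun i _ => E i)).
rewrite -natr_sum => /eqP; rewrite Num.Theory.pnatr_eq0 sum_nat_eq0 => /forallP h i.
have := h i; rewrite implyTb; case: (a i) => // m.
by rewrite eqn0Ngt bin_gt0.
Qed.
End Resolution.

(** * Maximal minors *)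

Section Minors.
Variables (F : fieldType) (r : nat).
Implicit Types (A : 'M[F]_(r, r.+1)) (v : 'rV[F]_r.+1).

Definition minors A : 'cV[F]_r.+1 := \col_j ((-1) ^+ j * \det (col' j A)).
(** The extra top row makes the signed minors the coefficients of a linear form in [v]
    ([det_border]). *)
Definition border v A : 'M[F]_r.+1 :=
  \matrix_(i, j) if unlift ord0 i is Some i' then A i' j else v 0 j.

Lemma border0 v A j : border v A ord0 j = v 0 j.
Proof. by rewrite mxE unlift_none. Qed.
Lemma borderS v A i j : border v A (lift ord0 i) j = A i j.
Proof. by rewrite mxE liftK. Qed.

Lemma det_border v A : \det (border v A) = (v *m minors A) 0 0.
Proof.
rewrite (expand_det_row _ ord0) mxE; apply: eq_bigr => j _.
rewrite border0 mxE /cofactor add0n; congr (_ * (_ * \det _)).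
by apply/matrixP => x y; rewrite !mxE liftK.
Qed.

Lemma border_row v A i x : (border v A *m x : 'cV[F]_r.+1) (lift ord0 i) 0 = (A *m x) i 0.
Proof. by rewrite !mxE; apply: eq_bigr => y _; rewrite borderS. Qed.
Lemma border_row0 v A x : (border v A *m x : 'cV[F]_r.+1) ord0 0 = (v *m x) 0 0.
Proof. by rewrite !mxE; apply: eq_bigr => y _; rewrite border0. Qed.

Lemma border_mulmx v A (U : 'M[F]_r.+1) : border (v *m U) (A *m U) = border v A *m U.
Proof.
apply/matrixP => i j; rewrite [RHS]mxE.
by case: (unliftP ord0 i) => [y ->|->]; rewrite (borderS, border0) mxE;
  apply: eq_bigr => x _; rewrite (borderS, border0).
Qed.

Lemma mul_minors A : A *m minors A = 0.
Proof.
apply/matrixP => i j; rewrite ord1 [RHS]mxE.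
have -> : (A *m minors A) i 0 = (row i A *m minors A) 0 0 by rewrite -row_mul [RHS]mxE.
rewrite -det_border (determinant_alternate (neq_lift ord0 i)) // => x.
by rewrite border0 borderS mxE.
Qed.

(** Both sides are tested against all rows [v], where [det_border] turns them into determinants. *)
Lemma minors_mulmx A (U : 'M[F]_r.+1) : U \in unitmx ->
  minors A = (\det U)^-1 *: (U *m minors (A *m U)).
Proof.
move=> uU; have dU : \det U != 0 by move: uU; rewrite unitmxE unitfE.
apply/colP => j; have E v : (v *m minors A) 0 0 = ((\det U)^-1 *: (v *m (U *m minors (A *m U)))) 0 0.
  by rewrite mulmxA [RHS]mxE -!det_border border_mulmx det_mulmx mulrC mulfK.
have := E (delta_mx 0 j); rewrite -!rowE mxE => ->.
by rewrite !mxE.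
Qed.

(** Bordering by a unit row at a nonzero minor gives an invertible matrix, which sends both [w] and
    the minors to multiples of the first unit vector. *)
Lemma kernel_minors A (w : 'cV[F]_r.+1) : minors A != 0 -> A *m w = 0 -> exists f, w = f *: minors A.
Proof.
move=> /matrix0Pn[j0 [z]]; rewrite ord1 => nz0 Aw; pose v : 'rV[F]_r.+1 := delta_mx 0 j0.
have Ev : (v *m minors A) 0 0 = minors A j0 0 by rewrite /v -rowE mxE.
have uB : border v A \in unitmx by rewrite unitmxE unitfE det_border Ev.
pose f := w j0 0 / minors A j0 0; exists f.
apply: (can_inj (mulKmx uB)); apply/colP => i.
have E (x : 'cV[F]_r.+1) : A *m x = 0 -> (border v A *m x) i 0 = (i == ord0)%:R * x j0 0.
  move=> Ax; case: (unliftP ord0 i) => [y ->|->].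
    by rewrite border_row Ax mxE mul0r.
  by rewrite border_row0 eqxx mul1r /v -rowE mxE.
rewrite (E w Aw) E; last by rewrite -scalemxAr mul_minors scaler0.
by congr (_ * _); rewrite mxE divfK.
Qed.

(* Cramer's rule *)
Lemma minors_image (O : F -> Prop) A j (i : 'I_r) : (forall x y, O x -> O y -> O (x * y)) ->
  (forall x y, O x -> O y -> O (x + y)) -> O 1 -> O (-1) -> O 0 -> (forall x y, O (A x y)) ->
  exists2 x : 'cV[F]_r.+1, forall y, O (x y 0) & A *m x = minors A j 0 *: delta_mx i 0.
Proof.
move=> OM OD O1 ON O0 OA; pose v : 'rV[F]_r.+1 := delta_mx 0 j.
have OB x y : O (border v A x y).
  case: (unliftP ord0 x) => [z ->|->]; first by rewrite borderS.
  by rewrite border0 mxE; case: (_ && _).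
have OX b : O ((-1) ^+ b) by elim: b => [|b IH]; rewrite ?expr0 // exprS; apply: (OM).
have Odet q (B : 'M[F]_q) : (forall x y, O (B x y)) -> O (\det B).
  move=> h; apply: (big_ind O) => // s _; apply: (OM) => //.
  by apply: (big_ind O).
exists (col (lift ord0 i) (\adj (border v A))).
  move=> y; rewrite !mxE /cofactor; apply: OM => //; apply: Odet => a b.
  by rewrite [X in O X]mxE [X in O X]mxE.
apply/colP => y; rewrite !mxE.
have := congr1 (fun B : 'M_r.+1 => B (lift ord0 y) (lift ord0 i)) (mul_mx_adj (border v A)).
rewrite det_border -rowE !mxE => E; rewrite (inj_eq (@lift_inj _ ord0)) in E.
rewrite eqxx andbT mulr_natr -E; apply: eq_bigr => x _.
by rewrite borderS !mxE.
Qed.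
End Minors.

(** * Length of the degeneracy scheme at a point *)

Section LocalLength.
Variables (k : closedFieldType) (n : nat) (Y : cone k n).
(* A two-dimensional regular local ring with residue field [k]. *)
Variable O : Y -> Prop.
Hypotheses (OD : forall x y, O x -> O y -> O (x + y)) (OM : forall x y, O x -> O y -> O (x * y)).
Hypothesis Oscal : forall c, O (scal Y c).
Variables u v : Y.
Hypotheses (Ou : O u) (Ov : O v) (nu : u != 0) (nv : v != 0).
Hypothesis residue : forall x, O x -> exists c b d, [/\ O b, O d & x = scal Y c + b * u + d * v].
Hypothesis proper : forall b d, O b -> O d -> b * u + d * v <> 1.
Hypothesis units : forall c b d, c != 0 -> O b -> O d -> O (scal Y c + b * u + d * v)^-1.
Hypothesis depth : forall N z, O (u ^+ N * z) -> O (v ^+ N * z) -> O z.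

Lemma O0 : O 0. Proof. by rewrite -(scal0 Y). Qed.
Lemma ON1 : O (-1). Proof. by rewrite -(scal1 Y) -scalN. Qed.
Lemma ON x : O x -> O (- x). Proof. by rewrite -mulN1r; apply: OM ON1. Qed.
Lemma OB x y : O x -> O y -> O (x - y). Proof. by move=> ? /ON; apply: OD. Qed.
Lemma Osum (T : Type) (s : seq T) (P : pred T) (f : T -> Y) :
  (forall i, P i -> O (f i)) -> O (\sum_(i <- s | P i) f i).
Proof. by move=> h; apply: (big_ind O) => //; apply: O0. Qed.
Lemma O1 : O 1. Proof. by rewrite -(scal1 Y). Qed.
Lemma OX x N : O x -> O (x ^+ N).
Proof. by move=> h; elim: N => [|N IH]; [apply: O1|rewrite exprS; apply: OM]. Qed.
Local Hint Resolve O1 O0 ON1 ON OB OX OD OM : core.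

(** The quotient of [g] by the power of [u] lies in the ring by [depth]. *)
Lemma params_regular N M f g : O f -> O g -> u ^+ N * f = v ^+ M * g ->
  exists z, [/\ O z, g = u ^+ N * z & f = v ^+ M * z].
Proof.
move=> hf hg E; exists (g / u ^+ N).
have Eg : u ^+ N * (g / u ^+ N) = g by rewrite mulrC divfK // expf_neq0.
have Ef : v ^+ M * (g / u ^+ N) = f by rewrite mulrA -E [u ^+ N * f]mulrC mulfK // expf_neq0.
split=> //; apply: (depth (N := N + M)); first by rewrite addnC exprD -mulrA Eg; auto.
by rewrite exprD -mulrA Ef; auto.
Qed.

Lemma unlift_widen N (j : 'I_N) : unlift ord_max (widen_ord (leqnSn N) j) = Some j.
Proof.
rewrite -[widen_ord _ _](_ : lift ord_max j = _) ?liftK //.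
by apply: val_inj; rewrite /= /bump leqNgt ltn_ord.
Qed.

Definition in_powers K x := exists b d, [/\ O b, O d & x = u ^+ K * b + v ^+ K * d].

Lemma pow_O K x : in_powers K x -> O x.
Proof. by move=> [b [d [hb hd ->]]]; auto. Qed.
Lemma powD K x y : in_powers K x -> in_powers K y -> in_powers K (x + y).
Proof.
move=> [b [d [hb hd ->]]] [b' [d' [hb' hd' ->]]]; exists (b + b'), (d + d'); split; auto.
by rewrite addrACA !mulrDr.
Qed.
Lemma powM K x y : O x -> in_powers K y -> in_powers K (x * y).
Proof.
move=> hx [b [d [hb hd ->]]]; exists (x * b), (x * d); split; auto.
by rewrite mulrDr; congr (_ + _); rewrite mulrCA.
Qed.
Lemma pow0 K : in_powers K 0.
Proof. by exists 0, 0; rewrite !mulr0 addr0; split; auto. Qed.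
Lemma powu K N x : (K <= N)%N -> O x -> in_powers K (u ^+ N * x).
Proof.
move=> le hx; exists (u ^+ (N - K) * x), 0; rewrite mulr0 addr0 mulrA -exprD subnKC //.
by split; auto.
Qed.
Lemma powv K N x : (K <= N)%N -> O x -> in_powers K (v ^+ N * x).
Proof.
move=> le hx; exists 0, (v ^+ (N - K) * x); rewrite mulr0 add0r mulrA -exprD subnKC //.
by split; auto.
Qed.

Lemma expand_v N x : O x -> exists (c : 'I_N -> k) b d, [/\ O b, O d &
  x = \sum_(j < N) scal Y (c j) * v ^+ j + (v ^+ N * b + u * d)].
Proof.
move=> hx; elim: N => [|N [c [b [d [hb hd E]]]]].
  by exists (fun=> 0), x, 0; rewrite big_ord0 mul1r mulr0 addr0 add0r; split; auto.
have [c' [b' [d' [hb' hd' Eb]]]] := residue hb.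
exists (fun i => oapp c c' (unlift ord_max i)), d', (v ^+ N * b' + d); split; auto.
rewrite E big_ord_recr /= unlift_none /=.
rewrite [X in _ = X + _ + _](eq_bigr (fun j : 'I_N => scal Y (c j) * v ^+ j)) => [|j _]; last by rewrite unlift_widen.
rewrite -addrA; congr (_ + _); rewrite Eb exprS; ring.
Qed.

(** Together with [free_uv] this makes the monomials a basis of the quotient of the ring by [u^M]
    and [v^N]. *)
Lemma expand_uv N M x : O x -> exists (c : 'I_M -> 'I_N -> k) b d, [/\ O b, O d &
  x = \sum_(i < M) u ^+ i * \sum_(j < N) scal Y (c i j) * v ^+ j + (v ^+ N * b + u ^+ M * d)].
Proof.
move=> hx; elim: M => [|M [c [b [d [hb hd E]]]]].
  by exists (fun _ _ => 0), 0, x; rewrite big_ord0 mul1r mulr0 !add0r; split; auto.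
have [c' [b' [d' [hb' hd' Ed]]]] := expand_v N hd.
exists (fun i => oapp c c' (unlift ord_max i)), (b + u ^+ M * b'), d'; split; auto.
rewrite E big_ord_recr /= unlift_none /=.
rewrite [X in _ = X + _ + _](eq_bigr (fun i : 'I_M => u ^+ i * \sum_(j < N) scal Y (c i j) * v ^+ j)) => [|i _]; last by rewrite unlift_widen.
rewrite -addrA; congr (_ + _); rewrite [X in u ^+ M * X]Ed exprS; ring.
Qed.

Lemma free_v N (c : 'I_N -> k) b d : O b -> O d ->
  \sum_(j < N) scal Y (c j) * v ^+ j = v ^+ N * b + u * d -> forall j, c j = 0.
Proof.
elim: N c b d => [|N IH] c b d hb hd; first by move=> _ [].
rewrite big_ord_recl /= expr0 mulr1.
set R := \sum_(i < N) scal Y (c (lift ord0 i)) * v ^+ i.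
rewrite (eq_bigr (fun i : 'I_N => v * (scal Y (c (lift ord0 i)) * v ^+ i))) => [|i _]; last first.
  by rewrite /bump /= add1n exprS mulrCA.
rewrite -mulr_sumr -/R exprS => E.
have hR : O R by apply: Osum => i _; auto.
have c0 : c ord0 = 0.
  apply/eqP; apply: contraT => nc.
  case: (@proper (scal Y (c ord0)^-1 * d) (scal Y (c ord0)^-1 * (v ^+ N * b - R))); auto.
  have -> : scal Y (c ord0)^-1 * d * u + scal Y (c ord0)^-1 * (v ^+ N * b - R) * v =
    scal Y (c ord0)^-1 * ((v * v ^+ N * b + u * d) - v * R) by ring.
  by rewrite -E addrK -scalM mulVf ?scal1.
have [z [hz E1 E2]] : exists z, [/\ O z, R - v ^+ N * b = u ^+ 1 * z & d = v ^+ 1 * z].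
  apply: (@params_regular 1 1) => //; auto.
  rewrite !expr1; move: E; rewrite c0 scal0 add0r mulrBr => ->; ring.
move=> j; have [y ->|->] := unliftP ord0 j; last exact: c0.
apply: (IH (fun i => c (lift ord0 i)) b z) => //.
by rewrite -/R -(expr1 u) -E1 addrC subrK.
Qed.

Lemma free_uv N M (c : 'I_M -> 'I_N -> k) b d : O b -> O d ->
  \sum_(i < M) u ^+ i * \sum_(j < N) scal Y (c i j) * v ^+ j = v ^+ N * b + u ^+ M * d -> forall i j, c i j = 0.
Proof.
elim: M c b d => [|M IH] c b d hb hd; first by move=> _ [].
pose V i := \sum_j scal Y (c i j) * v ^+ j.
rewrite big_ord_recl /= expr0 mul1r -/(V ord0).
set R := \sum_(i < M) u ^+ i * V (lift ord0 i).
rewrite (eq_bigr (fun i : 'I_M => u * (u ^+ i * V (lift ord0 i)))) => [|i _]; last first.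
  by rewrite /bump /= add1n exprS mulrA.
rewrite -mulr_sumr -/R exprS => E.
have hV i : O (V i) by apply: Osum => j _; auto.
have hR : O R by apply: Osum => i _; auto.
have c0 : forall j, c ord0 j = 0.
  apply: (@free_v N _ b (u ^+ M * d - R)); auto; rewrite -/(V ord0).
  by apply: (addIr (u * R)); rewrite E; ring.
have V0 : V ord0 = 0 by rewrite /V big1 // => j _; rewrite c0 scal0 mul0r.
have [z [hz E1 E2]] : exists z, [/\ O z, b = u ^+ 1 * z & R - u ^+ M * d = v ^+ N * z].
  apply: (@params_regular 1 N) => //; auto.
  by rewrite expr1; apply: (addIr (u * u ^+ M * d)); rewrite -E V0; ring.
move=> i; have [y ->|->] := unliftP ord0 i; last exact: c0.
apply: (IH (fun i => c (lift ord0 i)) z d) => //.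
by rewrite -E2 subrK.
Qed.

Section Socle.
Variable K' : nat.
Local Notation K := K'.+1.
Definition mono (c : 'I_K -> 'I_K -> k) : Y := \sum_(i < K) u ^+ i * \sum_(j < K) scal Y (c i j) * v ^+ j.
Definition coef (x : Y) : 'I_K -> 'I_K -> k :=
  sel (fun _ _ => 0) (fun c => in_powers K (x - mono c)).
(** The coefficient of the top monomial, a functional that is nonzero on the socle of the Gorenstein
    ring [O / (u^K, v^K)]. *)
Definition lam (x : Y) : k := coef x ord_max ord_max.

Lemma coefP x : O x -> in_powers K (x - mono (coef x)).
Proof.
move=> hx; suff /(@selP _ (fun _ _ => 0)) : exists c, in_powers K (x - mono c) by [].
have [c [b [d [hb hd E]]]] := expand_uv K K hx; exists c, d, b; split=> //.
by rewrite {1}E addrC addKr addrC.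
Qed.
Lemma powN x : in_powers K x -> in_powers K (- x).
Proof. by rewrite -mulN1r; apply: powM ON1. Qed.
Lemma monoB c d : mono c - mono d = mono (fun i j => c i j - d i j).
Proof.
rewrite -sumrB; apply: eq_bigr => i _; rewrite -mulrBr -sumrB; congr (_ * _).
by apply: eq_bigr => j _; rewrite -mulrBl scalD scalN.
Qed.
Lemma coef_uniq x c : O x -> in_powers K (x - mono c) -> forall i j, coef x i j = c i j.
Proof.
move=> hx h i j; apply/eqP; rewrite -subr_eq0; apply/eqP.
have [b [d [hb hd]]] := powD h (powN (coefP hx)).
rewrite (_ : x - mono c - (x - mono (coef x)) = mono (coef x) - mono c) ; last by ring.
by rewrite monoB addrC => /(free_uv hd hb).
Qed.

Lemma monoZ a c : scal Y a * mono c = mono (fun i j => a * c i j).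
Proof.
rewrite mulr_sumr; apply: eq_bigr => i _; rewrite mulrCA; congr (_ * _).
by rewrite mulr_sumr; apply: eq_bigr => j _; rewrite scalM mulrA.
Qed.
Lemma coef_lin a x y i j : O x -> O y -> coef (scal Y a * x - y) i j = a * coef x i j - coef y i j.
Proof.
move=> hx hy; rewrite (coef_uniq (c := fun i j => a * coef x i j - coef y i j)) //; auto.
rewrite -(monoB (fun i j => a * coef x i j)) -monoZ.
rewrite (_ : _ - _ = scal Y a * (x - mono (coef x)) + - (y - mono (coef y))); last by ring.
by apply: powD; [apply: powM (coefP hx)|apply: powN (coefP hy)].
Qed.
Lemma coef_pow x i j : in_powers K x -> coef x i j = 0.
Proof.
move=> h; rewrite (coef_uniq (c := fun _ _ => 0)) //; first exact: (pow_O h).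
rewrite /mono big1 ?subr0 // => i' _; rewrite big1 ?mulr0 // => j' _.
by rewrite scal0 mul0r.
Qed.
Lemma lam_0 : lam 0 = 0. Proof. by apply: coef_pow; apply: pow0. Qed.
Lemma lamB x y : O x -> O y -> lam (x - y) = lam x - lam y.
Proof. by move=> hx hy; have := coef_lin 1 ord_max ord_max hx hy; rewrite scal1 !mul1r. Qed.
Lemma lam_add x y : O x -> O y -> lam (x + y) = lam x + lam y.
Proof.
move=> hx hy; rewrite -[y in LHS]opprK lamB; auto.
by rewrite -[- y]sub0r lamB ?lam_0 ?sub0r ?opprK; auto.
Qed.
Lemma lamZ a x : O x -> lam (scal Y a * x) = a * lam x.
Proof.
by move=> hx; have := coef_lin a ord_max ord_max hx O0; rewrite !subr0 -/(lam 0) lam_0 subr0.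
Qed.
Lemma lam_bigsum (T : Type) (s : seq T) (f : T -> Y) : (forall i, O (f i)) ->
  lam (\sum_(i <- s) f i) = \sum_(i <- s) lam (f i).
Proof.
move=> h; elim: s => [|x s IH]; first by rewrite !big_nil lam_0.
by rewrite !big_cons lam_add ?IH //; apply: Osum.
Qed.
Lemma lam_monomial p q : lam (u ^+ p * v ^+ q) = ((p == K') && (q == K'))%:R.
Proof.
have [lep|ltp] := leqP p K'; last first.
  rewrite gtn_eqF //= /lam coef_pow //; apply: powu; auto.
have [leq|ltq] := leqP q K'; last first.
  by rewrite [q == _]gtn_eqF // andbF /lam coef_pow // mulrC; apply: powv; auto.
have Op : O (u ^+ p * v ^+ q) by auto.
rewrite /lam (coef_uniq (c := fun i j => ((i == inord p) && (j == inord q))%:R)) //.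
  by rewrite -!(inj_eq val_inj) /= !inordK ?ltnS // ![K' == _]eq_sym.
rewrite /mono (bigD1 (inord p)) //= [X in _ - (_ + X)]big1 => [|i /negPf ne]; last first.
  by rewrite big1 ?mulr0 // => j _; rewrite ne scal0 mul0r.
rewrite addr0 (bigD1 (inord q)) //= [X in _ * (_ + X)]big1 => [|j /negPf ne]; last first.
  by rewrite ne andbF scal0 mul0r.
by rewrite addr0 !eqxx scal1 mul1r !inordK ?ltnS // subrr; apply: pow0.
Qed.

(** Multiplication by the complementary monomial moves the coefficient to the top. *)
Lemma lam_coef x i j : O x -> coef x i j = lam (u ^+ (K' - i) * v ^+ (K' - j) * x).
Proof.
move=> hx; set w := u ^+ _ * _; have hw : O w by rewrite /w; auto.
have hm : O (mono (coef x)).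
  by apply: Osum => i' _; apply: OM; auto; apply: Osum => j' _; auto.
have -> : w * x = w * mono (coef x) + w * (x - mono (coef x)) by rewrite -mulrDr subrKC.
rewrite lam_add; auto; rewrite [X in _ = _ + X]coef_pow ?addr0; last exact: powM (coefP hx).
have hj i' j' : O (u ^+ i' * (scal Y (coef x i j) * v ^+ j')) by auto.
rewrite /mono mulr_sumr lam_bigsum => [|i']; last first.
  by apply: OM => //; apply: OM; auto; apply: Osum => j' _; auto.
rewrite (bigD1 i) //= [X in _ + X]big1 ?addr0 => [|i' ne].
  rewrite !mulr_sumr lam_bigsum => [|j']; last by auto.
  rewrite (bigD1 j) //= [X in _ + X]big1 ?addr0 => [|j' ne].
    rewrite (_ : w * _ = scal Y (coef x i j) * (u ^+ K' * v ^+ K')).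
      by rewrite lamZ ?lam_monomial ?eqxx ?mulr1; auto.
    have Ei : u ^+ K' = u ^+ (K' - i) * u ^+ i by rewrite -exprD subnK // -ltnS.
    have Ej : v ^+ K' = v ^+ (K' - j) * v ^+ j by rewrite -exprD subnK // -ltnS.
    rewrite /w Ei Ej; ring.
  rewrite (_ : w * _ = scal Y (coef x i j') * (u ^+ (K' - i + i) * v ^+ (K' - j + j'))).
    rewrite lamZ ?lam_monomial; auto; have : (K' - j + j' == K')%N = false.
      apply/negP => /eqP E; move/negP: ne; apply; apply/eqP/val_inj => /=.
      by move: E (ltn_ord j); clear; lia.
    by move=> ->; rewrite andbF mulr0.
  rewrite /w !exprD; ring.
rewrite !mulr_sumr lam_bigsum => [|j']; last by auto.
apply: big1 => j' _.
rewrite (_ : w * _ = scal Y (coef x i' j') * (u ^+ (K' - i + i') * v ^+ (K' - j + j'))).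
  rewrite lamZ ?lam_monomial; auto; have : (K' - i + i' == K')%N = false.
    apply/negP => /eqP E; move/negP: ne; apply; apply/eqP/val_inj => /=.
    by move: E (ltn_ord i); clear; lia.
  by move=> ->; rewrite mulr0.
rewrite /w !exprD; ring.
Qed.

(* The pairing [lam (x * y)] on [O / (u ^+ K, v ^+ K)] is perfect. *)
Lemma lam_nondegenerate x : O x -> (forall y, O y -> lam (x * y) = 0) -> in_powers K x.
Proof.
move=> hx h; have := coefP hx; rewrite /mono big1 ?subr0 // => i _.
rewrite big1 ?mulr0 // => j _; rewrite lam_coef // [_ * x]mulrC h ?scal0 ?mul0r //; auto.
Qed.

(** The coefficients of [th] are the values of [phi] on complementary monomials; by [lam_coef] both
    functionals then agree on monomials. *)
Lemma lam_represent (phi : Y -> k) :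
  (forall a x y, O x -> O y -> phi (scal Y a * x + y) = a * phi x + phi y) ->
  (forall x, in_powers K x -> phi x = 0) ->
  exists2 th, O th & forall x, O x -> lam (th * x) = phi x.
Proof.
move=> lin kill; pose c i j := phi (u ^+ (K' - i) * v ^+ (K' - j)).
have hm : O (mono c).
  by apply: Osum => i' _; apply: OM; auto; apply: Osum => j' _; auto.
exists (mono c) => // x hx.
pose psi x := lam (mono c * x) - phi x.
have phi0 : phi 0 = 0 by apply: kill; apply: pow0.
have psiD y z : O y -> O z -> psi (y + z) = psi y + psi z.
  move=> hy hz; rewrite /psi mulrDr lam_add; auto.
  by have := lin 1 y z hy hz; rewrite scal1 !mul1r => ->; rewrite opprD addrACA.
have psiZ a y : O y -> psi (scal Y a * y) = a * psi y.
  move=> hy; rewrite /psi mulrCA lamZ; auto.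
  by have := lin a y 0 hy O0; rewrite !addr0 phi0 addr0 => ->; rewrite mulrBr.
have psi_sum T (s : seq T) (f : T -> Y) : (forall i, O (f i)) -> (forall i, psi (f i) = 0) ->
    psi (\sum_(i <- s) f i) = 0.
  move=> hf h; elim: s => [|y s IH]; first by rewrite big_nil /psi mulr0 lam_0 phi0 subr0.
  by rewrite big_cons psiD ?h ?IH ?addr0 //; apply: Osum.
suff : psi x = 0 by rewrite /psi => /eqP; rewrite subr_eq0 => /eqP.
have -> : x = mono (coef x) + (x - mono (coef x)) by rewrite subrKC.
have hx' : O (mono (coef x)) by apply: Osum => i' _; apply: OM; auto; apply: Osum => j' _; auto.
rewrite psiD; auto; rewrite [X in _ + X](_ : _ = 0) ?addr0; last first.
  by rewrite /psi kill ?subr0; [apply: coef_pow; apply: powM (coefP hx)|apply: coefP].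
apply: (psi_sum) => i; first by apply: OM; auto; apply: Osum => j' _; auto.
rewrite mulr_sumr; apply: (psi_sum) => j; first by auto.
rewrite mulrCA psiZ; auto.
suff -> : psi (u ^+ i * v ^+ j) = 0 by rewrite mulr0.
have Ei : (K' - rev_ord i = i)%N by rewrite /= subSS subKn // -ltnS.
have Ej : (K' - rev_ord j = j)%N by rewrite /= subSS subKn // -ltnS.
rewrite /psi mulrC -{1}Ei -{1}Ej -lam_coef //.
rewrite (coef_uniq (c := c)) ?subrr //; last exact: pow0.
by rewrite /c Ei Ej subrr.
Qed.
End Socle.

Variables (r : nat) (sg : 'M[Y]_(r, r.+1)).
Hypothesis Osg : forall i j, O (sg i j).
Definition minor_ideal (x : Y) : Prop := exists c : 'I_r.+1 -> Y, (forall j, O (c j)) /\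
  x = \sum_j c j * \det (col' j sg).

Lemma Osign j x : O x -> O ((-1) ^+ j * x). Proof. by auto. Qed.
Lemma minorP x : minor_ideal x <->
  exists c : 'I_r.+1 -> Y, (forall j, O (c j)) /\ x = \sum_j c j * minors sg j 0.
Proof.
split=> -[c [hc ->]]; exists (fun j : 'I_r.+1 => (-1) ^+ j * c j); split=> [j|]; try exact: Osign;
  apply: eq_bigr => j _; rewrite mxE.
  by rewrite mulrACA -expr2 sqrr_sign mul1r.
by rewrite mulrCA mulrA.
Qed.
Lemma Odet q (B : 'M[Y]_q) : (forall x y, O (B x y)) -> O (\det B).
Proof.
move=> h; apply: Osum => s _; apply: OM; auto.
by apply: (big_ind O); auto.
Qed.
Lemma Ominors j : O (minors sg j 0).
Proof. by rewrite mxE; apply: Osign; apply: Odet => x y; rewrite mxE. Qed.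
Lemma minor_O x : minor_ideal x -> O x.
Proof. by move=> /minorP[c [hc ->]]; apply: Osum => j _; have := Ominors j; auto. Qed.
Lemma minor_in j : minor_ideal (minors sg j 0).
Proof.
apply/minorP; exists (fun i => (i == j)%:R); split=> [i|]; first by case: eqP; auto.
by rewrite (bigD1 j) //= eqxx mul1r big1 ?addr0 // => i /negPf ->; rewrite mul0r.
Qed.
Lemma minorD x y : minor_ideal x -> minor_ideal y -> minor_ideal (x + y).
Proof.
move=> [c [hc ->]] [d [hd ->]]; exists (fun j => c j + d j); split; first by auto.
by rewrite -big_split; apply: eq_bigr => j _; rewrite mulrDl.
Qed.
Lemma minorM x y : O x -> minor_ideal y -> minor_ideal (x * y).
Proof.
move=> hx [d [hd ->]]; exists (fun j => x * d j); split; first by auto.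
by rewrite mulr_sumr; apply: eq_bigr => j _; rewrite mulrA.
Qed.

Lemma pow_minor K x : minor_ideal (u ^+ K) -> minor_ideal (v ^+ K) -> in_powers K x -> minor_ideal x.
Proof.
by move=> hu hv [b [d [hb hd ->]]]; apply: minorD; rewrite mulrC; apply: minorM.
Qed.

(** Applying [sg] to [u^K x + v^K y] gives 0, because [sg] kills its minors; regularity of the
    powers then produces [ga]. With [q] generated by the two powers and [I] by the minors, this
    realizes the linkage map from [(q : I) / q] to the cokernel of [sg]. *)
Lemma colon_lift K th : O th -> (forall x, minor_ideal x -> in_powers K (th * x)) ->
  exists (x y : 'cV[Y]_r.+1) (ga : 'cV[Y]_r), [/\ forall j, O (x j 0) /\ O (y j 0), forall i, O (ga i 0),
    th *: minors sg = u ^+ K *: x + v ^+ K *: y,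
    sg *m x = - (v ^+ K *: ga) & sg *m y = u ^+ K *: ga].
Proof.
move=> hth h.
have ex j : exists bd : Y * Y, [/\ O bd.1, O bd.2 & th * minors sg j 0 = u ^+ K * bd.1 + v ^+ K * bd.2].
  by have [b [d [? ? ?]]] := h _ (minor_in j); exists (b, d).
have [f hf] := ord_choice ex.
pose x : 'cV[Y]_r.+1 := \col_j (f j).1; pose y : 'cV[Y]_r.+1 := \col_j (f j).2.
have E : th *: minors sg = u ^+ K *: x + v ^+ K *: y.
  by apply/colP => j; have [_ _] := hf j; rewrite !mxE.
have Oxy j : O (x j 0) /\ O (y j 0) by rewrite !mxE; case: (hf j).
have Osx i : O ((sg *m x) i 0) by rewrite mxE; apply: Osum => j _; apply: OM => //; case: (Oxy j).
have Osy i : O ((sg *m y) i 0) by rewrite mxE; apply: Osum => j _; apply: OM => //; case: (Oxy j).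
have E0 : u ^+ K *: (sg *m x) = - (v ^+ K *: (sg *m y)).
  apply/eqP; rewrite -subr_eq0 opprK !scalemxAr -mulmxDr -E -scalemxAr mul_minors scaler0.
  by [].
have ex' i : exists z, [/\ O z, (sg *m y) i 0 = u ^+ K * z & (sg *m x) i 0 = - (v ^+ K * z)].
  have := congr1 (fun M : 'cV_r => M i 0) E0; rewrite [LHS]mxE [RHS]mxE [in RHS]mxE => E1.
  have [|||z [hz Ey Ex]] := @params_regular K K (- (sg *m x) i 0) ((sg *m y) i 0); auto.
    by rewrite mulrN E1 opprK.
  by exists z; split=> //; rewrite -Ex opprK.
have [g hg] := ord_choice ex'; exists x, y, (\col_i g i); split=> // [i||].
- by rewrite mxE; case: (hg i).
- by apply/colP => i; have [_ _ ->] := hg i; rewrite !mxE.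
- by apply/colP => i; have [_ -> _] := hg i; rewrite !mxE.
Qed.

(** The first [len + 1] powers of [f] satisfy a relation modulo the ideal. After its lowest power of
    [f] is taken out, what remains is a nonzero constant plus an element of the maximal ideal, a
    unit. *)
Lemma quot_power len f b d : quot_dim (scal Y) O minor_ideal len -> O b -> O d -> f = b * u + d * v ->
  exists N, minor_ideal (f ^+ N).
Proof.
move=> [bs [_ sp _]] hb hd Ef.
have Of : O f by rewrite Ef; auto.
have ex (i : 'I_len.+1) : exists c : 'I_len -> k, minor_ideal (f ^+ i - \sum_j scal Y (c j) * bs j).
  by apply: sp; auto.
have [c hc] := ord_choice ex.
pose M : 'M[k]_(len.+1, len) := \matrix_(i, j) c i j.
have : kermx M != 0.
  rewrite kermx_eq0 /row_free; apply/eqP => E; have := rank_leq_col M.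
  by rewrite E ltnn.
move/matrix0Pn => [i [j nz]]; pose a := row i (kermx M).
have aM : a *m M = 0 by rewrite -row_mul mulmx_ker row0.
have key : minor_ideal (\sum_i scal Y (a 0 i) * f ^+ i).
  have -> : \sum_i scal Y (a 0 i) * f ^+ i =
      \sum_i scal Y (a 0 i) * (f ^+ i - \sum_j scal Y (c i j) * bs j).
    rewrite (eq_bigr _ (fun i _ => mulrBr (scal Y (a 0 i)) _ _)) sumrB.
    rewrite [X in _ - X](_ : _ = 0) ?subr0 //.
    under eq_bigr => i0 _ do rewrite mulr_sumr.
    rewrite exchange_big big1 //= => j0 _.
    under eq_bigr => i0 _ do rewrite mulrA -scalM.
    rewrite -mulr_suml (_ : \sum_i0 _ = 0) ?mul0r //.
    have := congr1 (fun B : 'rV_len => scal Y (B 0 j0)) aM.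
    rewrite mxE [RHS](_ : _ = 0); last by rewrite mxE scal0.
    move=> H; rewrite -[RHS]H (big_morph (scal Y) (@scalD _ _ Y) (@scal0 _ _ Y)); apply: eq_bigr => i0 _.
    by rewrite [M _ _]mxE.
  elim/big_ind : _ => [|x y|i0 _].
  - by exists (fun=> 0); split; auto; rewrite big1 // => ? _; rewrite mul0r.
  - exact: minorD.
  - by apply: minorM.
have nza : exists i, a 0 i != 0 by exists j; rewrite mxE.
have gen N' (a' : 'I_N' -> k) q : (exists i, a' i != 0) ->
    minor_ideal (f ^+ q * \sum_i scal Y (a' i) * f ^+ i) -> exists N, minor_ideal (f ^+ N).
  elim: N' a' q => [|N' IH] a' q [i0 nz0]; first by case: i0 nz0.
  rewrite big_ord_recl /= expr0 mulr1.
  rewrite (eq_bigr (fun i : 'I_N' => f * (scal Y (a' (lift ord0 i)) * f ^+ i))) => [|y _]; last first.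
    by rewrite /bump /= add1n exprS mulrCA.
  rewrite -mulr_sumr; set R := \sum_(i < N') _.
  have hR : O R by apply: Osum => y _; auto.
  have [a0|na0] := eqVneq (a' ord0) 0.
    rewrite a0 scal0 add0r mulrA -exprSr; apply: IH.
    by case: (unliftP ord0 i0) nz0 => [y ->|->] nz0; [exists y|rewrite a0 eqxx in nz0].
  move=> h; exists q; have ui := units na0 (OM hR hb) (OM hR hd).
  rewrite -[f ^+ q](mulfK (_ : scal Y (a' ord0) + f * R != 0)).
    by rewrite [_ / _]mulrC; apply: minorM => //; rewrite Ef mulrDl addrA [b * u * R]mulrC [d * v * R]mulrC !mulrA.
  apply/eqP => E; apply: (@proper (- (scal Y (a' ord0)^-1 * R * b)) (- (scal Y (a' ord0)^-1 * R * d))); auto.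
  have -> : - (scal Y (a' ord0)^-1 * R * b) * u + - (scal Y (a' ord0)^-1 * R * d) * v =
    - (scal Y (a' ord0)^-1 * (f * R)) by rewrite Ef; ring.
  move/eqP: E; rewrite addrC addr_eq0 => /eqP ->.
  by rewrite mulrN opprK -scalM mulVf ?scal1.
by apply: (gen _ (fun i => a 0 i) 0%N nza); rewrite expr0 mul1r.
Qed.

(** The coordinates with respect to a basis of [O / I] are functionals of the form [lam (th x)] that
    kill [I], so [th I] lies in [q], the ideal of the two powers, and [colon_lift] turns each [th]
    into a vector [ga]. If a combination of the [ga] lies in the image of [sg], the lifts can be
    corrected to multiples of the minors; then the combination of the [th] lies in [q], and its
    coefficients are 0. *)
Theorem local_length len : quot_dim (scal Y) O minor_ideal len ->
  exists ga : 'I_len -> 'cV[Y]_r, (forall y i, O (ga y i 0)) /\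
  forall (c : 'I_len -> k) (x : 'cV[Y]_r.+1), (forall j, O (x j 0)) ->
    \sum_y scal Y (c y) *: ga y = sg *m x -> forall y, c y = 0.
Proof.
move=> ql; have [N1 hN1] : exists N, minor_ideal (u ^+ N).
  by apply: (quot_power (b := 1) (d := 0) ql); auto; rewrite mul1r mul0r addr0.
have [N2 hN2] : exists N, minor_ideal (v ^+ N).
  by apply: (quot_power (b := 0) (d := 1) ql); auto; rewrite mul1r mul0r add0r.
pose K' := (N1 + N2)%N; pose K := K'.+1.
have hu : minor_ideal (u ^+ K) by rewrite /K /K' -addnS addnC exprD; apply: minorM; auto.
have hv : minor_ideal (v ^+ K) by rewrite /K /K' -addSn exprD; apply: minorM; auto.
have [b [hb sp fr]] := ql.
pose cd x := sel (fun=> 0) (fun c : 'I_len -> k => minor_ideal (x - \sum_i scal Y (c i) * b i)).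
have cdP x : O x -> minor_ideal (x - \sum_i scal Y (cd x i) * b i).
  by move=> /sp /(@selP _ (fun=> 0)).
have mN x : minor_ideal x -> minor_ideal (- x) by rewrite -mulN1r; apply: minorM.
have cd_uniq x c : minor_ideal (x - \sum_i scal Y (c i) * b i) -> O x -> forall i, cd x i = c i.
  move=> h hx i; apply/eqP; rewrite -subr_eq0; apply/eqP.
  apply: (fr (fun i => cd x i - c i)).
  rewrite (_ : \sum__ _ = (x - \sum_i scal Y (c i) * b i) + - (x - \sum_i scal Y (cd x i) * b i)).
    by apply: minorD => //; apply: mN; apply: cdP.
  rewrite opprB addrC addrA subrK -sumrB; apply: eq_bigr => i' _.
  by rewrite scalD scalN mulrBl.
have rep y : exists th, [/\ O th, forall x, O x -> lam K' (th * x) = cd x y &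
    forall x, minor_ideal x -> in_powers K (th * x)].
  have cd0 x : minor_ideal x -> cd x y = 0.
    move=> hx; rewrite (cd_uniq x (fun=> 0)) //; last exact: minor_O.
    by rewrite big1 ?subr0 // => i _; rewrite scal0 mul0r.
  have [||th hth Eth] := @lam_represent K' (fun x => cd x y).
  - move=> a x z hx hz; rewrite (cd_uniq _ (fun i => a * cd x i + cd z i)) //; auto.
    rewrite (_ : _ - _ = scal Y a * (x - \sum_i scal Y (cd x i) * b i) + (z - \sum_i scal Y (cd z i) * b i)).
      by apply: minorD; [apply: minorM => //|]; apply: cdP.
    rewrite (eq_bigr (fun i => scal Y a * (scal Y (cd x i) * b i) + scal Y (cd z i) * b i)) => [|i _].
      by rewrite big_split -mulr_sumr /=; ring.
    by rewrite scalD scalM mulrDl mulrA.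
  - by move=> x /(pow_minor hu hv); apply: cd0.
  exists th; split=> // x hx; have Ox := minor_O hx; apply: lam_nondegenerate; auto => z hz.
  by rewrite -mulrA Eth ?cd0 //; auto; rewrite mulrC; apply: minorM.
have [th hth] := ord_choice rep.
have lift y : exists xyg : 'cV[Y]_r.+1 * 'cV[Y]_r.+1 * 'cV[Y]_r,
   [/\ forall j, O (xyg.1.1 j 0) /\ O (xyg.1.2 j 0), forall i, O (xyg.2 i 0),
    th y *: minors sg = u ^+ K *: xyg.1.1 + v ^+ K *: xyg.1.2,
    sg *m xyg.1.1 = - (v ^+ K *: xyg.2) & sg *m xyg.1.2 = u ^+ K *: xyg.2].
  have [h1 _ h2] := hth y; have [x [z [g ?]]] := colon_lift h1 h2.
  by exists (x, z, g).
have [f hf] := ord_choice lift.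
exists (fun y => (f y).2); split=> [y i|c z hz E]; first by case: (hf y).
pose T := \sum_y scal Y (c y) * th y.
pose x := \sum_y scal Y (c y) *: (f y).1.1 + v ^+ K *: z.
pose y := \sum_y scal Y (c y) *: (f y).1.2 - u ^+ K *: z.
have OT : O T by apply: Osum => i _; have [? _ _] := hth i; auto.
have sx : sg *m x = 0.
  rewrite /x mulmxDr mulmx_sumr -scalemxAr -E scaler_sumr -big_split big1 //= => i _.
  by have [_ _ _ e _] := hf i; rewrite -scalemxAr e scalerN !scalerA mulrC addNr.
have sy : sg *m y = 0.
  rewrite /y mulmxBr mulmx_sumr -scalemxAr -E scaler_sumr -sumrB big1 //= => i _.
  by have [_ _ _ _ e] := hf i; rewrite -scalemxAr e !scalerA mulrC subrr.
have Exy : T *: minors sg = u ^+ K *: x + v ^+ K *: y.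
  rewrite /x /y scalerDr scalerBr !scalerA [v ^+ K * _]mulrC addrACA subrr addr0.
  rewrite /T scaler_suml !scaler_sumr -big_split; apply: eq_bigr => i _.
  by have [_ _ e _ _] := hf i; rewrite -scalerA e scalerDr !scalerA /= ![scal _ _ * _]mulrC.
have nm : minors sg != 0.
  apply/eqP => m0; have /minorP[d [_]] := hu; rewrite big1 => [/eqP|j _]; last by rewrite m0 mxE mulr0.
  by rewrite expf_eq0 (negPf nu) andbF.
have [xi Ex] := kernel_minors nm sx; have [eta Ey] := kernel_minors nm sy.
have frac q w : w = q *: minors sg -> (forall j, O (w j 0)) -> O q.
  move=> Ew Ow.
  have qI t : minor_ideal t -> O (t * q).
    move=> /minorP[d [hd ->]]; rewrite mulr_suml; apply: Osum => j _; rewrite -mulrA; apply: OM => //.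
    by have := Ow j; rewrite Ew mxE mulrC.
  by apply: (depth (N := K)); apply: qI.
have Oxi : O xi.
  apply: (frac xi x) => // j; rewrite mxE summxE mxE; apply: OD; last by auto.
  by apply: Osum => i _; rewrite mxE; have [/(_ j)[? _] _ _ _ _] := hf i; auto.
have Oeta : O eta.
  apply: (frac eta y) => // j; rewrite mxE summxE !mxE; apply: OB; last by auto.
  by apply: Osum => i _; rewrite mxE; have [/(_ j)[_ ?] _ _ _ _] := hf i; auto.
have hT : in_powers K T.
  exists xi, eta; split=> //; move/matrix0Pn: nm => [j [z0 nz]]; rewrite ord1 in nz.
  have E' : T *: minors sg = (u ^+ K * xi + v ^+ K * eta) *: minors sg.
    by rewrite Exy Ex Ey scalerDl !scalerA.
  apply: (mulIf nz); have := congr1 (fun M : 'cV_r.+1 => M j 0) E'.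
  by rewrite mxE [RHS]mxE.
move=> i; have : lam K' (T * b i) = 0 by rewrite mulrC; apply: coef_pow; apply: powM.
rewrite /T mulr_suml lam_bigsum => [|j]; last by have [? _ _] := hth j; auto.
rewrite (bigD1 i) //= big1 ?addr0 => [|j ne]; last first.
  have [h1 h2 _] := hth j; rewrite -mulrA lamZ ?h2; auto.
  rewrite (cd_uniq _ (fun q => (q == i)%:R)) ?(negPf ne) ?mulr0 //.
  rewrite (bigD1 i) //= eqxx scal1 mul1r big1 ?addr0 ?subrr => [|q /negPf ->]; last by rewrite scal0 mul0r.
  by rewrite -(mul0r (u ^+ K)); apply: minorM.
have [h1 h2 _] := hth i; rewrite -mulrA lamZ ?h2; auto.
rewrite (cd_uniq _ (fun q => (q == i)%:R)) ?eqxx ?mulr1 //.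
rewrite (bigD1 i) //= eqxx scal1 mul1r big1 ?addr0 ?subrr => [|q /negPf ->]; last by rewrite scal0 mul0r.
by rewrite -(mul0r (u ^+ K)); apply: minorM.
Qed.
End LocalLength.

(** * Local rings of the surface *)

(** The substitution adding [d i] times ['X_i0] to the other variables turns the two linear forms
    into variables. *)
Lemma shear_coprime (k : closedFieldType) (i0 j h : 'I_3) (d : 'I_3 -> k) M (F G : {mpoly k[3]}) :
  j != h -> j != i0 -> h != i0 ->
  ('X_h - (d h)%:MP * 'X_i0) ^+ M * F = ('X_j - (d j)%:MP * 'X_i0) ^+ M * G ->
  exists Q, F = ('X_j - (d j)%:MP * 'X_i0) ^+ M * Q.
Proof.
move=> jh ji hi E.
pose sub (a : k) : {mpoly k[3]} -> {mpoly k[3]} :=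
  subst_forms (fun i : 'I_3 => 'X_i + (if i == i0 then 0 else (a * d i)%:MP) * 'X_i0 : {mpoly k[3]}).
have subX a i : sub a 'X_i = 'X_i + (if i == i0 then 0 else (a * d i)%:MP) * 'X_i0.
  by rewrite /sub /subst_forms mmapX mmap1U.
have subX0 a : sub a 'X_i0 = 'X_i0 by rewrite subX eqxx mul0r addr0.
have subK H : sub (-1) (sub 1 H) = H.
  elim/mpoly_alg_ind: H => [c|i|A B IA IB|A B IA IB].
  - by rewrite /sub !substC.
  - rewrite subX /sub substD substM -/(sub (-1) _) -/(sub (-1) _) -/(sub (-1) 'X_i0) subX subX0.
    case: eqP => _; first by rewrite /sub /subst_forms rmorph0 !mul0r !addr0.
    by rewrite /sub substC -addrA -mulrDl -mpolyCD mulN1r mul1r addNr mpolyC0 mul0r addr0.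
  - by move: IA IB; rewrite /sub !substD => -> ->.
  - by move: IA IB; rewrite /sub !substM => -> ->.
have subl a i : i != i0 -> sub a ('X_i - (d i)%:MP * 'X_i0) = 'X_i + ((a - 1) * d i)%:MP * 'X_i0.
  move=> /negPf ne; rewrite -mulNr -mpolyCN /sub substD substM substC -/(sub a _) -/(sub a _) subX subX0 ne.
  by rewrite -addrA -mulrDl -mpolyCD mulrBl mul1r.
have subl1 i : i != i0 -> sub 1 ('X_i - (d i)%:MP * 'X_i0) = 'X_i.
  by move=> ne; rewrite subl // subrr mul0r mpolyC0 mul0r addr0.
have sX a A N : sub a (A ^+ N) = sub a A ^+ N by rewrite /sub /subst_forms rmorphXn.
have := congr1 (sub 1) E; rewrite /sub !substM -!/(sub 1 _) !sX (subl1 h) // (subl1 j) // => E'.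
have [Q EQ] := monomial_coprime jh E'.
exists (sub (-1) Q); rewrite -[F]subK EQ /sub substM -!/(sub (-1) _) sX; congr (_ ^+ _ * _).
by rewrite -{1}(subl1 j) // subK.
Qed.

Section PointLocal.
Variables (k : closedFieldType) (n : nat) (Y : cone k n) (l : 'I_3 -> {mpoly k[n.+1]}).
Local Notation S := {mpoly k[n.+1]}.
Local Notation "'π' F" := (@cproj k n Y F) (at level 8, F at level 2).
Variables (K : nat) (par : parameters Y l K).
Variables (I : finType) (a : I -> nat) (e : I -> Y).
Hypothesis fa : free_algebra l a e.
Variable p : 'I_n.+1 -> k.
Hypothesis hp : onv Y p.
Let hP := ptden_class hp.

Lemma inA_stk m (x : Y) : inA x -> hdg m x -> stk m p x.
Proof.
move=> h hm; have [->|nz] := eqVneq x 0; first exact: hloc0.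
by have [t -> [F hF ->]] := inA_hdg nz h hm; apply: hloc_pi.
Qed.

Lemma stk_div m (G : S) d (x : Y) : G \is d.-homog -> G.@[p] != 0 -> stk (d%:Z + m) p (π G * x) -> stk m p x.
Proof.
move=> hG Gp h; have := hlocM hP (hloc_inv Y (D := ptden p) hG Gp) h.
by rewrite addKr mulKf // (onv_nz hp Gp).
Qed.

Lemma cmax_stk (x : Y) : cmax p x -> stk 0 p x.
Proof. by move=> [F [G [d [hF hG _ Gp ->]]]]; exists F, G, d, d; rewrite subrr. Qed.

Lemma stk0_split (x : Y) : stk 0 p x -> exists c y, cmax p y /\ x = scal Y c + y.
Proof.
move=> [F [G [d [f [hF hG E Gp ->]]]]]; have Ed : d = f by apply/eqP; rewrite -eqz_nat -subr_eq0 E.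
rewrite -Ed in hG; pose c := F.@[p] / G.@[p]; exists c, (π (F - c *: G) / π G); split.
  exists (F - c *: G), G, d; split=> //; last by rewrite mevalB mevalZ divfK // subrr.
  by apply: rpredB => //; apply: rpredZ.
by rewrite piB piZ mulrBl mulfK ?(onv_nz hp Gp) // subrKC.
Qed.

Lemma cmax_proper : ~ cmax p (1 : Y).
Proof.
move=> [F [G [d [hF hG Fp Gp E]]]]; have nG := onv_nz hp Gp.
have : π G = π F by rewrite -[LHS]mul1r E divfK.
by move/(onv_eval hp) => E'; rewrite E' Fp eqxx in Gp.
Qed.

Variables (u v : Y).
Hypothesis huv : cparam p u v.

Lemma param_cmax b d : stk 0 p b -> stk 0 p d -> cmax p (b * u + d * v).
Proof. by move=> hb hd; apply/huv; exists b, d. Qed.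
Lemma param_stk : stk 0 p u /\ stk 0 p v.
Proof.
by split; apply: cmax_stk; apply/huv; [exists 1, 0|exists 0, 1];
  rewrite mul1r mul0r ?addr0 ?add0r; split=> //; (exact: hloc1 || exact: hloc0).
Qed.

Lemma stk0_residue x : stk 0 p x -> exists c b d, [/\ stk 0 p b, stk 0 p d & x = scal Y c + b * u + d * v].
Proof.
by move=> /stk0_split[c [y [/huv[b [d [hb hd ->]]] ->]]]; exists c, b, d; rewrite addrA.
Qed.
Lemma stk0_proper b d : stk 0 p b -> stk 0 p d -> b * u + d * v <> 1.
Proof. by move=> hb hd E; apply: cmax_proper; rewrite -E; apply: param_cmax. Qed.
Lemma stk0_units c b d : c != 0 -> stk 0 p b -> stk 0 p d -> stk 0 p (scal Y c + b * u + d * v)^-1.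
Proof.
move=> nc hb hd; rewrite -addrA; have [F [G [q [hF hG Fp Gp ->]]]] := param_cmax hb hd.
have nG := onv_nz hp Gp.
have -> : scal Y c + π F / π G = π (c *: G + F) / π G by rewrite piD piZ mulrDl mulfK.
rewrite invf_div; exists G, (c *: G + F), q, q; rewrite subrr; split=> //.
  by apply: rpredD => //; apply: rpredZ.
by rewrite /ptden mevalD mevalZ Fp addr0 mulf_neq0.
Qed.

(** In each term of the binomial expansion one of the two exponents is at least [N]. *)
Lemma submodule_power (W : Y -> Prop) N b d z : (forall x y, W x -> W y -> W (x + y)) -> W 0 ->
  (forall x y, stk 0 p x -> W y -> W (x * y)) -> stk 0 p b -> stk 0 p d ->
  W (u ^+ N * z) -> W (v ^+ N * z) -> W ((b * u + d * v) ^+ (N + N) * z).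
Proof.
move=> WD W0 WM hb hd hu hv; have [Ou Ov] := param_stk.
have OX (x : Y) q : stk 0 p x -> stk 0 p (x ^+ q) by move=> h; have := hlocX hP q h; rewrite mul0r.
have OM (x y : Y) : stk 0 p x -> stk 0 p y -> stk 0 p (x * y) by move=> h1 h2; have := hlocM hP h1 h2; rewrite addr0.
rewrite exprDn mulr_suml; apply: (big_ind W) => // i _.
rewrite mulrnAl; elim: ('C(_, _)) => [|q IH]; rewrite ?mulr0n // mulrS; apply: WD => //.
have [le|lt] := leqP N i.
  have -> : (b * u) ^+ (N + N - i) * (d * v) ^+ i * z =
     (b * u) ^+ (N + N - i) * (d ^+ i * v ^+ (i - N)) * (v ^+ N * z).
    have Ev : v ^+ i = v ^+ (i - N) * v ^+ N by rewrite -exprD subnK.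
    by rewrite [(d * v) ^+ i]exprMn Ev !mulrA.
  by apply: WM => //; apply: (OM); [apply: (OX); apply: (OM)|apply: (OM); apply: (OX)].
have le : (N <= N + N - i)%N by move: lt; clear; lia.
have -> : (b * u) ^+ (N + N - i) * (d * v) ^+ i * z =
    (d * v) ^+ i * (b ^+ (N + N - i) * u ^+ (N + N - i - N)) * (u ^+ N * z).
  have Eu : u ^+ (N + N - i) = u ^+ (N + N - i - N) * u ^+ N by rewrite -exprD subnK.
  by rewrite [(b * u) ^+ _]exprMn Eu mulrAC -mulrA [_ * z]mulrC !mulrA [_ * (d * v) ^+ i]mulrC !mulrA mulrAC.
by apply: WM => //; apply: (OM); [apply: (OX); apply: (OM)|apply: (OM); apply: (OX)].
Qed.

(* [A] is free over [k[l]], hence two coprime linear forms in the [l i] through [p] suffice to test regularity. *)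
Lemma stk_depth m N z : u != 0 -> stk m p (u ^+ N * z) -> stk m p (v ^+ N * z) -> stk m p z.
Proof.
move=> nu hu hv; have [i0 li0] := par_empty par hp.
have [Ou Ov] := param_stk.
have hlf := par_homog par.
pose d (j : 'I_3) := (l j).@[p] / (l i0).@[p].
pose lam j : S := l j - d j *: l i0.
have hlam j : lam j \is 1.-homog by apply: rpredB => //; apply: rpredZ.
have lamp j : (lam j).@[p] = 0 by rewrite mevalB mevalZ /d divfK // subrr.
pose M := (N + N)%N.
have key j : exists G g, [/\ (G : S) \is g.-homog, G.@[p] != 0 & inA (π G * (π (lam j) ^+ M * z))].
  have : cmax p (π (lam j) / π (l i0)) by exists (lam j), (l i0), 1%N.
  move/huv => [b [c [hb hc E]]].
  have : stk m p ((b * u + c * v) ^+ M * z).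
    apply: (submodule_power (W := stk m p)) => //.
    - exact: hlocD.
    - exact: hloc0.
    - by move=> x y hx hy; have := hlocM hP hx hy; rewrite add0r.
  rewrite -E expr_div_n => -[F [G [f [g [hF hG _ Gp E']]]]].
  exists G, g; split=> //; exists (F * l i0 ^+ M).
  have nG := onv_nz hp Gp; have nl0 := onv_nz hp li0.
  have -> : π (lam j) ^+ M * z = π F / π G * π (l i0) ^+ M.
    by rewrite -E' mulrAC divfK // expf_neq0.
  by rewrite mulrA mulrCA divff // mulr1 piM piX.
have [j [h [jh ji hi]]] : exists j h : 'I_3, [/\ j != h, j != i0 & h != i0].
  case: (ord3P i0) => [->|[->|->]].
  - by exists (lift ord0 ord0), ord_max.
  - by exists ord0, ord_max.
  - by exists ord0, (lift ord0 ord0).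
have [G1 [g1 [hG1 G1p A1]]] := key j; have [G2 [g2 [hG2 G2p A2]]] := key h.
pose G := G1 * G2; have hG : G \is (g1 + g2).-homog := dhomogM hG1 hG2.
have Gp : G.@[p] != 0 by rewrite mevalM mulf_neq0.
have B1 : inA (π (lam j) ^+ M * (π G * z)).
  rewrite (_ : _ * _ = π G2 * (π G1 * (π (lam j) ^+ M * z))); last by rewrite piM; ring.
  by apply: inAM => //; apply: inApi.
have B2 : inA (π (lam h) ^+ M * (π G * z)).
  rewrite (_ : _ * _ = π G1 * (π G2 * (π (lam h) ^+ M * z))); last by rewrite piM; ring.
  by apply: inAM => //; apply: inApi.
pose lb i : {mpoly k[3]} := 'X_i - (d i)%:MP * 'X_i0.
have Elam i : π (lam i) ^+ M = rho Y l (lb i ^+ M).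
  by rewrite rhoX rhoB rhoM rhoC !rhoXi /lam piB piZ.
set z' := π G * z in B1 B2.
have hz' : inA z'.
  have ex i : exists Q, co l e (π (lam j) ^+ M * z') i = lb j ^+ M * Q.
    apply: (shear_coprime (h := h) (G := co l e (π (lam h) ^+ M * z') i)) => //.
    rewrite -/(lb h) -/(lb j) -!(co_rho fa) // -!Elam; congr (co _ _ _ _); ring.
  have [Q hQ] := ord_choice (fun y : 'I_#|I| => ex (enum_val y)).
  have nl : π (lam j) ^+ M != 0.
    rewrite Elam; apply/eqP => /(rho_inj fa)/eqP; rewrite expf_eq0 => /andP[_ /eqP E].
    have := congr1 (fun q => q@_(U_(j))%MM) E; rewrite /lb mcoeffB mcoeffCM !mcoeffX mcoeff0 eqxx.
    rewrite (_ : (U_(i0) == U_(j))%MM = false) ?mulr0 ?subr0; first by move/eqP; rewrite oner_eq0.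
    apply/negP => /eqP /mnmP /(_ j); rewrite !mnm1E eqxx eq_sym (negPf ji); by [].
  have -> : z' = \sum_(y < #|I|) rho Y l (Q y) * e (enum_val y).
    apply: (mulfI nl); rewrite [LHS](coE fa B1) (sum_over_enum (fun i => rho Y l (co l e _ i) * e i)).
    rewrite mulr_sumr; apply: eq_bigr => y _.
    by rewrite hQ rhoM -Elam mulrA.
  apply: inA_sum => y _; apply: inAM; [exact: inA_rho|exact: (inAe fa)].
have hz : hdg m z.
  have := stk_hdg hp hu; have := hdgV (expf_neq0 N nu) (hlocX (nzden_class Y) N (stk_hdg hp Ou)).
  rewrite mul0r oppr0 => h1 h2; have := hlocM (nzden_class Y) h1 h2.
  by rewrite add0r mulKf // expf_neq0.
apply: (stk_div hG Gp); apply: inA_stk => //.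
exact: (hlocM (nzden_class Y) (hloc_pi (nzden_class Y) hG) hz).
Qed.

Hypothesis chark : [pchar k] =i pred0.
(** By [ld_wedge] the wedge of [u] and [v] does not vanish on the two derivations. *)
Lemma param_neq0 : u != 0 /\ v != 0.
Proof.
have nl := par_nz par; have hlf := par_homog par.
have [D1 [D2 [hD1 hD2 _ _ nT]]] := derivations_exist chark hlf nl fa.
have [w [G [f [q ld]]]] := local_data_exists chark fa hp huv.
have E := ld_wedge hlf hp ld hD1 hD2.
have nw : D1 u * D2 v - D1 v * D2 u != 0.
  apply: contraTneq (mulf_neq0 (expf_neq0 3 (nmuw hp ld)) nT) => E0.
  by rewrite negbK; apply/eqP; rewrite [LHS]E E0 !mulr0.
have D0 (D : Y -> Y) : kder D -> D 0 = 0.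
  by move=> [h _ _]; have := h 0 0; rewrite addr0 => /eqP; rewrite -subr_eq0 opprD addrA subrr sub0r oppr_eq0 => /eqP.
split; apply: contra_neq nw => ->; rewrite !(D0 _ hD1) !(D0 _ hD2); ring.
Qed.
End PointLocal.

(** * Bundles and their modules of sections *)

Section Frames.
Variables (k : closedFieldType) (n : nat) (Y : cone k n).
Local Notation S := {mpoly k[n.+1]}.
Local Notation "'π' F" := (@cproj k n Y F) (at level 8, F at level 2).

Record frames (r : nat) (fr : ('I_n.+1 -> k) -> 'M[Y]_r) : Prop := Frames {
  fr_unit : forall p, onv Y p -> fr p \in unitmx /\ forall i j, hdg 0 (fr p i j);
  fr_coh : forall p, onv Y p -> exists G : S, exists d : nat, [/\ G \is d.-homog, G.@[p] != 0 &
    forall q, onv Y q -> G.@[q] != 0 -> forall i j,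
      stk 0 q ((fr p *m invmx (fr q)) i j) /\ stk 0 q ((fr q *m invmx (fr p)) i j)] }.

Definition gsec (r : nat) (fr : ('I_n.+1 -> k) -> 'M[Y]_r) (m : int) (v : 'rV[Y]_r) : Prop :=
  (forall i, hdg m (v 0 i)) /\
  forall p, onv Y p -> forall i, stk m p ((v *m invmx (fr p)) 0 i).

Lemma stkM m m' p (x y : Y) : onv Y p -> stk m p x -> stk m' p y -> stk (m + m') p (x * y).
Proof. by move=> hp; apply: (hlocM (ptden_class hp)). Qed.
Lemma stk0M m p (x y : Y) : onv Y p -> stk 0 p x -> stk m p y -> stk m p (x * y).
Proof. by move=> hp hx hy; rewrite -[m]add0r; apply: stkM. Qed.
Lemma stkM0 m p (x y : Y) : onv Y p -> stk m p x -> stk 0 p y -> stk m p (x * y).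
Proof. by move=> hp hx hy; rewrite mulrC; apply: stk0M. Qed.
Lemma stk_sum m p (T : Type) (s : seq T) (P : pred T) (f : T -> Y) : onv Y p ->
  (forall i, P i -> stk m p (f i)) -> stk m p (\sum_(i <- s | P i) f i).
Proof. by move=> hp; apply: (hloc_sum (ptden_class hp)). Qed.

Lemma coh_positive r fr : frames (r := r) fr -> forall p, onv Y p -> exists G : S, exists d : nat,
  [/\ G \is d.-homog, G.@[p] != 0, G.@[fun=> 0] = 0 &
    forall q, onv Y q -> G.@[q] != 0 -> forall i j,
      stk 0 q ((fr p *m invmx (fr q)) i j) /\ stk 0 q ((fr q *m invmx (fr p)) i j)].
Proof.
move=> hfr p hp; have [G [d [hG Gp h]]] := fr_coh hfr hp; have [[i pi] _] := hp.
exists ('X_i * G), (1 + d)%N; split.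
- exact: dhomogM (dhomogXi k i) hG.
- by rewrite mevalM mevalXU mulf_neq0.
- by rewrite mevalM mevalXU mul0r.
by move=> q hq; rewrite mevalM mulf_eq0 negb_or => /andP[_]; apply: h.
Qed.

Lemma hdg_invmx r (A : 'M[Y]_r) : A \in unitmx -> (forall i j, hdg 0 (A i j)) ->
  forall i j, hdg 0 (invmx A i j).
Proof.
move=> uA hA i j; have hN := nzden_class Y.
have dA : \det A != 0 by move: uA; rewrite unitmxE unitfE.
have hd : hdg 0 (\det A) := hloc_det hN hA.
rewrite /invmx uA mxE; rewrite -[0]addr0; apply: (hlocM hN).
  by have := hdgV dA hd; rewrite oppr0.
rewrite !mxE /cofactor -[0]addr0; apply: (hlocM hN).
  by have := hlocX hN (j + i) (hlocN hN (hloc1 hN)); rewrite mul0r.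
apply: (hloc_det hN) => x y; rewrite [X in hloc _ _ X]mxE [X in hloc _ _ X]mxE; exact: hA.
Qed.

Section Serre.
Variables (r : nat) (fr : ('I_n.+1 -> k) -> 'M[Y]_r).
Hypothesis hfr : frames fr.

(** Serre's theorem on twists. Where a form [G1] belonging to [p'] is nonzero, the frame at [p']
    trivializes the bundle, and a power of [G0] clears the denominators of the transition matrix.
    The polynomials [F] over whose open set such an exponent exists form an ideal without zeros, so
    one exponent serves everywhere. *)
Theorem serre p : onv Y p -> exists G d, [/\ (G : S) \is d.-homog, G.@[p] != 0 &
  forall i, gsec fr d%:Z (π G *: row i (fr p))].
Proof.
move=> hp; have hN := nzden_class Y.
have [G0 [g [hG0 G0p G00 h0]]] := coh_positive hfr hp.
have [up hdp] := fr_unit hfr hp.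
pose J F := exists N, forall q, onv Y q -> F.@[q] != 0 -> forall M, (N <= M)%N -> forall i j,
  stk (g * M)%N%:Z q (π G0 ^+ M * (fr p *m invmx (fr q)) i j).
have iJ : ideal J.
  split.
  - by exists 0%N => q _; rewrite meval0 eqxx.
  - move=> F F' [N hF] [N' hF']; exists (N + N')%N => q hq; rewrite mevalD => nz M le i j.
    have [F0|nF] := eqVneq F.@[q] 0.
      rewrite F0 add0r in nz; apply: hF' => //; exact: leq_trans (leq_addl _ _) le.
    by apply: hF => //; apply: leq_trans (leq_addr _ _) le.
  by move=> c F [N hF]; exists N => q hq; rewrite mevalM mulf_eq0 negb_or => /andP[_]; apply: hF.
have kJ F : π F = 0 -> J F.
  by move=> F0; exists 0%N => q [_ hq]; rewrite hq ?eqxx.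
have ptJ p' : onv Y p' -> exists2 H, J H & H.@[p'] != 0.
  move=> hp'; have [G1 [g1 [hG1 G1p' G10 h1]]] := coh_positive hfr hp'; exists G1 => //.
  have [up' hdp'] := fr_unit hfr hp'.
  pose y i j := (fr p *m invmx (fr p')) i j.
  have hy i j : hdg 0 (y i j).
    rewrite /y mxE; apply: (hloc_sum hN) => x _; rewrite -[0]addr0; apply: (hlocM hN).
      exact: hdp.
    exact: (hdg_invmx up' hdp').
  have ex (ij : 'I_r * 'I_r) : exists N, forall M, (N <= M)%N -> inA (π (G0 * G1) ^+ M * y ij.1 ij.2).
    pose Jy F := inA (π F * y ij.1 ij.2).
    have [|F F0||q hq nz|N hN'] := @nullstellensatz_open k n Y Jy (G0 * G1).
    - split; rewrite /Jy; first by rewrite pi0 mul0r; apply: inA0.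
        by move=> A B hA hB; rewrite piD mulrDl; apply: inAD.
      by move=> A B hB; rewrite piM -mulrA; apply: inAM => //; apply: inApi.
    - by rewrite /Jy F0 mul0r; apply: inA0.
    - by rewrite mevalM G00 mul0r.
    - move: nz; rewrite mevalM mulf_eq0 negb_or => /andP[G0q G1q].
      have : stk 0 q (y ij.1 ij.2).
        rewrite /y -[fr p](mulmxKV (fr_unit hfr hq).1) -(mulmxA (fr p *m _)) mxE; apply: stk_sum => // x _.
        by apply: stk0M => //; [case: (h0 q hq G0q ij.1 x)|case: (h1 q hq G1q x ij.2)].
      move=> [F [G [? [? [_ _ _ Gq E]]]]]; exists G => //.
      by rewrite /Jy E mulrC divfK ?(onv_nz hq Gq) //; apply: inApi.
    - by exists N => M le; rewrite -piX; apply: hN'.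
  have [Nf hNf] := ord_choice (fun x : 'I_#|{: 'I_r * 'I_r}| => ex (enum_val x)).
  pose N := (\sum_x Nf x)%N; exists N => q hq G1q M le i j.
  have hA i' j' : inA (π (G0 * G1) ^+ M * y i' j').
    have := hNf (enum_rank (i', j')); rewrite enum_rankK; apply.
    by apply: leq_trans le; rewrite /N (bigD1 (enum_rank (i', j'))) //= leq_addr.
  rewrite -[fr p](mulmxKV up') -(mulmxA (fr p *m _)) mxE mulr_sumr; apply: stk_sum => // x _.
  rewrite mulrA; apply: stkM0 => //; last by case: (h1 q hq G1q x j).
  have hG1M : G1 ^+ M \is (g1 * M).-homog := dhomogMn M hG1.
  have hG0M : G0 ^+ M \is (g * M).-homog := dhomogMn M hG0.
  have G1M : (G1 ^+ M).@[q] != 0 by rewrite rmorphXn /= expf_neq0.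
  apply: (stk_div hq hG1M G1M); apply: (inA_stk hq).
    by have := hA i x; rewrite piM exprMn mulrAC mulrC -[π G1 ^+ M]piX.
  apply: (hlocM hN); first exact: hloc_pi.
  rewrite -[(g * M)%N%:Z]addr0; apply: (hlocM hN); last exact: hy.
  by rewrite -piX; apply: hloc_pi.
have [N1 hN1] := projective_nullstellensatz iJ kJ ptJ.
have [Nf hNf] := ord_choice (fun i : 'I_n.+1 => hN1 N1 ('X_i ^+ N1) (leqnn _)
  (eq_ind _ (fun d => is_true ('X_i ^+ N1 \is d.-homog)) (dhomogMn N1 (dhomogXi k i)) _ (mul1n N1))).
pose M := (\sum_x Nf x)%N.
exists (G0 ^+ M), (g * M)%N; split.
- exact: dhomogMn.
- by rewrite rmorphXn /= expf_neq0.
move=> i; split=> [j|q hq j].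
  rewrite !mxE -[(g * M)%N%:Z]addr0; apply: (hlocM hN); last exact: hdp.
  by apply: hloc_pi => //; apply: dhomogMn.
have [[x qx] _] := hq.
rewrite -scalemxAl mxE -row_mul mxE piX; apply: (hNf x q hq) => //.
  by rewrite rmorphXn /= mevalXU expf_neq0.
by rewrite /M (bigD1 x) //= leq_addr.
Qed.
End Serre.

Lemma fdim_columns (W : Y -> Prop) q m : fdim (V := kmod Y^o) W m -> W 0 ->
  fdim (V := kmod 'cV[Y]_q) (fun x => forall i, W (x i 0)) (q * m).
Proof.
move=> [b [hb sp fr]] W0.
pose g (x : 'I_q * 'I_m) : kmod 'cV[Y]_q := b x.2 *: delta_mx x.1 0.
have lin (c : 'I_q * 'I_m -> k) i : (\sum_x c x *: g x : 'cV[Y]_q) i 0 = \sum_y c (i, y) *: (b y : kmod Y^o).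
  rewrite summxE (eq_bigr (fun x => (fun i' y => (c (i', y) *: g (i', y) : 'cV[Y]_q) i 0) x.1 x.2)) => [|[]//].
  rewrite -(pair_bigA _ (fun i' y => (c (i', y) *: g (i', y) : 'cV[Y]_q) i 0)) /= (bigD1 i) //=.
  rewrite [X in _ + X]big1 ?addr0 => [|i' ne].
    by apply: eq_bigr => y _; rewrite !kscaleE !mxE !eqxx mulr1.
  by rewrite big1 // => y _; rewrite kscaleE !mxE eq_sym (negPf ne) mulr0 mulr0.
have := @fdim_fin k (kmod 'cV[Y]_q) (fun x => forall i, W ((x : 'cV_q) i 0)) _ g.
rewrite card_prod !card_ord; apply.
- by move=> [i y] j; rewrite /g !mxE eqxx andbT; case: (j == i); rewrite ?mulr1 ?mulr0.
- move=> u hu; have ex j : exists c : 'I_m -> k, (u : 'cV_q) j 0 = \sum_y c y *: (b y : kmod Y^o) by apply: sp.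
  have [c hc] := ord_choice ex.
  exists (fun x => c x.1 x.2); apply/colP => j; rewrite lin; exact: hc.
- move=> c E [j y]; apply: (fr (fun y => c (j, y))); rewrite -lin E; exact: mxE.
Qed.
End Frames.

(** The shift by [D] does not affect the leading coefficient of quadratic growth. *)
Lemma growth_compare q D b : (forall t, q * 'C(t + 2, 2) <= b * 'C(t + D + 2, 2))%N -> (q <= b)%N.
Proof.
move=> h; rewrite leqNgt; apply/negP => lt.
(* Large enough for [b (x + D + 2) (x + D + 1)] to be less than [(b + 1) (x + 2) (x + 1)]. *)
pose x := (2 * b * D + D)%N.
have E N : ('C(N + 2, 2) * 2 = (N + 2) * N.+1)%N.
  by have := bin_ffact (N + 2) 2; rewrite addn2 ffactnS ffactn1.
have := leq_mul (h x) (leqnn 2); rewrite -!mulnA !E.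
have : (b.+1 * ((x + 2) * x.+1) <= q * ((x + 2) * x.+1))%N by rewrite leq_mul2r lt orbT.
move=> h1 h2; have {h1 h2} := leq_trans h1 h2; rewrite /x.
clear; nia.
Qed.

(** * Duality for the module of sections *)

Section DualModule.
Variables (k : closedFieldType) (n : nat) (Y : cone k n) (l : 'I_3 -> {mpoly k[n.+1]}).
Local Notation S := {mpoly k[n.+1]}.
Local Notation "'π' F" := (@cproj k n Y F) (at level 8, F at level 2).
Variables (K : nat) (par : parameters Y l K).
Variables (I : finType) (a : I -> nat) (e : I -> Y).
Hypothesis fa : free_algebra l a e.
Variables (s : nat) (ps : I -> Y) (tau : I -> {mpoly k[3]}).
Hypothesis hs : forall j, (a j <= s)%N.
Hypothesis fps : free_algebra l (fun j => (s - a j)%N) ps.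
Hypothesis htau : forall j, homd 0 (s - a j) (tau j).

(** The generator of [Hom (A, R)] for which [e] and [ps] are dual bases ([tr_dual]). *)
Definition tr (c : Y) : {mpoly k[3]} := \sum_j tau j * co l e c j.
Hypothesis dualE : forall c, inA c -> c = \sum_i rho Y l (tr (c * e i)) * ps i.

Lemma trD x y : inA x -> inA y -> tr (x + y) = tr x + tr y.
Proof. by move=> hx hy; rewrite /tr -big_split; apply: eq_bigr => j _; rewrite (coD fa) // mulrDr. Qed.
Lemma tr_rho c x : inA x -> tr (rho Y l c * x) = c * tr x.
Proof.
by move=> hx; rewrite /tr mulr_sumr; apply: eq_bigr => j _; rewrite (co_rho fa) // mulrCA.
Qed.
Lemma tr0 : tr 0 = 0.
Proof. by have := tr_rho 0 (inA0 Y); rewrite rho0 !mul0r. Qed.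
Lemma tr_sum (T : Type) (r : seq T) (f : T -> Y) : (forall i, inA (f i)) ->
  tr (\sum_(i <- r) f i) = \sum_(i <- r) tr (f i).
Proof.
move=> h; elim: r => [|x r IH]; first by rewrite !big_nil tr0.
by rewrite !big_cons trD ?IH //; apply: inA_sum.
Qed.
Lemma tr_homd t x : inAt t x -> homd t s (tr x).
Proof.
move=> hx; apply: homd_sum => j; have := co_homd fa j hx; have := htau j.
rewrite /homd leqn0 subn_eq0; have [le|lt] := leqP s (a j); last first.
  by move=> -> _; rewrite mul0r; case: ifP => // _; apply: dhomog0.
have -> : a j = s by apply/eqP; rewrite eqn_leq hs le.
rewrite subnn; case: ifP => _ h1 h2; last by rewrite h2 mulr0.
by have := dhomogM h1 h2; rewrite add0n.
Qed.
Lemma tr_dual i j : tr (ps i * e j) = (i == j)%:R.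
Proof.
have hi := inAe fps i.
have E : \sum_j rho Y l (tr (ps i * e j)) * ps j = \sum_j rho Y l ((i == j)%:R) * ps j.
  rewrite -(dualE hi) (bigD1 i) //= eqxx rho1 mul1r big1 ?addr0 // => j' /negPf ne.
  by rewrite eq_sym ne rho0 mul0r.
exact: (fa_uniq fps E j).
Qed.

Variables (r : nat) (fr : ('I_n.+1 -> k) -> 'M[Y]_r) (b : nat) (s0 : 'M[Y]_(b, r)).
Hypothesis hfr : frames fr.
Hypothesis hs0 : forall j, gsec fr 0 (row j s0).
Hypothesis hM : forall m v, gsec fr m v -> modS s0 v.
Variables (J : finType) (eb : J -> 'rV[Y]_r).
Hypothesis eb0 : forall j, modSt s0 0 (eb j).
Hypothesis ebs : forall t v, modSt s0 t v -> exists2 c : J -> {mpoly k[3]},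
  forall j, homd t 0 (c j) & v = \sum_j rho Y l (c j) *: eb j.
Hypothesis ebf : forall c : J -> {mpoly k[3]}, \sum_j rho Y l (c j) *: eb j = 0 -> forall j, c j = 0.

Lemma s0_hdg i j : hdg 0 (s0 i j).
Proof. by have [h _] := hs0 i; have := h j; rewrite mxE. Qed.

Lemma eb_span v : modS s0 v -> exists c : J -> {mpoly k[3]}, v = \sum_j rho Y l (c j) *: eb j.
Proof.
move=> /dec_ex[w [hw [T [_ ->]]]].
have ex (d : 'I_T) : exists c : J -> {mpoly k[3]}, w d = \sum_j rho Y l (c j) *: eb j.
  by have [c _ E] := ebs (hw d); exists c.
have [c hc] := ord_choice ex; exists (fun j => \sum_d c d j).
rewrite (eq_bigr _ (fun d _ => hc d)) exchange_big; apply: eq_bigr => j _ /=.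
by rewrite rho_sum scaler_suml.
Qed.

Definition com (v : 'rV[Y]_r) : J -> {mpoly k[3]} :=
  sel (fun=> 0) (fun c => v = \sum_j rho Y l (c j) *: eb j).
Lemma comE v : modS s0 v -> v = \sum_j rho Y l (com v j) *: eb j.
Proof. by move=> /eb_span; exact: (selP (fun=> 0)). Qed.
Lemma com_uniq v c : v = \sum_j rho Y l (c j) *: eb j -> forall j, com v j = c j.
Proof.
move=> E j; have E' : v = \sum_j rho Y l (com v j) *: eb j.
  exact: (@selP _ (fun=> 0) (fun c => v = \sum_j rho Y l (c j) *: eb j) (ex_intro _ c E)).
apply/eqP; rewrite -subr_eq0; apply/eqP; apply: (ebf (c := fun j => com v j - c j)).
rewrite (eq_bigr (fun j => rho Y l (com v j) *: eb j - rho Y l (c j) *: eb j)) => [|i _].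
  by rewrite sumrB -E -E' subrr.
by rewrite rhoB scalerBl.
Qed.
Lemma comD v w j : modS s0 v -> modS s0 w -> com (v + w) j = com v j + com w j.
Proof.
move=> hv hw; rewrite (com_uniq (c := fun j => com v j + com w j)) //.
rewrite {1}(comE hv) {1}(comE hw) -big_split; apply: eq_bigr => i _.
by rewrite rhoD scalerDl.
Qed.
Lemma com_rho c v j : modS s0 v -> com (rho Y l c *: v) j = c * com v j.
Proof.
move=> hv; rewrite (com_uniq (c := fun j => c * com v j)) //.
rewrite {1}(comE hv) scaler_sumr; apply: eq_bigr => i _.
by rewrite rhoM scalerA.
Qed.
Lemma com_homd t v j : modSt s0 t v -> homd t 0 (com v j).
Proof. by move=> hv; have [c hc E] := ebs hv; rewrite (com_uniq E). Qed.
Lemma com_eb i j : com (eb i) j = (i == j)%:R.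
Proof.
rewrite (com_uniq (c := fun j => (i == j)%:R)) // (bigD1 i) //= eqxx rho1 scale1r.
by rewrite big1 ?addr0 // => x /negPf ne; rewrite eq_sym ne rho0 scale0r.
Qed.
Lemma ebS j : modS s0 (eb j). Proof. exact: modStS (eb0 j). Qed.

(* The graded dual [Hom (M, A)] of [M]. *)
Definition dualM (t : nat) (w : 'cV[Y]_r) : Prop :=
  (forall i, hdg t%:Z (w i 0)) /\ forall v, modS s0 v -> inA ((v *m w) 0 0).

Lemma section_basis p : onv Y p -> exists G d, [/\ (G : S) \is d.-homog, G.@[p] != 0,
  π G *: fr p \in unitmx & forall i, modSt s0 d (row i (π G *: fr p))].
Proof.
move=> hp; have [G [d [hG Gp hg]]] := serre hfr hp; exists G, d.
have nG := onv_nz hp Gp; have [up _] := fr_unit hfr hp.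
have uV : π G *: fr p \in unitmx by rewrite unitmxZ ?unitfE.
split=> // i; have E : row i (π G *: fr p) = π G *: row i (fr p) by apply/rowP => j; rewrite !mxE.
have [t [Et] ht] : exists2 t : nat, d%:Z = t%:Z & modSt s0 t (row i (π G *: fr p)).
  apply: (mod_hdg s0_hdg); first last.
  - by rewrite E; case: (hg i).
  - by rewrite E; apply: (hM (hg i)).
  apply/eqP => E0; have := row_free_unit (π G *: fr p); rewrite uV => /idP/row_freeP[B /(congr1 (row i))].
  rewrite row_mul E0 mul0mx row1 => /rowP/(_ i)/eqP.
  by rewrite !mxE !eqxx eq_sym oner_eq0.
by rewrite Et.
Qed.

Lemma modS_rowspace (V : 'M[Y]_r) v : V \in unitmx -> exists2 y : 'rV[Y]_r, v = y *m V &
  exists2 H, π H != 0 & forall i, inA (π H * y 0 i).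
Proof.
move=> uV; exists (v *m invmx V); first by rewrite mulmxKV.
by have [H nH hH] := common_den (fun i => (v *m invmx V) 0 i); exists H.
Qed.

Section DualSurjective.
Variables (t : nat) (mu : J -> {mpoly k[3]}).
Hypothesis hmu : forall j, homd t s (mu j).
(** [lamM] is the R-linear form on the module with values [mu] on the basis. [cv] is the A-linear
    map to A that [tr] turns into [lamM]. *)
Let lamM (v : 'rV[Y]_r) : {mpoly k[3]} := \sum_j com v j * mu j.
Let cv (v : 'rV[Y]_r) : Y := \sum_i rho Y l (lamM (e i *: v)) * ps i.

Let lamD v w : modS s0 v -> modS s0 w -> lamM (v + w) = lamM v + lamM w.
Proof. by move=> hv hw; rewrite /lamM -big_split; apply: eq_bigr => j _; rewrite comD // mulrDl. Qed.
Let lam_rho c v : modS s0 v -> lamM (rho Y l c *: v) = c * lamM v.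
Proof. by move=> hv; rewrite /lamM mulr_sumr; apply: eq_bigr => j _; rewrite com_rho // mulrA. Qed.
Let lam0 : lamM 0 = 0.
Proof. by have := lam_rho 0 (modS0 s0); rewrite rho0 scale0r mul0r. Qed.
Let lam_sum (T : Type) (q : seq T) (f : T -> 'rV[Y]_r) : (forall i, modS s0 (f i)) ->
  lamM (\sum_(i <- q) f i) = \sum_(i <- q) lamM (f i).
Proof.
move=> h; elim: q => [|x q IH]; first by rewrite !big_nil lam0.
by rewrite !big_cons lamD ?IH //; apply: modS_sum.
Qed.
Let cvD v w : modS s0 v -> modS s0 w -> cv (v + w) = cv v + cv w.
Proof.
move=> hv hw; rewrite /cv -big_split; apply: eq_bigr => i _.
by rewrite scalerDr lamD ?rhoD ?mulrDl //; apply: modSA => //; apply: (inAe fa).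
Qed.
Let lam_mul x v : inA x -> modS s0 v -> lamM (x *: v) = \sum_i co l e x i * lamM (e i *: v).
Proof.
move=> hx hv; rewrite {1}(coE fa hx) scaler_suml lam_sum => [|i]; last first.
  by rewrite -scalerA; do 2![apply: modSA; first by [apply: inA_rho|apply: (inAe fa)]].
apply: eq_bigr => i _; rewrite -scalerA lam_rho //.
by apply: modSA => //; apply: (inAe fa).
Qed.
Let cvA x v : inA x -> modS s0 v -> cv (x *: v) = x * cv v.
Proof.
move=> hx hv; rewrite /cv mulr_sumr.
have Ei i : lamM (e i *: (x *: v)) = \sum_j co l e (x * e i) j * lamM (e j *: v).
  by rewrite scalerA [e i * x]mulrC lam_mul //; apply: inAM => //; apply: (inAe fa).
rewrite (eq_bigr (fun i => \sum_j rho Y l (co l e (x * e i) j * lamM (e j *: v)) * ps i)) => [|i _]; last first.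
  by rewrite Ei rho_sum mulr_suml.
rewrite exchange_big; apply: eq_bigr => j _ /=.
rewrite mulrCA -[x * ps j](_ : \sum_i rho Y l (co l e (x * e i) j) * ps i = _).
  by rewrite mulr_sumr; apply: eq_bigr => i _; rewrite rhoM [_ * rho Y l (lamM _)]mulrC -mulrA.
have hj : inA (x * ps j) by apply: inAM => //; apply: (inAe fps).
rewrite [RHS](dualE hj); apply: eq_bigr => i _; congr (rho Y l _ * _).
have hxi : inA (x * e i) by apply: inAM => //; apply: (inAe fa).
rewrite mulrAC {2}(coE fa hxi) mulr_suml tr_sum => [|q]; last first.
  by apply: inAM; [apply: inAM; [apply: inA_rho|apply: (inAe fa)]|apply: (inAe fps)].
rewrite (bigD1 j) //= big1 ?addr0 => [|q /negPf ne].
  by rewrite -mulrA tr_rho [e j * _]mulrC ?tr_dual ?eqxx ?mulr1 //; apply: inAM; [apply: (inAe fps)|apply: (inAe fa)].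
by rewrite -mulrA tr_rho [e q * _]mulrC ?tr_dual 1?eq_sym ?ne ?mulr0 //; apply: inAM; [apply: (inAe fps)|apply: (inAe fa)].
Qed.

Let cv_inAt d v : modSt s0 d v -> inAt (t + d) (cv v).
Proof.
move=> hv; apply: inAt_sum => i _; have hi := fa_deg fa i; have hpi := fa_deg fps i.
have hc j : com (e i *: v) j \is (a i + d).-homog.
  by have := com_homd j (modStA hi hv); rewrite /homd subn0.
have [le|lt] := leqP s t; last first.
  rewrite (_ : lamM _ = 0) ?rho0 ?mul0r; first exact: inAt0.
  by apply: big1 => j _; have := hmu j; rewrite /homd leqNgt lt /= => ->; rewrite mulr0.
have -> : (t + d = (a i + d + (t - s)) + (s - a i))%N by have := hs i; move: le; clear; lia.
apply: inAtM => //; apply: rho_inAt; first exact: (par_homog par).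
apply: rpred_sum => j _; apply: dhomogM => //.
by have := hmu j; rewrite /homd le.
Qed.

Let cv_inA v : modS s0 v -> inA (cv v).
Proof. by move=> hv; apply: inA_sum => i _; apply: inAM; [apply: inA_rho|apply: (inAe fps)]. Qed.

(** An A-linear map is determined over the fraction field by its values on a frame, so [cv] is given
    by a column [w]. *)
Lemma dual_surjective : exists2 w, dualM t w & forall j, tr ((eb j *m w) 0 0) = mu j.
Proof.
have hN := nzden_class Y.
have [p hp] := exists_point Y; have [G [d [hG Gp uV hV]]] := section_basis hp.
set V := π G *: fr p in uV hV.
pose w : 'cV[Y]_r := invmx V *m \col_i cv (row i V).
have main v : modS s0 v -> (v *m w) 0 0 = cv v.
  move=> hv; have [y Ev [H nH hH]] := modS_rowspace v uV.
  apply: (mulfI nH); rewrite -cvA //; last exact: inApi.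
  have -> : π H *: v = \sum_i (π H * y 0 i) *: row i V.
    by rewrite Ev mulmx_sum_row scaler_sumr; apply: eq_bigr => i _; rewrite scalerA.
  have -> : cv (\sum_i (π H * y 0 i) *: row i V) = \sum_i (π H * y 0 i) * cv (row i V).
    have cv0 : cv 0 = 0 by have := cvA (inA0 Y) (modS0 s0); rewrite scale0r mul0r.
    have h i : modS s0 ((π H * y 0 i) *: row i V) by apply: modSA => //; apply: modStS (hV i).
    elim: (index_enum _) => [|x q IH]; first by rewrite !big_nil.
    rewrite !big_cons cvD // ?IH; last by apply: modS_sum.
    by rewrite cvA //; apply: modStS (hV x).
  rewrite Ev -mulmxA mulKVmx // mxE mulr_sumr; apply: eq_bigr => i _.
  by rewrite [in LHS]mxE mulrA.
exists w; last first.
  move=> j; rewrite main; last exact: ebS.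
  rewrite /cv tr_sum => [|i]; last by apply: inAM; [apply: inA_rho|apply: (inAe fps)].
  have -> : mu j = lamM (1 *: eb j).
    rewrite scale1r /lamM (bigD1 j) //= com_eb eqxx mul1r big1 ?addr0 // => x /negPf ne.
    by rewrite com_eb eq_sym ne mul0r.
  rewrite lam_mul //; [|exact: inA1|exact: ebS].
  apply: eq_bigr => i _; rewrite tr_rho; last exact: (inAe fps).
  rewrite [RHS]mulrC; congr (_ * _); rewrite -[ps i]mulr1 {1}(coE fa (inA1 Y)) mulr_sumr tr_sum => [|q]; last first.
    by apply: inAM; [apply: (inAe fps)|apply: inAM; [apply: inA_rho|apply: (inAe fa)]].
  rewrite (bigD1 i) //= big1 ?addr0 => [|q /negPf ne].
    by rewrite mulrCA tr_rho ?tr_dual ?eqxx ?mulr1 //; apply: inAM; [apply: (inAe fps)|apply: (inAe fa)].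
  by rewrite mulrCA tr_rho ?tr_dual 1?eq_sym ?ne ?mulr0 //; apply: inAM; [apply: (inAe fps)|apply: (inAe fa)].
split=> [i|v hv]; last by rewrite main //; apply: cv_inA.
have nG := onv_nz hp Gp; have [up hdp] := fr_unit hfr hp.
rewrite mxE; apply: (hloc_sum hN) => x _.
have -> : invmx V = (π G)^-1 *: invmx (fr p) by rewrite /V invmxZ // unitfE.
rewrite mxE [X in _ * X]mxE -[t%:Z](_ : (- d%:Z + 0) + (t + d)%N%:Z = _); last first.
  by rewrite addr0 PoszD addrC -addrA subrr addr0.
apply: (hlocM hN); last exact: (inAt_hdg (cv_inAt (hV x))).
apply: (hlocM hN); first exact: (hdgV nG (hloc_pi hN hG)).
exact: (hdg_invmx up hdp).
Qed.
End DualSurjective.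

(** By [dualE] a value of [w] is recovered from the [tr] of its multiples by the [e i], which are
    values of [w] on the module as well. *)
Lemma dual_injective t w : dualM t w -> (forall j, tr ((eb j *m w) 0 0) = 0) -> w = 0.
Proof.
move=> [_ hA] h.
have wD x y : ((x + y) *m w) 0 0 = (x *m w) 0 0 + (y *m w) 0 0 by rewrite mulmxDl mxE.
have wZ c x : ((c *: x) *m w) 0 0 = c * (x *m w) 0 0 by rewrite -scalemxAl mxE.
have wsum (c : J -> {mpoly k[3]}) :
    ((\sum_j rho Y l (c j) *: eb j) *m w) 0 0 = \sum_j rho Y l (c j) * (eb j *m w) 0 0.
  by rewrite mulmx_suml summxE; apply: eq_bigr => j _; rewrite wZ.
have hAe j : inA ((eb j *m w) 0 0) by apply: hA; apply: ebS.
have c0 j : (eb j *m w) 0 0 = 0.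
  rewrite (dualE (hAe j)) big1 // => i _.
  have hv : modS s0 (e i *: eb j) by apply: modSA; [apply: (inAe fa)|apply: ebS].
  rewrite [_ * e i]mulrC -wZ (comE hv) wsum tr_sum => [|q]; last by apply: inAM => //; apply: inA_rho.
  rewrite big1 ?rho0 ?mul0r // => q _.
  by rewrite tr_rho // h mulr0.
have w0 v : modS s0 v -> (v *m w) 0 0 = 0.
  by move=> hv; rewrite (comE hv) wsum big1 // => j _; rewrite c0 mulr0.
have [p hp] := exists_point Y; have [G [d [hG Gp uV hV]]] := section_basis hp.
apply: (can_inj (mulKmx uV)); apply/colP => i; rewrite mulmx0 [RHS]mxE.
by have := w0 _ (modStS (hV i)); rewrite -row_mul mxE.
Qed.

Lemma dual_inAt t d v w : dualM t w -> modSt s0 d v -> inAt (d + t) ((v *m w) 0 0).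
Proof.
have hN := nzden_class Y; move=> [hw hA] hv; have h := hA v (modStS hv).
have [->|nz] := eqVneq ((v *m w) 0 0) 0; first exact: inAt0.
have [|q [->]//] := inA_hdg nz h (m := (d + t)%N%:Z).
rewrite mxE; apply: (hloc_sum hN) => x _; rewrite PoszD; apply: (hlocM hN); last exact: hw.
exact: (modSt_hdg s0_hdg).
Qed.

Lemma subsp_dualM t : subsp (V := kmod 'cV[Y]_r) (dualM t).
Proof.
have hN := nzden_class Y; split.
  by split=> [i|v _]; [rewrite mxE; apply: hloc0|rewrite mulmx0 mxE; apply: inA0].
move=> c w w' [h1 h2] [h1' h2']; split=> [i|v hv]; rewrite kscaleE.
  have -> : (scal Y c *: (w : 'cV_r) + w') i 0 = scal Y c * w i 0 + w' i 0 by rewrite !mxE.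
  exact: (hlocD hN (hlocZ hN c (h1 i)) (h1' i)).
rewrite mulmxDr mxE; apply: inAD; last exact: h2'.
by rewrite -scalemxAr mxE; apply: inAM; [apply: inApi|apply: h2].
Qed.

(** [Hom_A (M, A)] is [Hom_R (M, R)] shifted by [s], and M is free over R with all its [#|J|]
    generators in degree 0. *)
Lemma fdim_dualM t : fdim (V := kmod 'cV[Y]_r) (dualM t) (#|J| * hd t s).
Proof.
have [b' [hb sp fr']] := fdim_homd k t s.
have ex (x : 'I_#|{: J * 'I_(hd t s)}|) : exists w, dualM t w /\
    forall j, tr ((eb j *m w) 0 0) = if j == (enum_val x).1 then b' (enum_val x).2 else 0.
  have [j|w hw Ew] := @dual_surjective t (fun j => if j == (enum_val x).1 then b' (enum_val x).2 else 0).
    case: eqP => _ //; rewrite /homd; case: ifP => // _; exact: dhomog0.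
  by exists w.
have [g' hg] := ord_choice ex; pose g x : kmod 'cV[Y]_r := g' (enum_rank x).
have Dg x : dualM t (g x) by case: (hg (enum_rank x)).
have Tg x j : tr ((eb j *m (g x : 'cV_r)) 0 0) = if j == x.1 then b' x.2 else 0.
  by have [_ /(_ j)] := hg (enum_rank x); rewrite enum_rankK.
have hA (w : 'cV[Y]_r) j : dualM t w -> inA ((eb j *m w) 0 0) by move=> [_ h]; apply: h; apply: ebS.
have trB (w w' : 'cV[Y]_r) j : dualM t w -> dualM t w' ->
    tr ((eb j *m (w - w')) 0 0) = tr ((eb j *m w) 0 0) - tr ((eb j *m w') 0 0).
  move=> hw hw'; rewrite mulmxBr mxE trD; [|exact: hA|by rewrite mxE; apply: inAN; apply: hA].
  congr (_ + _); rewrite mxE -[RHS]mulN1r -(tr_rho (-1)); last exact: hA.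
  by rewrite rhoN rho1 mulN1r.
have lin (c : J * 'I_(hd t s) -> k) j :
    tr ((eb j *m (\sum_x c x *: g x : 'cV[Y]_r)) 0 0) = \sum_y c (j, y) *: b' y.
  rewrite mulmx_sumr summxE tr_sum => [|x]; last first.
    by rewrite kscaleE -scalemxAr mxE; apply: inAM; [apply: inApi|apply: hA].
  rewrite (eq_bigr (fun x => (fun i y => if j == i then c (i, y) *: b' y else 0) x.1 x.2)) => [|[i y] _] /=.
    rewrite -(pair_bigA _ (fun i y => if j == i then c (i, y) *: b' y else 0)) /= (bigD1 j) //=.
    rewrite [X in _ + X]big1 ?addr0 => [|i /negPf ne]; first by rewrite eqxx.
    by rewrite big1 // => y _; rewrite eq_sym ne.
  rewrite kscaleE -scalemxAr mxE -(rhoC Y l) tr_rho; last exact: hA.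
  by rewrite Tg /= mul_mpolyC; case: (j == i); rewrite ?scaler0.
have := @fdim_fin k (kmod 'cV[Y]_r) (dualM t) _ g; rewrite card_prod card_ord; apply=> //.
- move=> w hw.
  have ex' (y : 'I_#|J|) : exists c : 'I_(hd t s) -> k,
      tr ((eb (enum_val y) *m (w : 'cV_r)) 0 0) = \sum_y c y *: b' y.
    by apply: sp; apply: tr_homd; apply: (dual_inAt (d := 0)).
  have [c hc] := ord_choice ex'.
  exists (fun x => c (enum_rank x.1) x.2); apply/eqP; rewrite -subr_eq0; apply/eqP.
  have hsum : dualM t (\sum_x c (enum_rank x.1) x.2 *: g x : kmod 'cV[Y]_r).
    by apply: (big_ind (dualM t)); [case: (subsp_dualM t)|move=> x y; apply: (subspD (subsp_dualM t))|move=> x _; apply: (subspZ _ (subsp_dualM t))].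
  apply: (dual_injective (t := t)).
    exact: (subspB (subsp_dualM t)).
  move=> j; rewrite trB // lin; have := hc (enum_rank j); rewrite enum_rankK => ->.
  by rewrite /= subrr.
- move=> c E [j y]; apply: (fr' (fun y => c (j, y))); rewrite -lin E.
  by rewrite mulmx0 mxE tr0.
Qed.

(** A frame multiplied by a form embeds [A^r] in the module up to a shift of degrees, and both are
    free over R. *)
Theorem rank_generators : (r * #|I| <= #|J|)%N.
Proof.
have [p hp] := exists_point Y; have [G [d [hG Gp uV hV]]] := section_basis hp.
set V := π G *: fr p in uV hV.
pose f (x : 'cV[Y]_r) : 'rV[Y]_r := x^T *m V.
apply: (@growth_compare _ (d + s)) => t.
have hD := fdim_columns r (fdim_A par fa (t + s)) (inAt0 Y (t + s)).
have sD : subsp (V := kmod 'cV[Y]_r) (fun x : kmod 'cV[Y]_r => forall i, inAt (t + s) ((x : 'cV_r) i 0)).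
  split=> [i|c x y hx hy i]; first by rewrite mxE; apply: inAt0.
  by rewrite kscaleE !mxE; apply: inAtD => //; apply: inAtZ.
have [||m' [Em hm']] := @fdim_image k (kmod 'cV[Y]_r) (kmod 'rV[Y]_r) _ f _ 0 sD _ hD.
- move=> c x y; rewrite kscaleE /f; transitivity ((scal Y c *: (x : 'cV[Y]_r) + (y : 'cV[Y]_r))^T *m V) => //.
  by rewrite linearP mulmxDl -scalemxAl.
- exists (fun=> 0); split=> [[]//|x [_ fx]|c _ []//].
  exists (fun=> 0); rewrite big_ord0; apply: trmx_inj; apply: (can_inj (mulmxK uV)).
  by rewrite trmx0 mul0mx; exact: fx.
have hMt : fdim (V := kmod 'rV[Y]_r) (modSt s0 (t + s + d)) (#|J| * hd (t + s + d) 0).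
  have := @fdim_graded_free k n Y l _ (modSt s0 (t + s + d)) J (fun=> 0%N) eb (t + s + d).
  rewrite sum_nat_const; apply=> //.
  - move=> j c; rewrite /homd subn0 => hc; rewrite -[(t + s + d)%N]addn0.
    by apply: modStA => //; apply: rho_inAt => //; apply: (par_homog par).
  - exact: ebs.
have := fdim_le _ hm' hMt; rewrite add0n in Em; rewrite -Em => le.
have {le} le : (r * (\sum_i hd (t + s) (a i)) <= #|J| * hd (t + s + d) 0)%N.
  apply: le => v [x hx ->]; rewrite /f mulmx_sum_row; apply: modSt_sum => i _.
  by rewrite mxE; apply: modStA.
rewrite [(d + s)%N]addnC addnA; move: le; rewrite {2}/hd leq0n subn0; apply: leq_trans.
rewrite -mulnA leq_mul2l -sum_nat_const; apply/orP; right; apply: leq_sum => i _.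
have := hs i => le; rewrite /hd (leq_trans le (leq_addl t s)).
by apply: leq_bin2l; move: le; clear; lia.
Qed.
End DualModule.

(** * The degeneracy locus of sections *)

Lemma homog_scale (K : fieldType) n d (F : {mpoly K[n]}) (p q : 'I_n -> K) c :
  F \is d.-homog -> (forall i, q i = c * p i) -> F.@[q] = c ^+ d * F.@[p].
Proof.
move=> hF Eq; rewrite !mevalE mulr_sumr; apply: eq_big_seq => m hm.
have -> : c ^+ d = \prod_i c ^+ m i by rewrite prodrXr -mdegE (dhomogP _ _ _ hF m hm).
by rewrite mulrCA; congr (_ * _); rewrite -big_split; apply: eq_bigr => i _; rewrite Eq exprMn.
Qed.

Lemma homog_prod (K : fieldType) n (T : finType) (P : pred T) d (f : T -> {mpoly K[n]}) :
  (forall i, P i -> f i \is d.-homog) -> \prod_(i | P i) f i \is (#|P| * d).-homog.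
Proof.
move=> h; rewrite -sum_nat_const.
by apply: (big_ind2 (fun (x : {mpoly K[n]}) m => is_true (x \is m.-homog))) => // [|x m y m' hx hy];
  [exact: dhomog1|exact: dhomogM].
Qed.

Lemma independent_dim (K : fieldType) (V : lmodType K) (W B : V -> Prop) D m (T : finType) (g : T -> V) :
  subsp B -> (forall v, B v -> W v) -> fdim W D -> fdim B m -> (forall x, W (g x)) ->
  (forall c : T -> K, B (\sum_x c x *: g x) -> forall x, c x = 0) -> (m + #|T| <= D)%N.
Proof.
move=> sB BW [w [hw spw _]] [b [hb spb fb]] hg ind.
pose f (i : 'I_(m + #|T|)) := match split i with inl j => b j | inr x => g (enum_val x) end.
have fl j : f (lshift _ j) = b j by rewrite /f (unsplitK (inl _ j)).
have fR j : f (rshift _ j) = g (enum_val j) by rewrite /f (unsplitK (inr _ j)).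
apply: (@steinitz K V _ _ f w) => [c|i]; last first.
  by apply: spw; rewrite /f; case: split => j; [apply: BW|].
rewrite big_split_ord /=; under eq_bigr => j _ do rewrite fl; under [X in _ + X]eq_bigr => j _ do rewrite fR.
move=> E; have c0 x : c (rshift m x) = 0.
  have := ind (fun x => c (rshift m (enum_rank x))); rewrite (sum_over_enum (fun x => c (rshift m (enum_rank x)) *: g x)).
  under eq_bigr => j _ do rewrite enum_valK.
  rewrite (_ : \sum_j _ = - \sum_j c (lshift #|T| j) *: b j); last first.
    by apply/eqP; rewrite -addr_eq0 addrC E.
  move=> /(_ _ (enum_val x)); rewrite enum_valK; apply.
  by rewrite -scaleN1r; apply: subspZ => //; apply: subsp_sum.
have := E; rewrite [X in _ + X]big1 ?addr0 => [/fb h|j _]; last by rewrite c0 scale0r.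
by move=> i; rewrite -(splitK i); case: split => j /=.
Qed.

Lemma fdim_extend (K : fieldType) (V : lmodType K) (W B : V -> Prop) m e (b : 'I_e -> V) :
  (forall v, B v -> W v) -> fdim B m -> (forall i, W (b i)) ->
  (forall v, W v -> exists c : 'I_e -> K, B (v - \sum_i c i *: b i)) ->
  (forall c : 'I_e -> K, B (\sum_i c i *: b i) -> forall i, c i = 0) -> subsp B -> fdim W (m + e).
Proof.
move=> BW [w [hw spw fw]] hb sp ind sB.
pose f (i : 'I_(m + e)) := match split i with inl j => w j | inr x => b x end.
have fl j : f (lshift _ j) = w j by rewrite /f (unsplitK (inl _ j)).
have fR j : f (rshift _ j) = b j by rewrite /f (unsplitK (inr _ j)).
have fE (c : 'I_(m + e) -> K) : \sum_i c i *: f i =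
    \sum_j c (lshift e j) *: w j + \sum_j c (rshift m j) *: b j.
  by rewrite big_split_ord /=; congr (_ + _); apply: eq_bigr => j _; rewrite ?fl ?fR.
exists f; split.
- by move=> i; rewrite /f; case: split => j; [apply: BW|].
- move=> v /sp[c hc]; have [d hd] := spw _ hc.
  exists (fun i => match split i with inl j => d j | inr x => c x end); rewrite fE.
  rewrite (eq_bigr (fun j => d j *: w j)) => [|j _]; last by rewrite (unsplitK (inl _ j)).
  rewrite [X in _ + X](eq_bigr (fun j => c j *: b j)) => [|j _]; last by rewrite (unsplitK (inr _ j)).
  by rewrite -hd subrK.
- move=> c; rewrite fE => E.
  have c0 x : c (rshift m x) = 0.
    apply: (ind (fun x => c (rshift m x))).
    rewrite (_ : \sum_j _ = - \sum_j c (lshift e j) *: w j); last by apply/eqP; rewrite -addr_eq0 addrC E.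
    by rewrite -scaleN1r; apply: subspZ => //; apply: subsp_sum.
  have := E; rewrite [X in _ + X]big1 ?addr0 => [/fw h|j _]; last by rewrite c0 scale0r.
  by move=> i; rewrite -(splitK i); case: split => j /=.
Qed.

(** Natural values that do not increase along an arithmetic progression become constant on it, and a
    polynomial that is constant at infinitely many points is constant. *)
Lemma poly_eventually_const (Q : {poly rat}) (t0 D N : nat) : (0 < D)%N ->
  (forall t, (t0 <= t)%N -> exists2 q : nat, (N <= q)%N & Q.[t%:R] = q%:R) ->
  (forall t q q' : nat, (t0 <= t)%N -> Q.[t%:R] = q%:R -> Q.[(t + D)%N%:R] = q'%:R -> (q' <= q)%N) ->
  exists2 q : nat, (N <= q)%N & Q = (q%:R)%:P.
Proof.
move=> D0 hq mono.
have [t1 [q [le1 E1 cst]]] : exists t1 q, [/\ (t0 <= t1)%N, Q.[t1%:R] = q%:R &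
    forall i, Q.[(t1 + i * D)%N%:R] = q%:R].
  apply: NNPP => no.
  have step q : forall t, (t0 <= t)%N -> Q.[t%:R] = q%:R -> False.
    elim/ltn_ind: q => q IH t le E; apply: no; exists t, q; split=> // i.
    elim: i => [|i IHi]; first by rewrite mul0n addn0.
    have le' : (t0 <= t + i * D)%N := leq_trans le (leq_addr _ _).
    have [q' _ E'] := hq (t + i * D + D)%N (leq_trans le' (leq_addr _ _)).
    rewrite mulSn addnCA addnC E'; congr (_%:R); apply/eqP; rewrite eqn_leq (mono _ _ _ le' IHi E').
    rewrite leqNgt; apply/negP => lt.
    exact: (IH q' lt _ (leq_trans le' (leq_addr _ _)) E').
  by have [q _ E] := hq t0 (leqnn _); apply: (step q t0).
have hN : (N <= q)%N.
  have [q' le' E'] := hq t1 le1; rewrite E1 in E'.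
  by move/eqP: E'; rewrite Num.Theory.eqr_nat => /eqP ->.
exists q => //; apply/eqP; rewrite -subr_eq0; apply: contraT => nz.
have := @max_poly_roots rat (Q - q%:R%:P) [seq (t1 + i * D)%N%:R | i <- iota 0 (size (Q - q%:R%:P))] nz.
rewrite size_map size_iota ltnn => H; apply: H.
  by apply/allP => x /mapP[i _ ->]; apply/rootP; rewrite hornerD hornerN hornerC cst subrr.
rewrite map_inj_uniq ?iota_uniq // => i j /eqP; rewrite Num.Theory.eqr_nat eqn_add2l eqn_pmul2r //.
by move/eqP.
Qed.

Lemma quotient_split (F : fieldType) (x y z w m1 m2 : F) :
  (m1 * m2)^-1 * (x * (y * z) * w) = x * z * w / m1 * (y / m2).
Proof. rewrite invfM; ring. Qed.

Section Degeneracy.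
Variables (k : closedFieldType) (n : nat) (Y : cone k n) (l : 'I_3 -> {mpoly k[n.+1]}).
Local Notation S := {mpoly k[n.+1]}.
Local Notation "'π' F" := (@cproj k n Y F) (at level 8, F at level 2).
Hypothesis chark : [pchar k] =i pred0.
Variables (K : nat) (par : parameters Y l K).
Variables (I : finType) (a : I -> nat) (e : I -> Y).
Hypothesis fa : free_algebra l a e.
Hypothesis satA : forall N x, (forall F, F \is N.-homog -> inA (π F * x)) -> inA (x : Y).
Hypothesis smooth : forall p, onv Y p -> exists u v : Y, cparam p u v.

(** A point has many homogeneous coordinates and a frame may depend on the choice, so local
    conditions have to be carried from one choice to another. *)
Lemma same_stk p q m (x : Y) : same_point p q -> stk m p x -> stk m q x.
Proof.
move=> [c nc Eq] [F [G [d [g [hF hG Em Gp ->]]]]]; exists F, G, d, g; split=> //.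
by rewrite /ptden (homog_scale hG Eq) mulf_neq0 // expf_neq0.
Qed.

Lemma same_onv p q : same_point p q -> onv Y q -> onv Y p.
Proof.
move=> [c nc Eq] [[i qi] hq]; split; first by exists i; apply: contraNneq qi => pi; rewrite Eq pi mulr0.
move=> F F0; rewrite (pihomog_partitionE (leqnn (msize F))) raddf_sum big1 //= => d _.
have := hq _ (cone_homog d F0); rewrite (homog_scale (pihomogP _ _ _) Eq) => /eqP.
by rewrite mulf_eq0 expf_eq0 (negPf nc) andbF => /eqP.
Qed.

Lemma same_frames r (fr : ('I_n.+1 -> k) -> 'M[Y]_r) p q m (v : 'rV[Y]_r) : frames fr ->
  onv Y q -> same_point p q -> (forall i, stk m p ((v *m invmx (fr p)) 0 i)) ->
  forall i, stk m q ((v *m invmx (fr q)) 0 i).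
Proof.
move=> hfr hq pq h i; have hp := same_onv pq hq; have [up _] := fr_unit hfr hp.
have [G [d [hG Gp hc]]] := fr_coh hfr hp.
have Gq : G.@[q] != 0 by have [c nc Eq] := pq; rewrite (homog_scale hG Eq) mulf_neq0 // expf_neq0.
have -> : v *m invmx (fr q) = (v *m invmx (fr p)) *m (fr p *m invmx (fr q)) by rewrite mulmxA mulmxKV.
rewrite mxE; apply: (stk_sum _ hq) => x _.
by apply: (stkM0 hq); [apply: (same_stk pq)|case: (hc q hq Gq x i)].
Qed.

Section AtPoint.
Variable p : 'I_n.+1 -> k.
Hypothesis hp : onv Y p.
Let O := stk (Y := Y) 0 p.
Let OD : forall x y, O x -> O y -> O (x + y) := hlocD (ptden_class hp) (m := 0).
Let OM x y : O x -> O y -> O (x * y). Proof. exact: stk0M. Qed.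
Let Os : forall c, O (scal Y c) := hloc_scal (ptden_class hp).
Variables (r : nat) (sg : 'M[Y]_(r, r.+1)).
Hypothesis Osg : forall i j, O (sg i j).

Lemma point_length len : quot_dim (scal Y) O (minor_ideal O sg) len ->
  exists ga : 'I_len -> 'cV[Y]_r, (forall y i, O (ga y i 0)) /\
  forall (c : 'I_len -> k) (x : 'cV[Y]_r.+1), (forall j, O (x j 0)) ->
    \sum_y scal Y (c y) *: ga y = sg *m x -> forall y, c y = 0.
Proof.
have [u [v huv]] := smooth hp; have [Ou Ov] := param_stk hp huv.
have [nu nv] := param_neq0 par fa hp huv chark.
apply: (local_length OD OM Os Ou Ov nu (stk0_residue hp huv) (stk0_proper hp huv)) => //.
- by move=> c b d; apply: stk0_units.
- by move=> N z; apply: (stk_depth par fa hp huv nu).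
Qed.

Lemma point_power len f : quot_dim (scal Y) O (minor_ideal O sg) len -> cmax p f ->
  exists N, minor_ideal O sg (f ^+ N).
Proof.
have [u [v huv]] := smooth hp; have [Ou Ov] := param_stk hp huv.
move=> hq /huv[b [d [hb hd E]]].
apply: (quot_power OD OM Os Ou Ov (stk0_proper hp huv) _ hq hb hd E).
by move=> c b' d'; apply: stk0_units.
Qed.

Lemma point_depth len m z : quot_dim (scal Y) O (minor_ideal O sg) len ->
  (forall x, minor_ideal O sg x -> stk m p (x * z)) -> stk m p z.
Proof.
have [u [v huv]] := smooth hp; have [Ou Ov] := param_stk hp huv.
have [nu nv] := param_neq0 par fa hp huv chark.
have cu : cmax p u by apply/huv; exists 1, 0; rewrite mul1r mul0r addr0; split=> //; [apply: (hloc1 (ptden_class hp))|apply: (hloc0 (ptden_class hp))].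
have cv : cmax p v by apply/huv; exists 0, 1; rewrite mul1r mul0r add0r; split=> //; [apply: (hloc0 (ptden_class hp))|apply: (hloc1 (ptden_class hp))].
move=> hq h; have [N1 h1] := point_power hq cu; have [N2 h2] := point_power hq cv.
have OX (x : Y) q : O x -> O (x ^+ q) by move=> hx; have := hlocX (ptden_class hp) q hx; rewrite mul0r.
apply: (stk_depth par fa hp huv (N := N1 + N2)) => //.
  by rewrite addnC exprD -mulrA; apply: (stk0M hp); [apply: (OX)|apply: h].
by rewrite exprD -mulrA; apply: (stk0M hp); [apply: (OX)|apply: h].
Qed.

(** By Cramer's rule ([minors_image]) every minor times a unit vector is in the image. *)
Lemma ideal_image (y : 'cV[Y]_r) : (forall i, minor_ideal O sg (y i 0)) ->
  exists2 x : 'cV[Y]_r.+1, forall j, O (x j 0) & y = sg *m x.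
Proof.
move=> hy; have ex i : exists x : 'cV[Y]_r.+1, (forall j, O (x j 0)) /\ y i 0 *: delta_mx i 0 = sg *m x.
  have /(minorP OM Os)[c [hc ->]] := hy i.
  have ex j : exists x : 'cV[Y]_r.+1, (forall j, O (x j 0)) /\ sg *m x = minors sg j 0 *: delta_mx i 0.
    have [|||x hx E] := minors_image j i OM OD _ _ _ Osg.
    - by rewrite -(scal1 Y).
    - by rewrite -(scal1 Y) -scalN.
    - exact: (hloc0 (ptden_class hp)).
    by exists x.
  have [f hf] := ord_choice ex; exists (\sum_j c j *: f j); split=> [j|].
    rewrite summxE; apply: (stk_sum _ hp) => j' _; rewrite mxE; apply: OM => //.
    by case: (hf j').
  rewrite mulmx_sumr scaler_suml; apply: eq_bigr => j _.
  by have [_ E] := hf j; rewrite -scalemxAr E scalerA.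
have [f hf] := ord_choice ex; exists (\sum_i f i) => [j|].
  by rewrite summxE; apply: (stk_sum _ hp) => i _; have [hfi _] := hf i; apply: hfi.
rewrite mulmx_sumr [LHS]matrix_sum_delta; apply: eq_bigr => i _.
by rewrite big_ord1; case: (hf i).
Qed.
End AtPoint.

Variables (r : nat) (fr : ('I_n.+1 -> k) -> 'M[Y]_r.+1) (b : nat) (s0 : 'M[Y]_(b, r.+1)).
Hypothesis hfr : frames fr.
Hypothesis hs0 : forall j, gsec fr 0 (row j s0).
Hypothesis hM : forall m v, gsec fr m v -> modS s0 v.

Lemma dualM_local t (w : 'cV[Y]_r.+1) p i : onv Y p -> dualM s0 t w -> stk t%:Z p ((fr p *m w) i 0).
Proof.
move=> hp hw; have [G [d [hG Gp uV hV]]] := section_basis hfr hs0 hM hp.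
apply: (stk_div hp hG Gp); rewrite -PoszD.
have -> : π G * (fr p *m w) i 0 = (row i (π G *: fr p) *m w) 0 0.
  by rewrite -row_mul [RHS]mxE -scalemxAl [RHS]mxE.
have [F hF ->] := dual_inAt hs0 hw (hV i); exact: (hloc_pi (ptden_class hp)).
Qed.

Lemma dualM_of_local t (w : 'cV[Y]_r.+1) : (forall i, hdg t%:Z (w i 0)) ->
  (forall p i, onv Y p -> stk t%:Z p ((fr p *m w) i 0)) -> dualM s0 t w.
Proof.
move=> hw h; split=> // v [u ->]; rewrite mpiE mulmx_suml summxE.
apply: inA_sum => j _; rewrite -scalemxAl mxE; apply: inAM; first exact: inApi.
apply: (@inAtA _ _ Y t); apply: (linear_normality_at satA) => p hp.
have [_ hj] := hs0 j; have [up _] := fr_unit hfr hp.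
rewrite -[row j s0](mulmxKV up) -(mulmxA (row j s0 *m _)) mxE; apply: (stk_sum _ hp) => x _.
by apply: (stk0M hp); [apply: hj|apply: h].
Qed.

Variables (frC : ('I_n.+1 -> k) -> 'M[Y]_1) (h : Y).
Hypothesis hfrC : frames frC.
Hypothesis effC : forall p, onv Y p -> stk 0 p (frC p 0 0).
Hypotheses (nh : h != 0) (hh : hdg 0 h).
Hypothesis hc1 : forall p, onv Y p -> clocal_generator 0 p (h * \det (fr p) * frC p 0 0).

Variables (sig : 'M[Y]_(r, r.+1)) (L : nat) (pts : 'I_L -> 'I_n.+1 -> k) (len : 'I_L -> nat).
Hypothesis hsig : forall j, gsec fr 0 (row j sig).
Hypothesis ptsX : forall i, onv Y (pts i).
Hypothesis ptsI : forall i j, same_point (pts i) (pts j) -> i = j.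
Let sp p := sig *m invmx (fr p).
Hypothesis cover : forall q, onv Y q -> (exists i, same_point (pts i) q) \/ minor_ideal (stk 0 q) (sp q) 1.
Hypothesis lens : forall i, quot_dim (scal Y) (stk 0 (pts i)) (minor_ideal (stk 0 (pts i)) (sp (pts i))) (len i).

Lemma sp_stk p i j : onv Y p -> stk 0 p (sp p i j).
Proof. by move=> hp; have [_ /(_ p hp j)] := hsig i; rewrite -row_mul mxE. Qed.
Lemma sig_hdg i j : hdg 0 (sig i j).
Proof. by have [/(_ j)] := hsig i; rewrite mxE. Qed.

Definition curve_section t (v : Y) : Prop := gsec frC t (const_mx v).
Lemma curve_sectionE t v : curve_section t v <-> hdg t v /\
  forall p, onv Y p -> stk t p (v / frC p 0 0).
Proof.
have E (p : 'I_n.+1 -> k) : onv Y p -> (const_mx v *m invmx (frC p) : 'M[Y]_1) 0 0 = v / frC p 0 0.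
  move=> hp; rewrite [frC p]mx11_scalar invmx_scalar mul_mx_scalar !mxE eqxx mulr1n.
  by rewrite mulrC.
split=> -[h1 h2]; split.
- by have := h1 0; rewrite mxE.
- by move=> p hp; rewrite -E //; apply: h2.
- by move=> i; rewrite mxE.
- by move=> p hp i; rewrite ord1 E //; apply: h2.
Qed.

Lemma curve_inAt t v : curve_section t%:Z v -> inAt t v.
Proof.
move/curve_sectionE => [_ hv]; apply: (linear_normality_at satA) => p hp.
have [nz _ _] := hc1 hp; have nC : frC p 0 0 != 0 by apply: contraNneq nz => ->; rewrite mulr0.
by rewrite -[v](divfK nC); apply: (stkM0 hp); [apply: hv|apply: effC].
Qed.

Lemma minors_local v p : onv Y p ->
  fr p *m ((h * v) *: minors sig) = (h * \det (fr p) * frC p 0 0 * (v / frC p 0 0)) *: minors (sp p).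
Proof.
move=> hp; have [up _] := fr_unit hfr hp; have [nz _ _] := hc1 hp.
have nC : frC p 0 0 != 0 by apply: contraNneq nz => ->; rewrite mulr0.
have ui : invmx (fr p) \in unitmx by rewrite unitmx_inv.
rewrite (minors_mulmx sig ui) det_inv invrK scalerA -scalemxAr mulmxA mulmxV // mul1mx.
congr (_ *: _); rewrite -[in RHS]mulrA [_ * (v / _)]mulrC divfK // -!mulrA; congr (_ * _).
exact: mulrC.
Qed.

Lemma minors_nonzero : minors sig != 0.
Proof.
have [p hp] := exists_point Y; have ptd q (hq : onv Y q) c : stk 0 q (scal Y c) := hloc_scal (ptden_class hq) c.
have [q [hq [x hx nx]]] : exists q, onv Y q /\ exists2 x, minor_ideal (stk 0 q) (sp q) x & x != 0.
  case: (cover hp) => [[i pi]|h1]; last by exists p; split=> //; exists 1 => //; apply: oner_neq0.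
  exists (pts i); split=> //; have [u [v huv]] := smooth (ptsX i).
  have [nu _] := param_neq0 par fa (ptsX i) huv chark.
  have cu : cmax (pts i) u.
    by apply/huv; exists 1, 0; rewrite mul1r mul0r addr0; split=> //; [apply: hloc1; apply: ptden_class|apply: hloc0; apply: ptden_class].
  have [N hN] := point_power (ptsX i) (lens i) cu.
  by exists (u ^+ N) => //; rewrite expf_neq0.
apply: contraNneq nx => m0; have [up _] := fr_unit hfr hq.
have dU : \det (invmx (fr q)) != 0 by move: up; rewrite -unitmx_inv unitmxE unitfE.
have m0' : minors (sp q) = 0.
  have := minors_mulmx sig (_ : invmx (fr q) \in unitmx); rewrite unitmx_inv m0 => /(_ up)/esym/eqP.
  rewrite scaler_eq0 invr_eq0 (negPf dU) /= => /eqP E.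
  by rewrite -[LHS]mul1mx -(mulmxV up) -mulmxA E mulmx0.
move: hx => /(minorP (fun x y => @stk0M _ _ Y 0 q x y hq) (ptd q hq))[c [_ ->]].
by rewrite big1 // => j _; rewrite m0' mxE mulr0.
Qed.

(** Over the fraction field the minors span the kernel, which yields [v]. Off the degeneracy locus
    the minors generate the unit ideal, so [v] is locally a section of the ideal of the curve; at
    the points of the locus this follows from [point_depth]. *)
Lemma kernel_section t (w : 'cV[Y]_r.+1) : dualM s0 t w /\ sig *m w = 0 <->
  exists2 v, curve_section t%:Z v & w = (h * v) *: minors sig.
Proof.
have hN := nzden_class Y; split=> [[hw sw]|[v hv ->]]; last first.
  split; last by rewrite -scalemxAr mul_minors scaler0.
  have [hvd hvp] := (curve_sectionE _ _).1 hv.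
  apply: dualM_of_local => [i|p i hp].
    rewrite mxE -[t%:Z]addr0 -[t%:Z]add0r; apply: (hlocM hN); first exact: (hlocM hN hh hvd).
    rewrite mxE -[0]addr0; apply: (hlocM hN).
      by have := hlocX hN i (hlocN hN (hloc1 hN)); rewrite mul0r.
    by apply: (hloc_det hN) => x y; rewrite mxE; apply: sig_hdg.
  rewrite (minors_local v hp) mxE; have [_ hu _] := hc1 hp.
  apply: (stkM0 hp); first by apply: (stk0M hp); [apply: hu|apply: hvp].
  rewrite mxE -[0]addr0; apply: (stkM hp).
    by have := hlocX (ptden_class hp) i (hlocN (ptden_class hp) (hloc1 (ptden_class hp))); rewrite mul0r.
  by apply: (hloc_det (ptden_class hp)) => x y; rewrite mxE; apply: sp_stk.
have [f Ef] := kernel_minors minors_nonzero sw; pose v := f / h.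
have Ev : h * v = f by rewrite mulrC divfK.
exists v; last by rewrite Ev.
have step p x : onv Y p -> minor_ideal (stk 0 p) (sp p) x -> stk t%:Z p (x * (v / frC p 0 0)).
  move=> hp /(minorP (fun x y => @stk0M _ _ Y 0 p x y hp) (hloc_scal (ptden_class hp)))[c [hc ->]].
  rewrite mulr_suml; apply: (stk_sum _ hp) => j _; rewrite -mulrA; apply: (stk0M hp) => //.
  have := dualM_local j hp hw; rewrite Ef -Ev (minors_local v hp) mxE.
  have [nz _ hu] := hc1 hp; rewrite oppr0 in hu => hj.
  have := stk0M hp hu hj; set U := h * _ * _ in nz *.
  by rewrite -(mulrA U) (mulKf nz) mulrC.
have key p : onv Y p -> stk t%:Z p (v / frC p 0 0).
  move=> hp; case: (cover hp) => [[i pi]|h1]; last by have := step p 1 hp h1; rewrite mul1r.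
  have hi : stk t%:Z (pts i) (v / frC (pts i) 0 0).
    by apply: (point_depth (ptsX i) (lens i)) => x; apply: step.
  have E (q : 'I_n.+1 -> k) : onv Y q -> (const_mx v *m invmx (frC q) : 'M[Y]_1) 0 0 = v / frC q 0 0.
    by move=> hq; rewrite [frC q]mx11_scalar invmx_scalar mul_mx_scalar !mxE eqxx mulr1n mulrC.
  rewrite -E //; apply: (same_frames hfrC hp pi) => j.
  by rewrite ord1 E.
apply/curve_sectionE; split=> //.
have [p hp] := exists_point Y; have [nz _ _] := hc1 hp.
have nC : frC p 0 0 != 0 by apply: contraNneq nz => ->; rewrite mulr0.
by rewrite -[v](divfK nC); apply: (stk_hdg hp); apply: (stkM0 hp); [apply: key|apply: effC].
Qed.

Definition image t (y : 'cV[Y]_r) : Prop := exists2 w, dualM s0 t w & y = sig *m w.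

Lemma subsp_image t : subsp (V := kmod 'cV[Y]_r) (image t).
Proof.
have [h0 hD] := subsp_dualM s0 t; split; first by exists 0; rewrite ?mulmx0.
move=> c y y' [w hw ->] [w' hw' ->]; exists (c *: (w : kmod _) + w'); first exact: hD.
by rewrite !kscaleE mulmxDr -scalemxAr.
Qed.

Definition cols t (y : 'cV[Y]_r) : Prop := forall i, inAt t (y i 0).
Lemma subsp_cols t : subsp (V := kmod 'cV[Y]_r) (cols t).
Proof.
split=> [i|c x y hx hy i]; first by rewrite mxE; apply: inAt0.
by rewrite kscaleE !mxE; apply: inAtD => //; apply: inAtZ.
Qed.

Lemma image_cols t y : image t y -> cols t y.
Proof.
move=> [w hw ->] i; apply: (linear_normality_at satA) => p hp; have [up _] := fr_unit hfr hp.
rewrite -[sig](mulmxKV up) -(mulmxA (sp p)) mxE; apply: (stk_sum _ hp) => x _.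
by apply: (stk0M hp); [apply: sp_stk|apply: dualM_local].
Qed.

Lemma image_inAt t d x y : inAt d x -> image t y -> image (d + t)%N (x *: y).
Proof.
have hN := nzden_class Y; move=> hx [w [h1 h2] ->]; exists (x *: w); last by rewrite scalemxAr.
split=> [i|v hv].
  have -> : (x *: w) i 0 = x * w i 0 by rewrite mxE.
  by rewrite PoszD; apply: (hlocM hN (inAt_hdg hx) (h1 i)).
rewrite -scalemxAr mxE; apply: inAM; [apply: inAtA hx|apply: (h2 _ hv)].
Qed.

Lemma dual_den p (x : 'cV[Y]_r.+1) : onv Y p -> (forall i, stk 0 p (x i 0)) ->
  exists (G : S) g, [/\ G \is g.-homog, G.@[p] != 0 & dualM s0 g (π G *: (invmx (fr p) *m x))].
Proof.
move=> hp hx; have hP := ptden_class hp; have hN := nzden_class Y.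
have [up hdp] := fr_unit hfr hp.
have hy j : stk 0 p ((s0 *m (invmx (fr p) *m x)) j 0).
  rewrite mulmxA mxE; apply: (stk_sum _ hp) => i _; apply: (stk0M hp) => //.
  by have [_ /(_ p hp i)] := hs0 j; rewrite -row_mul mxE.
have [G [g [hG Gp hd]]] := hloc_den hP (m := fun=> 0) hy.
exists G, g; split=> //; split=> [i|v [u ->]].
  rewrite mxE -[g%:Z]addr0; apply: (hlocM hN); first exact: hloc_pi.
  rewrite mxE; apply: (hloc_sum hN) => j _; rewrite -[0]addr0; apply: (hlocM hN).
    exact: hdg_invmx.
  exact: (stk_hdg hp).
rewrite mpiE mulmx_suml summxE; apply: inA_sum => j _.
rewrite -scalemxAl mxE; apply: inAM; first exact: inApi.
have [F [d [_ _ E]]] := hd j; rewrite -scalemxAr mxE -row_mul mxE E; exact: inApi.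
Qed.

Lemma separating : exists Lf : 'I_L -> 'I_L -> S, forall i j,
  [/\ Lf i j \is 1.-homog, (Lf i j).@[pts i] != 0 & j != i -> (Lf i j).@[pts j] = 0].
Proof.
have ex (ij : 'I_L * 'I_L) : exists F : S, [/\ F \is 1.-homog, F.@[pts ij.1] != 0 &
    ij.2 != ij.1 -> F.@[pts ij.2] = 0].
  case: ij => i j /=; have [[x nx] _] := ptsX i.
  have [->|ne] := eqVneq j i; first by exists 'X_x; rewrite mevalXU; split=> //; apply: dhomogXi.
  have [[y ny] _] := ptsX j; apply: NNPP => no.
  have E z : pts i z * pts j y = pts i y * pts j z.
    apply/eqP; rewrite -subr_eq0; apply: contraT => nz; case: no.
    exists (pts j y *: 'X_z - pts j z *: 'X_y); split.
    - by apply: rpredB; apply: rpredZ; apply: dhomogXi.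
    - by rewrite mevalB !mevalZ !mevalXU [pts j y * _]mulrC [pts j z * _]mulrC.
    - by move=> _; rewrite mevalB !mevalZ !mevalXU mulrC subrr.
  move/negP: ne; apply; apply/eqP; apply: ptsI; exists (pts i y / pts j y).
    rewrite mulf_neq0 ?invr_eq0 //; apply: contraNneq nx => z0.
    by have := E x; rewrite z0 mul0r => /eqP; rewrite mulf_eq0 (negPf ny) orbF.
  by move=> z; rewrite mulrAC -E mulfK.
have [f hf] := ord_choice (fun x : 'I_#|{: 'I_L * 'I_L}| => ex (enum_val x)).
by exists (fun i j => f (enum_rank (i, j))) => i j; have := hf (enum_rank (i, j)); rewrite enum_rankK.
Qed.

Lemma avoiding_form : exists F : S, F \is L.+1.-homog /\ forall i, F.@[pts i] != 0.
Proof.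
have [Lf hL] := separating; exists (\sum_i Lf i i * \prod_j Lf i j); split.
  apply: rpred_sum => i _; rewrite -(add1n L); apply: dhomogM; first by case: (hL i i).
  have := @homog_prod k n.+1 'I_L xpredT 1 (Lf i).
  by rewrite muln1 card_ord; apply=> j _; case: (hL i j).
move=> i; rewrite raddf_sum (bigD1 i) //= [X in _ + X]big1 ?addr0 => [|j ne].
  rewrite mevalM mulf_neq0 //; first by case: (hL i i).
  by rewrite rmorph_prod /= prodf_seq_neq0; apply/allP => j _; case: (hL i j).
rewrite mevalM rmorph_prod /= (bigD1 i) //=; have [_ _ h0] := hL j i.
by rewrite h0 1?eq_sym // mul0r mulr0.
Qed.

(* Multiplication by a form without zeros on the degeneracy locus is onto on cokernels. *)
Lemma cokernel_onto (F : S) D : F \is D.-homog -> (forall i, F.@[pts i] != 0) ->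
  exists N, forall t y, (N <= t)%N -> cols t y -> (D <= t)%N ->
  exists x z, [/\ cols (t - D) x, image t z & y = π F *: x + z].
Proof.
move=> hF Fp.
(* Below degree [D] the multiple of [F] has to be 0; truncated subtraction would allow constants
   instead. *)
pose good d (y : 'cV[Y]_r) := exists x z,
  [/\ if (D <= d)%N then cols (d - D) x else x = 0, image d z & y = π F *: x + z].
have good0 d : good d 0.
  exists 0, 0; rewrite scaler0 addr0; split=> //; last by case: (subsp_image d).
  by case: ifP => // _; case: (subsp_cols (d - D)).
have goodD d y y' : good d y -> good d y' -> good d (y + y').
  move=> [x [z [hx hz ->]]] [x' [z' [hx' hz' ->]]]; exists (x + x'), (z + z'); split.
  - move: hx hx'; case: ifP => [_ hx hx'|_ -> ->]; last by rewrite addr0.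
    exact: (subspD (subsp_cols (d - D)) hx hx').
  - exact: (subspD (subsp_image d) hz hz').
  - by rewrite scalerDr addrACA.
have goodA d c q y : inAt c q -> good d y -> good (c + d)%N (q *: y).
  move=> hq [x [z [hx hz ->]]]; exists (q *: x), (q *: z); split; last 1 first.
  - by rewrite scalerDr !scalerA mulrC.
  - move: hx; case: leqP => le hx; last first.
      by rewrite hx scaler0; case: ifP => // _; case: (subsp_cols (c + d - D)).
    rewrite (leq_trans le (leq_addl _ _)) => i; rewrite mxE -addnBA //.
    exact: inAtM.
  - exact: image_inAt.
pose J i (H : S) := forall d, good d (π (pihomog mdeg d H) *: delta_mx i 0).
have iJ i : ideal (J i).
  split.
  - by move=> d; rewrite raddf0 pi0 scale0r.
  - by move=> A B hA hB d; rewrite raddfD /= piD scalerDl; apply: goodD.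
  - move=> c; elim/mpoly_alg_ind: c => [c|x|A B IA IB|A B IA IB] H hH.
    + move=> d; have hc : (c%:MP : S) \is 0.-homog by rewrite -[c%:MP]mulr1 mul_mpolyC; apply: dhomogZ; apply: dhomog1.
      rewrite (pihomogM_hom _ _ hc) leq0n subn0 piM -scalerA.
      exact: (goodA d 0%N _ _ (inAt_pi Y hc) (hH d)).
    + move=> d; rewrite (pihomogM_hom _ _ (dhomogXi k x)); have [le|le] := leqP 1 d; last by rewrite pi0 scale0r.
      by have := goodA _ _ _ _ (inAt_pi Y (dhomogXi k x)) (hH (d - 1)%N); rewrite subnKC // scalerA -piM.
    + by move=> d; rewrite mulrDl raddfD /= piD scalerDl; apply: goodD; [apply: IA|apply: IB].
    + by rewrite -mulrA; apply: IA; apply: IB.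
have pure i (H : S) d : H \is d.-homog -> good d (π H *: delta_mx i 0) -> J i H.
  by move=> hH g d'; rewrite (pihomog_component d' hH); case: eqP => [->|_] //; rewrite pi0 scale0r.
have exN (i : 'I_r) : exists N, forall t H, (N <= t)%N -> H \is t.-homog -> J i H.
  apply: (@projective_nullstellensatz k n Y (J i)) => // [H H0 d|p hp].
    by rewrite (cone_homog d H0) scale0r.
  (* Where [F] is nonzero, [F] itself belongs to the ideal; where it vanishes the point is off the
     locus, and [sig] is onto there. *)
  have [Fp0|Fp1] := eqVneq F.@[p] 0; last first.
    exists F => //; apply: (pure i F D hF); exists (delta_mx i 0), 0; rewrite leqnn addr0; split=> //.
      move=> j; rewrite subnn mxE; case: (_ && _); [exists 1; [exact: dhomog1|by rewrite pi1]|exact: inAt0].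
    by case: (subsp_image D).
  have unitI : minor_ideal (stk 0 p) (sp p) 1.
    case: (cover hp) => // -[i0 [c nc Ep]]; have := Fp i0.
    move: Fp0; rewrite (homog_scale hF Ep) => /eqP; rewrite mulf_eq0 expf_eq0 (negPf nc) andbF /=.
    by move=> ->.
  have [|x hx Ex] := ideal_image hp (sg := sp p) (fun x y => sp_stk x y hp) (y := delta_mx i 0).
    move=> j; rewrite mxE -[_%:R]mulr1.
    have := minorM (fun x y => @stk0M _ _ Y 0 p x y hp) (x := ((j == i) && (0 == 0 :> 'I_1))%:R) (sg := sp p) _ unitI.
    by apply; case: (_ && _); [apply: hloc1|apply: hloc0]; apply: ptden_class.
  have [G [g [hG Gp hw]]] := dual_den hp hx; exists G => //; apply: (pure i G g hG).
  exists 0, (π G *: delta_mx i 0); rewrite scaler0 add0r; split=> //.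
    by case: ifP => // _; case: (subsp_cols (g - D)).
  by exists (π G *: (invmx (fr p) *m x)) => //; rewrite -scalemxAr mulmxA Ex.
have [Nf hN] := ord_choice exN; exists (\sum_i Nf i)%N => t y le hy leD.
have : good t y.
  rewrite [y]matrix_sum_delta; apply: (big_ind (good t)) => [|v v'|i _]; [exact: good0|exact: goodD|].
  rewrite big_ord1.
  have [H hH EH] := hy i; rewrite EH; have := hN i t H _ hH t; rewrite (pihomog_component t hH) eqxx; apply.
  by apply: leq_trans le; rewrite (bigD1 i) //= leq_addr.
by move=> [x [z]]; rewrite leD => -[hx hz E]; exists x, z.
Qed.

Lemma stk0_quotient p t (x : Y) (M : S) : onv Y p -> M \is 1.-homog -> M.@[p] != 0 ->
  stk t%:Z p x -> stk 0 p (x / π M ^+ t).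
Proof.
move=> hp hM1 Mp hx; have nM := onv_nz hp Mp.
have hMt : M ^+ t \is t.-homog by have := dhomogMn t hM1; rewrite mul1n.
apply: (stk_div hp hMt); first by rewrite rmorphXn /= expf_neq0.
by rewrite addr0 piX mulrC divfK // expf_neq0.
Qed.

(** The local classes of [point_length] are made global: the class at one point is multiplied by a
    form that is a unit there and lies in the ideal of minors at the other points, so a combination
    can be tested at one point at a time. *)
Lemma interpolation : exists N, forall t, (N <= t)%N ->
  exists g : {i : 'I_L & 'I_(len i)} -> kmod 'cV[Y]_r, (forall x, cols t (g x)) /\
  forall c, image t (\sum_x c x *: g x : kmod 'cV[Y]_r) -> forall x, c x = 0.
Proof.
have [Lf hL] := separating.
pose ga i := proj1_sig (constructive_indefinite_description _
  (point_length (ptsX i) (fun x y => sp_stk x y (ptsX i)) (lens i))).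
have hga i : (forall y j, stk 0 (pts i) (ga i y j 0)) /\
  forall (c : 'I_(len i) -> k) (x : 'cV[Y]_r.+1), (forall j, stk 0 (pts i) (x j 0)) ->
    \sum_y scal Y (c y) *: ga i y = sp (pts i) *m x -> forall y, c y = 0.
  by rewrite /ga; case: (constructive_indefinite_description _ _).
have exG i : exists Gg : S * nat, [/\ Gg.1 \is Gg.2.-homog, Gg.1.@[pts i] != 0 &
    forall y j, inAt Gg.2 (π Gg.1 * ga i y j 0)].
  have hf (z : 'I_#|{: 'I_(len i) * 'I_r}|) : hloc (ptden (pts i)) 0 (ga i (enum_val z).1 (enum_val z).2 0).
    by have [h1 _] := hga i; apply: h1.
  have [G [g [hG Gp hd]]] := hloc_den (ptden_class (ptsX i)) (m := fun=> 0) hf.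
  exists (G, g); split=> // y j; have [F [d [hF Ed E]]] := hd (enum_rank (y, j)).
  move: E; rewrite enum_rankK /= => ->; apply: inAt_pi.
  by move: Ed; rewrite add0r => -[<-].
have [Gg hGg] := ord_choice exG.
have ptM i (x y : Y) : stk 0 (pts i) x -> stk 0 (pts i) y -> stk 0 (pts i) (x * y) := @stk0M _ _ Y 0 _ x y (ptsX i).
have exK (ij : 'I_L * 'I_L) : exists N, forall K, (N <= K)%N -> ij.2 != ij.1 ->
    minor_ideal (stk 0 (pts ij.1)) (sp (pts ij.1)) ((π (Lf ij.2 ij.1) / π (Lf ij.1 ij.1)) ^+ K).
  case: ij => i j /=; have [->|ne] := eqVneq j i; first by exists 0%N.
  have cf : cmax (pts i) (π (Lf j i) / π (Lf i i)).
    exists (Lf j i), (Lf i i), 1%N; have [h1 _ h2] := hL j i; have [h3 h4 _] := hL i i.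
    by split=> //; rewrite h2 // eq_sym.
  have [N hN] := point_power (ptsX i) (lens i) cf; exists N => K' le _.
  rewrite -(subnK le) exprD; apply: (minorM (ptM i)) => //.
  by have := hlocX (ptden_class (ptsX i)) (K' - N) (cmax_stk cf); rewrite mul0r.
have [Kf hKf] := ord_choice (fun x : 'I_#|{: 'I_L * 'I_L}| => exK (enum_val x)).
pose K1 := (\sum_x Kf x)%N.
have hK i j : j != i -> minor_ideal (stk 0 (pts i)) (sp (pts i)) ((π (Lf j i) / π (Lf i i)) ^+ K1).
  move=> ne; have := hKf (enum_rank (i, j)) K1; rewrite enum_rankK; apply=> //.
  by rewrite /K1 (bigD1 (enum_rank (i, j))) //= leq_addr.
(* Room for the factors vanishing at the other points and for the denominators; the rest of the
   degree is filled with powers of [Lf j j], which is nonzero at its point. *)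
exists (L * K1 + \sum_i (Gg i).2)%N => t le.
pose pad j := (t - L * K1 - (Gg j).2)%N.
have Et j : (pad j + L * K1 + (Gg j).2 = t)%N.
  have : ((Gg j).2 <= \sum_i (Gg i).2)%N by rewrite (bigD1 j) //= leq_addr.
  by rewrite /pad; move: le; clear; lia.
pose B j := Lf j j ^+ pad j * \prod_x Lf j x ^+ K1.
have hLX j x q : Lf j x ^+ q \is q.-homog by have [h1 _ _] := hL j x; have := dhomogMn q h1; rewrite mul1n.
have hB j : B j \is (pad j + L * K1).-homog.
  apply: dhomogM => //.
  by have := @homog_prod k n.+1 'I_L xpredT K1 (fun x => Lf j x ^+ K1); rewrite card_ord; apply.
have Bp j : (B j).@[pts j] != 0.
  rewrite mevalM rmorphXn rmorph_prod /= mulf_neq0 //.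
    by rewrite expf_neq0 //; case: (hL j j).
  by rewrite prodf_seq_neq0; apply/allP => x _ /=; rewrite rmorphXn /= expf_neq0 //; case: (hL j x).
pose g (x : {i : 'I_L & 'I_(len i)}) : kmod 'cV[Y]_r :=
  π (B (tag x)) *: (π (Gg (tag x)).1 *: ga (tag x) (tagged x)).
exists g; split=> [[j y] i|c [w hw Ew] [i y0]].
  rewrite /g /= !mxE -(Et j); apply: inAtM; first exact: inAt_pi.
  by have [_ _] := hGg j; apply.
have hp := ptsX i; have hP := ptden_class hp; set p := pts i in hp hP.
pose M := Lf i i; have [hM1 Mp _] := hL i i; have nM := onv_nz hp Mp.
pose im (v : 'cV[Y]_r) := exists2 z : 'cV[Y]_r.+1, forall j, stk 0 p (z j 0) & v = sp p *m z.
have imD v v' : im v -> im v' -> im (v + v').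
  move=> [z hz ->] [z' hz' ->]; exists (z + z'); last by rewrite mulmxDr.
  by move=> j; rewrite mxE; apply: (hlocD hP); [apply: hz|apply: hz'].
have imZ q v : stk 0 p q -> im v -> im (q *: v).
  move=> hq [z hz ->]; exists (q *: z); last by rewrite scalemxAr.
  by move=> j; rewrite mxE; apply: (ptM i).
have im0 : im 0 by exists 0; rewrite ?mulmx0 // => j; rewrite mxE; apply: (hloc0 hP).
have quo m' (x : Y) : inAt m' x -> stk 0 p (x / π M ^+ m').
  by move=> [F hF ->]; apply: (stk0_quotient hp hM1 Mp); apply: hloc_pi.
have other j (y : 'I_(len j)) : j != i -> im ((π M ^+ t)^-1 *: g (Tagged (fun i => 'I_(len i)) y) : 'cV_r).
  move=> ne; have [|z hz ->] := ideal_image hp (fun x y => sp_stk x y hp) (y := (π M ^+ t)^-1 *: g (Tagged (fun i => 'I_(len i)) y) : 'cV_r); last by exists z.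
  move=> q; pose bb := π (Lf j j ^+ pad j * \prod_(x | x != i) Lf j x ^+ K1) * (π (Gg j).1 * ga j y q 0).
  have hbb : inAt (t - K1) bb.
    have -> : (t - K1 = pad j + (L.-1 * K1) + (Gg j).2)%N.
      rewrite -(Et j); have : (L * K1 = L.-1 * K1 + K1)%N by rewrite -mulSnr prednK // (leq_ltn_trans _ (ltn_ord i)).
      by move=> ->; rewrite addnA addnAC addnK.
    apply: inAtM; last by have [_ _] := hGg j; apply.
    apply: inAt_pi; apply: dhomogM => //.
    have := @homog_prod k n.+1 'I_L (fun x => x != i) K1 (fun x => Lf j x ^+ K1).
    by rewrite cardC1 card_ord; apply.
  have -> : ((π M ^+ t)^-1 *: g (Tagged (fun i => 'I_(len i)) y) : 'cV_r) q 0 =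
      bb / π M ^+ (t - K1) * (π (Lf j i) / π M) ^+ K1.
    have leK : (K1 <= t)%N.
      rewrite -(Et j); apply: leq_trans (leq_addr _ _); apply: leq_trans (leq_addl _ _).
      by rewrite leq_pmull // (leq_ltn_trans _ (ltn_ord i)).
    rewrite /g /= mxE [X in _ * X]mxE [X in _ * (_ * X)]mxE -{1}(subnK leK) exprD expr_div_n /bb /B (bigD1 i) //= !piM (piX Y (Lf j i)).
    exact: quotient_split.
  by apply: (minorM (ptM i)); [apply: quo|apply: hK].
pose rho := π (B i * (Gg i).1) / π M ^+ t.
have [hGi Gip _] := hGg i.
have hR : B i * (Gg i).1 \is t.-homog by rewrite -{1}(Et i); apply: dhomogM.
have Rp : (B i * (Gg i).1).@[p] != 0 by rewrite mevalM (mulf_neq0 (Bp i) Gip).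
have hrho : stk 0 p rho^-1.
  rewrite invf_div; exists (M ^+ t), (B i * (Gg i).1), t, t; rewrite subrr piX; split=> //.
  by have := dhomogMn t hM1; rewrite mul1n.
have nrho : rho != 0 by rewrite mulf_neq0 ?invr_eq0 ?expf_neq0 // (onv_nz hp Rp).
have imW : im ((π M ^+ t)^-1 *: (sig *m w)).
  have [up _] := fr_unit hfr hp; exists ((π M ^+ t)^-1 *: (fr p *m w)).
    by move=> j; rewrite mxE mulrC; apply: (stk0_quotient hp hM1 Mp); apply: dualM_local.
  by rewrite -scalemxAr mulmxA /sp mulmxKV.
have main : im (\sum_y scal Y (c (Tagged (fun i => 'I_(len i)) y)) *: ga i y).
  have -> : \sum_y scal Y (c (Tagged (fun i => 'I_(len i)) y)) *: ga i y = rho^-1 *: ((π M ^+ t)^-1 *: (sig *m w) -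
      \sum_(j | j != i) \sum_(y < len j) scal Y (c (Tagged (fun i => 'I_(len i)) y)) *: ((π M ^+ t)^-1 *: g (Tagged (fun i => 'I_(len i)) y) : 'cV_r)).
    have E1 : sig *m w = \sum_j \sum_(y < len j) scal Y (c (Tagged (fun i => 'I_(len i)) y)) *: (g (Tagged (fun i => 'I_(len i)) y) : 'cV_r).
      by rewrite -Ew sig_big_dep /=; apply: eq_bigr => -[j y] _.
    have E2 : (π M ^+ t)^-1 *: (sig *m w) = \sum_j \sum_(y < len j)
        scal Y (c (Tagged (fun i => 'I_(len i)) y)) *: ((π M ^+ t)^-1 *: g (Tagged (fun i => 'I_(len i)) y) : 'cV_r).
      rewrite E1 scaler_sumr; apply: eq_bigr => j _; rewrite scaler_sumr; apply: eq_bigr => y _.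
      by move: (g _) => v0; rewrite !scalerA mulrC.
    rewrite E2 (bigD1 i) //= addrK.
    rewrite scaler_sumr; apply: eq_bigr => y _; rewrite /g /= !scalerA; congr (_ *: _).
    have nb := onv_nz hp (Bp i); have ng := onv_nz hp Gip; have nm := expf_neq0 t nM.
    rewrite /rho invf_div piM; move: (π (B i)) (π (Gg i).1) (π M ^+ t) (scal Y _) nb ng nm => b1 g1 m1 c1 nb ng nm.
    by field; rewrite nb ng nm.
  apply: (imZ) => //; apply: (imD) => //; rewrite -scaleN1r; apply: (imZ).
    by rewrite -(scal1 Y) -scalN; apply: (hloc_scal hP).
  apply: (big_ind im) => // j ne; apply: (big_ind im) => // y _.
  by apply: (imZ); [apply: (hloc_scal hP)|apply: other].
have [z hz Ez] := main; have [_ h2] := hga i.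
exact: (h2 (fun y => c (Tagged (fun i => 'I_(len i)) y)) z hz Ez y0).
Qed.

Variables (be s : nat) (PC : {poly rat}).
Hypothesis hdual : forall t, fdim (V := kmod 'cV[Y]_r.+1) (dualM s0 t) (be * hd t s).
Hypothesis genus : exists t0, forall t, (t0 <= t)%N -> exists q,
  quot_dim (@mpolyC n.+1 k) (fun F : S => F \is t.-homog) (fun F => curve_section t%:Z (π F)) q /\ PC.[t%:R] = q%:R.

Lemma subsp_curve t : subsp (V := kmod Y^o) (curve_section t%:Z).
Proof.
split=> [|c x y /curve_sectionE[h1 h2] /curve_sectionE[h1' h2']]; apply/curve_sectionE.
  by split=> [|p hp]; [apply: (hloc0 (nzden_class Y))|rewrite mul0r; apply: (hloc0 (ptden_class hp))].
rewrite kscaleE; split=> [|p hp].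
  by apply: (hlocD (nzden_class Y)) => //; apply: (hlocZ (nzden_class Y)).
have hP := ptden_class hp; rewrite mulrDl; apply: (hlocD hP); last exact: h2'.
by rewrite -[scal Y c *: _]/(scal Y c * x) -mulrA; apply: (hlocZ hP); apply: h2.
Qed.

Let dA t := (\sum_i hd t (a i))%N.

(** Dimensions in degree [t] along [0 -> I_C -> Hom (E, O) -> image -> 0]: by [kernel_section] the
    kernel is the space of sections of [I_C], of dimension [dA t - q]. *)
Lemma level t q : quot_dim (@mpolyC n.+1 k) (fun F : S => F \is t.-homog) (fun F => curve_section t%:Z (π F)) q ->
  exists m, fdim (V := kmod 'cV[Y]_r) (image t) m /\ (be * hd t s + q = dA t + m)%N.
Proof.
move=> [bq [hbq spq frq]]; have hA := fdim_A par fa t.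
have [|m1 _ hm1] := fdim_sub (subsp_curve t) _ hA; first exact: curve_inAt.
have lin (c : 'I_q -> k) : π (\sum_i (c i)%:MP * bq i) = \sum_i c i *: (π (bq i) : kmod Y^o).
  by rewrite pi_sum; apply: eq_bigr => i _; rewrite piM.
have E1 : dA t = (m1 + q)%N.
  apply: (fdim_unique hA); apply: (fdim_extend (V := kmod Y^o) (W := inAt t) (B := curve_section t%:Z) (b := fun i => π (bq i))) => //.
  - exact: curve_inAt.
  - by move=> i; apply: inAt_pi.
  - by move=> _ [F hF ->]; have [c hc] := spq F hF; exists c; rewrite -lin -piB.
  - by move=> c; rewrite -lin; apply: frq.
  - exact: subsp_curve.
pose f (v : kmod Y^o) : kmod 'cV[Y]_r.+1 := (h * v) *: minors sig.
have [||m2 [E2 hm2]] := @fdim_image k (kmod Y^o) (kmod 'cV[Y]_r.+1) _ f m1 0 (subsp_curve t) _ hm1.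
- move=> c x y; rewrite /f !kscaleE -[scal Y c *: (x : Y^o)]/(scal Y c * x).
  by rewrite mulrDr [h * (_ * x)]mulrCA scalerDl scalerA.
- exists (fun=> 0); split=> [[]//|v [_ fv]|c _ []//].
  have /eqP : ((h * (v : Y)) *: minors sig) = 0 := fv.
  rewrite scaler_eq0 (negPf minors_nonzero) orbF mulf_eq0 (negPf nh) => /eqP ->.
  by exists (fun=> 0); rewrite big_ord0.
have hker : fdim (V := kmod 'cV[Y]_r.+1) (fun w => dualM s0 t w /\ sig *m (w : 'cV_r.+1) = 0) m1.
  rewrite E2 add0n; apply: (fdim_ext _ hm2) => w; split=> [[v hv ->]|/kernel_section[v hv ->]].
    by apply/kernel_section; exists v.
  by exists v.
have [|m [Em hm]] := @fdim_image k (kmod 'cV[Y]_r.+1) (kmod 'cV[Y]_r) _ (fun w => sig *m (w : 'cV_r.+1)) _ m1 (subsp_dualM s0 t) _ (hdual t) hker.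
  by move=> c x y; rewrite !kscaleE mulmxDr -scalemxAr.
by exists m; split=> //; rewrite E1 Em addnAC.
Qed.

(** For large [t] the polynomial [Q] gives the dimension of the cokernel of [sig] in degree [t].
    That dimension is at least the sum of the lengths by [interpolation] and does not increase by
    [cokernel_onto], so [Q] is constant and can be evaluated at 0. *)
Theorem degeneracy_count : exists2 q : nat, (\sum_i len i <= q)%N &
  (r.+1)%:R * (free_hilbert a).[0] - be%:R * ((1 - s%:R) * (2%:R - s%:R) / 2%:R) - PC.[0] = q%:R.
Proof.
pose Bs := binp 2 \Po ('X + (2%:R - s%:R)%:P).
pose Q : {poly rat} := (r.+1)%:R *: free_hilbert a - be%:R *: Bs - PC.
have EBs t : (s <= t)%N -> Bs.[t%:R] = (hd t s)%:R.
  move=> le; rewrite horner_comp hornerD hornerX hornerC.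
  have -> : t%:R + (2%:R - s%:R) = (t + 2 - s)%N%:R :> rat.
    by rewrite natrB ?natrD ?addrA // (leq_trans le (leq_addr _ _)).
  by rewrite binpE /hd le addnBAC.
have [t0 ht0] := genus.
have [N1 hN1] := interpolation.
have [F [hF Fp]] := avoiding_form.
have [N2 hN2] := cokernel_onto hF Fp.
pose T := (t0 + s + \sum_i a i + N1 + N2)%N.
have lea t i : (T <= t)%N -> (a i <= t + 2)%N.
  by move=> le; have : (a i <= \sum_i a i)%N; [rewrite (bigD1 i) //= leq_addr|move: le; rewrite /T; clear; lia].
have value t : (T <= t)%N -> exists m, [/\ fdim (V := kmod 'cV[Y]_r) (image t) m,
    (m + \sum_i len i <= r * dA t)%N & Q.[t%:R] = (r * dA t - m)%N%:R].
  move=> le; have [|q [hq EP]] := ht0 t; first by move: le; rewrite /T; clear; lia.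
  have [m [hm Em]] := level hq; exists m.
  have lm : (m + \sum_i len i <= r * dA t)%N.
    have [|g [hg ind]] := hN1 t; first by move: le; rewrite /T; clear; lia.
    have := independent_dim (subsp_image t) (image_cols (t := t)) (fdim_columns r (fdim_A par fa t) (inAt0 Y t)) hm hg ind.
    rewrite card_tagged sumnE big_map big_enum /=.
    by under [X in (_ + X)%N]eq_bigr => i _ do rewrite card_ord.
  split=> //; rewrite /Q !hornerD !hornerN !hornerZ EP EBs ?free_hilbertE => [|i|]; [|exact: lea|]; last first.
    by move: le; rewrite /T; clear; lia.
  have Em' : be%:R * (hd t s)%:R + q%:R = (dA t)%:R + m%:R :> rat by rewrite -natrM -!natrD Em.
  rewrite -addrA -opprD Em' natrB ?(leq_trans (leq_addr _ _) lm) // natrM -[r.+1%:R]natr1 -/(dA t).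
  by rewrite mulrDl mul1r opprD addrA addrK.
(* The step [L.+1] is the degree of the form provided by [avoiding_form]. *)
have mono t q q' : (T <= t)%N -> Q.[t%:R] = q%:R -> Q.[(t + L.+1)%N%:R] = q'%:R -> (q' <= q)%N.
  move=> le Eq Eq'; have le' := leq_trans le (leq_addr L.+1 t).
  have [m [hm lm Em]] := value t le; have [m' [hm' lm' Em']] := value _ le'.
  have -> : q = (r * dA t - m)%N by apply/eqP; rewrite -(Num.Theory.eqr_nat rat) -Em -Eq.
  have -> : q' = (r * dA (t + L.+1) - m')%N by apply/eqP; rewrite -(Num.Theory.eqr_nat rat) -Em' -Eq'.
  have hc := fdim_columns r (fdim_A par fa t) (inAt0 Y t).
  have hc' := fdim_columns r (fdim_A par fa (t + L.+1)) (inAt0 Y (t + L.+1)).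
  have [g sg] := fdim_spanned hc; have [w [hw spw _]] := hm'.
  have [x [b' [hb' spb frb]]] := quot_basis (subsp_cols t) (subsp_image t) sg.
  have := independent_dim (subsp_image t) (image_cols (t := t)) hc hm hb' frb; rewrite card_ord -/(dA t) => l1.
  pose f (i : 'I_(m' + x)) : kmod 'cV[Y]_r := match split i with inl j => w j | inr j => π F *: (b' j : 'cV_r) end.
  have [|y] := @fdim_exists k (kmod 'cV[Y]_r) (cols (t + L.+1)) _ f (subsp_cols _).
    move=> v hv; have [|z [z' [hz hz' Ev]]] := hN2 _ v _ hv (leq_addl _ _).
      by move: le'; rewrite /T; clear; lia.
    rewrite addnK in hz; have [c hcz] := spb z hz.
    have him : image (t + L.+1) (π F *: (z - \sum_i c i *: b' i : 'cV_r) + z').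
      apply: (subspD (subsp_image _)) => //; rewrite addnC; apply: image_inAt => //; exact: inAt_pi.
    have [d Ed] := spw _ him.
    exists (fun i => match split i with inl j => d j | inr j => c j end).
    rewrite big_split_ord /= (eq_bigr (fun j => d j *: w j)) => [|j _]; last by rewrite /f (unsplitK (inl _ j)).
    rewrite [X in _ + X](eq_bigr (fun j => π F *: (c j *: b' j : 'cV_r))) => [|j _]; last first.
      by rewrite /f (unsplitK (inr _ j)) !kscaleE !scalerA mulrC.
    rewrite -Ed Ev -scaler_sumr scalerBr addrAC subrK //.
  move=> ly hy; rewrite (fdim_unique hc' hy).
  by move: l1 ly; clear; lia.
have [//|t le|q hq EQ] := @poly_eventually_const Q T L.+1 (\sum_i len i)%N _ _ mono.
  have [m [_ lm ->]] := value t le; exists (r * dA t - m)%N => //.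
  by rewrite leq_subRL ?(leq_trans (leq_addr _ _) lm).
exists q => //; have : Q.[0] = q%:R by rewrite EQ hornerC.
rewrite /Q !hornerD !hornerN !hornerZ horner_comp hornerD hornerX hornerC binp2E add0r => <-.
by congr (_ - _ * _ - _); field.
Qed.
End Degeneracy.

(** * The main estimate *)

(* [kappa a] is the value at [-a] of the Hilbert polynomial [(t + 1) (t + 2) / 2] of the plane. *)
Definition kappa (a : nat) : nat := if a == 0%N then 1%N else 'C(a.-1, 2).

Lemma kappaE a : (1 - a%:R) * (2%:R - a%:R) / 2%:R = (kappa a)%:R :> rat.
Proof.
case: a => [|a]; first by rewrite /kappa /=; field.
rewrite /kappa /= -binpE binp2E -natr1.
by set x : rat := a%:R; field.
Qed.

Lemma kappa_le a s : (a <= s)%N -> (kappa a <= (a == 0) + (a != 0) * kappa s)%N.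
Proof.
case: a => [|a] le; first by rewrite /kappa /=.
case: s le => [|s] // le; rewrite /kappa /= add0n mul1n.
exact: leq_bin2l.
Qed.

Lemma kappa_eq0 s : kappa s = 0%N -> (s == 1)%N || (s == 2)%N.
Proof.
case: s => [|[|[|s]]] //; rewrite /kappa /= => /eqP.
by rewrite eqn0Ngt bin_gt0.
Qed.

(** If N of the [a i] are nonzero, the bounds give [r + r (N + 1) kappa s <= r (1 + N kappa s)],
    hence [kappa s = 0]. *)
Lemma twist_bound (I : finType) (a : I -> nat) (s r b : nat) : (0 < r)%N ->
  (forall i, a i <= s)%N -> (\sum_i (a i == 0) = 1)%N -> (r * #|I| <= b)%N ->
  (r + b * kappa s <= r * \sum_i kappa (a i))%N -> (s == 1)%N || (s == 2)%N.
Proof.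
move=> r0 as_ u0 rb h; apply: kappa_eq0; apply/eqP; rewrite -leqn0 leqNgt; apply/negP => ks.
have E : (\sum_i (a i != 0) + 1 = #|I|)%N.
  by rewrite -u0 -big_split /= -sum1_card; apply: eq_bigr => i _; case: (a i == 0).
have le : (\sum_i kappa (a i) <= 1 + (\sum_i (a i != 0)) * kappa s)%N.
  rewrite -u0 big_distrl -big_split /=; apply: leq_sum => i _; exact: kappa_le.
have := leq_trans h (leq_mul (leqnn r) le).
have := leq_mul rb (leqnn (kappa s)); rewrite -E; move: ks r0; clear; nia.
Qed.

Lemma ccm_ext (k : closedFieldType) n (Y : cone k n) r (M M' : 'rV[Y]_r -> Prop) :
  (forall v, M v <-> M' v) -> ccm M -> ccm M'.
Proof.
move=> h [Fs [h1 [h2 h3] h4]]; exists Fs.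
have hs (Gs : seq {mpoly k[n.+1]}) v : cseq_mul M Gs v <-> cseq_mul M' Gs v.
  by split=> -[w [hw E]]; exists w; split=> // j; apply/h.
split=> //.
  split=> [i v lt /h hv /hs hm|]; first by apply/hs; apply: h2.
  by have [v hv nv] := h3; exists v; [apply/h|move=> /hs].
apply: krull_dim_ext h4 => F.
by split=> hF v /h; apply: hF.
Qed.

(** The length [n - 2] of the resolution is a truncated subtraction, so [2 <= n] has to be known.
    The generator of degree 0 alone contributes 3 to the dimension of degree 1. *)
Lemma ambient_dim_ge2 (k : closedFieldType) n (Y : cone k n) l K (I : finType) (a : I -> nat) (e : I -> Y) :
  parameters Y l K -> free_algebra l a e -> (2 <= n)%N.
Proof.
move=> par fa; have u0 := unique_degree0 par fa; have dA := fdim_A par fa 1.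
have [| |m _ hm] := fdim_sub (W := fun F => F \is 1.-homog /\ cproj Y F = 0) _ _ (fdim_homog k n 1).
- split; first by split; [apply: dhomog0|apply: pi0].
  move=> c u v [hu Eu] [hv Ev]; split; first by apply: rpredD => //; apply: rpredZ.
  by rewrite piD piZ Eu Ev mulr0 addr0.
- by move=> F [].
have h : fdim (fun F : {mpoly k[n.+1]} => F \is 1.-homog) (m + \sum_i hd 1 (a i))%N.
  apply: (@fdim_ker_im k _ (kmod Y^o) (fun F => F \is 1.-homog) (fun F => cproj Y F) m _ _ _ hm dA).
  - split; first exact: dhomog0.
    by move=> c u v hu hv; apply: rpredD => //; apply: rpredZ.
  - by move=> c u v _ _; rewrite piD piZ.
have := fdim_unique h (fdim_homog k n 1); rewrite add1n binSn => E.
have : (\sum_i 3 * (a i == 0) <= \sum_i hd 1 (a i))%N.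
  by apply: leq_sum => i _; case: eqP => [->|_]; rewrite ?muln0.
by rewrite -big_distrr /= u0; move: E; clear; lia.
Qed.

(** * The estimate for a cone *)

Section ConeMain.
Variables (k : closedFieldType) (n : nat) (Y : cone k n).
Local Notation S := {mpoly k[n.+1]}.
Local Notation "'π' F" := (@cproj k n Y F) (at level 8, F at level 2).
Hypothesis chark : [pchar k] =i pred0.
Hypothesis cmA : ccm (@modA k n Y).
Hypotheses (dim2 : relevant_chain Y 2%N) (ndim3 : ~ relevant_chain Y 3%N).
Variable m : int.
Hypothesis can : ccanonical Y m.
Hypothesis smooth : forall p, onv Y p -> exists u v : Y, cparam p u v.
Variables (r : nat) (fr : ('I_n.+1 -> k) -> 'M[Y]_r.+1).
Hypothesis hfr : frames fr.
Variables (b : nat -> nat) (s0 : 'M[Y]_(b 0%N, r.+1)) (phi : forall i, 'M[S]_(b i.+1, b i)).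
Hypothesis hb : forall i, (n - 2 < i)%N -> b i = 0%N.
Hypothesis hs0 : forall j, gsec fr 0 (row j s0).
Hypothesis hphi : forall i x y, phi i x y \is 1.-homog.
Hypothesis hM : forall m v, gsec fr m v -> modS s0 v.
Hypothesis h0 : forall u : 'rV[S]_(b 0%N), map_mx (cproj Y) u *m s0 = 0 <-> exists w, u = w *m phi 0%N.
Hypothesis hex : forall i (u : 'rV[S]_(b i.+1)), u *m phi i = 0 <-> exists w, u = w *m phi i.+1.
Hypothesis cmM : ccm (modS s0).
Variables (frC : ('I_n.+1 -> k) -> 'M[Y]_1) (h : Y).
Hypothesis hfrC : frames frC.
Hypothesis effC : forall p, onv Y p -> stk 0 p (frC p 0 0).
Hypotheses (nh : h != 0) (hh : hdg 0 h).
Hypothesis hc1 : forall p, onv Y p -> clocal_generator 0 p (h * \det (fr p) * frC p 0 0).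
Variables (sig : 'M[Y]_(r, r.+1)) (L : nat) (pts : 'I_L -> 'I_n.+1 -> k) (len : 'I_L -> nat).
Hypothesis hsig : forall j, gsec fr 0 (row j sig).
Hypothesis ptsX : forall i, onv Y (pts i).
Hypothesis ptsI : forall i j, same_point (pts i) (pts j) -> i = j.
Hypothesis cover : forall q, onv Y q -> (exists i, same_point (pts i) q) \/
  minor_ideal (stk 0 q) (sig *m invmx (fr q)) 1.
Hypothesis lens : forall i, quot_dim (scal Y) (stk 0 (pts i))
  (minor_ideal (stk 0 (pts i)) (sig *m invmx (fr (pts i)))) (len i).
Variables (PC : {poly rat}) (g : int).
Hypothesis genus : exists t0, forall t, (t0 <= t)%N -> exists q,
  quot_dim (@mpolyC n.+1 k) (fun F : S => F \is t.-homog) (fun F => curve_section frC t%:Z (π F)) q /\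
  PC.[t%:R] = q%:R.
Hypothesis hg : g%:~R = 1 - PC.[0].
Hypothesis numbers : (\sum_i len i)%N%:Z = g - 1 + (r.+1)%:Z.

Theorem cone_main :
  ((3 <= n)%N /\ exists (l' : 'I_(n - 3) -> S) (q : S),
    [/\ forall i, l' i \is 1.-homog,
      forall c : 'I_(n - 3) -> k, \sum_i c i *: l' i = 0 -> forall i, c i = 0,
      q \is 2.-homog &
      forall F, π F = 0 <-> exists (x : 'I_(n - 3) -> S) (y : S), F = \sum_i x i * l' i + y * q]) \/
  (m = -1 /\ forall x : Y, (forall p, onv Y p -> stk 1 p x) -> inAt 1 x).
Proof.
have [l [K par]] := parameters_exist cmA dim2 ndim3.
(* The coordinate ring is treated as the module generated by 1, so that [cm_free] covers it too. *)
have cm1 : ccm (modS (1%:M : 'M[Y]_1)) by apply: ccm_ext cmA => v; split=> /modS_one.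
have [R2 R3 [I [a [ev [hev spv frv]]]]] := cm_free cmA dim2 ndim3 par (@hdg_one _ _ Y 1) cm1.
pose e i := ev i 0 0.
have sc (x : Y) (v : 'rV[Y]_1) : x *: v = const_mx (x * v 0 0).
  by apply/rowP => j; rewrite ord1 !mxE.
have m1E (v : 'rV[Y]_1) t : modSt (1%:M : 'M[Y]_1) t v <-> inAt t (v 0 0).
  split=> [[u hu ->]|[F hF E]].
    by exists (u 0 0) => //; rewrite /mpi mulmx1 mxE.
  exists (\row_j F) => [j|]; first by rewrite mxE.
  by apply/rowP => j; rewrite /mpi mulmx1 ord1 !mxE E.
have ee (v : 'rV[Y]_1) : v = const_mx (v 0 0) by apply/rowP => j; rewrite ord1 mxE.
have fa : free_algebra l a e.
  split=> [i|t x hx|cc E].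
  - by apply/m1E.
  - have [|cc hcc E] := spv t (const_mx x); first by apply/m1E; rewrite mxE.
    exists cc => //; have := congr1 (fun v : 'rV_1 => v 0 0) E; rewrite mxE => ->.
    by rewrite summxE; apply: eq_bigr => i _; rewrite mxE.
  apply: frv; apply/rowP => j; rewrite ord1 summxE mxE -[RHS]E; apply: eq_bigr => i _.
  by rewrite mxE.
have hl := par_homog par; have nl := par_nz par.
have satA N x : (forall F, F \is N.-homog -> inA (π F * x)) -> inA (x : Y).
  apply: (saturation (nl ord_max) (nl (lift ord0 ord0)) (hl _) (hl _)).
  move=> v w /modS_one hv /modS_one hw E; have [v' /modS_one hv' Ev] := R2 v w hv hw E.
  by exists v'.
have [D1 [D2 [hD1 hD2 gD1 gD2 nT]]] := derivations_exist chark hl nl fa.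
have [f [ca [cb [hf hca hcb hcan]]]] := can.
have [s [ps [tau [Em hs fps htau dE]]]] :=
  dual_basis hl nl fa chark (par_empty par) satA hD1 hD2 gD1 gD2 nT hf hca hcb hcan.
have hs0h i j : hdg 0 (s0 i j) by have [/(_ j)] := hs0 i; rewrite mxE.
have [_ _ [J [aJ [eb [heb spb frb]]]]] := cm_free cmA dim2 ndim3 par hs0h cmM.
have cn : (n - 2 + 2 <= n)%N by rewrite subnK //; apply: ambient_dim_ge2 par fa.
have aJ0 := generators_degree0 cn hb hphi hex h0 par heb spb frb.
have eb0 j : modSt s0 0 (eb j) by have := heb j; rewrite aJ0.
have ebs t v : modSt s0 t v -> exists2 cc : J -> {mpoly k[3]},
    forall j, homd t 0 (cc j) & v = \sum_j rho Y l (cc j) *: eb j.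
  by move=> /spb[cc hcc E]; exists cc => // j; have := hcc j; rewrite aJ0.
have hrank := rank_generators par fa hs hfr hs0 hM eb0 ebs frb.
have hdual t := fdim_dualM par fa hs fps htau dE hfr hs0 hM eb0 ebs frb t.
have [q leq Eq] := degeneracy_count chark par fa satA smooth hfr hs0 hM hfrC effC nh hh hc1 hsig ptsX ptsI
  cover lens hdual genus.
have u0 := unique_degree0 par fa; have us := unique_degree0 par fps.
have EP : (free_hilbert a).[0] = (\sum_i kappa (a i))%N%:R.
  rewrite /free_hilbert horner_sum natr_sum; apply: eq_bigr => i _.
  rewrite horner_comp hornerD hornerX hornerC binp2E add0r -kappaE.
  by set x : rat := (a i)%:R; field.
have key : (r.+1 + #|J| * kappa s <= r.+1 * \sum_i kappa (a i))%N.
  have EN : ((\sum_i len i)%N%:R : rat) = r.+1%:R - PC.[0].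
    rewrite -[LHS]/((\sum_i len i)%N%:Z%:~R) numbers !intrD intrN /= hg.
    have -> : (r.+1%:Z)%:~R = r.+1%:R :> rat by [].
    by move: (PC.[0]) (r.+1%:R) => u v; ring.
  have : ((\sum_i len i)%N%:R <= q%:R :> rat)%R by rewrite Num.Theory.ler_nat.
  rewrite EN -Eq kappaE EP => le2.
  rewrite -(Num.Theory.ler_nat rat) natrD !natrM -Num.Theory.subr_ge0.
  by move: le2; rewrite -Num.Theory.subr_ge0; congr (is_true (_ <= _)%R); ring.
(* For [s = 1] the degrees 0 and 1 occur once each: 0 by [unique_degree0], and 1 by the same lemma
   for the dual basis, whose degrees are [s - a i]. *)
case/orP: (twist_bound (ltn0Sn r) hs u0 hrank key) => /eqP Es.
  left; apply: (quadric_equation par fa) => [i|//|].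
    by have := hs i; rewrite Es.
  by rewrite -[RHS]us; apply: eq_bigr => i _; rewrite Es; have := hs i; rewrite Es; case: (a i) => [|[|]].
right; split; first by rewrite Em Es.
by move=> x hx; apply: (linear_normality_at satA).
Qed.
End ConeMain.

(** * The cone over a variety *)

Section VarietyCone.
Variables (k : closedFieldType) (n : nat) (X : projective_variety k n).
Local Notation S := {mpoly k[n.+1]}.
Local Notation Q := {ideal_quot X}.

Lemma fraction_quotient (R : idomainType) (x : {fraction R}) : exists a b : R,
  FracField.tofrac b != 0 /\ x = FracField.tofrac a / FracField.tofrac b.
Proof.
elim/quotW: x => x; exists (frac x).1, (frac x).2.
have nd : FracField.tofrac (frac x).2 != 0 by rewrite tofrac_eq0 denom_ratioP.
split=> //; apply: (mulIf nd); rewrite divfK //.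
unlock FracField.tofrac; rewrite -[LHS]FracField.pi_mul; apply/eqmodP => /=.
rewrite FracField.equivfE /FracField.mulf !numden_Ratio ?mulr1 ?mulf_neq0 ?oner_neq0 ?denom_ratioP //.
by rewrite mulrC.
Qed.

(** A copy of [to_L] that can carry the structure of a ring morphism. *)
Definition toL : S -> L X := to_L X.
Lemma toL_zmod : zmod_morphism toL.
Proof. by move=> x y; rewrite /toL /to_L !rmorphB. Qed.
Lemma toL_monoid : monoid_morphism toL.
Proof. by split=> [|x y]; rewrite /toL /to_L ?rmorph1 ?rmorphM. Qed.
HB.instance Definition _ := GRing.isZmodMorphism.Build S (L X) toL toL_zmod.
HB.instance Definition _ := GRing.isMonoidMorphism.Build S (L X) toL toL_monoid.

Lemma toL_eq0 F : toL F = 0 <-> F \in (X : {pred S}).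
Proof.
rewrite -[F in F \in _]subr0 Quotient.idealrBE /toL /to_L.
split=> [/eqP|/eqP E]; rewrite ?tofrac_eq0 => //.
  by move=> /eqP E; apply/eqP; rewrite E raddf0.
by apply/eqP; rewrite tofrac_eq0 E raddf0.
Qed.

Lemma toL_homog d F : toL F = 0 -> toL (pihomog mdeg d F) = 0.
Proof. by move=> /toL_eq0 h; apply/toL_eq0; apply: pv_homogeneous. Qed.

Lemma toL_frac (a : L X) : exists F G, toL G != 0 /\ a = toL F / toL G.
Proof.
have [x [y [nz ->]]] := fraction_quotient a.
exists (repr x), (repr y); rewrite /toL /to_L !reprK; split=> //.
Qed.

Lemma toL_rel : exists i, toL 'X_i != 0.
Proof.
have [i hi] := pv_relevant X; exists i; apply/eqP => /toL_eq0 h.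
by rewrite h in hi.
Qed.

Definition variety_cone : cone k n := @Cone k n (L X) toL toL_homog toL_frac toL_rel.
End VarietyCone.

Section Transport.
Variables (k : closedFieldType) (n : nat) (X : projective_variety k n).
Local Notation S := {mpoly k[n.+1]}.
Local Notation Y := (variety_cone X).

Lemma onvE : @onv k n Y = on_variety X.
Proof.
apply: functional_extensionality => p; apply: propositional_extensionality.
by split=> -[h1 h2]; split=> // F /toL_eq0 /h2.
Qed.

Lemma prime_chain_ext (R : comNzRingType) (Q : {pred R} -> Prop) (J J' : R -> Prop) e :
  (forall x, J x <-> J' x) -> prime_chain Q J e -> prime_chain Q J' e.
Proof.
move=> h [P [h1 h2]]; exists P; split=> // i le; have [? ? ? hJ] := h1 i le; split=> //.
by move=> F /h /hJ.
Qed.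

Lemma chain_transport e : relevant_chain Y e <->
  prime_chain (fun P => homogeneous_ideal P /\ relevant P) (fun F : S => F \in (X : {pred S})) e.
Proof. by split; apply: prime_chain_ext => F; [|symmetry]; apply: toL_eq0. Qed.

Lemma smooth_transport : smooth_surface X -> [/\ relevant_chain Y 2, ~ relevant_chain Y 3 &
  forall p, onv Y p -> exists u v : Y, cparam p u v].
Proof.
move=> [[c2 c3] h]; split; first exact/chain_transport.
  by move/chain_transport.
by move=> p; rewrite onvE => /h.
Qed.

Lemma ACM_transport : ACM X -> ccm (@modA k n Y).
Proof. exact: id. Qed.

Lemma canonical_transport m : canonical_iso_twist X m -> ccanonical Y m.
Proof. by rewrite /ccanonical onvE. Qed.

Lemma gsec_transport r (E : vector_bundle X r) : gsec (Y := Y) (frame E) = global_section E.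
Proof. by rewrite /gsec onvE. Qed.

Lemma frames_transport r (E : vector_bundle X r) : frames (Y := Y) (frame E).
Proof.
split; rewrite onvE; [exact: frame_unit|exact: frame_coherent].
Qed.
End Transport.

Theorem proposition2p13 (k : closedFieldType) (hk : [pchar k] =i pred0)
    (n d r c2 : nat) (g : int)
    (X : projective_variety k n) (E : vector_bundle X r) (C : vector_bundle X 1) :
  smooth_surface X ->
  arithmetically_gorenstein_surface X ->
  variety_degree X d ->
  (2 <= d)%N ->
  ulrich E ->
  smooth_curve C ->
  first_chern_class_represented E C ->
  arithmetic_genus C g ->
  second_chern_number E c2 ->
  c2%:Z = g - 1 + r%:Z ->
  smooth_quadric_surface X \/ del_pezzo X.
Proof.
move=> sm [acm [m can]] _ _ [r0 cmE [e de lr]] [effC _ _] [h [nh hh hc1]] [PC genus hg]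
  [sig [L [pts [len [hsig [ptsX ptsI] cover lens ->]]]]] numbers.
have e2 : e = 2%N by apply: max_prime_chain_unique de sm.1.
subst e; move: lr => [b [s0 [phi [hb [hs0 hphi] hG h0 hex]]]].
have [dim2 ndim3 par] := smooth_transport sm.
(* An Ulrich bundle has positive rank, so the [r.-1] sections become [r] sections of a bundle of
   rank [r.+1]. *)
case: r r0 E cmE s0 hs0 hG h0 hc1 sig hsig cover lens numbers => // r _ E cmE s0 hs0 hG h0 hc1 sig hsig cover lens numbers.
pose Y := variety_cone X.
have hM t v : gsec (Y := Y) (frame E) t v -> modS (Y := Y) s0 v.
  rewrite gsec_transport => hv; have /hG[u ->] : Gamma_star E v; last by exists u.
  (* A section of a single twist is an element of [Gamma_star] concentrated in one degree. *)
  exists [:: t], (fun=> v); split; last by rewrite big_seq1.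
  by move=> t'; rewrite inE => /eqP ->.
have cmM : ccm (modS (Y := Y) s0).
  apply: (@ccm_ext k n Y r.+1 (Gamma_star E)) cmE => v; split=> [/hG|hv]; first by [].
  exact/hG.
have [[n3 [l [q [hl fl hq EX]]]]|[Em ln]] := @cone_main k n Y hk (ACM_transport acm) dim2 ndim3 m
  (canonical_transport can) par r (frame E) (frames_transport E) b s0 phi hb
  ltac:(rewrite gsec_transport; exact: hs0) hphi hM h0 hex cmM (frame C) h (frames_transport C)
  ltac:(rewrite onvE; exact: effC) nh hh ltac:(rewrite onvE; exact: hc1) sig L pts len
  ltac:(rewrite gsec_transport; exact: hsig) ltac:(rewrite onvE; exact: ptsX) ptsI
  ltac:(rewrite onvE; exact: cover) lens PC g
  ltac:(rewrite /curve_section gsec_transport; exact: genus) hg numbers.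
- left; split=> //; split=> //; exists l, q; split=> // F.
  by rewrite -EX; symmetry; apply: toL_eq0.
- right; split=> //; first by rewrite -Em.
  by move=> x hx; apply: ln => p; rewrite onvE; apply: hx.
Qed.
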